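(* Let $(M,\mathcal{O}_{\mathrm{gr}})$ be a split complex supermanifold with reduction $(M,\mathcal F)$, let $\mathcal{S}=\mathcal{S}_{\bar 0}\oplus\mathcal{S}_{\bar 1}$ be a $\mathbb{Z}_2$-graded locally free sheaf of $\mathcal{F}$-modules on $M$ of finite rank $p|q$ with $p+q>0$, and let $\mathcal{E}_{\mathrm{gr}}=\mathcal{O}_{\mathrm{gr}}\otimes_{\mathcal{F}}\mathcal{S}$. 1) There is a bijection $$\{[\mathcal{E}]\mid \mathrm{gr}\,\mathcal{O}=\mathcal{O}_{\mathrm{gr}},\ \mathrm{gr}\,\mathcal{E}=\mathcal{E}_{\mathrm{gr}}\}\ \stackrel{1:1}{\longleftrightarrow}\ H^1(M,\mathcal{QA}ut_{(1)(2)}\mathcal{E}_{\mathrm{gr}})/H^0(M,\mathcal{QA}ut_0\mathcal{E}_{\mathrm{gr}}),$$ where on the left $(M,\mathcal O)$ runs over complex supermanifolds with reduction $(M,\mathcal F)$ and retract $(M,\mathcal O_{\mathrm{gr}})$, $\mathcal E$ runs over locally free sheaves of $\mathcal O$-modules on $(M,\mathcal O)$ with retract $\mathcal E_{\mathrm{gr}}$, and $[\mathcal E]$ is the quasi-isomorphism class of $\mathcal E$. The unit element $\epsilon\in H^1(M,\mathcal{QA}ut_{(1)(2)}\mathcal{E}_{\mathrm{gr}})$ is fixed under the action of the group $H^0(M,\mathcal{QA}ut_0\mathcal{E}_{\mathrm{gr}})$. 2) Let $a\in H^1(M,\mathcal{A}ut_{(2)}\mathcal{O}_{\mathrm{gr}})/H^0(M,\mathcal{A}ut_0\mathcal{O}_{\mathrm{gr}})$,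 and let $[(M,\mathcal O)]$ be the class of supermanifolds corresponding to $a$ by Green's theorem. Then there is a bijection between the elements of the set $\widetilde F^{-1}(a)$ and the quasi-isomorphism classes of locally free sheaves with retract $\mathcal E_{\mathrm{gr}}$ on supermanifolds contained in $[(M,\mathcal O)]$.
   Context: A complex supermanifold $(M,\mathcal O)$ of dimension $n|m$ is a $\mathbb Z_2$-graded ringed space locally isomorphic to a superdomain in $\mathbb C^{n|m}$. Let $\mathcal J\subset\mathcal O$ be the sheaf of ideals generated by $\mathcal O_{\bar 1}$; $\mathcal F=\mathcal O/\mathcal J$ is the structure sheaf of the underlying complex manifold (the reduction) $(M,\mathcal F)$. Put $\mathrm{gr}\,\mathcal O=\bigoplus_{p\ge0}\mathrm{gr}\,\mathcal O_p$, $\mathrm{gr}\,\mathcal O_p=\mathcal J^p/\mathcal J^{p+1}$; then $\mathrm{gr}\,\mathcal O_p\simeq\bigwedge^p_{\mathcal F}\mathrm{gr}\,\mathcal O_1$ with $\mathrm{gr}\,\mathcal O_1$ a locally free $\mathcal F$-module, and $(M,\mathrm{gr}\,\mathcal O)$ is the retract of $(M,\mathcal O)$. A supermanifold is split if $\mathcal O\simeq\bigwedge_{\mathcal F}\mathcal G$ for a locally free sheaf of $\mathcal F$-modules $\mathcal G$; then $\mathcal O$ is $\mathbb Z$-graded. A $\mathbb Z_2$-graded sheaf of $\mathcal O$-modules is locally free of rank $p|q$ if it is locally isomorphic to $\mathcal O^p\oplus\Pi(\mathcal O)^q$, where $\Pi$ is the parity change. For a locally free sheaf $\mathcal E$ of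 $\mathcal O$-modules put $\mathcal E_{(p)}=\mathcal J^p\mathcal E$, $\mathcal E_{\mathrm{red}}=\mathcal E/\mathcal J\mathcal E$ (a $\mathbb Z_2$-graded locally free $\mathcal F$-module). The retract of $\mathcal E$ is the $\mathbb Z$-graded locally free sheaf of $\mathrm{gr}\,\mathcal O$-modules $\mathrm{gr}\,\mathcal E=\bigoplus_p\mathcal E_{(p)}/\mathcal E_{(p+1)}\simeq\mathrm{gr}\,\mathcal O\otimes_{\mathcal F}\mathcal E_{\mathrm{red}}$. The sheaf $\mathcal E_{\mathrm{gr}}=\mathcal O_{\mathrm{gr}}\otimes_{\mathcal F}\mathcal S$ has $\mathbb Z$-grading $(\mathcal E_{\mathrm{gr}})_p=(\mathcal O_{\mathrm{gr}})_p\otimes\mathcal S$ and $\mathbb Z_2$-grading $(\mathcal E_{\mathrm{gr}})_{\bar 0}=\mathcal O_{\bar0}\otimes\mathcal S_{\bar0}+\mathcal O_{\bar1}\otimes\mathcal S_{\bar1}$, $(\mathcal E_{\mathrm{gr}})_{\bar 1}=\mathcal O_{\bar0}\otimes\mathcal S_{\bar1}+\mathcal O_{\bar1}\otimes\mathcal S_{\bar0}$ (with $\mathcal O=\mathcal O_{\mathrm{gr}}$). The conditions $\mathrm{gr}\,\mathcal O=\mathcal O_{\mathrm{gr}}$, $\mathrm{gr}\,\mathcal E=\mathcal E_{\mathrm{gr}}$ mean equality up to identification by (compatible) isomorphisms preserving the $\mathbb Z$- and $\mathbb Z_2$-gradings and inducing the identity on $\mathcal F$. All isomorphisms of supermanifolds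 considered induce the identity on the reduction, and $[(M,\mathcal O)]$ denotes the class of supermanifolds isomorphic to $(M,\mathcal O)$. Let $\mathcal E_1,\mathcal E_2$ be locally free sheaves of modules over $\mathcal O$, $\mathcal O'$ respectively. Given a homomorphism $\Psi:\mathcal O\to\mathcal O'$ of sheaves of superalgebras, a $\Psi$-morphism $\Phi=\Phi_\Psi:\mathcal E_1\to\mathcal E_2$ is a homomorphism of $\mathbb Z_2$-graded sheaves of vector spaces with $\Phi(fv)=\Psi(f)\Phi(v)$. A quasi-isomorphism is an invertible $\Psi$-morphism for some isomorphism $\Psi$; a quasi-automorphism is a quasi-isomorphism $\mathcal E\to\mathcal E$. $\mathcal{QA}ut\,\mathcal E$ is the sheaf of groups of (local) quasi-automorphisms $\Phi_\Psi$ of $\mathcal E$, and $$\mathcal{QA}ut_{(p)(q)}\mathcal E=\{\Phi_\Psi\mid \Phi_\Psi(v)\equiv v \bmod \mathcal E_{(p)},\ \Psi(f)\equiv f\bmod\mathcal J^q\ \text{for } v\in\mathcal E,\ f\in\mathcal O\}.$$ $\mathcal{QA}ut_0\mathcal E_{\mathrm{gr}}$ is the subsheaf of $\mathcal{QA}ut\,\mathcal E_{\mathrm{gr}}$ of those $\Phi_\Psi$ preserving the $\mathbb Z$-grading of $\mathcal E_{\mathrm{gr}}$. $\mathcal Aut\,\mathcal O_{\mathrm{gr}}$ is the sheaf of automorphisms of the sheaf of superalgebras $\mathcal O_{\mathrm{gr}}$, $\mathcal Aut_{(2)}\mathcal O_{\mathrm{gr}}$ is the subsheaf of those $a$ with $a(u)\equiv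 u\bmod\mathcal J^2$, and $\mathcal Aut_0\mathcal O_{\mathrm{gr}}$ is the subsheaf of those preserving the $\mathbb Z$-grading. $H^1(M,\mathcal Q)$ for a sheaf of non-abelian groups $\mathcal Q$ is the usual (Čech) pointed cohomology set, with unit $\epsilon$ the class of the trivial cocycle. The groups $H^0(M,\mathcal{QA}ut_0\mathcal E_{\mathrm{gr}})$ and $H^0(M,\mathcal Aut_0\mathcal O_{\mathrm{gr}})$ act by conjugation $\delta\mapsto b\circ\delta\circ b^{-1}$ on $\mathcal{QA}ut_{(1)(2)}\mathcal E_{\mathrm{gr}}$ and $\mathcal Aut_{(2)}\mathcal O_{\mathrm{gr}}$, hence on their $H^1$; quotients are orbit sets. The homomorphism $F:\mathcal{QA}ut\,\mathcal E_{\mathrm{gr}}\to\mathcal Aut\,\mathcal O_{\mathrm{gr}}$, $\Phi_\Psi\mapsto\Psi$, is compatible with these actions and induces the map $$\widetilde F: H^1(M,\mathcal{QA}ut_{(1)(2)}\mathcal E_{\mathrm{gr}})/H^0(M,\mathcal{QA}ut_0\mathcal E_{\mathrm{gr}})\to H^1(M,\mathcal Aut_{(2)}\mathcal O_{\mathrm{gr}})/H^0(M,\mathcal Aut_0\mathcal O_{\mathrm{gr}}).$$ Green's theorem: the set $\{[(M,\mathcal O)]\mid\mathrm{gr}\,\mathcal O=\mathcal O_{\mathrm{gr}}\}$ is in bijection with $H^1(M,\mathcal Aut_{(2)}\mathcal O_{\mathrm{gr}})/H^0(M,\mathcal Aut_0\mathcal O_{\mathrm{gr}})$; the class of a cocycle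 $(\gamma_{ij})$ on a cover $(U_i)$ corresponds to the supermanifold obtained by gluing the sheaves $\mathcal O_{\mathrm{gr}}|_{U_i}$ over $U_i\cap U_j$ via $\gamma_{ij}$ (equivalently, $\gamma_{ij}=\sigma_i\circ\sigma_j^{-1}$ for local isomorphisms $\sigma_i:\mathcal O|_{U_i}\to\mathcal O_{\mathrm{gr}}|_{U_i}$ inducing the identity on $\mathrm{gr}$). *)

(* Defs.v *)
From HB Require Import structures.
From mathcomp Require Import all_boot all_order all_algebra.
From mathcomp Require Import all_classical all_reals all_analysis.
From mathcomp Require Import complex.

Set Implicit Arguments.
Unset Strict Implicit.
Unset Printing Implicit Defensive.

Import Order.TTheory GRing.Theory Num.Theory.
Import numFieldNormedType.Exports.

Local Open Scope classical_set_scope.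
Local Open Scope ring_scope.

(* R[i] packed as a numFieldType, so that its topology is the one attached to
   its modulus. *)
Definition complexes (R : realType) : numFieldType := R[i].

Record opens (T : topologicalType) := Opens { oset :> set T; opensP : open oset }.

Definition opensT (T : topologicalType) : opens T := Opens (@openT T).
Definition opensI (T : topologicalType) (U V : opens T) : opens T :=
  Opens (openI (opensP U) (opensP V)).

Fact opensIl (T : topologicalType) (U V : opens T) : opensI U V `<=` U.
Proof. by move=> x []. Qed.

Fact opensIr (T : topologicalType) (U V : opens T) : opensI U V `<=` V.
Proof. by move=> x []. Qed.

Section Sheaves.
Variables (R : realType) (T : topologicalType).
Local Notation C := (complexes R).

Definition sheaf_condition (X : opens T -> Type)
    (res : forall U V : opens T, V `<=` U -> X U -> X V) : Prop :=
  forall (U : opens T) (I : Type) (V : I -> opens T)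
         (hV : forall i, V i `<=` U) (s : forall i, X (V i)),
    (forall x, oset U x -> exists i, oset (V i) x) ->
    (forall i j (W : opens T) (hi : W `<=` V i) (hj : W `<=` V j),
        res _ _ hi (s i) = res _ _ hj (s j)) ->
    exists! t : X U, forall i, res _ _ (hV i) t = s i.

Record abSheaf := AbSheaf {
  ab_sec :> opens T -> zmodType;
  ab_res : forall U V : opens T, V `<=` U -> {additive ab_sec U -> ab_sec V};
  ab_res_id : forall (U : opens T) (h : U `<=` U) s, ab_res h s = s;
  ab_res_comp : forall (U V W : opens T) (h1 : V `<=` U) (h2 : W `<=` V)
    (h3 : W `<=` U) s, ab_res h2 (ab_res h1 s) = ab_res h3 s;
  ab_glue : sheaf_condition (fun U V h => ab_res h)
}.

(* Sheaves of unital associative C-algebras. The sections over the empty set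
   form the zero ring, whence pzRingType; the algebra structure is given by
   the central ring morphism from the constants, since algType excludes the
   zero ring. *)
Record algSheaf := AlgSheaf {
  alg_sec :> opens T -> pzRingType;
  alg_res : forall U V : opens T, V `<=` U -> {rmorphism alg_sec U -> alg_sec V};
  alg_res_id : forall (U : opens T) (h : U `<=` U) s, alg_res h s = s;
  alg_res_comp : forall (U V W : opens T) (h1 : V `<=` U) (h2 : W `<=` V)
    (h3 : W `<=` U) s, alg_res h2 (alg_res h1 s) = alg_res h3 s;
  alg_glue : sheaf_condition (fun U V h => alg_res h);
  scal : forall U : opens T, {rmorphism C -> alg_sec U};
  scal_res : forall (U V : opens T) (h : V `<=` U) c,
    alg_res h (scal U c) = scal V c;
  scal_central : forall (U : opens T) c s, scal U c * s = s * scal U c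
}.

Record modSheaf (A : algSheaf) := ModSheaf {
  mod_sec :> forall U : opens T, lmodType (A U);
  mod_res : forall U V : opens T, V `<=` U -> {additive mod_sec U -> mod_sec V};
  mod_res_scale : forall (U V : opens T) (h : V `<=` U) a v,
    mod_res h (a *: v) = alg_res A h a *: mod_res h v;
  mod_res_id : forall (U : opens T) (h : U `<=` U) s, mod_res h s = s;
  mod_res_comp : forall (U V W : opens T) (h1 : V `<=` U) (h2 : W `<=` V)
    (h3 : W `<=` U) s, mod_res h2 (mod_res h1 s) = mod_res h3 s;
  mod_glue : sheaf_condition (fun U V h => mod_res h)
}.

Definition ab_of_alg (A : algSheaf) : abSheaf :=
  @AbSheaf (fun U => A U) (fun U V h => alg_res A h)
    (@alg_res_id A) (@alg_res_comp A) (@alg_glue A).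
Coercion ab_of_alg : algSheaf >-> abSheaf.

Definition ab_of_mod (A : algSheaf) (E : modSheaf A) : abSheaf :=
  @AbSheaf (fun U => E U) (fun U V h => mod_res E h)
    (@mod_res_id A E) (@mod_res_comp A E) (@mod_glue A E).
Coercion ab_of_mod : modSheaf >-> abSheaf.

Record abHom (X Y : abSheaf) := AbHom {
  ab_fun :> forall U : opens T, {additive X U -> Y U};
  ab_fun_res : forall (U V : opens T) (h : V `<=` U) s,
    ab_fun V (ab_res X h s) = ab_res Y h (ab_fun U s)
}.

Record algHom (A B : algSheaf) := AlgHom {
  alg_fun :> forall U : opens T, {rmorphism A U -> B U};
  alg_fun_res : forall (U V : opens T) (h : V `<=` U) s,
    alg_fun V (alg_res A h s) = alg_res B h (alg_fun U s);
  alg_fun_scal : forall (U : opens T) c, alg_fun U (scal A U c) = scal B U c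
}.

Definition subsheaf (X : abSheaf) := forall U : opens T, X U -> Prop.

Definition locally (X : abSheaf) (P : subsheaf X) : subsheaf X := fun U s =>
  forall x, oset U x ->
    exists (V : opens T) (h : V `<=` U), oset V x /\ P V (ab_res X h s).

Section Locally.
Variables (X : abSheaf) (P : subsheaf X).

Fact locally0 (U : opens T) :
  (forall V : opens T, P (0 : X V)) -> locally P (0 : X U).
Proof.
by move=> P0 x Ux; exists U, (@subset_refl _ U); split=> //; rewrite raddf0.
Qed.

Fact locallyN (U : opens T) (s : X U) :
  (forall (V : opens T) (t : X V), P t -> P (- t)) -> locally P s -> locally P (- s).
Proof.
move=> PN Ps x /Ps [V [h [Vx Pt]]]; exists V, h; split=> //.
by rewrite raddfN; apply: PN.
Qed.

Hypothesis P_res : forall (U V : opens T) (h : V `<=` U) (s : X U),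
  P s -> P (ab_res X h s).

Fact locally_res (U V : opens T) (h : V `<=` U) (s : X U) :
  locally P s -> locally P (ab_res X h s).
Proof.
move=> Ps x Vx; have [W [k [Wx Pt]]] := Ps x (h _ Vx).
exists (opensI W V), (@opensIr _ W V); split=> //.
have kU : opensI W V `<=` U := subset_trans (@opensIr _ W V) h.
rewrite (ab_res_comp _ _ kU) -(ab_res_comp k (@opensIl _ W V) kU).
exact: P_res.
Qed.

Fact locallyD (U : opens T) (s t : X U) :
  (forall (V : opens T) (u v : X V), P u -> P v -> P (u + v)) ->
  locally P s -> locally P t -> locally P (s + t).
Proof.
move=> PD Ps Pt x Ux; have [V [h [Vx PV]]] := Ps x Ux.
have [W [k [Wx PW]]] := Pt x Ux.
have hU : opensI V W `<=` U := subset_trans (@opensIl _ V W) h.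
exists (opensI V W), hU; split=> //; rewrite raddfD; apply: PD.
  by rewrite -(ab_res_comp h (@opensIl _ V W) hU); apply: P_res.
by rewrite -(ab_res_comp k (@opensIr _ V W) hU); apply: P_res.
Qed.
End Locally.

(* f, defined on the subsheaf A, is an epimorphism of sheaves A -> D with
   kernel B; that is, f induces an isomorphism of the quotient sheaf A / B
   onto D. *)
Record quotient_iso (X Y : abSheaf) (A B : subsheaf X) (D : subsheaf Y)
    (f : forall U : opens T, X U -> Y U) : Prop := QuotientIso {
  quo_into : forall U s, A U s -> D U (f U s);
  quo_add : forall U s t, A U s -> A U t -> f U (s + t) = f U s + f U t;
  quo_res : forall (U V : opens T) (h : V `<=` U) s, A U s ->
    f V (ab_res X h s) = ab_res Y h (f U s);
  quo_ker : forall U s, A U s -> (f U s = 0 <-> B U s);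
  quo_onto : forall U t, D U t ->
    locally (fun V t' => exists2 s, A V s & f V s = t') t
}.

(* Homogeneous components indexed by bool: false is even, true is odd. *)
Record grading (X : abSheaf) := Grading {
  homog : bool -> subsheaf X;
  homog0 : forall b U, homog b (0 : X U);
  homogB : forall b U (s t : X U), homog b s -> homog b t -> homog b (s - t);
  homog_res : forall b (U V : opens T) (h : V `<=` U) s,
    homog b s -> homog b (ab_res X h s);
  homog_split : forall (U : opens T) (s : X U), exists! y : X U * X U,
    [/\ homog false y.1, homog true y.2 & s = y.1 + y.2]
}.

(* Supercommutativity is not required here; it holds for supermanifolds by
   the local model. *)
Record superSheaf := SuperSheaf {
  salg :> algSheaf;
  sgr : grading salg;
  sgrM : forall a b (U : opens T) (f g : salg U),
    homog sgr a f -> homog sgr b g -> homog sgr (a (+) b) (f * g);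
  sgr_scal : forall (U : opens T) c, homog sgr false (scal salg U c)
}.

Record superMod (O : superSheaf) := SuperMod {
  smod :> modSheaf O;
  mgr : grading smod;
  mgrZ : forall a b (U : opens T) (f : O U) (v : smod U),
    homog (sgr O) a f -> homog mgr b v -> homog mgr (a (+) b) (f *: v)
}.

Section PurelyEven.
Variable A : algSheaf.

Definition even_hom (b : bool) : subsheaf A := fun U s => b -> s = 0.

Fact even_hom0 b U : even_hom b (0 : A U). Proof. by []. Qed.

Fact even_homB b U (s t : A U) : even_hom b s -> even_hom b t -> even_hom b (s - t).
Proof. by move=> hs ht hb; rewrite (hs hb) (ht hb) subr0. Qed.

Fact even_hom_res b (U V : opens T) (h : V `<=` U) s :
  even_hom b s -> even_hom b (ab_res A h s).
Proof. by move=> hs hb; rewrite (hs hb) raddf0. Qed.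

Fact even_hom_split (U : opens T) (s : A U) : exists! y : A U * A U,
  [/\ even_hom false y.1, even_hom true y.2 & s = y.1 + y.2].
Proof.
exists (s, 0); split=> /=; first by split=> //; rewrite addr0.
by move=> [u v] /= [_ /(_ isT) -> ->]; rewrite addr0.
Qed.

Definition even_grading : grading A :=
  @Grading A even_hom even_hom0 even_homB even_hom_res even_hom_split.

Fact even_grM a b (U : opens T) (f g : A U) :
  homog even_grading a f -> homog even_grading b g ->
  homog even_grading (a (+) b) (f * g).
Proof.
case: a b => [] [] hf hg // _; first by rewrite hf ?mul0r.
by rewrite hg ?mulr0.
Qed.

Fact even_gr_scal (U : opens T) c : homog even_grading false (scal A U c).
Proof. by []. Qed.

Definition purely_even : superSheaf := SuperSheaf even_grM even_gr_scal.
End PurelyEven.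

Definition is_basis (A : algSheaf) (E : modSheaf A) (r : nat) (U : opens T)
    (e : 'I_r -> E U) : Prop :=
  forall (V : opens T) (h : V `<=` U) (v : E V),
    exists! c : {ffun 'I_r -> A V}, v = \sum_i c i *: mod_res E h (e i).

Definition locally_free_of_rank (A : algSheaf) (E : modSheaf A) (r : nat) : Prop :=
  forall x : T, exists (U : opens T) (e : 'I_r -> E U), oset U x /\ is_basis e.

(* An isomorphism O^p (+) Pi(O)^q -> E over U is the same thing as a basis
   whose first p members are even and whose last q members are odd. *)
Definition locally_free_of_superrank (O : superSheaf) (E : superMod O)
    (p q : nat) : Prop :=
  forall x : T, exists (U : opens T) (e : 'I_(p + q) -> E U),
    [/\ oset U x, is_basis e & forall i : 'I_(p + q), homog (mgr E) (p <= i)%N (e i)].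

Definition locally_free (O : superSheaf) (E : superMod O) : Prop :=
  exists p q : nat, locally_free_of_superrank E p q.

Section Filtration.
Variable O : superSheaf.

Definition Jideal : subsheaf O := locally (X := O) (fun V (s : O V) =>
  exists (k : nat) (a b c : 'I_k -> O V),
    (forall i, homog (sgr O) true (b i)) /\ s = \sum_i a i * b i * c i).

Fixpoint Jpow (p : nat) : subsheaf O :=
  if p is p'.+1 then
    locally (X := O) (fun V (s : O V) => exists (k : nat) (a b : 'I_k -> O V),
      (forall i, Jpow p' (a i) /\ Jideal (b i)) /\ s = \sum_i a i * b i)
  else fun _ _ => True.

Definition Epow (E : superMod O) (p : nat) : subsheaf E :=
  locally (X := E) (fun V (s : E V) =>
  exists (k : nat) (a : 'I_k -> O V) (v : 'I_k -> E V),
    (forall i, Jpow p (a i)) /\ s = \sum_i a i *: v i).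

Fact Jideal_res (U V : opens T) (h : V `<=` U) (s : O U) :
  Jideal s -> Jideal (alg_res O h s).
Proof.
apply: (locally_res (X := O)) => {}U {}V {}h {}s [k [a [b [c [hb ->]]]]].
exists k, (fun i => alg_res O h (a i)), (fun i => alg_res O h (b i)),
  (fun i => alg_res O h (c i)).
split=> [i|]; first exact: (homog_res h (hb i)).
by rewrite -[LHS]/(alg_res O h _) rmorph_sum; apply: eq_bigr => i _; rewrite !rmorphM.
Qed.

Let Jsum p : subsheaf O := fun V (s : O V) => exists (k : nat) (a b : 'I_k -> O V),
  (forall i, Jpow p (a i) /\ Jideal (b i)) /\ s = \sum_i a i * b i.

Let Jsum_res p :
  (forall (U V : opens T) (h : V `<=` U) (s : O U), Jpow p s -> Jpow p (alg_res O h s)) ->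
  forall (U V : opens T) (h : V `<=` U) (s : O U), Jsum p s -> Jsum p (alg_res O h s).
Proof.
move=> IH U V h s [k [a [b [hab ->]]]].
exists k, (fun i => alg_res O h (a i)), (fun i => alg_res O h (b i)); split=> [i|].
  by case: (hab i) => ha hb; split; [exact: IH | exact: Jideal_res].
by rewrite -[LHS]/(alg_res O h _) rmorph_sum; apply: eq_bigr => i _; rewrite rmorphM.
Qed.

Fact Jpow_res p (U V : opens T) (h : V `<=` U) (s : O U) :
  Jpow p s -> Jpow p (alg_res O h s).
Proof.
elim: p U V h s => [//|p IH] U V h s.
exact: (locally_res (X := O) (P := Jsum p) (Jsum_res IH)).
Qed.

Fact Jpow0 p (U : opens T) : Jpow p (0 : O U).
Proof.
case: p => [//|p]; apply: (locally0 (X := O)) => V.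
exists 0%N, (fun=> 0), (fun=> 0); split=> [[]//|].
by rewrite big_ord0.
Qed.

Fact JpowN p (U : opens T) (s : O U) : Jpow p s -> Jpow p (- s).
Proof.
elim: p U s => [//|p IH] U s.
apply: (locallyN (X := O)) => V _ [k [a [b [hab ->]]]].
exists k, (fun i => - a i), b; split=> [i|].
  by case: (hab i) => ha hb; split; first exact: IH.
by rewrite -sumrN; apply: eq_bigr => i _; rewrite mulNr.
Qed.

Fact JpowD p (U : opens T) (s t : O U) : Jpow p s -> Jpow p t -> Jpow p (s + t).
Proof.
case: p => [//|p].
apply: (locallyD (X := O) (P := Jsum p)) => [|V u v].
  exact: (Jsum_res (@Jpow_res p)).
move=> [k [a [b [hab ->]]]] [l [c [d [hcd ->]]]].
exists (k + l)%N, (fun i => match fintype.split i with inl j => a j | inr j => c j end),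
  (fun i => match fintype.split i with inl j => b j | inr j => d j end); split=> [i|].
  by case: (fintype.split i).
rewrite big_split_ord /=; congr (_ + _); apply: eq_bigr => i _.
  by rewrite (unsplitK (inl i)).
by rewrite (unsplitK (inr i)).
Qed.

Section EpowGroup.
Variables (E : superMod O) (p : nat).

Let Esum : subsheaf E := fun V (s : E V) =>
  exists (k : nat) (a : 'I_k -> O V) (v : 'I_k -> E V),
    (forall i, Jpow p (a i)) /\ s = \sum_i a i *: v i.

Fact Epow0 (U : opens T) : Epow p (0 : E U).
Proof.
apply: (locally0 (X := E)) => V.
by exists 0%N, (fun=> 0), (fun=> 0); split=> [[]//|]; rewrite big_ord0.
Qed.

Fact EpowN (U : opens T) (v : E U) : Epow p v -> Epow p (- v).
Proof.
apply: (locallyN (X := E)) => V _ [k [a [b [ha ->]]]].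
exists k, (fun i => - a i), b; split=> [i|]; first exact/JpowN/ha.
by rewrite -sumrN; apply: eq_bigr => i _; rewrite scaleNr.
Qed.

Fact EpowD (U : opens T) (v w : E U) : Epow p v -> Epow p w -> Epow p (v + w).
Proof.
apply: (locallyD (X := E) (P := Esum)) => [V W h s|V x y].
  move=> [k [a [b [ha ->]]]].
  exists k, (fun i => alg_res O h (a i)), (fun i => mod_res E h (b i)).
  split=> [i|]; first exact/Jpow_res/ha.
  by rewrite /= raddf_sum; apply: eq_bigr => i _; rewrite mod_res_scale.
move=> [k [a [b [ha ->]]]] [l [c [d [hc ->]]]].
exists (k + l)%N, (fun i => match fintype.split i with inl j => a j | inr j => c j end),
  (fun i => match fintype.split i with inl j => b j | inr j => d j end); split=> [i|].
  by case: (fintype.split i).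
rewrite big_split_ord /=; congr (_ + _); apply: eq_bigr => i _.
  by rewrite (unsplitK (inl i)).
by rewrite (unsplitK (inr i)).
Qed.
End EpowGroup.
End Filtration.

(* A superfunction sum_I f_I xi_I in the odd coordinates xi_1, ..., xi_m, where
   xi_I is the product of the xi_i, i in I, in increasing order. The
   coefficients are functions on all of C^n of which only the values on the
   domain under consideration matter. *)
Definition superfun (n m : nat) := {set 'I_m} -> 'rV[C]_n -> C.

Definition superfun_eq n m (D : set 'rV[C]_n) (f g : superfun n m) : Prop :=
  forall I x, D x -> f I x = g I x.

Definition shuffle_sign m (I J : {set 'I_m}) : C :=
  (-1) ^+ #|[pred ij : 'I_m * 'I_m | [&& ij.1 \in I, ij.2 \in J & (ij.2 < ij.1)%N]]|.

Definition superfun_mul n m (f g : superfun n m) : superfun n m := fun K x =>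
  \sum_(I : {set 'I_m} | I \subset K)
     shuffle_sign I (K :\: I) * (f I x * g (K :\: I) x).

Definition holomorphic n (D : set 'rV[C]_n) (f : 'rV[C]_n -> C) : Prop :=
  forall x, D x -> differentiable f x.

(* An isomorphism of (U, O|_U) with the superdomain over the open set
   chart U of C^n, whose sheaf is that of holomorphic functions tensored with
   the exterior algebra on m generators. *)
Record superchart (O : superSheaf) (n m : nat) (U : opens T) := SuperChart {
  chart : T -> 'rV[C]_n;
  chart_inj : forall x y, oset U x -> oset U y -> chart x = chart y -> x = y;
  chart_homeo : forall W : set T, W `<=` U -> (open W <-> open (chart @` W));
  coef : forall W : opens T, W `<=` U -> O W -> superfun n m;
  coef_holo : forall (W : opens T) (h : W `<=` U) s I,
    holomorphic (chart @` W) (coef h s I);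
  coef_bij : forall (W : opens T) (h : W `<=` U) (f : superfun n m),
    (forall I, holomorphic (chart @` W) (f I)) ->
    exists! s : O W, superfun_eq (chart @` W) (coef h s) f;
  coef_res : forall (W W' : opens T) (h : W `<=` U) (h' : W' `<=` U)
      (k : W' `<=` W) s,
    superfun_eq (chart @` W') (coef h' (alg_res O k s)) (coef h s);
  coefD : forall (W : opens T) (h : W `<=` U) s t,
    superfun_eq (chart @` W) (coef h (s + t))
      (fun I x => coef h s I x + coef h t I x);
  coefM : forall (W : opens T) (h : W `<=` U) s t,
    superfun_eq (chart @` W) (coef h (s * t))
      (superfun_mul (coef h s) (coef h t));
  coef_scal : forall (W : opens T) (h : W `<=` U) c,
    superfun_eq (chart @` W) (coef h (scal O W c))
      (fun I _ => if I == finset.set0 then c else 0);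
  coef_hom : forall (W : opens T) (h : W `<=` U) b s,
    homog (sgr O) b s <->
    forall (I : {set 'I_m}) x, (chart @` W) x -> odd #|I| != b -> coef h s I x = 0
}.

(* The identification of O / J with F is part of the data, since isomorphisms
   have to induce the identity on F. Via this identification the charts make
   (T, F) a complex manifold of dimension n. *)
Record supermanifold (F : algSheaf) (n m : nat) := Supermanifold {
  sm_sheaf :> superSheaf;
  red : algHom sm_sheaf F;
  red_quotient : quotient_iso (X := sm_sheaf) (Y := F)
    (fun _ _ => True) (@Jideal sm_sheaf) (fun _ _ => True) (fun U => red U);
  sm_charts : forall x : T, exists U : opens T,
    oset U x /\ inhabited (superchart sm_sheaf n m U)
}.

(* Universal property of the exterior algebra of the F-module G: A is an
   F-algebra through iF, and iG : G -> A is the universal F-linear map into a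
   sheaf of F-algebras all of whose values have square zero. *)
Record is_exterior_algebra (F : algSheaf) (G : modSheaf F) (A : algSheaf)
    (iF : algHom F A) (iG : abHom G A) : Prop := IsExteriorAlgebra {
  ext_central : forall (U : opens T) c a, iF U c * a = a * iF U c;
  ext_linear : forall (U : opens T) c g, iG U (c *: g) = iF U c * iG U g;
  ext_square : forall (U : opens T) g, iG U g * iG U g = 0;
  ext_universal : forall (B : algSheaf) (bF : algHom F B) (bG : abHom G B),
    (forall (U : opens T) c b, bF U c * b = b * bF U c) ->
    (forall (U : opens T) c g, bG U (c *: g) = bF U c * bG U g) ->
    (forall (U : opens T) g, bG U g * bG U g = 0) ->
    let extends (h : algHom A B) :=
      (forall (U : opens T) c, h U (iF U c) = bF U c) /\
      (forall (U : opens T) g, h U (iG U g) = bG U g) in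
    exists2 h, extends h &
      forall h', extends h' -> forall (U : opens T) a, h' U a = h U a
}.

(* Universal property of A (x)_F S for balanced maps, where A is an F-algebra
   through iF; E is an A-module, j s stands for 1 (x) s and f *: j s for
   f (x) s. *)
Record is_tensor_product (F A : algSheaf) (iF : algHom F A) (S : modSheaf F)
    (E : modSheaf A) (j : abHom S E) : Prop := IsTensorProduct {
  tens_linear : forall (U : opens T) c s, j U (c *: s) = iF U c *: j U s;
  tens_universal : forall (N : abSheaf)
      (beta : forall U : opens T, A U -> S U -> N U),
    (forall (U : opens T) f f' s, beta U (f + f') s = beta U f s + beta U f' s) ->
    (forall (U : opens T) f s s', beta U f (s + s') = beta U f s + beta U f s') ->
    (forall (U : opens T) f c s, beta U (f * iF U c) s = beta U f (c *: s)) ->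
    (forall (U V : opens T) (h : V `<=` U) f s,
       beta V (alg_res A h f) (mod_res S h s) = ab_res N h (beta U f s)) ->
    let factors (u : abHom E N) :=
      forall (U : opens T) f s, u U (f *: j U s) = beta U f s in
    exists2 u, factors u &
      forall u', factors u' -> forall (U : opens T) v, u' U v = u U v
}.

Section Split.
Variables (F : algSheaf) (n m : nat) (X : supermanifold F n m).

(* An isomorphism of X with the exterior algebra of G. *)
Record split_structure (G : modSheaf F) := SplitStructure {
  incF : algHom F X;
  incG : abHom G X;
  incF_even : forall (U : opens T) c, homog (sgr X) false (incF U c);
  incG_odd : forall (U : opens T) g, homog (sgr X) true (incG U g);
  incF_red : forall (U : opens T) c, red X U (incF U c) = c;
  split_exterior : is_exterior_algebra incF incG
}.

Variables (G : modSheaf F) (spl : split_structure G).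

(* The p-th exterior power of G inside X. *)
Definition Odeg (p : nat) : subsheaf X := locally (X := X) (fun V (s : X V) =>
  exists (k : nat) (c : 'I_k -> F V) (g : 'I_k -> 'I_p -> G V),
    s = \sum_i incF spl V (c i) * \prod_(l < p) incG spl V (g i l)).

(* As j is even and the f (x) s generate, the parity of E is the one defined
   by X_a (x) S_b in E_(a+b). *)
Record tensor_structure (S : superMod (purely_even F)) (E : superMod X) :=
  TensorStructure {
  incS : abHom S E;
  incS_hom : forall b (U : opens T) s,
    homog (mgr S) b s -> homog (mgr E) b (incS U s);
  tensP : is_tensor_product (F := F) (incF spl) (S := S) incS
}.

Variables (S : superMod (purely_even F)) (E : superMod X).
Variable tens : tensor_structure S E.

Definition Edeg (p : nat) : subsheaf E := locally (X := E) (fun V (v : E V) =>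
  exists (k : nat) (a : 'I_k -> X V) (s : 'I_k -> S V),
    (forall i, Odeg p (a i)) /\ v = \sum_i a i *: incS tens V (s i)).
End Split.

Definition homfam (X Y : abSheaf) (U : opens T) :=
  forall V : opens T, V `<=` U -> X V -> Y V.

Section Isomorphisms.
Variables (F : algSheaf) (n m : nat).
Implicit Types X Y Z : supermanifold F n m.

Record is_superhom X Y (U : opens T) (f : homfam X Y U) : Prop := IsSuperhom {
  shD : forall V h s t, f V h (s + t) = f V h s + f V h t;
  shM : forall V h s t, f V h (s * t) = f V h s * f V h t;
  sh_scal : forall V h c, f V h (scal X V c) = scal Y V c;
  sh_res : forall (V W : opens T) (hV : V `<=` U) (hW : W `<=` U)
    (h : W `<=` V) s, f W hW (alg_res X h s) = alg_res Y h (f V hV s);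
  sh_hom : forall V h b s, homog (sgr X) b s -> homog (sgr Y) b (f V h s);
  sh_red : forall V h s, red Y V (f V h s) = red X V s
}.

(* Isomorphisms of supermanifolds X|_U -> Y|_U over F. The inverse is stored so
   that inversion is a swap; it is determined by sfwd. *)
Record siso X Y (U : opens T) := Siso {
  sfwd : homfam X Y U;
  sbwd : homfam Y X U;
  sfwdP : is_superhom sfwd;
  sbwdP : is_superhom sbwd;
  sfwdK : forall (V : opens T) (h : V `<=` U), cancel (@sfwd V h) (@sbwd V h);
  sbwdK : forall (V : opens T) (h : V `<=` U), cancel (@sbwd V h) (@sfwd V h)
}.

Record is_quasihom X Y (E : superMod X) (E' : superMod Y) (U : opens T)
    (psi : homfam X Y U) (phi : homfam E E' U) : Prop := IsQuasihom {
  qhD : forall V h v w, phi V h (v + w) = phi V h v + phi V h w;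
  qhZ : forall V h f v, phi V h (f *: v) = psi V h f *: phi V h v;
  qh_res : forall (V W : opens T) (hV : V `<=` U) (hW : W `<=` U)
    (h : W `<=` V) v, phi W hW (mod_res E h v) = mod_res E' h (phi V hV v);
  qh_hom : forall V h b v, homog (mgr E) b v -> homog (mgr E') b (phi V h v)
}.

(* qfwd is Phi, and sfwd qbase is Psi. Linearity over C is a case of qhZ. *)
Record qiso X Y (E : superMod X) (E' : superMod Y) (U : opens T) := Qiso {
  qbase : siso X Y U;
  qfwd : homfam E E' U;
  qbwd : homfam E' E U;
  qfwdP : is_quasihom (sfwd qbase) qfwd;
  qbwdP : is_quasihom (sbwd qbase) qbwd;
  qfwdK : forall (V : opens T) (h : V `<=` U), cancel (@qfwd V h) (@qbwd V h);
  qbwdK : forall (V : opens T) (h : V `<=` U), cancel (@qbwd V h) (@qfwd V h)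
}.

Definition siso_id X (U : opens T) : siso X X U.
Proof. by exists (fun V h s => s) (fun V h s => s). Defined.

Definition siso_comp X Y Z (U : opens T) (a : siso Y Z U) (b : siso X Y U) :
  siso X Z U.
Proof.
exists (fun V h s => sfwd a h (sfwd b h s)) (fun V h s => sbwd b h (sbwd a h s)).
- have pa := sfwdP a; have pb := sfwdP b; split=> *.
  + by rewrite (shD pb) (shD pa).
  + by rewrite (shM pb) (shM pa).
  + by rewrite (sh_scal pb) (sh_scal pa).
  + by rewrite (sh_res pb) (sh_res pa).
  + by apply: (sh_hom pa); apply: (sh_hom pb).
  + by rewrite (sh_red pa) (sh_red pb).
- have pa := sbwdP a; have pb := sbwdP b; split=> *.
  + by rewrite (shD pa) (shD pb).
  + by rewrite (shM pa) (shM pb).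
  + by rewrite (sh_scal pa) (sh_scal pb).
  + by rewrite (sh_res pa) (sh_res pb).
  + by apply: (sh_hom pb); apply: (sh_hom pa).
  + by rewrite (sh_red pb) (sh_red pa).
- by move=> V h s; rewrite sfwdK sfwdK.
- by move=> V h s; rewrite sbwdK sbwdK.
Defined.

Definition siso_inv X Y (U : opens T) (a : siso X Y U) : siso Y X U :=
  Siso (sbwdP a) (sfwdP a) (@sbwdK _ _ _ a) (@sfwdK _ _ _ a).

Definition siso_res X Y (U V : opens T) (h : V `<=` U) (a : siso X Y U) :
  siso X Y V.
Proof.
exists (fun W k s => sfwd a (subset_trans k h) s)
       (fun W k s => sbwd a (subset_trans k h) s).
- by case: (sfwdP a) => *; split=> *; auto.
- by case: (sbwdP a) => *; split=> *; auto.
- by move=> W k s; rewrite sfwdK.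
- by move=> W k s; rewrite sbwdK.
Defined.

Fact siso_eq X Y (U : opens T) (a b : siso X Y U) :
  (forall (V : opens T) (h : V `<=` U) s, sfwd a h s = sfwd b h s) -> a = b.
Proof.
move=> eqab; have eqf : sfwd a = sfwd b.
  by apply: functional_extensionality_dep => V; apply/funext => h; apply/funext.
have eqg : sbwd a = sbwd b.
  apply: functional_extensionality_dep => V; apply/funext => h; apply/funext => s.
  by rewrite -[RHS](sfwdK a h) eqf sbwdK.
case: a b eqf eqg {eqab} => [f g fP gP fK gK] [f' g' fP' gP' fK' gK'] /= eqf eqg.
by subst; congr Siso; exact: Prop_irrelevance.
Qed.

Definition qiso_id X (E : superMod X) (U : opens T) : qiso E E U.
Proof. by exists (siso_id X U) (fun V h s => s) (fun V h s => s). Defined.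

Definition qiso_comp X Y Z (E : superMod X) (E' : superMod Y) (E'' : superMod Z)
  (U : opens T) (a : qiso E' E'' U) (b : qiso E E' U) : qiso E E'' U.
Proof.
exists (siso_comp (qbase a) (qbase b)) (fun V h s => qfwd a h (qfwd b h s))
  (fun V h s => qbwd b h (qbwd a h s)).
- have pa := qfwdP a; have pb := qfwdP b; split=> *.
  + by rewrite (qhD pb) (qhD pa).
  + by rewrite (qhZ pb) (qhZ pa).
  + by rewrite (qh_res pb) (qh_res pa).
  + by apply: (qh_hom pa); apply: (qh_hom pb).
- have pa := qbwdP a; have pb := qbwdP b; split=> *.
  + by rewrite (qhD pa) (qhD pb).
  + by rewrite (qhZ pa) (qhZ pb).
  + by rewrite (qh_res pa) (qh_res pb).
  + by apply: (qh_hom pb); apply: (qh_hom pa).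
- by move=> V h s; rewrite qfwdK qfwdK.
- by move=> V h s; rewrite qbwdK qbwdK.
Defined.

Definition qiso_inv X Y (E : superMod X) (E' : superMod Y) (U : opens T)
    (a : qiso E E' U) : qiso E' E U :=
  @Qiso _ _ _ _ _ (siso_inv (qbase a)) _ _ (qbwdP a) (qfwdP a)
    (@qbwdK _ _ _ _ _ a) (@qfwdK _ _ _ _ _ a).

Definition qiso_res X Y (E : superMod X) (E' : superMod Y) (U V : opens T)
  (h : V `<=` U) (a : qiso E E' U) : qiso E E' V.
Proof.
exists (siso_res h (qbase a)) (fun W k s => qfwd a (subset_trans k h) s)
       (fun W k s => qbwd a (subset_trans k h) s).
- by case: (qfwdP a) => *; split=> *; auto.
- by case: (qbwdP a) => *; split=> *; auto.
- by move=> W k s; rewrite qfwdK.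
- by move=> W k s; rewrite qbwdK.
Defined.

Fact qiso_eq X Y (E : superMod X) (E' : superMod Y) (U : opens T)
    (a b : qiso E E' U) :
  (forall (V : opens T) (h : V `<=` U) s, sfwd (qbase a) h s = sfwd (qbase b) h s) ->
  (forall (V : opens T) (h : V `<=` U) s, qfwd a h s = qfwd b h s) -> a = b.
Proof.
move=> /siso_eq eqb eqab; have eqf : qfwd a = qfwd b.
  by apply: functional_extensionality_dep => V; apply/funext => h; apply/funext.
have eqg : qbwd a = qbwd b.
  apply: functional_extensionality_dep => V; apply/funext => h; apply/funext => s.
  by rewrite -[RHS](qfwdK a h) eqf qbwdK.
case: a b eqb eqf eqg {eqab}
  => [c f g fP gP fK gK] [c' f' g' fP' gP' fK' gK'] /= eqb eqf eqg.
by subst; congr Qiso; exact: Prop_irrelevance.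
Qed.

Section Preservation.
Variables (X Y : supermanifold F n m) (U : opens T) (psi : homfam X Y U).
Hypothesis psiP : is_superhom psi.

Fact superhom_sum (V : opens T) (h : V `<=` U) k (s : 'I_k -> X V) :
  psi h (\sum_i s i) = \sum_i psi h (s i).
Proof.
apply: (big_morph (psi h)) => [s1 s2|]; first exact: (shD psiP).
by apply: (addrI (psi h 0)); rewrite -(shD psiP) !addr0.
Qed.

Fact superhom_Jideal (V : opens T) (h : V `<=` U) s :
  Jideal s -> Jideal (psi h s).
Proof.
move=> Js x /Js [W [k [Wx [r [a [b [c [hb es]]]]]]]].
have kU := subset_trans k h.
exists W, k; split=> //.
exists r, (fun i => psi kU (a i)), (fun i => psi kU (b i)), (fun i => psi kU (c i)).
split=> [i|]; first exact: (sh_hom psiP).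
rewrite -[LHS](sh_res psiP _ kU) es superhom_sum.
by apply: eq_bigr => i _; rewrite !(shM psiP).
Qed.

Fact superhom_Jpow p (V : opens T) (h : V `<=` U) s :
  Jpow p s -> Jpow p (psi h s).
Proof.
elim: p V h s => [//|p IH] V h s Js x /Js [W [k [Wx [r [a [b [hab es]]]]]]].
have kU := subset_trans k h.
exists W, k; split=> //.
exists r, (fun i => psi kU (a i)), (fun i => psi kU (b i)).
split=> [i|].
  by case: (hab i) => ha hb; split; [exact: IH | exact: superhom_Jideal].
rewrite -[LHS](sh_res psiP _ kU) es superhom_sum.
by apply: eq_bigr => i _; rewrite !(shM psiP).
Qed.

Variables (E : superMod X) (E' : superMod Y) (phi : homfam E E' U).
Hypothesis phiP : is_quasihom psi phi.

Fact quasihom_Epow p (V : opens T) (h : V `<=` U) (v : E V) :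
  Epow p v -> Epow p (phi h v).
Proof.
move=> Ev x /Ev [W [k [Wx [r [a [w [ha es]]]]]]].
have kU := subset_trans k h.
exists W, k; split=> //.
exists r, (fun i => psi kU (a i)), (fun i => phi kU (w i)).
split=> [i|]; first exact: superhom_Jpow.
rewrite -[LHS](qh_res phiP _ kU) es.
transitivity (\sum_i phi kU (a i *: w i)).
  apply: (big_morph (phi kU)) => [s1 s2|]; first exact: (qhD phiP).
  by apply: (addrI (phi kU 0)); rewrite -(qhD phiP) !addr0.
by apply: eq_bigr => i _; rewrite (qhZ phiP).
Qed.
End Preservation.
End Isomorphisms.
End Sheaves.

Section Cohomology.
Variable T : topologicalType.
Local Open Scope group_scope.

(* The gluing property plays no role in the definition of Cech cohomology, so
   it is not part of the record. *)
Record grpPresheaf := GrpPresheaf {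
  grp_sec :> opens T -> groupType;
  grp_res : forall U V : opens T, V `<=` U -> grp_sec U -> grp_sec V;
  grp_resM : forall (U V : opens T) (h : V `<=` U) a b,
    grp_res h (a * b) = grp_res h a * grp_res h b;
  grp_res_id : forall (U : opens T) (h : U `<=` U) a, grp_res h a = a;
  grp_res_comp : forall (U V W : opens T) (h1 : V `<=` U) (h2 : W `<=` V)
    (h3 : W `<=` U) a, grp_res h2 (grp_res h1 a) = grp_res h3 a
}.

Record subgrp (Q : grpPresheaf) := Subgrp {
  sg_mem :> forall U : opens T, Q U -> Prop;
  sg1 : forall U, sg_mem (1 : Q U);
  sgM : forall U (a b : Q U), sg_mem a -> sg_mem b -> sg_mem (a * b);
  sgV : forall U (a : Q U), sg_mem a -> sg_mem a^-1;
  sg_res : forall (U V : opens T) (h : V `<=` U) (a : Q U),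
    sg_mem a -> sg_mem (grp_res h a)
}.

Section Cocycles.
Variables (Q : grpPresheaf) (N : subgrp Q).

Record cocycle := Cocycle {
  cidx : Type;
  cov : cidx -> opens T;
  covP : forall x : T, exists i, oset (cov i) x;
  cval : forall i j, Q (opensI (cov i) (cov j));
  cval_mem : forall i j, N _ (cval i j);
  cvalM : forall i j k (W : opens T) (hij : W `<=` opensI (cov i) (cov j))
      (hjk : W `<=` opensI (cov j) (cov k))
      (hik : W `<=` opensI (cov i) (cov k)),
    grp_res hij (cval i j) * grp_res hjk (cval j k) = grp_res hik (cval i k)
}.

Arguments cov : clear implicits.
Arguments cval : clear implicits.

(* d_kl = b_k c_kl b_l^-1 on a common refinement of the two covers. *)
Definition cohomologous (c d : cocycle) : Prop :=
  exists (K : Type) (W : K -> opens T) (r : K -> cidx c) (s : K -> cidx d)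
         (b : forall k, Q (W k)),
    [/\ forall x : T, exists k, oset (W k) x,
        forall k, W k `<=` cov c (r k),
        forall k, W k `<=` cov d (s k),
        forall k, N _ (b k) &
        forall k l (V : opens T) (hk : V `<=` W k) (hl : V `<=` W l)
          (hc : V `<=` opensI (cov c (r k)) (cov c (r l)))
          (hd : V `<=` opensI (cov d (s k)) (cov d (s l))),
          grp_res hd (cval d (s k) (s l)) =
          grp_res hk (b k) * grp_res hc (cval c (r k) (r l)) * (grp_res hl (b l))^-1].

Definition cohom_class (c : cocycle) : cocycle -> Prop := cohomologous c.

(* The elements of H^1 are the cohomology classes. Predicates are used for
   sets of cocycles because set is confined to a smaller universe. *)
Definition H1 (z : cocycle -> Prop) : Prop := exists c, z = cohom_class c.

Fact trivial_cocycle_subproof i j k (W : opens T)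
    (hij : W `<=` opensI (opensT T) (opensT T))
    (hjk : W `<=` opensI (opensT T) (opensT T))
    (hik : W `<=` opensI (opensT T) (opensT T)) :
  grp_res hij ((fun _ _ : unit => 1 : Q _) i j) *
    grp_res hjk ((fun _ _ : unit => 1 : Q _) j k) =
  grp_res hik ((fun _ _ : unit => 1 : Q _) i k).
Proof. by rewrite (Prop_irrelevance hjk hij) -grp_resM mulg1; congr grp_res. Qed.

Definition trivial_cocycle : cocycle :=
  @Cocycle unit (fun _ => opensT T) (fun x => ex_intro _ tt I)
    (fun _ _ => 1) (fun _ _ => sg1 N _) trivial_cocycle_subproof.

Definition H1_unit : cocycle -> Prop := cohom_class trivial_cocycle.
End Cocycles.
Arguments cov {Q N} c i : rename.
Arguments cval {Q N} c i j : rename.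

(* A acts on N by conjugation inside Q. *)
Definition conj_stable (Q : grpPresheaf) (N A : subgrp Q) : Prop :=
  forall (U : opens T) (b a : Q U), A U b -> N U a -> N U (b * a * b^-1).

Section Action.
Variables (Q : grpPresheaf) (N A : subgrp Q) (AN : conj_stable N A).

Definition H0 := {b : Q (opensT T) | A (opensT T) b}.

Definition res_global (b : H0) (U : opens T) : Q U :=
  grp_res (fun x (_ : oset U x) => I : oset (opensT T) x) (sval b).

Fact conj_cocycle_mem (b : H0) (c : cocycle N) i j :
  N _ (res_global b _ * cval c i j * (res_global b _)^-1).
Proof. by apply: AN; [apply: sg_res; exact: (svalP b) | exact: cval_mem]. Qed.

Fact grp_resV (U V : opens T) (h : V `<=` U) (a : Q U) :
  grp_res h a^-1 = (grp_res h a)^-1.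
Proof.
have e1 : grp_res h (1 : Q U) = 1.
  by apply: (mulgI (grp_res h 1)); rewrite -grp_resM !mulg1.
by apply: (mulgI (grp_res h a)); rewrite -grp_resM !mulgV.
Qed.

Fact conj_cocycleM (b : H0) (c : cocycle N) i j k (W : opens T)
    (hij : W `<=` opensI (cov c i) (cov c j))
    (hjk : W `<=` opensI (cov c j) (cov c k))
    (hik : W `<=` opensI (cov c i) (cov c k)) :
  grp_res hij (res_global b _ * cval c i j * (res_global b _)^-1) *
    grp_res hjk (res_global b _ * cval c j k * (res_global b _)^-1) =
  grp_res hik (res_global b _ * cval c i k * (res_global b _)^-1).
Proof.
have e (U : opens T) (h : W `<=` U) : grp_res h (res_global b U) = res_global b W.
  exact: grp_res_comp.
rewrite !grp_resM !grp_resV !e -(cvalM hij hjk hik) !mulgA.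
by rewrite -(mulgA _ (res_global b W)^-1) mulVg mulg1.
Qed.

Definition conj_cocycle (b : H0) (c : cocycle N) : cocycle N :=
  Cocycle (@covP _ _ c) (@conj_cocycle_mem b c) (@conj_cocycleM b c).

Definition H1_act (b : H0) (z : cocycle N -> Prop) : cocycle N -> Prop :=
  fun d => exists2 c, z c & cohomologous (conj_cocycle b c) d.

Definition H1_orbit (z : cocycle N -> Prop) : (cocycle N -> Prop) -> Prop :=
  fun z' => exists b, z' = H1_act b z.

(* H^1(N) / H^0(A), as the set of orbits. *)
Definition H1_mod_H0 (o : (cocycle N -> Prop) -> Prop) : Prop :=
  exists2 z, H1 z & o = H1_orbit z.
End Action.

Section Functoriality.
Variables (Q Q' : grpPresheaf) (N : subgrp Q) (N' A' : subgrp Q').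
Variable F : forall U : opens T, Q U -> Q' U.
Hypothesis FM : forall U (a b : Q U), F (a * b) = F a * F b.
Hypothesis F_res : forall (U V : opens T) (h : V `<=` U) a,
  F (grp_res h a) = grp_res h (F a).
Hypothesis FN : forall U (a : Q U), N U a -> N' U (F a).

Fact push_cocycleM (c : cocycle N) i j k (W : opens T)
    (hij : W `<=` opensI (cov c i) (cov c j))
    (hjk : W `<=` opensI (cov c j) (cov c k))
    (hik : W `<=` opensI (cov c i) (cov c k)) :
  grp_res hij (F (cval c i j)) * grp_res hjk (F (cval c j k)) =
  grp_res hik (F (cval c i k)).
Proof. by rewrite -!F_res -FM cvalM. Qed.

Definition push_cocycle (c : cocycle N) : cocycle N' :=
  Cocycle (@covP _ _ c) (fun i j => FN (@cval_mem _ _ c i j)) (@push_cocycleM c).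

Definition H1_push (z : cocycle N -> Prop) : cocycle N' -> Prop :=
  fun d => exists2 c, z c & cohomologous (push_cocycle c) d.

Variable AN' : conj_stable N' A'.

(* The orbit of the images of the elements of o. *)
Definition H1_mod_push (o : (cocycle N -> Prop) -> Prop) :
    (cocycle N' -> Prop) -> Prop :=
  fun z' => exists2 z, o z & H1_orbit AN' (H1_push z) z'.
End Functoriality.
End Cohomology.
Arguments cov {T Q N} c i : rename.
Arguments cval {T Q N} c i j : rename.
Arguments H1_unit {T Q} N.

Section Automorphisms.
Variables (R : realType) (T : topologicalType).
Variables (F : algSheaf R T) (n m : nat) (X : supermanifold F n m).

Definition saut (U : opens T) : Type := siso X X U.

HB.instance Definition _ U := gen_eqMixin (saut U).
HB.instance Definition _ U := gen_choiceMixin (saut U).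

Section SautGroup.
Variable U : opens T.
Fact sautA : associative (fun a b : saut U => siso_comp a b : saut U).
Proof. by move=> a b c; apply: siso_eq. Qed.
Fact saut1g : left_id (siso_id X U : saut U) (fun a b : saut U => siso_comp a b).
Proof. by move=> a; apply: siso_eq. Qed.
Fact sautg1 : right_id (siso_id X U : saut U) (fun a b : saut U => siso_comp a b).
Proof. by move=> a; apply: siso_eq. Qed.
Fact sautVg : left_inverse (siso_id X U : saut U) (fun a => siso_inv a)
  (fun a b : saut U => siso_comp a b).
Proof. by move=> a; apply: siso_eq => V h s /=; rewrite sfwdK. Qed.
Fact sautgV : right_inverse (siso_id X U : saut U) (fun a => siso_inv a)
  (fun a b : saut U => siso_comp a b).
Proof. by move=> a; apply: siso_eq => V h s /=; rewrite sbwdK. Qed.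
HB.instance Definition _ :=
  isGroup.Build (saut U) sautA saut1g sautg1 sautVg sautgV.
End SautGroup.

Definition saut_res (U V : opens T) (h : V `<=` U) (a : saut U) : saut V := siso_res h a.

Fact saut_resM (U V : opens T) (h : V `<=` U) (a b : saut U) :
  saut_res h (a * b)%g = (saut_res h a * saut_res h b)%g.
Proof. exact: siso_eq. Qed.

Fact saut_res_id (U : opens T) (h : U `<=` U) (a : saut U) : saut_res h a = a.
Proof.
by apply: siso_eq => V k s; rewrite /= (Prop_irrelevance (subset_trans k h) k).
Qed.

Fact saut_res_comp (U V W : opens T) (h1 : V `<=` U) (h2 : W `<=` V) (h3 : W `<=` U)
  (a : saut U) : saut_res h2 (saut_res h1 a) = saut_res h3 a.
Proof.
apply: siso_eq => V' k s /=.
by rewrite (Prop_irrelevance (subset_trans (subset_trans k h2) h1) (subset_trans k h3)).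
Qed.

Definition SAut : grpPresheaf T :=
  @GrpPresheaf T (fun U => saut U) saut_res saut_resM saut_res_id saut_res_comp.

Definition Aut_mod_mem (p : nat) (U : opens T) (a : SAut U) : Prop :=
  forall (V : opens T) (h : V `<=` U) (f : X V), Jpow p (sfwd a h f - f).

Section AutMod.
Variable p : nat.
Fact Aut_mod1 (U : opens T) : Aut_mod_mem p (1%g : SAut U).
Proof. by move=> V h f /=; rewrite subrr; exact: Jpow0. Qed.

Fact Aut_modM (U : opens T) (a b : SAut U) :
  Aut_mod_mem p a -> Aut_mod_mem p b -> Aut_mod_mem p (a * b)%g.
Proof.
move=> ha hb V h f; rewrite -(subrK (sfwd b h f) (sfwd _ h f)) -addrA.
by apply: JpowD; [exact: ha | exact: hb].
Qed.

Fact Aut_modV (U : opens T) (a : SAut U) : Aut_mod_mem p a -> Aut_mod_mem p a^-1%g.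
Proof.
by move=> ha V h f; have := JpowN (ha V h (sbwd a h f)); rewrite sbwdK opprB.
Qed.

Fact Aut_mod_res (U V : opens T) (h : V `<=` U) (a : SAut U) :
  Aut_mod_mem p a -> Aut_mod_mem p (grp_res h a).
Proof. by move=> ha W k f; exact: ha. Qed.

Definition Aut_mod : subgrp SAut :=
  @Subgrp _ SAut (Aut_mod_mem p) Aut_mod1 Aut_modM Aut_modV Aut_mod_res.
End AutMod.

Fact Aut_mod_mem_conj (p : nat) (U : opens T) (a b : SAut U) :
  Aut_mod_mem p a -> Aut_mod_mem p (b * a * b^-1)%g.
Proof.
move=> ha V h f.
have -> : sfwd (b * a * b^-1)%g h f - f =
    sfwd b h (sfwd a h (sbwd b h f) - sbwd b h f).
  apply: (addIr (sfwd b h (sbwd b h f))).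
  by rewrite -(shD (sfwdP b)) subrK sbwdK subrK.
by apply: (superhom_Jpow (sfwdP b)); exact: ha.
Qed.

Fact Aut_mod_conj (p : nat) (A : subgrp SAut) : conj_stable (Aut_mod p) A.
Proof. by move=> U b a _; exact: Aut_mod_mem_conj. Qed.

Section GradedAut.
Variables (G : modSheaf F) (spl : split_structure X G).

Definition Aut_deg0_mem (U : opens T) (a : SAut U) : Prop :=
  forall (V : opens T) (h : V `<=` U) p (f : X V),
    Odeg spl p f <-> Odeg spl p (sfwd a h f).

Fact Aut_deg01 (U : opens T) : Aut_deg0_mem (1%g : SAut U). Proof. by []. Qed.

Fact Aut_deg0M (U : opens T) (a b : SAut U) :
  Aut_deg0_mem a -> Aut_deg0_mem b -> Aut_deg0_mem (a * b)%g.
Proof.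
move=> ha hb V h p f.
by apply: (iff_trans (hb V h p f)); exact: (ha V h p).
Qed.

Fact Aut_deg0V (U : opens T) (a : SAut U) : Aut_deg0_mem a -> Aut_deg0_mem a^-1%g.
Proof.
move=> ha V h p f; have e := ha V h p (sbwd a h f).
by rewrite sbwdK in e; exact: (iff_sym e).
Qed.

Fact Aut_deg0_res (U V : opens T) (h : V `<=` U) (a : SAut U) :
  Aut_deg0_mem a -> Aut_deg0_mem (grp_res h a).
Proof. by move=> ha W k p f; exact: ha. Qed.

Definition Aut_deg0 : subgrp SAut :=
  @Subgrp _ SAut Aut_deg0_mem Aut_deg01 Aut_deg0M Aut_deg0V Aut_deg0_res.
End GradedAut.

Variable E : superMod X.

Definition qaut (U : opens T) : Type := qiso E E U.

HB.instance Definition _ U := gen_eqMixin (qaut U).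
HB.instance Definition _ U := gen_choiceMixin (qaut U).

Section QautGroup.
Variable U : opens T.
Fact qautA : associative (fun a b : qaut U => qiso_comp a b : qaut U).
Proof. by move=> a b c; apply: qiso_eq. Qed.
Fact qaut1g : left_id (qiso_id E U : qaut U) (fun a b : qaut U => qiso_comp a b).
Proof. by move=> a; apply: qiso_eq. Qed.
Fact qautg1 : right_id (qiso_id E U : qaut U) (fun a b : qaut U => qiso_comp a b).
Proof. by move=> a; apply: qiso_eq. Qed.
Fact qautVg : left_inverse (qiso_id E U : qaut U) (fun a => qiso_inv a)
  (fun a b : qaut U => qiso_comp a b).
Proof.
by move=> a; apply: qiso_eq => V h s /=; [rewrite sfwdK | rewrite qfwdK].
Qed.
Fact qautgV : right_inverse (qiso_id E U : qaut U) (fun a => qiso_inv a)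
  (fun a b : qaut U => qiso_comp a b).
Proof.
by move=> a; apply: qiso_eq => V h s /=; [rewrite sbwdK | rewrite qbwdK].
Qed.
HB.instance Definition _ :=
  isGroup.Build (qaut U) qautA qaut1g qautg1 qautVg qautgV.
End QautGroup.

Definition qaut_res (U V : opens T) (h : V `<=` U) (a : qaut U) : qaut V := qiso_res h a.

Fact qaut_resM (U V : opens T) (h : V `<=` U) (a b : qaut U) :
  qaut_res h (a * b)%g = (qaut_res h a * qaut_res h b)%g.
Proof. exact: qiso_eq. Qed.

Fact qaut_res_id (U : opens T) (h : U `<=` U) (a : qaut U) : qaut_res h a = a.
Proof.
by apply: qiso_eq => V k s; rewrite /= (Prop_irrelevance (subset_trans k h) k).
Qed.

Fact qaut_res_comp (U V W : opens T) (h1 : V `<=` U) (h2 : W `<=` V) (h3 : W `<=` U)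
  (a : qaut U) : qaut_res h2 (qaut_res h1 a) = qaut_res h3 a.
Proof.
by apply: qiso_eq => V' k s /=;
  rewrite (Prop_irrelevance (subset_trans (subset_trans k h2) h1) (subset_trans k h3)).
Qed.

Definition QAut : grpPresheaf T :=
  @GrpPresheaf T (fun U => qaut U) qaut_res qaut_resM qaut_res_id qaut_res_comp.

Definition QAut_base (U : opens T) (a : QAut U) : SAut U := qbase a.

Fact QAut_baseM (U : opens T) (a b : QAut U) :
  QAut_base (a * b)%g = (QAut_base a * QAut_base b)%g.
Proof. by []. Qed.

Fact QAut_base_res (U V : opens T) (h : V `<=` U) (a : QAut U) :
  QAut_base (grp_res h a) = grp_res h (QAut_base a).
Proof. by []. Qed.

Definition QAut_mod_mem (p q : nat) (U : opens T) (a : QAut U) : Prop :=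
  (forall (V : opens T) (h : V `<=` U) (v : E V), Epow p (qfwd a h v - v)) /\
  (forall (V : opens T) (h : V `<=` U) (f : X V), Jpow q (sfwd (qbase a) h f - f)).

Section QAutMod.
Variables p q : nat.
Fact QAut_mod1 (U : opens T) : QAut_mod_mem p q (1%g : QAut U).
Proof.
by split=> V h f /=; rewrite subrr; [exact: Epow0 | exact: Jpow0].
Qed.

Fact QAut_modM (U : opens T) (a b : QAut U) :
  QAut_mod_mem p q a -> QAut_mod_mem p q b -> QAut_mod_mem p q (a * b)%g.
Proof.
move=> [ha ha'] [hb hb']; split=> V h f.
  rewrite -(subrK (qfwd b h f) (qfwd _ h f)) -addrA.
  by apply: EpowD; [exact: ha | exact: hb].
exact: (Aut_modM (a := QAut_base a) (b := QAut_base b)).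
Qed.

Fact QAut_modV (U : opens T) (a : QAut U) :
  QAut_mod_mem p q a -> QAut_mod_mem p q a^-1%g.
Proof.
move=> [ha ha']; split=> V h f.
  by have := EpowN (ha V h (qbwd a h f)); rewrite qbwdK opprB.
exact: (Aut_modV (a := QAut_base a)).
Qed.

Fact QAut_mod_res (U V : opens T) (h : V `<=` U) (a : QAut U) :
  QAut_mod_mem p q a -> QAut_mod_mem p q (grp_res h a).
Proof. by move=> [ha ha']; split=> W k f; [exact: ha | exact: ha']. Qed.

Definition QAut_mod : subgrp QAut :=
  @Subgrp _ QAut (QAut_mod_mem p q) QAut_mod1 QAut_modM QAut_modV QAut_mod_res.
End QAutMod.

Fact QAut_mod_conj (p q : nat) (A : subgrp QAut) : conj_stable (QAut_mod p q) A.
Proof.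
move=> U b a _ [ha ha'] /=; split=> V h f.
  have -> : qfwd (b * a * b^-1)%g h f - f =
      qfwd b h (qfwd a h (qbwd b h f) - qbwd b h f).
    apply: (addIr (qfwd b h (qbwd b h f))).
    by rewrite -(qhD (qfwdP b)) subrK qbwdK subrK.
  by apply: (quasihom_Epow (sfwdP (qbase b)) (qfwdP b)); exact: ha.
exact: (Aut_mod_mem_conj (a := QAut_base a) (QAut_base b)).
Qed.

Section GradedQAut.
Variables (G : modSheaf F) (spl : split_structure X G).
Variables (S : superMod (purely_even F)) (tens : tensor_structure spl S E).

Definition QAut_deg0_mem (U : opens T) (a : QAut U) : Prop :=
  forall (V : opens T) (h : V `<=` U) p (v : E V),
    Edeg tens p v <-> Edeg tens p (qfwd a h v).

Fact QAut_deg01 (U : opens T) : QAut_deg0_mem (1%g : QAut U). Proof. by []. Qed.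

Fact QAut_deg0M (U : opens T) (a b : QAut U) :
  QAut_deg0_mem a -> QAut_deg0_mem b -> QAut_deg0_mem (a * b)%g.
Proof.
move=> ha hb V h p f.
by apply: (iff_trans (hb V h p f)); exact: (ha V h p).
Qed.

Fact QAut_deg0V (U : opens T) (a : QAut U) :
  QAut_deg0_mem a -> QAut_deg0_mem a^-1%g.
Proof.
move=> ha V h p f; have e := ha V h p (qbwd a h f).
by rewrite qbwdK in e; exact: (iff_sym e).
Qed.

Fact QAut_deg0_res (U V : opens T) (h : V `<=` U) (a : QAut U) :
  QAut_deg0_mem a -> QAut_deg0_mem (grp_res h a).
Proof. by move=> ha W k p f; exact: ha. Qed.

Definition QAut_deg0 : subgrp QAut :=
  @Subgrp _ QAut QAut_deg0_mem QAut_deg01 QAut_deg0M QAut_deg0V QAut_deg0_res.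
End GradedQAut.
End Automorphisms.

Section Classes.
Variables (R : realType) (T : topologicalType).
Variables (F : algSheaf R T) (n m : nat).

Record superBundle := SuperBundle {
  base_sm : supermanifold F n m;
  bundle : superMod base_sm;
  bundle_lf : locally_free bundle
}.

Definition quasi_isomorphic (x y : superBundle) : Prop :=
  inhabited (qiso (bundle x) (bundle y) (opensT T)).

Definition qclass (x : superBundle) : superBundle -> Prop := quasi_isomorphic x.

Variables (X : supermanifold F n m) (G : modSheaf F) (spl : split_structure X G).
Variables (S : superMod (purely_even F)) (E : superMod X).
Variable tens : tensor_structure spl S E.

(* sym p : J^p -> X_p and symE p : E_(p) -> (E_gr)_p induce compatible
   isomorphisms of graded sheaves gr O = X and gr E = E_gr. *)
Record is_retract_iso (x : superBundle)
    (sym : nat -> forall U : opens T, base_sm x U -> X U)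
    (symE : nat -> forall U : opens T, bundle x U -> E U) : Prop :=
  IsRetractIso {
  sym_iso : forall p, quotient_iso (X := base_sm x) (Y := X)
    (@Jpow _ _ (base_sm x) p) (@Jpow _ _ (base_sm x) p.+1) (Odeg spl p) (sym p);
  symM : forall p q (U : opens T) (f g : base_sm x U), Jpow p f -> Jpow q g ->
    sym (p + q)%N U (f * g) = sym p U f * sym q U g;
  sym_hom : forall p b (U : opens T) (f : base_sm x U), Jpow p f ->
    homog (sgr (base_sm x)) b f -> homog (sgr X) b (sym p U f);
  sym_red : forall (U : opens T) (f : base_sm x U),
    red X U (sym 0%N U f) = red (base_sm x) U f;
  symE_iso : forall p, quotient_iso (X := bundle x) (Y := E)
    (@Epow _ _ _ (bundle x) p) (@Epow _ _ _ (bundle x) p.+1) (Edeg tens p)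
    (symE p);
  symEZ : forall p q (U : opens T) (f : base_sm x U) (v : bundle x U),
    Jpow p f -> Epow q v ->
    symE (p + q)%N U (f *: v) = sym p U f *: symE q U v;
  symE_hom : forall p b (U : opens T) (v : bundle x U), Epow p v ->
    homog (mgr (bundle x)) b v -> homog (mgr E) b (symE p U v)
}.

Definition has_retract (x : superBundle) : Prop :=
  exists sym symE, @is_retract_iso x sym symE.

(* Y is obtained by gluing the restrictions of X to the members of the cover
   along the c_ij: there are isomorphisms s_i from Y to X over U_i with
   s_i = c_ij s_j over the intersections. *)
Definition glued_supermanifold (c : cocycle (Aut_mod X 2))
    (Y : supermanifold F n m) : Prop :=
  exists s : forall i, siso Y X (cov c i),
    forall i j (V : opens T) (hi : V `<=` cov c i) (hj : V `<=` cov c j)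
      (hij : V `<=` opensI (cov c i) (cov c j)) (f : Y V),
      sfwd (s i) hi f = sfwd (cval c i j : saut X _) hij (sfwd (s j) hj f).

Definition glued_bundle (c : cocycle (QAut_mod E 1 2)) (x : superBundle) : Prop :=
  exists s : forall i, qiso (bundle x) E (cov c i),
    forall i j (V : opens T) (hi : V `<=` cov c i) (hj : V `<=` cov c j)
      (hij : V `<=` opensI (cov c i) (cov c j)),
      (forall f : base_sm x V, sfwd (qbase (s i)) hi f =
         sfwd (qbase (cval c i j : qaut E _)) hij (sfwd (qbase (s j)) hj f)) /\
      (forall v : bundle x V, qfwd (s i) hi v =
         qfwd (cval c i j : qaut E _) hij (qfwd (s j) hj v)).

Definition Aut_orbits := (cocycle (Aut_mod X 2) -> Prop) -> Prop.
Definition QAut_orbits := (cocycle (QAut_mod E 1 2) -> Prop) -> Prop.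

(* H^1(Aut_(2)) / H^0(Aut_0) and H^1(QAut_(1)(2)) / H^0(QAut_0) *)
Definition Aut_quotient : Aut_orbits -> Prop :=
  H1_mod_H0 (Aut_mod_conj (p := 2) (A := Aut_deg0 spl)).
Definition QAut_quotient : QAut_orbits -> Prop :=
  H1_mod_H0 (QAut_mod_conj (p := 1) (q := 2) (A := QAut_deg0 tens)).

Definition QAut_act : H0 (QAut_deg0 tens) ->
    (cocycle (QAut_mod E 1 2) -> Prop) -> cocycle (QAut_mod E 1 2) -> Prop :=
  H1_act (QAut_mod_conj (p := 1) (q := 2) (A := QAut_deg0 tens)).

Definition QAut_orbit : (cocycle (QAut_mod E 1 2) -> Prop) -> QAut_orbits :=
  H1_orbit (QAut_mod_conj (p := 1) (q := 2) (A := QAut_deg0 tens)).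

Fact QAut_mod_base (U : opens T) (a : QAut E U) :
  QAut_mod E 1 2 U a -> Aut_mod X 2 U (QAut_base a).
Proof. by case. Qed.

Definition Ftilde : QAut_orbits -> Aut_orbits :=
  H1_mod_push (@QAut_baseM _ _ _ _ _ _ E) (@QAut_base_res _ _ _ _ _ _ E)
    QAut_mod_base (Aut_mod_conj (p := 2) (A := Aut_deg0 spl)).

(* The class of supermanifolds which Green's theorem attaches to a. *)
Definition green_class (a : Aut_orbits) (Y : supermanifold F n m) : Prop :=
  exists z c, [/\ a z, z c & glued_supermanifold c Y].
End Classes.

(* f restricts to a bijection from A onto B. As with H1, set_bij is not
   applicable for reasons of universes. *)
Definition bijective_between (P Q : Type) (A : P -> Prop) (B : Q -> Prop)
    (f : P -> Q) : Prop :=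
  [/\ forall x, A x -> B (f x),
      forall x y, A x -> A y -> f x = f y -> x = y &
      forall y, B y -> exists2 x, A x & f x = y].

(* Main.v *)
(* Bundles with the given retract are exactly those obtained by gluing E along a cocycle
   in QAut_(1)(2). Indeed, sections of such a bundle that lift a local basis of E and local
   odd generators of X under the symbol maps form again a basis and generators, J being
   nilpotent; this trivializes the bundle, and two such trivializations differ by an element
   of QAut_(1)(2). Conversely, the leading term of a section of a glued bundle does not
   depend on the trivialization, since elements of QAut_(1)(2) act trivially on leading
   terms.

   A quasi-isomorphism of glued bundles makes their cocycles c and d cohomologous in QAut.
   Now QAut_(1)(2) is normal in QAut, meets QAut_0 trivially and, locally, together with it
   generates QAut: an automorphism is congruent to the one that it induces on leading
   terms. Hence the QAut_0-parts of the local sections that conjugate c into d glue to a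
   global one, so that c and d define the same orbit. The same argument for Aut O_gr, in
   the case of the identity map of a manifold, shows that a glued supermanifold determines
   the orbit of its cocycle, which gives the second part. *)

From HB Require Import structures.
Require Import Defs.
From mathcomp Require Import all_boot all_order all_algebra.
From mathcomp Require Import all_classical all_reals all_analysis.
From mathcomp Require Import complex.

Set Implicit Arguments.
Unset Strict Implicit.
Unset Printing Implicit Defensive.

Import Order.TTheory GRing.Theory Num.Theory.

Local Open Scope classical_set_scope.
Local Open Scope ring_scope.

(** * Exterior monomials *)

(** Exterior algebra and tensor product are given by universal properties for sheaves on all of [T],
    while bases exist only locally. A chart of [X] supplies a concrete local model on the same
    number m of generators, and direct images from an open subset make the universal properties
    applicable over it. The indices 1 and 2 in QAut_(1)(2) suffice for a trivial action on all
    leading terms because gr O is generated in degrees 0 and 1, and gr E over gr O in degree 0.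
    Degree 0 of gr O is F, which is fixed anyway. By parity the congruence modulo J^2 holds
    automatically on even sections, so it is a condition on odd generators alone. An element of
    QAut_0 is only required to preserve the grading of E. That the underlying automorphism of O
    preserves the grading of O is deduced by letting sections act on a member of a basis of E; this
    is where p + q > 0 enters. Both the trivial intersection with QAut_(1)(2) and the description of
    [Ftilde] on orbits depend on it. *)

Section Monomials.
Variable m : nat.
Implicit Types (i j : 'I_m) (v w : seq 'I_m) (I J K : {set 'I_m}).

(** The squares are listed separately, since in a general ring 2 may be a zero divisor. *)
Definition anticommuting (A : pzRingType) (eta : 'I_m -> A) : Prop :=
  (forall i j, eta i * eta j = - (eta j * eta i)) /\ forall i, eta i * eta i = 0.

Definition word (A : pzRingType) (eta : 'I_m -> A) w : A := \prod_(i <- w) eta i.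

Definition monomial (A : pzRingType) (eta : 'I_m -> A) I : A := word eta (enum I).

Definition signed_word (A : pzRingType) (eta : 'I_m -> A)
    (o : option (bool * seq 'I_m)) : A :=
  if o is Some (b, w) then (-1) ^+ b * word eta w else 0.

(* None stands for a word with a repeated letter, which evaluates to 0. *)
Fixpoint insert_sign i w : option (bool * seq 'I_m) :=
  if w is j :: w' then
    if (i < j)%N then Some (false, i :: w) else
    if i == j then None else
    if insert_sign i w' is Some (b, v) then Some (~~ b, j :: v) else None
  else Some (false, [:: i]).

(** Insertion sort; the boolean is the parity of the number of transpositions made. *)
Fixpoint sort_sign w : option (bool * seq 'I_m) :=
  if w is i :: w' then
    if sort_sign w' is Some (b, v) then
      if insert_sign i v is Some (b', v') then Some (b (+) b', v') else None
    else None
  else Some (false, [::]).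

Lemma insert_signP (A : pzRingType) (eta : 'I_m -> A) i w :
  anticommuting eta -> eta i * word eta w = signed_word eta (insert_sign i w).
Proof.
case=> eC e2; elim: w => [|j w IH] /=.
  by rewrite /word big_nil big_seq1 expr0 mul1r mulr1.
case: ifP => [_|_]; first by rewrite /= expr0 mul1r /word !big_cons.
case: eqP => [->|_]; first by rewrite /word big_cons mulrA e2 mul0r.
rewrite /word big_cons mulrA eC mulNr -mulrA -/(word eta w) IH.
case: (insert_sign i w) => [[b v]|] /=; last by rewrite mulr0 oppr0.
rewrite /word big_cons -/(word eta v); case: b => /=.
  by rewrite expr1 expr0 mul1r mulN1r mulrN opprK.
by rewrite expr1 expr0 mul1r mulN1r.
Qed.

Lemma sort_signP (A : pzRingType) (eta : 'I_m -> A) w :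
  anticommuting eta -> word eta w = signed_word eta (sort_sign w).
Proof.
move=> e; elim: w => [|i w IH] /=; first by rewrite expr0 mul1r.
rewrite /word big_cons -/(word eta w) IH.
case: (sort_sign w) => [[b v]|] /=; last by rewrite mulr0.
have -> : eta i * ((-1) ^+ b * word eta v) = (-1) ^+ b * (eta i * word eta v).
  by rewrite mulrA -signr_odd; case: (odd b);
    rewrite ?expr0 ?expr1 ?mulr1 ?mul1r ?mulN1r ?mulrN1 ?mulNr.
rewrite insert_signP //; case: (insert_sign i v) => [[b' v']|] /=; last by rewrite mulr0.
by rewrite mulrA signr_addb.
Qed.

Let lto := relpre (@nat_of_ord m) ltn.

Let lto_trans : transitive lto. Proof. by move=> y x z; apply: ltn_trans. Qed.

Lemma insert_sign_sorted i w b v : sorted lto w -> insert_sign i w = Some (b, v) ->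
  sorted lto v /\ perm_eq v (i :: w).
Proof.
elim: w b v => [|j w IH] b v //= sw; first by case=> _ <-.
case: (ltngtP i j) => [ij|ji|ij].
- by case=> _ <-; rewrite /= /lto /= ij.
- have -> : (i == j) = false by apply/eqP=> e; rewrite e ltnn in ji.
  case E: insert_sign => [[b' v']|] // [_ <-].
  have [sv pv] := IH _ _ (path_sorted sw) E; split; last first.
    rewrite -cat1s -[i :: j :: w]/([:: i] ++ j :: w) -[j :: w]/([:: j] ++ w).
    by rewrite perm_sym perm_catCA perm_cat2l perm_sym.
  rewrite /= (path_sortedE lto_trans) sv andbT (perm_all _ pv) /=.
  by rewrite {1}/lto /= ji /=; move: sw; rewrite (path_sortedE lto_trans) => /andP[].
- by rewrite (ord_inj ij) eqxx.
Qed.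

Lemma sort_sign_sorted w b v : sort_sign w = Some (b, v) -> sorted lto v /\ perm_eq v w.
Proof.
elim: w b v => [|i w IH] b v /=; first by case=> _ <-.
case E: sort_sign => [[b' v']|] //; have [s1 p1] := IH _ _ E.
case E': insert_sign => [[b2 v2]|] // [_ <-].
have [s2 p2] := insert_sign_sorted s1 E'; split=> //.
by apply: (perm_trans p2); rewrite perm_cons.
Qed.

Lemma enum_set_sorted I : sorted lto (enum I).
Proof.
rewrite {1}/enum_mem; apply: sorted_filter => //.
by rewrite -enumT -sorted_map val_enum_ord iota_ltn_sorted.
Qed.

(** The structure constants of the exterior algebra in the basis of monomials. They are computed
    from the index sets alone and so are the same for every anticommuting family in every ring;
    [frame_mapM] rests on this. *)
Definition set_sign I J : option (bool * {set 'I_m}) :=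
  omap (fun bv => (bv.1, [set x in bv.2])) (sort_sign (enum I ++ enum J)).

Definition signed_monomial (A : pzRingType) (eta : 'I_m -> A) o : A :=
  if o is Some (b, K) then (-1) ^+ (b : bool) * monomial eta K else 0.

Lemma monomialM (A : pzRingType) (eta : 'I_m -> A) I J : anticommuting eta ->
  monomial eta I * monomial eta J = signed_monomial eta (set_sign I J).
Proof.
move=> e; rewrite /monomial /word -big_cat -/(word eta _) sort_signP // /set_sign.
case E: sort_sign => [[b v]|] //=; congr (_ * _).
have [sv _] := sort_sign_sorted E; rewrite /monomial; congr word.
(* A strictly increasing word is the enumeration of the set of its letters. *)
apply: (irr_sorted_eq lto_trans) => //; first by move=> x; rewrite /lto /= ltnn.
  exact: enum_set_sorted.
by move=> x; rewrite mem_enum inE.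
Qed.

(** Sorting keeps the length, and a strictly increasing word repeats no letter. This makes products
    additive in the degree. *)
Lemma set_sign_card I J b K : set_sign I J = Some (b, K) -> #|K| = (#|I| + #|J|)%N.
Proof.
rewrite /set_sign; case E: sort_sign => [[b' v]|] //= [_ <-].
have [sv pv] := sort_sign_sorted E.
rewrite cardsE (card_uniqP _) ?(perm_size pv) ?size_cat -?cardE //.
by apply: (sorted_uniq lto_trans _ sv) => x; rewrite /lto /= ltnn.
Qed.

Lemma monomial0 (A : pzRingType) (eta : 'I_m -> A) : monomial eta finset.set0 = 1.
Proof. by rewrite /monomial /word enum_set0 big_nil. Qed.

Lemma monomial1 (A : pzRingType) (eta : 'I_m -> A) i :
  monomial eta (finset.set1 i) = eta i.
Proof. by rewrite /monomial /word enum_set1 big_seq1. Qed.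

Lemma rmorph_monomial (A B : pzRingType) (f : {rmorphism A -> B}) (eta : 'I_m -> A) I :
  f (monomial eta I) = monomial (fun i => f (eta i)) I.
Proof. by rewrite /monomial /word rmorph_prod. Qed.
End Monomials.

(** * Sheaves and gradings *)

Section SheafBasics.
Variable T : topologicalType.
Implicit Types (X Y : abSheaf T) (U V W : opens T).

Lemma sub_opensI U V W : W `<=` U -> W `<=` V -> W `<=` opensI U V.
Proof. by move=> h k x Wx; split; [apply: h | apply: k]. Qed.

Lemma subT U : U `<=` opensT T. Proof. by []. Qed.

(** Both sections glue the restrictions of [s] to the open sets on which [s] and [t] agree, and
    gluing is unique. *)
Lemma ab_separated X U (s t : X U) :
  (forall x, oset U x -> exists (V : opens T) (h : V `<=` U),
     oset V x /\ ab_res X h s = ab_res X h t) -> s = t.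
Proof.
move=> st; pose I := {V : opens T | exists h : V `<=` U, ab_res X h s = ab_res X h t}.
pose V (i : I) : opens T := sval i.
have hV i : V i `<=` U by case: (svalP i).
have est i : ab_res X (hV i) s = ab_res X (hV i) t.
  by case: (svalP i) => h; rewrite (Prop_irrelevance (hV i) h).
have [||r [_ ru]] := @ab_glue _ X U I V hV (fun i => ab_res X (hV i) s).
- by move=> x /st [W [h [Wx e]]]; exists (exist _ W (ex_intro _ h e)).
- move=> i j W hi hj; have hU := subset_trans hi (hV i).
  by rewrite (ab_res_comp _ _ hU) (ab_res_comp _ _ hU).
by rewrite -(ru s) // -(ru t) // => i; rewrite -?est.
Qed.

Lemma ab_gluing X U (I : Type) (V : I -> opens T) (hV : forall i, V i `<=` U)
    (s : forall i, X (V i)) :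
  (forall x, oset U x -> exists i, oset (V i) x) ->
  (forall i j W (hi : W `<=` V i) (hj : W `<=` V j),
     ab_res X hi (s i) = ab_res X hj (s j)) ->
  exists t : X U, forall i, ab_res X (hV i) t = s i.
Proof. by move=> cV sV; have [t [ht _]] := ab_glue hV cV sV; exists t. Qed.

(** Uniqueness supplies the agreement on overlaps. As [P] is not assumed to be local, the glued
    section is known to satisfy it near each point only; for local properties the callers pass from
    there to all of [U]. *)
Lemma ab_glue_unique X U (P : forall V : opens T, V `<=` U -> X V -> Prop) :
  (forall V W (hV : V `<=` U) (hW : W `<=` U) (k : W `<=` V) t,
     P V hV t -> P W hW (ab_res X k t)) ->
  (forall V (hV : V `<=` U) t t', P V hV t -> P V hV t' -> t = t') ->
  (forall x, oset U x -> exists V (hV : V `<=` U) t, oset V x /\ P V hV t) ->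
  exists s : X U, forall x, oset U x ->
    exists V (hV : V `<=` U), oset V x /\ P V hV (ab_res X hV s).
Proof.
move=> Pres Puniq Pex.
pose I := {V : opens T | exists (hV : V `<=` U) t, P V hV t}.
pose V (i : I) : opens T := sval i.
have hV i : V i `<=` U by case: (svalP i).
have ht i : exists t, P (V i) (hV i) t.
  by case: (svalP i) => k; rewrite (Prop_irrelevance (hV i) k).
pose t i := sval (cid (ht i)).
have tP i : P (V i) (hV i) (t i) by rewrite /t; case: cid.
have cV x : oset U x -> exists i, oset (V i) x.
  by move=> /Pex [W [hW [u [Wx Pu]]]]; exists (exist _ W (ex_intro _ hW (ex_intro _ u Pu))).
have [//||s hs] := @ab_gluing X U I V hV t.
  move=> i j W hi hj; have hU := subset_trans hi (hV i).
  by apply: (Puniq _ hU); apply: Pres (tP _).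
exists s => x /cV [i Vx]; exists (V i), (hV i); split=> //; rewrite hs; exact: tP.
Qed.

Lemma locally_idem X (P : subsheaf X) U (s : X U) :
  locally (locally P) s -> locally P s.
Proof.
move=> Ps x /Ps [V [h [Vx /(_ x Vx) [W [k [Wx Pt]]]]]].
have kU := subset_trans k h; exists W, kU; split=> //.
by rewrite -(ab_res_comp h k).
Qed.

Lemma locally_in X (P : subsheaf X) U (s : X U) : P U s -> locally P s.
Proof. by move=> Ps x Ux; exists U, (@subset_refl _ U); rewrite ab_res_id. Qed.

Section Grading.
Variables (X : abSheaf T) (g : grading X).

Lemma homogN b U (s : X U) : homog g b s -> homog g b (- s).
Proof. by move=> hs; rewrite -sub0r; apply: homogB => //; apply: homog0. Qed.

Lemma homogD b U (s t : X U) : homog g b s -> homog g b t -> homog g b (s + t).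
Proof. by move=> hs ht; rewrite -(opprK t); apply: homogB => //; apply: homogN. Qed.

Lemma homog_sum b U (I : Type) (r : seq I) (P : pred I) (f : I -> X U) :
  (forall i, P i -> homog g b (f i)) -> homog g b (\sum_(i <- r | P i) f i).
Proof. by move=> hf; apply: big_ind => //; [apply: homog0 | move=> *; apply: homogD]. Qed.

Lemma homog_decomp U (s : X U) :
  exists s0 s1, [/\ homog g false s0, homog g true s1 & s = s0 + s1].
Proof.
by have [[a b] [[/= ha hb e] _]] := homog_split g s; exists a, b.
Qed.

Lemma homog_unique U (s s' t t' : X U) : homog g false s -> homog g false s' ->
  homog g true t -> homog g true t' -> s + t = s' + t' -> s = s' /\ t = t'.
Proof.
move=> *; have [y [_ yu]] := homog_split g (s + t).
have e1 : y = (s, t) by apply: yu.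
have e2 : y = (s', t') by apply: yu.
by move: e2; rewrite e1 => -[].
Qed.

Lemma homog_disjoint U (s : X U) b : homog g b s -> homog g (~~ b) s -> s = 0.
Proof.
case: b => /= hs hs'.
  by have [] := homog_unique hs' (homog0 g false U) (homog0 g true U) hs (addrC _ _).
by have [] := homog_unique hs (homog0 g false U) (homog0 g true U) hs' (addrC _ _).
Qed.

(** Near each point the component of the other parity is a difference of two sections of parity [b],
    so it has both parities there and vanishes. *)
Lemma homog_local b U (s : X U) :
  (forall x, oset U x -> exists V (h : V `<=` U), oset V x /\ homog g b (ab_res X h s)) ->
  homog g b s.
Proof.
have [s0 [s1 [h0 h1 es]]] := homog_decomp s => hs.
case: b hs => hs.
  suff e : s0 = 0 by rewrite es e add0r.
  apply: ab_separated => x /hs [V [h [Vx hV]]]; exists V, h; split=> //.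
  rewrite raddf0; have := homog_res h h0; have := homog_res h h1.
  move=> k1 k0; apply: (homog_disjoint (b := false)) => //=.
  have -> : ab_res X h s0 = ab_res X h s - ab_res X h s1 by rewrite es raddfD addrK.
  exact: homogB.
suff e : s1 = 0 by rewrite es e addr0.
apply: ab_separated => x /hs [V [h [Vx hV]]]; exists V, h; split=> //.
rewrite raddf0; have := homog_res h h0; have := homog_res h h1.
move=> k1 k0; apply: (homog_disjoint (b := true)) => //=.
have -> : ab_res X h s1 = ab_res X h s - ab_res X h s0 by rewrite es raddfD addrAC subrr add0r.
exact: homogB.
Qed.
End Grading.
End SheafBasics.

(** * Powers of the ideal J *)

Section JideaL.
Variables (R : realType) (T : topologicalType) (O : superSheaf R T).
Implicit Types U V W : opens T.

Lemma res_comp (A : algSheaf R T) U V W (h1 : V `<=` U) (h2 : W `<=` V) (h3 : W `<=` U)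
  (s : A U) : alg_res A h2 (alg_res A h1 s) = alg_res A h3 s.
Proof. exact: alg_res_comp. Qed.

Lemma Jideal_local U (s : O U) : locally (X := O) (@Jideal R T O) s -> Jideal s.
Proof. exact: (@locally_idem _ O). Qed.

Lemma Jpow_local p U (s : O U) : locally (X := O) (@Jpow R T O p) s -> Jpow p s.
Proof. by case: p => [//|p]; apply: (@locally_idem _ O). Qed.

Lemma Jideal0 U : Jideal (0 : O U).
Proof.
apply: (locally0 (X := O)) => V; exists 0%N, (fun=> 0), (fun=> 0), (fun=> 0).
by split=> [[]//|]; rewrite big_ord0.
Qed.

Lemma JidealD U (s t : O U) : Jideal s -> Jideal t -> Jideal (s + t).
Proof.
apply: (locallyD (X := O)) => [V W h u [k [a [b [c [hb ->]]]]]|].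
  exists k, (fun i => alg_res O h (a i)), (fun i => alg_res O h (b i)),
    (fun i => alg_res O h (c i)); split=> [i|]; first exact: (homog_res h (hb i)).
  by rewrite -[LHS]/(alg_res O h _) rmorph_sum; apply: eq_bigr => i _; rewrite !rmorphM.
move=> V u v [k [a [b [c [hb ->]]]]] [l [a' [b' [c' [hb' ->]]]]].
pose f (A : Type) (x : 'I_k -> A) (y : 'I_l -> A) i :=
  match fintype.split i with inl j => x j | inr j => y j end.
exists (k + l)%N, (f _ a a'), (f _ b b'), (f _ c c'); split=> [i|].
  by rewrite /f; case: (fintype.split i).
rewrite big_split_ord /=; congr (_ + _); apply: eq_bigr => i _; rewrite /f.
  by rewrite (unsplitK (inl i)).
by rewrite (unsplitK (inr i)).
Qed.

Lemma JidealMl U (a s : O U) : Jideal s -> Jideal (a * s).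
Proof.
move=> Js x /Js [V [h [Vx [k [b [c [d [hc e]]]]]]]]; exists V, h; split=> //.
exists k, (fun i => alg_res O h a * b i), c, d; split=> //.
rewrite -[LHS]/(alg_res O h _) rmorphM [alg_res O h s]e mulr_sumr.
by apply: eq_bigr => i _; rewrite !mulrA.
Qed.

Lemma JidealMr U (a s : O U) : Jideal s -> Jideal (s * a).
Proof.
move=> Js x /Js [V [h [Vx [k [b [c [d [hc e]]]]]]]]; exists V, h; split=> //.
exists k, b, c, (fun i => d i * alg_res O h a); split=> //.
rewrite -[LHS]/(alg_res O h _) rmorphM [alg_res O h s]e mulr_suml.
by apply: eq_bigr => i _; rewrite !mulrA.
Qed.

Lemma Jideal_odd U (s : O U) : homog (sgr O) true s -> Jideal s.
Proof.
move=> hs; apply: (@locally_in _ O); exists 1%N, (fun=> 1), (fun=> s), (fun=> 1).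
by split=> //; rewrite big_ord1 mul1r mulr1.
Qed.

Lemma JpowB p U (s t : O U) : Jpow p s -> Jpow p t -> Jpow p (s - t).
Proof. by move=> hs ht; apply: JpowD => //; apply: JpowN. Qed.

Lemma Jpow_sum p U (I : Type) (r : seq I) (P : pred I) (f : I -> O U) :
  (forall i, P i -> Jpow p (f i)) -> Jpow p (\sum_(i <- r | P i) f i).
Proof. by move=> hf; apply: big_ind => //; [apply: Jpow0 | move=> *; apply: JpowD]. Qed.

Lemma JpowMJ p U (a b : O U) : Jpow p a -> Jideal b -> Jpow p.+1 (a * b).
Proof.
move=> ha hb; apply: (@locally_in _ O); exists 1%N, (fun=> a), (fun=> b).
by rewrite big_ord1.
Qed.

Lemma JpowMr p U (a s : O U) : Jpow p s -> Jpow p (s * a).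
Proof.
case: p => [//|p] Js x /Js [V [h [Vx [k [b [c [hbc e]]]]]]]; exists V, h; split=> //.
exists k, b, (fun i => c i * alg_res O h a); split=> [i|].
  by case: (hbc i) => hb hc; split=> //; apply: JidealMr.
rewrite -[LHS]/(alg_res O h _) rmorphM [alg_res O h s]e mulr_suml.
by apply: eq_bigr => i _; rewrite !mulrA.
Qed.

Lemma JpowMl p U (a s : O U) : Jpow p s -> Jpow p (a * s).
Proof.
elim: p U a s => [//|p IH] U a s Js x /Js [V [h [Vx [k [b [c [hbc e]]]]]]].
exists V, h; split=> //.
exists k, (fun i => alg_res O h a * b i), c; split=> [i|].
  by case: (hbc i) => hb hc; split=> //; apply: IH.
rewrite -[LHS]/(alg_res O h _) rmorphM [alg_res O h s]e mulr_sumr.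
by apply: eq_bigr => i _; rewrite !mulrA.
Qed.

Lemma Jpow_S p U (s : O U) : Jpow p.+1 s -> Jpow p s.
Proof.
move=> Js; apply: Jpow_local => x /Js [V [h [Vx [k [b [c [hbc e]]]]]]].
exists V, h; split=> //; rewrite e; apply: Jpow_sum => i _; apply: JpowMr.
by case: (hbc i).
Qed.

Lemma Jpow_le p q U (s : O U) : (q <= p)%N -> Jpow p s -> Jpow q s.
Proof.
move=> /subnK <-; elim: (p - q)%N => [//|k IH]; rewrite addSn => /Jpow_S; exact: IH.
Qed.

Lemma Jpow1 U (s : O U) : Jpow 1 s <-> Jideal s.
Proof.
split=> hs; last by rewrite -[s]mul1r; apply: JpowMJ.
apply: Jideal_local => x /hs [V [h [Vx [k [b [c [hbc e]]]]]]].
exists V, h; split=> //; rewrite e.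
apply: big_ind => [|u v|i _]; [exact: Jideal0 | exact: JidealD |].
by apply: JidealMl; case: (hbc i).
Qed.

Lemma JpowM p q U (a b : O U) : Jpow p a -> Jpow q b -> Jpow (p + q) (a * b).
Proof.
elim: q U a b => [|q IH] U a b ha hb; first by rewrite addn0; apply: JpowMr.
apply: Jpow_local => x /hb [V [h [Vx [k [c [d [hcd e]]]]]]].
exists V, h; split=> //; rewrite -[ab_res _ _ _]/(alg_res O h _) rmorphM.
rewrite [alg_res O h b]e mulr_sumr; apply: Jpow_sum => i _.
rewrite mulrA addnS; case: (hcd i) => hc hd; apply: JpowMJ => //.
by apply: IH => //; apply: Jpow_res.
Qed.
End JideaL.

(** * Shuffle signs and superdomain charts *)

Section ShuffleSign.
Variables (R : realType) (m : nat).
Local Notation C := (complexes R).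
Implicit Types I J K : {set 'I_m}.

Lemma shuffle_sign0l J : shuffle_sign R finset.set0 J = 1.
Proof.
rewrite /shuffle_sign (_ : #|_| = 0%N) ?expr0 //.
by apply: eq_card0 => -[i j]; rewrite !inE.
Qed.

Lemma shuffle_sign_sqr I J : shuffle_sign R I J * shuffle_sign R I J = 1.
Proof. by rewrite /shuffle_sign -expr2 sqrr_sign. Qed.

(** A pair in the product of the disjoint sets [I] and [J] is counted in exactly one of the two
    signs, so the two counts add up to the product of the cardinalities. *)
Lemma shuffle_signC I J : I :&: J = finset.set0 ->
  shuffle_sign R J I = (-1) ^+ (#|I| * #|J|) * shuffle_sign R I J.
Proof.
move=> dIJ; rewrite /shuffle_sign.
set A := [pred ij | [&& ij.1 \in I, ij.2 \in J & (ij.2 < ij.1)%N]].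
set B := [pred ij | _].
have -> : (#|I| * #|J| = #|A| + #|B|)%N.
  pose sw (p : 'I_m * 'I_m) := (p.2, p.1).
  have swK : involutive sw by case.
  rewrite -cardsX -(fintype.card_image (inv_inj swK) B) -cardUI.
  rewrite [X in (_ = _ + X)%N]eq_card0; last first.
    move=> [i j]; rewrite !inE /=; apply/negP => /andP[/and3P[/= _ _ lt]].
    by case/fintype.imageP => -[i' j'] /and3P[/= _ _ lt'] [e1 e2]; subst; move: lt';
      rewrite ltnNge ltnW.
  rewrite addn0; apply: eq_card => -[i j]; rewrite !inE /=.
  have -> : ((i, j) \in [seq sw x | x in B]) = ((j, i) \in B) by rewrite -[(i,j)]/(sw (j,
    i)) fintype.mem_image //; apply: inv_inj.
  rewrite !inE /=; case iI: (i \in I); case jJ: (j \in J) => //=.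
  case: ltngtP => // eij; have : i \in I :&: J by rewrite inE iI (ord_inj (esym eij)) jJ.
  by rewrite dIJ inE.
by rewrite addnC exprD -mulrA -exprD addnn -[X in _ * X]signr_odd odd_double expr0 mulr1.
Qed.
End ShuffleSign.

Section Chart.
Variables (R : realType) (T : topologicalType) (O : superSheaf R T) (n m : nat).
Variables (U : opens T) (ch : superchart O n m U).
Local Notation C := (complexes R).
Implicit Types (W : opens T) (I J K : {set 'I_m}).

Lemma coef_ext W (h : W `<=` U) (s t : O W) :
  superfun_eq (chart ch @` W) (coef ch h s) (coef ch h t) -> s = t.
Proof.
move=> st; have [u [_ uu]] := @coef_bij _ _ _ _ _ _ ch W h (coef ch h t) (coef_holo h t).
by rewrite -(uu s) // -(uu t).
Qed.

Lemma coef0 W (h : W `<=` U) : superfun_eq (chart ch @` W) (coef ch h 0) (fun _ _ => 0).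
Proof.
move=> I x Wx; have := @Defs.coefD _ _ _ _ _ _ ch W h 0 0 I x Wx.
by rewrite addr0 => e; apply: (addrI (coef ch h 0 I x)); rewrite -e addr0.
Qed.

Lemma coef_sum W (h : W `<=` U) (J : Type) (r : seq J) (P : pred J) (f : J -> O W) :
  superfun_eq (chart ch @` W) (coef ch h (\sum_(j <- r | P j) f j))
    (fun I x => \sum_(j <- r | P j) coef ch h (f j) I x).
Proof.
move=> I x Wx; elim: r => [|j r IH]; first by rewrite !big_nil coef0.
rewrite !big_cons; case: (P j) => //.
by rewrite (Defs.coefD h _ _ I Wx) IH.
Qed.

Lemma coefN W (h : W `<=` U) s :
  superfun_eq (chart ch @` W) (coef ch h (- s)) (fun I x => - coef ch h s I x).
Proof.
move=> I x Wx; apply: (addrI (coef ch h s I x)).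
by rewrite -(Defs.coefD h _ _ I Wx) !subrr coef0.
Qed.

Lemma coef_elem W (h : W `<=` U) I (g : 'rV[C]_n -> C) :
  holomorphic (chart ch @` W) g -> exists s : O W,
  superfun_eq (chart ch @` W) (coef ch h s) (fun J x => if J == I then g x else 0).
Proof.
move=> hg; have [|s [es _]] := @coef_bij _ _ _ _ _ _ ch W h
  (fun J x => if J == I then g x else 0); last by exists s.
by move=> J; case: (J == I) => // x _; apply: differentiable_cst.
Qed.

(** The substitution of [K :\: I] for [I] interchanges the factors in the convolution sum. Only
    index sets of the parities [a] and [b] contribute, and for these the sign from [shuffle_signC]
    is the constant on the right. *)
Lemma supercomm W (f g : O W) a b : W `<=` U -> homog (sgr O) a f -> homog (sgr O) b g ->
  f * g = (-1) ^+ (a && b) * (g * f).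
Proof.
move=> h /(@coef_hom _ _ _ _ _ _ ch W h) hf /(@coef_hom _ _ _ _ _ _ ch W h) hg;
  apply: (coef_ext (h := h)) => K x Wx.
have -> : coef ch h ((-1) ^+ (a && b) * (g * f)) K x =
    (-1) ^+ (a && b) * coef ch h (g * f) K x.
  case: (a && b); first by rewrite expr1 !mulN1r coefN.
  by rewrite expr0 !mul1r.
rewrite (Defs.coefM h f g K Wx) (Defs.coefM h g f K Wx) /superfun_mul mulr_sumr.
rewrite [RHS](reindex_onto (fun I => K :\: I) (fun I => K :\: I)) /=; last first.
  by move=> I sIK; rewrite finset.setDDr finset.setDv finset.set0U; apply/finset.setIidPr.
apply: eq_big => [I|I sIK].
  rewrite finset.subsetDl /=; apply/idP/eqP => [sIK|<-]; last exact: finset.subsetDl.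
  by rewrite finset.setDDr finset.setDv finset.set0U; apply/finset.setIidPr.
have -> : K :\: (K :\: I) = I.
  by rewrite finset.setDDr finset.setDv finset.set0U; apply/finset.setIidPr.
case: (eqVneq (odd #|I|) a) => [ea|na]; last by rewrite (hf I x) // !(mul0r, mulr0).
case: (eqVneq (odd #|K :\: I|) b) => [eb|nb]; last by rewrite (hg _ x) // !(mul0r, mulr0).
have dIK : I :&: (K :\: I) = finset.set0.
  by rewrite finset.setIDA -finset.setIDAC finset.setDv finset.set0I.
rewrite (shuffle_signC R dIK) -[in X in _ = X * _]ea -eb -oddM signr_odd.
rewrite !mulrA -exprD addnn -signr_odd odd_double expr0 mul1r -!mulrA.
by rewrite [coef ch h f I x * _]mulrC.
Qed.
End Chart.

Section ChartMul.
Variables (R : realType) (T : topologicalType) (O : superSheaf R T) (n m : nat).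
Variables (U : opens T) (ch : superchart O n m U).
Local Notation C := (complexes R).
Implicit Types (V W : opens T) (I J K : {set 'I_m}).

Lemma coefM_elem W (h : W `<=` U) (s t : O W) I (g : 'rV[C]_n -> C) :
  superfun_eq (chart ch @` W) (coef ch h s) (fun J x => if J == I then g x else 0) ->
  superfun_eq (chart ch @` W) (coef ch h (s * t)) (fun K x =>
    if I \subset K then shuffle_sign R I (K :\: I) * (g x * coef ch h t (K :\: I) x) else 0).
Proof.
move=> es K x Wx; rewrite (Defs.coefM h s t K Wx) /superfun_mul.
case: ifP => IK.
  rewrite (bigD1 I) //= es // eqxx big1 ?addr0 // => J /andP[_ /negbTE nJ].
  by rewrite es // nJ mul0r mulr0.
rewrite big1 // => J JK; rewrite es //; case: eqP => [eJ|]; last by rewrite mul0r mulr0.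
by rewrite -eJ JK in IK.
Qed.

Lemma coefM_set0 W (h : W `<=` U) (s t : O W) x : (chart ch @` W) x ->
  coef ch h (s * t) finset.set0 x = coef ch h s finset.set0 x * coef ch h t finset.set0 x.
Proof.
move=> Wx; rewrite (Defs.coefM h s t _ Wx) /superfun_mul.
rewrite (big_pred1 finset.set0) => [|I]; last by rewrite finset.subset0.
by rewrite shuffle_sign0l mul1r finset.setD0.
Qed.

Lemma Jideal_coef_set0 W (h : W `<=` U) (s : O W) x : Jideal s -> (chart ch @` W) x ->
  coef ch h s finset.set0 x = 0.
Proof.
move=> Js [y Wy <-]; have [V [k [Vy [r [a [b [c [hb e]]]]]]]] := Js y Wy.
have kU := subset_trans k h.
have Vx : (chart ch @` V) (chart ch y) by exists y.
rewrite -(coef_res h kU k s _ Vx) [alg_res O k s]e (coef_sum kU _ _ _ _ Vx) big1 // => i _.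
rewrite !(coefM_set0 kU) // (proj1 (@coef_hom _ _ _ _ _ _ ch V kU true (b i)) (hb i)) //.
  by rewrite mulr0 mul0r.
by rewrite finset.cards0.
Qed.

(** Cut [s] into the terms [el I] with a single index set. For nonempty [I] such a term is, up to a
    constant, the product of an odd coordinate with another section. *)
Lemma coef_set0_Jideal W (h : W `<=` U) (s : O W) :
  (forall x, (chart ch @` W) x -> coef ch h s finset.set0 x = 0) -> Jideal s.
Proof.
move=> s0.
pose el I := sval (cid (@coef_elem _ _ _ _ _ _ ch W h I _ (coef_holo h s I))).
have elP I : superfun_eq (chart ch @` W) (coef ch h (el I))
  (fun J x => if J == I then coef ch h s I x else 0) by rewrite /el; case: cid.
have -> : s = \sum_(I : {set 'I_m} | I != finset.set0) el I.
  apply: (coef_ext (ch := ch) (h := h)) => K x Wx; rewrite (coef_sum h _ _ _ _ Wx).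
  have [->|K0] := eqVneq K finset.set0.
    rewrite s0 // big1 // => I I0; rewrite elP // eq_sym (negbTE I0) //.
  rewrite (bigD1 K) //= elP // eqxx big1 ?addr0 // => I /andP[_ nI].
  by rewrite elP // eq_sym (negbTE nI).
apply: big_ind => [|u v|I I0]; [exact: Jideal0 | exact: JidealD |].
have [i iI] := set0Pn _ I0.
have [u hu] := @coef_elem _ _ _ _ _ _ ch W h (finset.set1 i) (fun=> 1)
  (fun x _ => differentiable_cst _ _).
have [v hv] := @coef_elem _ _ _ _ _ _ ch W h (I :\ i) _ (coef_holo h s I).
(* Being its own inverse, the sign cancels the one produced by the product [u * v]. *)
have -> : el I = scal O W (shuffle_sign R (finset.set1 i) (I :\ i)) * (u * v).
  apply: (coef_ext (ch := ch) (h := h)) => K x Wx.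
  have cs : superfun_eq (chart ch @` W)
      (coef ch h (scal O W (shuffle_sign R (finset.set1 i) (I :\ i))))
      (fun J x => if J == finset.set0 then shuffle_sign R (finset.set1 i) (I :\ i) else 0).
    by move=> J y Wy; rewrite (coef_scal h).
  rewrite elP // (coefM_elem (u * v) cs K Wx) finset.sub0set finset.setD0 shuffle_sign0l mul1r.
  rewrite (coefM_elem v hu K Wx) finset.sub1set mul1r.
  case: eqP => [->|nKI].
    by rewrite iI hv // eqxx mulrA shuffle_sign_sqr mul1r.
  case: ifP => iK; last by rewrite mulr0.
  rewrite hv //; case: eqP => [e|]; last by rewrite !mulr0.
  by case: nKI; rewrite -(finset.setD1K iK) e finset.setD1K.
apply: JidealMl; apply: JidealMr; apply: Jideal_odd.
apply/(coef_hom ch h) => J x Wx oJ; rewrite hu //; case: eqP => // eJ.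
by rewrite eJ cards1 in oJ.
Qed.
End ChartMul.

(** * Frames *)

Section Supercommutative.
Variables (R : realType) (T : topologicalType) (F : algSheaf R T) (n m : nat).
Variable Y : supermanifold F n m.
Implicit Types (U V W : opens T).

Lemma red_eq0 W (s : Y W) : red Y W s = 0 <-> Jideal s.
Proof. exact: (quo_ker (red_quotient Y)). Qed.

Lemma sm_supercomm W (f g : Y W) a b : homog (sgr Y) a f -> homog (sgr Y) b g ->
  f * g = (-1) ^+ (a && b) * (g * f).
Proof.
move=> hf hg; apply: (@ab_separated _ Y) => x Wx; have [U [Ux [ch]]] := sm_charts Y x.
exists (opensI U W), (@opensIr _ U W); split=> //.
rewrite -![ab_res _ _ _]/(alg_res Y (@opensIr _ U W) _) !rmorphM rmorph_sign.
apply: (supercomm ch); first exact: opensIl.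
  exact: (homog_res (@opensIr _ U W) hf).
exact: (homog_res (@opensIr _ U W) hg).
Qed.

Lemma sm_even_central W (f g : Y W) : homog (sgr Y) false f -> f * g = g * f.
Proof.
move=> hf; have [g0 [g1 [h0 h1 ->]]] := homog_decomp (sgr Y) g.
by rewrite mulrDr mulrDl (sm_supercomm hf h0) (sm_supercomm hf h1) /= expr0 !mul1r.
Qed.

Lemma sm_odd_anticomm W (f g : Y W) : homog (sgr Y) true f -> homog (sgr Y) true g ->
  f * g = - (g * f).
Proof. by move=> hf hg; rewrite (sm_supercomm hf hg) expr1 mulN1r. Qed.

(** The square equals its own negative, and 2 is an invertible constant. *)
Lemma sm_odd_sqr W (f : Y W) : homog (sgr Y) true f -> f * f = 0.
Proof.
move=> hf; have e := sm_odd_anticomm hf hf.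
have e2 : scal Y W 2 * (f * f) = 0.
  by rewrite (rmorphD _ 1 1) rmorph1 mulrDl mul1r {1}e addNr.
rewrite -[LHS]mul1r -(rmorph1 (scal Y W)) -(@mulVf (complexes R) 2) ?pnatr_eq0 //.
by rewrite rmorphM -mulrA e2 mulr0.
Qed.

Lemma odd_anticommuting W (eta : 'I_m -> Y W) :
  (forall i, homog (sgr Y) true (eta i)) -> anticommuting eta.
Proof. by move=> he; split=> *; [apply: sm_odd_anticomm | apply: sm_odd_sqr]. Qed.

Lemma homog1 W : homog (sgr Y) false (1 : Y W).
Proof. by rewrite -(rmorph1 (scal Y W)); apply: sgr_scal. Qed.

Lemma homog_monomial W (eta : 'I_m -> Y W) (I : {set 'I_m}) :
  (forall i, homog (sgr Y) true (eta i)) ->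
  homog (sgr Y) (odd #|I|) (monomial eta I).
Proof.
move=> he; rewrite /monomial /word cardE; elim: (enum I) => [|i w IH] /=.
  by rewrite big_nil; apply: homog1.
by rewrite big_cons; exact: (Defs.sgrM (he i) IH).
Qed.

Lemma Jpow_monomial W (eta : 'I_m -> Y W) (I : {set 'I_m}) :
  (forall i, Jideal (eta i)) -> Jpow #|I| (monomial eta I).
Proof.
move=> he; rewrite /monomial /word cardE; elim: (enum I) => [//|i w IH].
rewrite big_cons; apply: (@JpowM _ _ Y 1 (size w)) => //; exact/Jpow1.
Qed.
End Supercommutative.

Section Frames.
Variables (R : realType) (T : topologicalType) (F : algSheaf R T) (n m : nat).
Implicit Types (U V W : opens T).

(** A multiplicative local section of [red]: it embeds F as the superfunctions free of odd
    coordinates. Such an embedding depends on the chart. *)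
Record is_splitting (Y : supermanifold F n m) U (tau : homfam F Y U) : Prop := IsSplitting {
  spD : forall V h c d, tau V h (c + d) = tau V h c + tau V h d;
  spM : forall V h (c d : F V), tau V h (c * d) = tau V h c * tau V h d;
  sp_scal : forall V h c, tau V h (scal F V c) = scal Y V c;
  sp_res : forall V W (hV : V `<=` U) (hW : W `<=` U) (h : W `<=` V) c,
    tau W hW (alg_res F h c) = alg_res Y h (tau V hV c);
  sp_even : forall V h c, homog (sgr Y) false (tau V h c);
  sp_red : forall V h c, red Y V (tau V h c) = c
}.

Definition fsum (Y : supermanifold F n m) U (tau : homfam F Y U) (eta : 'I_m -> Y U)
    V (h : V `<=` U) (c : {set 'I_m} -> F V) : Y V :=
  \sum_(I : {set 'I_m}) tau V h (c I) * monomial (fun i => alg_res Y h (eta i)) I.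

(* Over U, tau and eta identify Y with the exterior algebra over F on the eta i. Charts
   provide frames, and frames are all that is used of the charts. *)
Record is_frame (Y : supermanifold F n m) U (tau : homfam F Y U)
    (eta : 'I_m -> Y U) : Prop := IsFrame {
  fr_split : is_splitting tau;
  fr_odd : forall i, homog (sgr Y) true (eta i);
  fr_span : forall V (h : V `<=` U) (y : Y V), exists c, y = fsum tau eta h c;
  fr_indep : forall V (h : V `<=` U) c, fsum tau eta h c = 0 -> forall I, c I = 0
}.
End Frames.

Section ChartFrame.
Variables (R : realType) (T : topologicalType) (F : algSheaf R T) (n m : nat).
Variables (Y : supermanifold F n m) (U : opens T) (ch : superchart Y n m U).
Implicit Types (V W : opens T) (I J K : {set 'I_m}).

(** [t] is the function [c] viewed as a superfunction without odd coordinates. A chart of O does not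
    mention F, so [c] enters through [red] and not through coefficients. *)
Let body W (h : W `<=` U) (c : F W) (t : Y W) : Prop :=
  red Y W t = c /\ forall I, I != finset.set0 -> forall x, (chart ch @` W) x ->
    coef ch h t I x = 0.

Let body_unique W (h : W `<=` U) c (t t' : Y W) : body h c t -> body h c t' -> t = t'.
Proof.
move=> [e b] [e' b']; apply/eqP; rewrite -subr_eq0; apply/eqP.
apply: (coef_ext (ch := ch) (h := h)) => I x Wx; rewrite (coef0 h _ Wx).
rewrite (Defs.coefD h _ _ _ Wx) (coefN h _ _ Wx).
have [->|I0] := eqVneq I finset.set0; last by rewrite b // b' // subrr.
have /(Jideal_coef_set0 (ch := ch) h) : Jideal (t - t').
  by apply/red_eq0; rewrite rmorphB e e' subrr.
by move=> /(_ x Wx); rewrite (Defs.coefD h _ _ _ Wx) (coefN h _ _ Wx).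
Qed.

Let body_res V W (hV : V `<=` U) (hW : W `<=` U) (h : W `<=` V) c t :
  body hV c t -> body hW (alg_res F h c) (alg_res Y h t).
Proof.
move=> [e b]; split; first by rewrite alg_fun_res e.
move=> I I0 x Wx; rewrite (coef_res hV hW h _ _ Wx) b //.
by case: Wx => y Wy <-; exists y => //; apply: h.
Qed.

Let body_coef W (h : W `<=` U) (s : Y W) : exists t : Y W, body h (red Y W s) t /\
  forall x, (chart ch @` W) x -> coef ch h t finset.set0 x = coef ch h s finset.set0 x.
Proof.
have [t ht] := @coef_elem _ _ _ _ _ _ ch W h finset.set0 _ (coef_holo h s finset.set0).
exists t; split; last by move=> x Wx; rewrite ht // eqxx.
split; last by move=> I I0 x Wx; rewrite ht // (negbTE I0).
apply/eqP; rewrite -subr_eq0 -rmorphB; apply/eqP/red_eq0.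
apply: (coef_set0_Jideal (ch := ch) (h := h)) => x Wx.
by rewrite (Defs.coefD h _ _ _ Wx) (coefN h _ _ Wx) ht // eqxx subrr.
Qed.

(** Since [red] is onto only locally, lifts of [c] are chosen locally, freed of their odd terms by
    [body_coef], and glued by [body_unique]. *)
Let body_exists W (h : W `<=` U) (c : F W) : exists t, body h c t.
Proof.
have [|||s hs] := @ab_glue_unique _ Y W
    (fun V k t => body (subset_trans k h) (alg_res F k c) t).
- move=> V V' hV hV' k t bt.
  by rewrite -(res_comp hV k hV'); apply: body_res bt.
- by move=> V hV t t'; apply: body_unique.
- move=> x Wx; have [V [k [Vx [s _ es]]]] := quo_onto (red_quotient Y) (t := c) Logic.I Wx.
  have [r [br _]] := body_coef (subset_trans k h) s; exists V, k, r; split=> //.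
  by move: br; rewrite es.
exists s; split.
  apply: (@ab_separated _ F) => x /hs [V [k [Vx [e _]]]]; exists V, k; split=> //.
  by rewrite -[LHS]/(alg_res F k _) -alg_fun_res.
move=> K K0 _ [x /hs [V [k [Vx [_ b]]]] <-].
have Vx' : (chart ch @` V) (chart ch x) by exists x.
rewrite -(coef_res h (subset_trans k h) k s _ Vx'); exact: b.
Qed.

Definition chart_splitting : homfam F Y U := fun W h c => sval (cid (body_exists h c)).

Let splitP W (h : W `<=` U) c : body h c (chart_splitting h c).
Proof. by rewrite /chart_splitting; case: cid. Qed.

Let splitE W (h : W `<=` U) c t : body h c t -> chart_splitting h c = t.
Proof. by move=> bt; apply: body_unique (splitP h c) bt. Qed.

Lemma chart_splittingP : is_splitting chart_splitting.
Proof.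
split.
- move=> V h c d; apply: splitE.
  have [ec bc] := splitP h c; have [ed bd] := splitP h d; split.
    by rewrite rmorphD ec ed.
  by move=> I I0 x Vx; rewrite (Defs.coefD h _ _ _ Vx) bc // bd // addr0.
- move=> V h c d; apply: splitE.
  have [ec bc] := splitP h c; have [ed bd] := splitP h d; split.
    by rewrite rmorphM ec ed.
  move=> I I0 x Vx; rewrite (Defs.coefM h _ _ _ Vx) /superfun_mul big1 // => J JI.
  have [J0|J0] := eqVneq J finset.set0; last by rewrite bc // mul0r mulr0.
  by rewrite bd ?mulr0 ?mulr0 // J0 finset.setD0.
- move=> V h c; apply: splitE; split; first exact: alg_fun_scal.
  by move=> I I0 x Vx; rewrite (coef_scal h _ _ Vx) (negbTE I0).
- move=> V W hV hW h c; apply: splitE; apply: body_res; exact: splitP.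
- move=> V h c; apply/(coef_hom ch h) => I x Vx oI.
  have [_ b] := splitP h c; apply: b => //.
  by apply: contraNneq oI => ->; rewrite finset.cards0.
- by move=> V h c; case: (splitP h c).
Qed.

Lemma chart_splitting_surj W (h : W `<=` U) (s : Y W) : exists c,
  forall x, (chart ch @` W) x ->
  coef ch h (chart_splitting h c) finset.set0 x = coef ch h s finset.set0 x.
Proof.
have [t [bt et]] := body_coef h s; exists (red Y W s) => x Wx.
by rewrite (splitE bt) et.
Qed.

Lemma chart_splitting0 W (h : W `<=` U) c : 
  (forall x, (chart ch @` W) x -> coef ch h (chart_splitting h c) finset.set0 x = 0) ->
  c = 0.
Proof.
move=> e0; have [e b] := splitP h c; rewrite -e.
suff -> : chart_splitting h c = 0 by rewrite rmorph0.
apply: (coef_ext (ch := ch) (h := h)) => I x Wx; rewrite (coef0 h _ Wx).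
by have [->|I0] := eqVneq I finset.set0; [apply: e0 | apply: b].
Qed.

Lemma chart_splitting_coef W (h : W `<=` U) c :
  superfun_eq (chart ch @` W) (coef ch h (chart_splitting h c)) (fun J x =>
    if J == finset.set0 then coef ch h (chart_splitting h c) finset.set0 x else 0).
Proof.
have [_ b] := splitP h c.
by move=> J x Wx; have [->//|J0] := eqVneq J finset.set0; rewrite b.
Qed.

Let xi_ex i := @coef_elem _ _ _ _ _ _ ch U (@subset_refl _ U) (finset.set1 i) (fun=> 1)
  (fun x _ => differentiable_cst _ _).

Definition chart_odd i : Y U := sval (cid (xi_ex i)).

Let xi_coef W (h : W `<=` U) i : superfun_eq (chart ch @` W)
  (coef ch h (alg_res Y h (chart_odd i)))
  (fun J _ => if J == finset.set1 i then 1 else 0).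
Proof.
move=> J x Wx; rewrite (coef_res (@subset_refl _ U) h h _ _ Wx) /chart_odd.
case: cid => s /= ->//; case: Wx => y Wy <-; exists y => //; exact: h.
Qed.

(** The coefficient [e] is a product of shuffle signs. Only [e * e = 1] is recorded, which is what
    allows one to divide by it. *)
Let word_coef W (h : W `<=` U) (w : seq 'I_m) : uniq w -> exists2 e : complexes R, e * e = 1 &
  superfun_eq (chart ch @` W)
    (coef ch h (word (fun i => alg_res Y h (chart_odd i)) w))
    (fun J _ => if J == [set x in w] then e else 0).
Proof.
elim: w => [|i w IH] /=.
  move=> _; exists 1; rewrite ?mulr1 // => J x Wx.
  rewrite /word big_nil -(rmorph1 (scal Y W)) (coef_scal h _ _ Wx).
  by rewrite (_ : [set x in [::]] = finset.set0) //; apply/setP => y; rewrite !inE.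
move=> /andP[iw /IH [e e1 he]].
exists (shuffle_sign R (finset.set1 i) [set x in w] * e).
  by rewrite mulrACA shuffle_sign_sqr e1 mulr1.
move=> J x Wx; rewrite /word big_cons (coefM_elem _ (xi_coef h i) _ Wx) finset.sub1set mul1r he //.
have iw' : i \notin [set x in w] by rewrite inE.
have ew : [set x in i :: w] = i |: [set x in w] by apply/setP => y; rewrite !inE.
rewrite ew; case: ifP => iJ.
  have [eJ|nJ] := eqVneq (J :\ i) [set x in w]; first by rewrite -eJ finset.setD1K // eqxx.
  rewrite mulr0; case: eqP => // eJ; case/eqP: nJ; rewrite eJ.
  by rewrite finset.setU1K.
by case: eqP => // eJ; rewrite eJ finset.setU11 in iJ.
Qed.

Lemma chart_frame : is_frame chart_splitting chart_odd.
Proof.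
have mono_coef W (h : W `<=` U) I : exists2 e : complexes R, e * e = 1 &
  superfun_eq (chart ch @` W)
    (coef ch h (monomial (fun i => alg_res Y h (chart_odd i)) I))
    (fun J _ => if J == I then e else 0).
  have [e e1 he] := word_coef h (enum_uniq I); exists e => // J x Wx.
  by rewrite /monomial he // (_ : [set x in enum I] = I) //; apply/setP => y; rewrite inE mem_enum.
have term_coef W (h : W `<=` U) c I : exists2 e : complexes R, e * e = 1 &
    superfun_eq (chart ch @` W) (coef ch h
      (chart_splitting h c * monomial (fun i => alg_res Y h (chart_odd i)) I))
    (fun J x => if J == I then coef ch h (chart_splitting h c) finset.set0 x * e else 0).
  have [e e1 he] := mono_coef W h I; exists e => // J x Wx.
  rewrite (coefM_elem _ (chart_splitting_coef h c) _ Wx) finset.sub0set finset.setD0.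
  by rewrite shuffle_sign0l mul1r he //; case: eqP; rewrite ?mulr0.
split.
- exact: chart_splittingP.
- move=> i; rewrite -(alg_res_id (@subset_refl _ U) (chart_odd i)).
  apply/(coef_hom ch (@subset_refl _ U)) => J x Wx oJ; rewrite xi_coef //.
  by case: eqP => // eJ; rewrite eJ cards1 in oJ.
- move=> V h y.
  have ex I : exists c, superfun_eq (chart ch @` V) (coef ch h
      (chart_splitting h c * monomial (fun i => alg_res Y h (chart_odd i)) I))
    (fun J x => if J == I then coef ch h y I x else 0).
    have [e e1 he] := mono_coef V h I.
    have [t ht] := @coef_elem _ _ _ _ _ _ ch V h finset.set0 _ (coef_holo h y I).
    (* The factor [e] cancels the sign that the monomial carries as a product of odd coordinates. *)
    have [c hc] := chart_splitting_surj h (scal Y V e * t); exists c => J x Vx.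
    rewrite (coefM_elem _ (chart_splitting_coef h c) _ Vx) finset.sub0set finset.setD0.
    rewrite shuffle_sign0l mul1r he // hc // coefM_set0 // (coef_scal h _ _ Vx) eqxx ht // eqxx.
    by case: eqP; rewrite ?mulr0 // mulrAC e1 mul1r.
  exists (fun I => sval (cid (ex I))).
  apply: (coef_ext (ch := ch) (h := h)) => K x Vx; rewrite /fsum (coef_sum h _ _ _ _ Vx).
  rewrite (bigD1 K) //= big1 ?addr0 => [|I nI]; case: cid => c /= hc; rewrite hc //.
    by rewrite eqxx.
  by rewrite eq_sym (negbTE nI).
- move=> V h c e0 I; apply: (chart_splitting0 (h := h)) => x Vx.
  have := coef0 (ch := ch) h I Vx; rewrite -e0 /fsum (coef_sum h _ _ _ _ Vx).
  rewrite (bigD1 I) //= big1 ?addr0 => [|K nK]; last first.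
    by have [e e1 he] := term_coef V h (c K) K; rewrite he // eq_sym (negbTE nK).
  have [e e1 he] := term_coef V h (c I) I; rewrite he // eqxx => e2.
  by rewrite -[LHS]mulr1 -e1 mulrA e2 mul0r.
Qed.
End ChartFrame.

Section FrameSums.
Variables (R : realType) (T : topologicalType) (F : algSheaf R T) (n m : nat).
Variables (Y : supermanifold F n m) (U : opens T) (tau : homfam F Y U).
Variables (eta : 'I_m -> Y U).
Hypotheses (tauP : is_splitting tau) (eta_odd : forall i, homog (sgr Y) true (eta i)).
Implicit Types (V W : opens T) (I J K : {set 'I_m}).

Definition mon V (h : V `<=` U) I : Y V := monomial (fun i => alg_res Y h (eta i)) I.

Lemma sp0 V (h : V `<=` U) : tau h 0 = 0.
Proof. by apply: (addrI (tau h 0)); rewrite -(spD tauP) !addr0. Qed.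

Lemma spN V (h : V `<=` U) c : tau h (- c) = - tau h c.
Proof. by apply: (addrI (tau h c)); rewrite -(spD tauP) !subrr sp0. Qed.

Lemma sp1 V (h : V `<=` U) : tau h (1 : F V) = 1.
Proof. by rewrite -(rmorph1 (scal F V)) (sp_scal tauP) rmorph1. Qed.

Lemma sp_central V (h : V `<=` U) c y : tau h c * y = y * tau h c.
Proof. by apply: sm_even_central; apply: (sp_even tauP). Qed.

Lemma mon_res V W (hV : V `<=` U) (hW : W `<=` U) (h : W `<=` V) I :
  alg_res Y h (mon hV I) = mon hW I.
Proof.
rewrite /mon rmorph_monomial; congr monomial; apply/funext => i.
exact: alg_res_comp.
Qed.

Lemma res_odd V (h : V `<=` U) i : homog (sgr Y) true (alg_res Y h (eta i)).
Proof. exact: (homog_res h (eta_odd i)). Qed.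

Lemma res_anticomm V (h : V `<=` U) : anticommuting (fun i => alg_res Y h (eta i)).
Proof. by apply: odd_anticommuting => i; apply: res_odd. Qed.

Lemma mon_homog V (h : V `<=` U) I : homog (sgr Y) (odd #|I|) (mon h I).
Proof. by apply: homog_monomial => i; apply: res_odd. Qed.

Lemma mon_Jpow V (h : V `<=` U) I : Jpow #|I| (mon h I).
Proof. by apply: Jpow_monomial => i; apply: Jideal_odd; apply: res_odd. Qed.

Lemma mon_set0 V (h : V `<=` U) : mon h finset.set0 = 1.
Proof. exact: monomial0. Qed.

Lemma mon_set1 V (h : V `<=` U) i : mon h (finset.set1 i) = alg_res Y h (eta i).
Proof. exact: monomial1. Qed.

Lemma monM V (h : V `<=` U) I J : mon h I * mon h J =
  if set_sign I J is Some (b, K) then (-1) ^+ (b : bool) * mon h K else 0.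
Proof. exact: monomialM (res_anticomm h). Qed.

Lemma fsumE V (h : V `<=` U) c : fsum tau eta h c = \sum_I tau h (c I) * mon h I.
Proof. by []. Qed.

Lemma fsumD V (h : V `<=` U) c d :
  fsum tau eta h (fun I => c I + d I) = fsum tau eta h c + fsum tau eta h d.
Proof. by rewrite !fsumE -big_split; apply: eq_bigr => I _; rewrite (spD tauP) mulrDl. Qed.

Lemma fsumN V (h : V `<=` U) c : fsum tau eta h (fun I => - c I) = - fsum tau eta h c.
Proof. by rewrite !fsumE -sumrN; apply: eq_bigr => I _; rewrite spN mulNr. Qed.

Lemma fsum0 V (h : V `<=` U) : fsum tau eta h (fun _ => 0) = 0.
Proof. by rewrite fsumE big1 // => I _; rewrite sp0 mul0r. Qed.

Lemma fsum_res V W (hV : V `<=` U) (hW : W `<=` U) (h : W `<=` V) c :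
  alg_res Y h (fsum tau eta hV c) = fsum tau eta hW (fun I => alg_res F h (c I)).
Proof.
rewrite !fsumE rmorph_sum; apply: eq_bigr => I _.
by rewrite rmorphM (mon_res hV hW) (sp_res tauP hV hW).
Qed.

Lemma fsum_delta V (h : V `<=` U) c I :
  fsum tau eta h (fun J => if J == I then c else 0) = tau h c * mon h I.
Proof.
rewrite fsumE (bigD1 I) //= eqxx big1 ?addr0 // => J /negbTE ->.
by rewrite sp0 mul0r.
Qed.

Lemma fsum_red V (h : V `<=` U) c : red Y V (fsum tau eta h c) = c finset.set0.
Proof.
rewrite fsumE rmorph_sum (bigD1 finset.set0) //= mon_set0 mulr1 (sp_red tauP).
rewrite big1 ?addr0 // => I I0; rewrite rmorphM.
suff -> : red Y V (mon h I) = 0 by rewrite mulr0.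
apply/red_eq0/Jpow1; apply: Jpow_le (mon_Jpow h I).
by rewrite card_gt0.
Qed.

(** One notion for several purposes: [pred1 p] gives the component of degree p, [leq p] the power
    J^p, and the condition [odd k == b] the sections of parity [b]. Products are then handled at
    once by [fdegM]. *)
Definition fdeg (P : pred nat) V (h : V `<=` U) (y : Y V) : Prop :=
  exists2 c, y = fsum tau eta h c & forall I, ~~ P #|I| -> c I = 0.

Lemma fdeg0 P V (h : V `<=` U) : fdeg P h 0.
Proof. by exists (fun _ => 0); rewrite ?fsum0. Qed.

Lemma fdegD P V (h : V `<=` U) y z : fdeg P h y -> fdeg P h z -> fdeg P h (y + z).
Proof.
move=> [c -> hc] [d -> hd]; exists (fun I => c I + d I); first by rewrite fsumD.
by move=> I PI; rewrite hc // hd // addr0.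
Qed.

Lemma fdegN P V (h : V `<=` U) y : fdeg P h y -> fdeg P h (- y).
Proof.
move=> [c -> hc]; exists (fun I => - c I); first by rewrite fsumN.
by move=> I PI; rewrite hc // oppr0.
Qed.

Lemma fdeg_sum P V (h : V `<=` U) (A : Type) (r : seq A) (Q : pred A) (f : A -> Y V) :
  (forall i, Q i -> fdeg P h (f i)) -> fdeg P h (\sum_(i <- r | Q i) f i).
Proof. by move=> hf; apply: big_ind => //; [apply: fdeg0 | move=> *; apply: fdegD]. Qed.

Lemma fdeg_mon (P : pred nat) V (h : V `<=` U) c I : P #|I| -> fdeg P h (tau h c * mon h I).
Proof.
move=> PI; exists (fun J => if J == I then c else 0); first by rewrite fsum_delta.
by move=> J PJ; case: eqP => // e; rewrite e PI in PJ.
Qed.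

Lemma fdegM (P Q S : pred nat) V (h : V `<=` U) y z :
  (forall a b, P a -> Q b -> S (a + b)%N) ->
  fdeg P h y -> fdeg Q h z -> fdeg S h (y * z).
Proof.
move=> PQS [c -> hc] [d -> hd]; rewrite !fsumE mulr_suml; apply: fdeg_sum => I _.
rewrite mulr_sumr; apply: fdeg_sum => J _.
have [PI|/hc ->] := boolP (P #|I|); last by rewrite sp0 !mul0r; apply: fdeg0.
have [QJ|/hd ->] := boolP (Q #|J|); last by rewrite sp0 mul0r mulr0; apply: fdeg0.
have -> : tau h (c I) * mon h I * (tau h (d J) * mon h J) =
    tau h (c I * d J) * (mon h I * mon h J).
  by rewrite (spM tauP) -!mulrA; congr (_ * _); rewrite !mulrA sp_central.
rewrite monM; case E: set_sign => [[b K]|]; last by rewrite mulr0; apply: fdeg0.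
have SK : S #|K| by rewrite (set_sign_card E); apply: PQS.
have -> : tau h (c I * d J) * ((-1) ^+ b * mon h K) =
  tau h ((-1) ^+ b * (c I * d J)) * mon h K.
  rewrite mulrA; congr (_ * _); case: b {E}; rewrite ?expr1 ?expr0 ?mulr1 ?mul1r //.
  by rewrite mulrN1 mulN1r spN.
exact: fdeg_mon.
Qed.

Lemma fdeg_weak (P Q : pred nat) V (h : V `<=` U) y :
  (forall k, P k -> Q k) -> fdeg P h y -> fdeg Q h y.
Proof.
move=> PQ [c -> hc]; exists c => // I nQ; apply: hc; apply: contra nQ; exact: PQ.
Qed.

Lemma fdeg_homog b V (h : V `<=` U) y : fdeg (fun k => odd k == b) h y -> homog (sgr Y) b y.
Proof.
move=> [c -> hc]; rewrite fsumE; apply: (homog_sum (g := sgr Y)) => I _.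
have [/eqP <-|/hc ->] := boolP (odd #|I| == b); last first.
  by rewrite sp0 mul0r; apply: (homog0 (sgr Y)).
exact: (Defs.sgrM (sp_even tauP h (c I)) (mon_homog h I)).
Qed.

Lemma fdeg_Jpow p V (h : V `<=` U) y : fdeg (leq p) h y -> Jpow p y.
Proof.
move=> [c -> hc]; rewrite fsumE; apply: Jpow_sum => I _.
have [pI|/hc ->] := boolP (p <= #|I|)%N; last by rewrite sp0 mul0r; apply: Jpow0.
by apply: JpowMl; apply: Jpow_le (mon_Jpow h I).
Qed.
End FrameSums.
Arguments fsumD {R T F n m Y U tau eta} tauP {V} h c d.
Arguments fsumN {R T F n m Y U tau eta} tauP {V} h c.
Arguments fsum0 {R T F n m Y U tau eta} tauP {V} h.
Arguments fsum_res {R T F n m Y U tau eta} tauP {V W} hV hW h c.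
Arguments fsum_delta {R T F n m Y U tau eta} tauP {V} h c I.
Arguments fdeg_mon {R T F n m Y U tau eta} tauP P {V} h c I.
Arguments fdeg0 {R T F n m Y U tau eta} tauP P {V} h.

Section FrameTheory.
Variables (R : realType) (T : topologicalType) (F : algSheaf R T) (n m : nat).
Variables (Y : supermanifold F n m) (U : opens T) (tau : homfam F Y U).
Variables (eta : 'I_m -> Y U) (fr : is_frame tau eta).
Implicit Types (V W : opens T) (I J K : {set 'I_m}).

Let tauP := fr_split fr.
Let etaP := fr_odd fr.
Local Notation fdeg := (fdeg tau eta).
Local Notation fsum := (fsum tau eta).

Lemma fsum_inj V (h : V `<=` U) c d : fsum h c = fsum h d -> c = d.
Proof.
move=> e; apply: funext => I; apply/eqP; rewrite -subr_eq0; apply/eqP.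
apply: (fr_indep fr (h := h) (c := fun I => c I - d I)).
by rewrite (fsumD tauP h c (fun I => - d I)) (fsumN tauP) e subrr.
Qed.

Lemma fdeg_disjoint (P Q : pred nat) V (h : V `<=` U) (y : Y V) :
  (forall k, P k -> Q k -> false) -> fdeg P h y -> fdeg Q h y -> y = 0.
Proof.
move=> PQ [c -> hc] [d /fsum_inj <- hd]; rewrite (_ : c = fun=> 0) ?(fsum0 tauP) //.
apply: funext => I; have [PI|/hc //] := boolP (P #|I|).
by apply: hd; apply/negP => QI; have := PQ _ PI QI.
Qed.

Lemma fdegI (P Q : pred nat) V (h : V `<=` U) (y : Y V) :
  fdeg P h y -> fdeg Q h y -> fdeg (predI P Q) h y.
Proof.
move=> [c -> hc] [d /fsum_inj <- hd]; exists c => // I.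
by rewrite negb_and => /orP[/hc|/hd].
Qed.

Lemma fdeg_local P V (h : V `<=` U) (y : Y V) :
  (forall x, oset V x -> exists W (k : W `<=` V), oset W x /\
     fdeg P (subset_trans k h) (alg_res Y k y)) -> fdeg P h y.
Proof.
have [c ->] := fr_span fr h y => hy; exists c => // I PI.
apply: (@ab_separated _ F) => x /hy [W [k [Wx [d e hd]]]]; exists W, k; split=> //.
rewrite raddf0 -[LHS]/(alg_res F k (c I)).
move: e; rewrite (fsum_res tauP h (subset_trans k h)) => /fsum_inj /(congr1 (@^~ I)) /= ->.
exact: hd.
Qed.

Lemma fdeg_split P V (h : V `<=` U) (y : Y V) :
  exists y1 y2, [/\ fdeg P h y1, fdeg (predC P) h y2 & y = y1 + y2].
Proof.
have [c ->] := fr_span fr h y.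
exists (fsum h (fun I => if P #|I| then c I else 0)),
  (fsum h (fun I => if P #|I| then 0 else c I)); split.
- by exists (fun I => if P #|I| then c I else 0) => // I /negbTE ->.
- by exists (fun I => if P #|I| then 0 else c I) => // I /=; rewrite negbK => ->.
rewrite -(fsumD tauP); congr (fsum h _); apply: funext => I.
by case: (P #|I|); rewrite ?addr0 ?add0r.
Qed.

(** The part of [y] in degrees of the other parity is homogeneous of that parity; as the difference
    of [y] and the remaining part it also has parity [b], so it vanishes. *)
Lemma homog_fdeg b V (h : V `<=` U) (y : Y V) :
  homog (sgr Y) b y <-> fdeg (fun k => odd k == b) h y.
Proof.
split=> [hy|]; last exact: fdeg_homog.
have [y1 [y2 [h1 h2 e]]] := fdeg_split (fun k => odd k == b) h y.
suff y20 : y2 = 0 by rewrite e y20 addr0.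
apply: (homog_disjoint (g := sgr Y) (b := b)).
  have -> : y2 = y - y1 by rewrite e addrAC subrr add0r.
  by apply: (homogB (g := sgr Y)) => //; apply: fdeg_homog h1.
apply: (fdeg_homog tauP etaP (h := h)); apply: fdeg_weak h2 => k /=.
by case: (odd k); case: b {h1 e hy}.
Qed.

Lemma Jideal_fdeg V (h : V `<=` U) (y : Y V) : Jideal y <-> fdeg (leq 1) h y.
Proof.
split=> [Jy|hy]; last by apply/Jpow1; apply: fdeg_Jpow hy.
have [c e] := fr_span fr h y; exists c => // I; rewrite -eqn0Ngt cards_eq0 => /eqP ->.
by rewrite -(fsum_red tauP etaP h) -e; apply/red_eq0.
Qed.

Lemma Jpow_fdeg p V (h : V `<=` U) (y : Y V) : Jpow p y <-> fdeg (leq p) h y.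
Proof.
split; last exact: fdeg_Jpow.
elim: p V h y => [|p IH] V h y.
  by have [c e] := fr_span fr h y; exists c.
move=> Jy; apply: fdeg_local => x /Jy [W [k [Wx [r [a [b [hab e]]]]]]].
exists W, k; split=> //; rewrite [alg_res Y k y]e.
apply: (fdeg_sum tauP) => i _; have [ha hb] := hab i.
apply: (fdegM tauP etaP (P := leq p) (Q := leq 1)); last exact/Jideal_fdeg.
  by move=> u v pu v1; rewrite -addn1 leq_add.
exact: IH.
Qed.

Lemma frame_Jpow_max V (h : V `<=` U) (y : Y V) : Jpow m.+1 y -> y = 0.
Proof.
move=> /(Jpow_fdeg _ h) [c -> hc]; rewrite (_ : c = fun=> 0) ?(fsum0 tauP) //.
apply: funext => I; apply: hc; rewrite -ltnNge ltnS -[X in (_ <= X)%N]card_ord.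
exact: max_card.
Qed.

Lemma frame_Jpow_homog p V (h : V `<=` U) (y y0 y1 : Y V) :
  homog (sgr Y) false y0 -> homog (sgr Y) true y1 -> y = y0 + y1 ->
  Jpow p y -> Jpow p y0 /\ Jpow p y1.
Proof.
move=> h0 h1 e /(Jpow_fdeg _ h) [c ey hc].
suff [e0 e1] : y0 = fsum h (fun I => if odd #|I| then 0 else c I) /\
    y1 = fsum h (fun I => if odd #|I| then c I else 0).
  by split; apply/(Jpow_fdeg _ h); rewrite ?e0 ?e1;
    eexists; try reflexivity; move=> I /hc ->; rewrite if_same.
apply: (homog_unique (g := sgr Y)) => //.
- apply/(homog_fdeg _ h); eexists; first reflexivity.
  by move=> I /=; case: (odd #|I|).
- apply/(homog_fdeg _ h); eexists; first reflexivity.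
  by move=> I /=; case: (odd #|I|).
rewrite -e ey -(fsumD tauP); congr (fsum h _); apply: funext => I.
by case: ifP; rewrite ?addr0 ?add0r.
Qed.

(** A section of parity [b] has components in degrees of parity [b] only, so degree p is skipped.
    For p = 1 this puts the even sections of J into J^2. *)
Lemma frame_Jpow_parity p b V (h : V `<=` U) (y : Y V) : homog (sgr Y) b y -> odd p != b ->
  Jpow p y -> Jpow p.+1 y.
Proof.
move=> /(homog_fdeg _ h) hy pb /(Jpow_fdeg _ h) Jy; apply/(Jpow_fdeg _ h).
apply: fdeg_weak (fdegI hy Jy) => k /= /andP[kb]; rewrite leq_eqVlt => /orP[/eqP e|//].
by rewrite e (eqP kb) eqxx in pb.
Qed.
End FrameTheory.

Section ManifoldFiltration.
Variables (R : realType) (T : topologicalType) (F : algSheaf R T) (n m : nat).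
Variable Y : supermanifold F n m.
Implicit Types (U V W : opens T).

Lemma sm_frame x : exists U (tau : homfam F Y U) (eta : 'I_m -> Y U),
  oset U x /\ is_frame tau eta.
Proof.
have [U [Ux [ch]]] := sm_charts Y x.
by exists U, (chart_splitting ch), (chart_odd ch); split=> //; apply: chart_frame.
Qed.

Lemma Jpow_max U (y : Y U) : Jpow m.+1 y -> y = 0.
Proof.
move=> Jy; apply: (@ab_separated _ Y) => x Ux; have [V [tau [eta [Vx fr]]]] := sm_frame x.
exists (opensI V U), (@opensIr _ V U); split=> //; rewrite raddf0.
apply: (frame_Jpow_max fr (@opensIl _ V U)); exact: (Jpow_res (@opensIr _ V U)).
Qed.

Lemma Jpow_homog p U (y y0 y1 : Y U) :
  homog (sgr Y) false y0 -> homog (sgr Y) true y1 -> y = y0 + y1 ->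
  Jpow p y -> Jpow p y0 /\ Jpow p y1.
Proof.
move=> h0 h1 e Jy; suff H x : oset U x -> exists V (h : V `<=` U), oset V x /\
    (Jpow p (alg_res Y h y0) /\ Jpow p (alg_res Y h y1)).
  by split; apply: Jpow_local => x /H [V [h [Vx []]]]; exists V, h.
move=> Ux; have [V [tau [eta [Vx fr]]]] := sm_frame x.
exists (opensI V U), (@opensIr _ V U); split=> //.
apply: (frame_Jpow_homog fr (@opensIl _ V U) (y := alg_res Y (@opensIr _ V U) y)).
- exact: (homog_res (@opensIr _ V U) h0).
- exact: (homog_res (@opensIr _ V U) h1).
- by rewrite e rmorphD.
exact: Jpow_res.
Qed.

Lemma Jpow_parity p b U (y : Y U) : homog (sgr Y) b y -> odd p != b ->
  Jpow p y -> Jpow p.+1 y.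
Proof.
move=> hy pb Jy; apply: Jpow_local => x Ux; have [V [tau [eta [Vx fr]]]] := sm_frame x.
exists (opensI V U), (@opensIr _ V U); split=> //.
apply: (frame_Jpow_parity fr (@opensIl _ V U) (b := b)) => //.
  exact: (homog_res (@opensIr _ V U) hy).
exact: Jpow_res.
Qed.
End ManifoldFiltration.

Lemma zmod_morphism_of (A B : zmodType) (f : A -> B) :
  (forall x y, f (x + y) = f x + f y) -> zmod_morphism f.
Proof. by move=> fD x y; apply: (addIr (f y)); rewrite -fD !subrK. Qed.

Definition additive_of (A B : zmodType) (f : A -> B)
    (fD : forall x y, f (x + y) = f x + f y) : {additive A -> B} :=
  HB.pack_for {additive A -> B} f (GRing.isZmodMorphism.Build _ _ f (zmod_morphism_of fD)).

Definition rmorphism_of (A B : pzRingType) (f : A -> B)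
    (fD : forall x y, f (x + y) = f x + f y)
    (fM : forall x y, f (x * y) = f x * f y) (f1 : f 1 = 1) : {rmorphism A -> B} :=
  HB.pack_for {rmorphism A -> B} f
    (GRing.isZmodMorphism.Build _ _ f (zmod_morphism_of fD))
    (GRing.isMonoidMorphism.Build _ _ f (conj f1 fM)).

(** * Direct images from an open subset *)

Section Pushforward.
Variables (R : realType) (T : topologicalType) (U : opens T).
Implicit Types (V W : opens T).

Lemma opensIS V W (h : W `<=` V) : opensI W U `<=` opensI V U.
Proof. by move=> x [Wx Ux]; split=> //; apply: h. Qed.

Lemma push_sheaf_condition (X : abSheaf T) :
  sheaf_condition (X := fun V => X (opensI V U)) (fun V W h => ab_res X (opensIS h)).
Proof.
move=> V I W hW s cov agr.
have [||t [ht tu]] := @ab_glue _ X (opensI V U) I (fun i => opensI (W i) U)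
    (fun i => opensIS (hW i)) s.
- by move=> x [/cov [i Wx] Ux]; exists i.
- move=> i j W' hi hj.
  have ki : W' `<=` W i := subset_trans hi (@opensIl _ _ _).
  have kj : W' `<=` W j := subset_trans hj (@opensIl _ _ _).
  (* The hypothesis compares sections over the intersection of W' and U. As W' lies in U,
     restricting them to W' loses nothing. *)
  have kU : W' `<=` opensI W' U.
    by apply: sub_opensI => //; apply: subset_trans hi (@opensIr _ _ _).
  have := congr1 (ab_res X kU) (agr i j W' ki kj).
  by rewrite (ab_res_comp _ _ hi) (ab_res_comp _ _ hj).
by exists t; split.
Qed.

(* The direct image of the restriction of X to U. Universal properties of sheaves on T
   are applied to it to obtain maps that are only defined over U. *)
Definition push_ab (X : abSheaf T) : abSheaf T :=
  @AbSheaf T (fun V => X (opensI V U)) (fun V W h => ab_res X (opensIS h))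
    (fun V h => ab_res_id (opensIS h))
    (fun V W W' h1 h2 h3 => ab_res_comp (opensIS h1) (opensIS h2) (opensIS h3))
    (@push_sheaf_condition X).

Definition push_alg (A : algSheaf R T) : algSheaf R T :=
  @AlgSheaf R T (fun V => A (opensI V U)) (fun V W h => alg_res A (opensIS h))
    (fun V h => alg_res_id (opensIS h))
    (fun V W W' h1 h2 h3 => alg_res_comp (opensIS h1) (opensIS h2) (opensIS h3))
    (@push_sheaf_condition A) (fun V => scal A (opensI V U))
    (fun V W h => scal_res A (opensIS h)) (fun V => @scal_central _ _ A (opensI V U)).
End Pushforward.

(** * Homomorphisms and isomorphisms given by frames *)

Section FrameMap.
Variables (R : realType) (T : topologicalType) (F : algSheaf R T) (n m : nat).
Variables (Y X : supermanifold F n m) (U : opens T).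
Variables (tau : homfam F Y U) (eta : 'I_m -> Y U) (fr : is_frame tau eta).
Variables (tau' : homfam F X U) (eta' : 'I_m -> X U).
Hypotheses (tauP' : is_splitting tau') (etaP' : forall i, homog (sgr X) true (eta' i)).
Implicit Types (V W : opens T) (I J K : {set 'I_m}).

Let tauP := fr_split fr.
Let etaP := fr_odd fr.

Definition fcoord V (h : V `<=` U) (y : Y V) := sval (cid (fr_span fr h y)).

Lemma fcoordK V (h : V `<=` U) y : fsum tau eta h (fcoord h y) = y.
Proof. by rewrite /fcoord; case: cid. Qed.

(** In [split_frame_of] this map is used to prove that the data in the target form a frame, so the
    target is given here by a splitting and odd sections. *)
Definition frame_map : homfam Y X U := fun V h y => fsum tau' eta' h (fcoord h y).

Lemma frame_map_fsum V (h : V `<=` U) c :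
  frame_map h (fsum tau eta h c) = fsum tau' eta' h c.
Proof. by rewrite /frame_map (fsum_inj fr (fcoordK h _)). Qed.

Lemma frame_mapD V (h : V `<=` U) y z :
  frame_map h (y + z) = frame_map h y + frame_map h z.
Proof.
rewrite -[y](fcoordK h) -[z](fcoordK h) -(fsumD tauP h (fcoord h y) (fcoord h z)).
by rewrite !frame_map_fsum (fsumD tauP').
Qed.

Lemma frame_map_sum V (h : V `<=` U) (A : Type) (r : seq A) (P : pred A) (f : A -> Y V) :
  frame_map h (\sum_(i <- r | P i) f i) = \sum_(i <- r | P i) frame_map h (f i).
Proof.
apply: (big_morph (frame_map h)); first exact: frame_mapD.
by apply: (addrI (frame_map h 0)); rewrite -frame_mapD !addr0.
Qed.

Lemma frame_map_mon V (h : V `<=` U) c I :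
  frame_map h (tau h c * mon eta h I) = tau' h c * mon eta' h I.
Proof. by rewrite -(fsum_delta tauP) frame_map_fsum (fsum_delta tauP'). Qed.

Lemma frame_map_tau V (h : V `<=` U) c : frame_map h (tau h c) = tau' h c.
Proof.
by have := frame_map_mon h c finset.set0; rewrite !mon_set0 !mulr1.
Qed.

Lemma frame_map_eta V (h : V `<=` U) i :
  frame_map h (alg_res Y h (eta i)) = alg_res X h (eta' i).
Proof.
have := frame_map_mon h 1 (finset.set1 i).
by rewrite !mon_set1 (sp1 tauP) (sp1 tauP') !mul1r.
Qed.

(** The even coefficients are central, and monomials multiply by the same [set_sign] on both
    sides. *)
Lemma frame_mapM V (h : V `<=` U) y z :
  frame_map h (y * z) = frame_map h y * frame_map h z.
Proof.
rewrite -[y](fcoordK h) -[z](fcoordK h) !fsumE mulr_suml !frame_map_sum mulr_suml.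
apply: eq_bigr => I _; rewrite !mulr_sumr frame_map_sum; apply: eq_bigr => J _.
have sw (Z : supermanifold F n m) (t : homfam F Z U) (e : 'I_m -> Z U) (a b : F V) :
    is_splitting t ->
    t _ h a * mon e h I * (t _ h b * mon e h J) = t _ h (a * b) * (mon e h I * mon e h J).
  move=> tP; rewrite (spM tP) -!mulrA; congr (_ * _).
  by rewrite !mulrA (sp_central tP).
rewrite !frame_map_mon !sw // !monM //.
case: set_sign => [[b K]|]; last by rewrite !mulr0 -(sp0 tauP h) frame_map_tau (sp0 tauP').
have sg (Z : supermanifold F n m) (t : homfam F Z U) (e : 'I_m -> Z U) (a : F V) :
    is_splitting t ->
    t _ h a * ((-1) ^+ b * mon e h K) = t _ h ((-1) ^+ b * a) * mon e h K.
  move=> tP; case: b; rewrite ?expr1 ?expr0 ?mul1r //.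
  by rewrite !mulN1r mulrN (spN tP) mulNr.
by rewrite !sg // frame_map_mon.
Qed.

Lemma frame_map_superhom : is_superhom frame_map.
Proof.
split.
- exact: frame_mapD.
- exact: frame_mapM.
- by move=> V h c; rewrite -(sp_scal tauP h) frame_map_tau (sp_scal tauP').
- move=> V W hV hW h s; rewrite -[s in LHS](fcoordK hV) (fsum_res tauP hV hW).
  by rewrite frame_map_fsum (fsum_res tauP' hV hW).
- move=> V h b s /(homog_fdeg fr _ h) [c -> hc]; rewrite frame_map_fsum.
  by apply: (fdeg_homog tauP' etaP' (h := h)); exists c.
- move=> V h s; rewrite -[s in RHS](fcoordK h) /frame_map.
  by rewrite (fsum_red tauP' etaP') (fsum_red tauP etaP).
Qed.
End FrameMap.

Section FrameIso.
Variables (R : realType) (T : topologicalType) (F : algSheaf R T) (n m : nat).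
Variables (Y X : supermanifold F n m) (U : opens T).
Variables (tau : homfam F Y U) (eta : 'I_m -> Y U) (fr : is_frame tau eta).
Variables (tau' : homfam F X U) (eta' : 'I_m -> X U) (fr' : is_frame tau' eta').

Definition frame_siso : siso Y X U.
Proof.
exists (frame_map fr tau' eta') (frame_map fr' tau eta).
- exact: (frame_map_superhom fr (fr_split fr') (fr_odd fr')).
- exact: (frame_map_superhom fr' (fr_split fr) (fr_odd fr)).
- by move=> V h y; rewrite /(frame_map fr _) frame_map_fsum fcoordK.
- by move=> V h y; rewrite /(frame_map fr' _) frame_map_fsum fcoordK.
Defined.

Lemma frame_siso_tau (V : opens T) (h : V `<=` U) c : sfwd frame_siso h (tau h c) = tau' h c.
Proof. by apply: frame_map_tau; exact: (fr_split fr'). Qed.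

Lemma frame_siso_eta (V : opens T) (h : V `<=` U) i :
  sfwd frame_siso h (alg_res Y h (eta i)) = alg_res X h (eta' i).
Proof. by apply: frame_map_eta; exact: (fr_split fr'). Qed.
End FrameIso.

(** * Coordinates with respect to a basis *)

Section BasisCoordinates.
Variables (R : realType) (T : topologicalType) (A : algSheaf R T) (E : modSheaf A).
Variables (r : nat) (U : opens T) (e : 'I_r -> E U) (eP : is_basis e).
Implicit Types V W : opens T.

Definition bsum V (h : V `<=` U) (c : 'I_r -> A V) : E V :=
  \sum_i c i *: mod_res E h (e i).

Lemma bsum_ex V (h : V `<=` U) v : exists c, v = bsum h c.
Proof. by have [c [ev _]] := eP h v; exists c. Qed.

Definition bcoord V (h : V `<=` U) v := sval (cid (bsum_ex h v)).

Lemma bcoordK V (h : V `<=` U) v : bsum h (bcoord h v) = v.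
Proof. by rewrite /bcoord; case: cid. Qed.

Lemma bsum_inj V (h : V `<=` U) c d : bsum h c = bsum h d -> c = d.
Proof.
move=> ecd; have [f [_ fu]] := eP h (bsum h c).
have fE g : bsum h c = bsum h g -> f = [ffun i => g i].
  move=> eg; apply: fu; rewrite {1}eg; apply: eq_bigr => i _; by rewrite ffunE.
apply: funext => i; have := fE c erefl; rewrite (fE d ecd) => /ffunP/(_ i).
by rewrite !ffunE.
Qed.

Lemma bcoord_bsum V (h : V `<=` U) c : bcoord h (bsum h c) = c.
Proof. by apply: (bsum_inj (h := h)); rewrite bcoordK. Qed.

Lemma bsumD V (h : V `<=` U) c d : bsum h (fun i => c i + d i) = bsum h c + bsum h d.
Proof. by rewrite -big_split; apply: eq_bigr => i _; rewrite scalerDl. Qed.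

Lemma bsumZ V (h : V `<=` U) a c : bsum h (fun i => a * c i) = a *: bsum h c.
Proof. by rewrite /bsum scaler_sumr; apply: eq_bigr => i _; rewrite scalerA. Qed.

Lemma bsum_res V W (hV : V `<=` U) (hW : W `<=` U) (h : W `<=` V) c :
  mod_res E h (bsum hV c) = bsum hW (fun i => alg_res A h (c i)).
Proof.
rewrite /bsum raddf_sum; apply: eq_bigr => i _.
by rewrite mod_res_scale (mod_res_comp hV h hW).
Qed.

Lemma bcoordD V (h : V `<=` U) v w i :
  bcoord h (v + w) i = bcoord h v i + bcoord h w i.
Proof.
by rewrite -{1}[v](bcoordK h) -{1}[w](bcoordK h) -bsumD bcoord_bsum.
Qed.

Lemma bcoordZ V (h : V `<=` U) a v i : bcoord h (a *: v) i = a * bcoord h v i.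
Proof. by rewrite -{1}[v](bcoordK h) -bsumZ bcoord_bsum. Qed.

Lemma bcoord_res V W (hV : V `<=` U) (hW : W `<=` U) (h : W `<=` V) v i :
  bcoord hW (mod_res E h v) i = alg_res A h (bcoord hV v i).
Proof. by rewrite -{1}[v](bcoordK hV) (bsum_res hV hW) bcoord_bsum. Qed.

Lemma bsum_delta V (h : V `<=` U) i :
  bsum h (fun j => if j == i then 1 else 0) = mod_res E h (e i).
Proof.
rewrite /bsum (bigD1 i) //= eqxx scale1r big1 ?addr0 // => j /negbTE ->.
by rewrite scale0r.
Qed.

Lemma bcoord_basis V (h : V `<=` U) i j :
  bcoord h (mod_res E h (e i)) j = if j == i then 1 else 0.
Proof. by rewrite -bsum_delta bcoord_bsum. Qed.

Lemma basis_res V (h : V `<=` U) : is_basis (fun i => mod_res E h (e i)).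
Proof.
move=> W k v; have kU := subset_trans k h.
have [c [ev cu]] := eP kU v; exists c; split.
  by rewrite {1}ev; apply: eq_bigr => i _; rewrite (mod_res_comp h k kU).
move=> d ed; apply: cu; rewrite {1}ed; apply: eq_bigr => i _.
by rewrite (mod_res_comp h k kU).
Qed.
End BasisCoordinates.

Section PushRestriction.
Variables (R : realType) (T : topologicalType) (U : opens T).

Definition push_res (A : algSheaf R T) : algHom A (push_alg U A).
Proof.
exists (fun V => alg_res A (@opensIl _ V U)).
- move=> V W h s /=; rewrite (res_comp _ _ (subset_trans (@opensIl _ W U) h)).
  by rewrite (res_comp _ _ (subset_trans (@opensIl _ W U) h)).
- by move=> V c /=; rewrite scal_res.
Defined.

Definition alg_comp (A B D : algSheaf R T) (f : algHom B D) (g : algHom A B) : algHom A D.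
Proof.
exists (fun V => (f V \o g V)%FUN : {rmorphism A V -> D V}).
- by move=> V W h s /=; rewrite !alg_fun_res.
- by move=> V c /=; rewrite !alg_fun_scal.
Defined.

End PushRestriction.

(** * The frame given by a split structure *)

Section SplitFrame.
Variables (R : realType) (T : topologicalType) (F : algSheaf R T) (n m : nat).
Variables (X : supermanifold F n m) (G : modSheaf F) (spl : split_structure X G).
Implicit Types V W : opens T.

Definition split_tau U : homfam F X U := fun V _ c => incF spl V c.

Lemma split_tauP U : is_splitting (@split_tau U).
Proof.
split=> *; rewrite /split_tau ?rmorphD ?rmorphM //.
- exact: alg_fun_scal.
- exact: alg_fun_res.
- exact: incF_even.
- exact: incF_red.
Qed.

Definition split_eta U (e : 'I_m -> G U) (i : 'I_m) : X U := incG spl U (e i).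

Lemma split_eta_odd U (e : 'I_m -> G U) i : homog (sgr X) true (split_eta e i).
Proof. exact: incG_odd. Qed.

Variables (U : opens T) (e : 'I_m -> G U) (eP : is_basis e).

Lemma incG_bsum V (h : V `<=` U) c :
  incG spl V (bsum e h c) = \sum_i incF spl V (c i) * alg_res X h (split_eta e i).
Proof.
rewrite /bsum raddf_sum; apply: eq_bigr => i _.
by rewrite (ext_linear (split_exterior spl)) -[mod_res _ _ _]/(ab_res G h _) ab_fun_res.
Qed.

Variables (tau : homfam F X U) (xi : 'I_m -> X U) (fr : is_frame tau xi).

Let tauP := fr_split fr.

Let bF V : {rmorphism F V -> push_alg U X V} :=
  @rmorphism_of (F V) (push_alg U X V)
    (fun c => tau (@opensIr _ V U) (alg_res F (@opensIl _ V U) c))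
    (fun c d => etrans (f_equal _ (rmorphD _ c d)) (spD tauP _ _ _))
    (fun c d => etrans (f_equal _ (rmorphM _ c d)) (spM tauP _ _ _))
    (etrans (f_equal _ (rmorph1 _)) (sp1 tauP _)).

Let bF_res V W (h : W `<=` V) c : bF W (alg_res F h c) = alg_res (push_alg U X) h (bF V c).
Proof.
rewrite /bF /= -(sp_res tauP (@opensIr _ V U) (@opensIr _ W U) (opensIS (U := U) h)).
congr (tau _ _); rewrite (res_comp _ _ (subset_trans (@opensIl _ W U) h)).
by rewrite (res_comp _ _ (subset_trans (@opensIl _ W U) h)).
Qed.

Let bF_scal V c : bF V (scal F V c) = scal (push_alg U X) V c.
Proof. by rewrite /bF /= scal_res (sp_scal tauP). Qed.

Let bFh : algHom F (push_alg U X) := @AlgHom _ _ F (push_alg U X) bF bF_res bF_scal.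

(** The F-linear map that sends the basis [e] to the odd coordinates [xi]. Its values are odd and so
    have square zero; the universal property extends it to the homomorphism [h0]. *)
Let bG_fun V (g : G V) : X (opensI V U) :=
  \sum_i tau (@opensIr _ V U) (bcoord eP (@opensIr _ V U) (mod_res G (@opensIl _ V U) g) i)
    * alg_res X (@opensIr _ V U) (xi i).

Let bG_funD V g g' : bG_fun (g + g' : G V) = bG_fun g + bG_fun g'.
Proof.
rewrite /bG_fun -big_split; apply: eq_bigr => i _.
by rewrite raddfD bcoordD (spD tauP) mulrDl.
Qed.

Let bG V : {additive G V -> push_alg U X V} :=
  @additive_of (G V) (push_alg U X V) (@bG_fun V) (@bG_funD V).

Let bG_res V W (h : W `<=` V) g : bG W (ab_res G h g) = ab_res (push_alg U X) h (bG V g).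
Proof.
rewrite /bG /= /bG_fun rmorph_sum; apply: eq_bigr => i _.
rewrite rmorphM (res_comp _ _ (@opensIr _ W U)); congr (_ * _).
rewrite -(sp_res tauP (@opensIr _ V U) (@opensIr _ W U)); congr (tau _ _).
rewrite -(bcoord_res eP _ (@opensIr _ W U) (opensIS (U := U) h)).
congr (bcoord eP _ _ _).
rewrite (mod_res_comp _ _ (subset_trans (@opensIl _ W U) h)).
by rewrite (mod_res_comp _ _ (subset_trans (@opensIl _ W U) h)).
Qed.

Let bGh : abHom G (push_alg U X) := @AbHom _ G (push_alg U X) bG bG_res.

Let h0_ex : exists2 h : algHom X (push_alg U X),
  (forall V c, h V (incF spl V c) = bF V c) /\
  (forall V g, h V (incG spl V g) = bG V g) & True.
Proof.
have [|||h [hF hG] _] := ext_universal (split_exterior spl) (bF := bFh) (bG := bGh).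
- by move=> V c b; exact: (sp_central tauP).
- move=> V c g; rewrite /bGh /= /bG_fun /bFh /= mulr_sumr; apply: eq_bigr => i _.
  by rewrite mod_res_scale bcoordZ (spM tauP) mulrA.
- move=> V g; apply: sm_odd_sqr; apply: (homog_sum (g := sgr X)) => i _.
  exact: (Defs.sgrM (sp_even tauP _ _) (res_odd (fr_odd fr) _ _)).
by exists h.
Qed.

Let h0 := s2val (cid2 h0_ex).
Let h0F V c : h0 V (incF spl V c) = bF V c.
Proof. by rewrite /h0; case: cid2 => h []. Qed.
Let h0G V g : h0 V (incG spl V g) = bG V g.
Proof. by rewrite /h0; case: cid2 => h []. Qed.

Let k := frame_map fr (@split_tau U) (split_eta e).
Let kP : is_superhom k.
Proof. by apply: frame_map_superhom; [apply: split_tauP | apply: split_eta_odd]. Qed.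

Let k1 V (h : V `<=` U) : k h 1 = 1.
Proof. by rewrite -(rmorph1 (scal X V)) (sh_scal kP) rmorph1. Qed.

Let kh V : {rmorphism X V -> push_alg U X V} :=
  @rmorphism_of (X V) (push_alg U X V) (fun a => k (@opensIr _ V U) (h0 V a))
    (fun c d => etrans (f_equal _ (rmorphD _ c d)) (shD kP _ _ _))
    (fun c d => etrans (f_equal _ (rmorphM _ c d)) (shM kP _ _ _))
    (etrans (f_equal _ (rmorph1 _)) (k1 _)).

Let khh : algHom X (push_alg U X).
Proof.
exists kh.
- move=> V W h s; rewrite /kh /= alg_fun_res.
  exact: (sh_res kP (@opensIr _ V U) (@opensIr _ W U) (opensIS (U := U) h)).
- by move=> V c; rewrite /kh /= alg_fun_scal; apply: (sh_scal kP).
Defined.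

Let resG : abHom G (push_alg U X).
Proof.
exists (fun V => additive_of (f := fun g => alg_res X (@opensIl _ V U) (incG spl V g))
  (fun g g' => etrans (f_equal _ (raddfD _ g g')) (rmorphD _ _ _))).
move=> V W h s /=; rewrite ab_fun_res.
rewrite -[ab_res _ _ _]/(alg_res X h _) (res_comp _ _ (subset_trans (@opensIl _ W U) h)).
by rewrite (res_comp _ _ (subset_trans (@opensIl _ W U) h)).
Defined.

(* Both sides are extensions to X of one map on G. Thus the map k, which sends the frame
   xi to the images of e, has the right inverse h0 given by the universal property. *)
Let k_h0 V a : k (@opensIr _ V U) (h0 V a) = alg_res X (@opensIl _ V U) a.
Proof.
have [|||h _ hu] := ext_universal (split_exterior spl)
   (bF := alg_comp (push_res U X) (incF spl)) (bG := resG).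
- move=> W c b.
  have hc := homog_res (g := sgr X) (@opensIl _ W U) (incF_even spl c).
  exact: (sm_even_central (b : X (opensI W U)) hc).
- by move=> W c g; rewrite /= (ext_linear (split_exterior spl)) rmorphM.
- by move=> W g; rewrite /= -rmorphM (ext_square (split_exterior spl)) rmorph0.
rewrite -[LHS]/(khh V a) -[RHS]/(push_res U X V a) !hu //; split=> W c.
- rewrite /= h0F /bF /= /k frame_map_tau; first by rewrite /split_tau alg_fun_res.
  exact: split_tauP.
rewrite /= h0G /bG /= /bG_fun /k.
rewrite frame_map_sum; last exact: split_tauP.
rewrite -[alg_res X _ _]/(ab_res X _ _) -ab_fun_res -[ab_res G _ c]/(mod_res G _ c).
rewrite -[in RHS](bcoordK eP (@opensIr _ W U) (mod_res G _ c)) incG_bsum.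
apply: eq_bigr => i _; rewrite -[frame_map _ _ _ _ _]/(k _ _) (shM kP) /k.
by rewrite frame_map_tau ?frame_map_eta //; apply: split_tauP.
Qed.

(** The chart frame [xi] is the model of the exterior algebra on m generators. By [k_h0] every
    section is the image under [k] of a sum in [xi], which gives generation. Conversely [h0] turns a
    relation between monomials in [e] into the same relation in [xi], which gives independence. *)
Lemma split_frame_of : is_frame (@split_tau U) (split_eta e).
Proof.
split; [exact: split_tauP | exact: split_eta_odd | |].
- move=> V h y; have VU : V `<=` opensI V U by apply: sub_opensI.
  exists (fun I => alg_res F VU (fcoord fr (@opensIr _ V U) (h0 V y) I)).
  rewrite -(fsum_res (@split_tauP U) (@opensIr _ V U)) -[fsum _ _ _ _]/(k _ _) k_h0.
  by rewrite (res_comp _ _ (@subset_refl _ V)) alg_res_id.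
- move=> V h c c0 I; have VU : V `<=` opensI V U by apply: sub_opensI.
  rewrite -[c I](alg_res_id (@subset_refl _ V)) -(res_comp (@opensIl _ V U) VU).
  suff -> : alg_res F (@opensIl _ V U) (c I) = 0 by rewrite rmorph0.
  apply: (fr_indep fr (h := @opensIr _ V U) (c := fun I => alg_res F (@opensIl _ V U) (c I))).
  rewrite -[RHS](rmorph0 (h0 V)) -c0 /fsum rmorph_sum; apply: eq_bigr => J _.
  rewrite rmorphM /split_tau h0F rmorph_monomial; congr (_ * monomial _ _).
  apply: funext => i; rewrite alg_fun_res /split_eta h0G /bG /= /bG_fun.
  rewrite (bigD1 i) //= big1 => [|j ji].
    rewrite (Prop_irrelevance (@opensIl _ U U) (@opensIr _ U U)) bcoord_basis eqxx (sp1 tauP)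
      mul1r addr0.
    by rewrite (res_comp _ _ (@opensIr _ V U)).
  rewrite (Prop_irrelevance (@opensIl _ U U) (@opensIr _ U U)) bcoord_basis (negbTE ji) (sp0
    tauP) mul0r //.
Qed.
End SplitFrame.

Section FrameRestriction.
Variables (R : realType) (T : topologicalType) (F : algSheaf R T) (n m : nat).
Variables (Y : supermanifold F n m) (U : opens T) (tau : homfam F Y U).
Variables (eta : 'I_m -> Y U) (fr : is_frame tau eta).
Variables (U' : opens T) (hU : U' `<=` U).
Implicit Types V W : opens T.

Definition homfam_res (A B : abSheaf T) (f : homfam A B U) : homfam A B U' :=
  fun V h => f V (subset_trans h hU).

Lemma splitting_res : is_splitting tau -> is_splitting (homfam_res tau : homfam F Y U').
Proof. by case=> *; split=> *; rewrite /homfam_res; auto. Qed.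

Lemma frame_res :
  is_frame (homfam_res tau : homfam F Y U') (fun i => alg_res Y hU (eta i)).
Proof.
have e V (h : V `<=` U') c : fsum (homfam_res tau : homfam F Y U')
    (fun i => alg_res Y hU (eta i)) h c = fsum tau eta (subset_trans h hU) c.
  apply: eq_bigr => I _; congr (_ * monomial _ _); apply: funext => i.
  exact: res_comp.
split.
- exact: splitting_res (fr_split fr).
- by move=> i; exact: (homog_res hU (fr_odd fr i)).
- move=> V h y; have [c ->] := fr_span fr (subset_trans h hU) y.
  by exists c; rewrite e.
- by move=> V h c; rewrite e; apply: fr_indep.
Qed.
End FrameRestriction.

Section SplitDegrees.
Variables (R : realType) (T : topologicalType) (F : algSheaf R T) (n m : nat).
Variables (X : supermanifold F n m) (G : modSheaf F) (spl : split_structure X G).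
Implicit Types U V W : opens T.

Lemma split_frame (hG : locally_free_of_rank G m) x :
  exists U (e : 'I_m -> G U), [/\ oset U x, is_basis e &
  is_frame (@split_tau _ _ _ _ _ _ _ spl U) (split_eta spl e)].
Proof.
have [U [e [Ux eP]]] := hG x; have [V [tau [xi [Vx fr]]]] := sm_frame X x.
have eP' := basis_res eP (@opensIl _ U V).
exists (opensI U V), (fun i => mod_res G (@opensIl _ U V) (e i)); split=> //.
exact: (split_frame_of spl eP' (frame_res fr (@opensIr _ U V))).
Qed.

Let P p : subsheaf X := fun V (s : X V) =>
  exists (k : nat) (c : 'I_k -> F V) (g : 'I_k -> 'I_p -> G V),
    s = \sum_i incF spl V (c i) * \prod_(l < p) incG spl V (g i l).

Let P_res p U V (h : V `<=` U) (s : X U) : P p s -> P p (ab_res X h s).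
Proof.
move=> [k [c [g ->]]]; exists k, (fun i => alg_res F h (c i)), (fun i l => mod_res G h (g i l)).
rewrite -[LHS]/(alg_res X h _) rmorph_sum; apply: eq_bigr => i _.
rewrite rmorphM rmorph_prod alg_fun_res; congr (_ * _); apply: eq_bigr => l _.
by rewrite -[RHS]/(incG spl V (ab_res G h (g i l))) ab_fun_res.
Qed.

Lemma Odeg_res p U V (h : V `<=` U) (s : X U) : Odeg spl p s -> Odeg spl p (alg_res X h s).
Proof. exact: (locally_res (X := X) (@P_res p)). Qed.

Lemma Odeg_local p U (s : X U) : locally (X := X) (@Odeg _ _ _ _ _ _ _ spl p) s -> Odeg spl p s.
Proof. exact: (@locally_idem _ X). Qed.

Lemma Odeg0 p U : Odeg spl p (0 : X U).
Proof.
apply: (locally0 (X := X)) => V; exists 0%N, (fun=> 0), (fun _ _ => 0).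
by rewrite big_ord0.
Qed.

Lemma OdegD p U (s t : X U) : Odeg spl p s -> Odeg spl p t -> Odeg spl p (s + t).
Proof.
apply: (locallyD (X := X) (@P_res p)) => V u v [k [c [g ->]]] [k' [c' [g' ->]]].
pose f (A : Type) (x : 'I_k -> A) (y : 'I_k' -> A) i :=
  match fintype.split i with inl j => x j | inr j => y j end.
exists (k + k')%N, (f _ c c'), (f _ g g').
rewrite big_split_ord /=; congr (_ + _); apply: eq_bigr => i _; rewrite /f.
  by rewrite (unsplitK (inl i)).
by rewrite (unsplitK (inr i)).
Qed.

Lemma OdegN p U (s : X U) : Odeg spl p s -> Odeg spl p (- s).
Proof.
apply: (locallyN (X := X)) => V _ [k [c [g ->]]]; exists k, (fun i => - c i), g.
by rewrite -sumrN; apply: eq_bigr => i _; rewrite rmorphN mulNr.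
Qed.

Lemma Odeg_sum p U (A : Type) (r : seq A) (Q : pred A) (f : A -> X U) :
  (forall i, Q i -> Odeg spl p (f i)) -> Odeg spl p (\sum_(i <- r | Q i) f i).
Proof. by move=> hf; apply: big_ind => //; [apply: Odeg0 | move=> *; apply: OdegD]. Qed.

Variables (U : opens T) (e : 'I_m -> G U) (eP : is_basis e).
Hypothesis fr : is_frame (@split_tau _ _ _ _ _ _ _ spl U) (split_eta spl e).

(** Every factor taken from [G] is a combination of the generators and so has degree 1. Conversely
    each monomial in the generators is itself a product of members of [G]. *)
Lemma Odeg_fdeg p V (h : V `<=` U) (y : X V) :
  Odeg spl p y <-> fdeg (@split_tau _ _ _ _ _ _ _ spl U) (split_eta spl e) (pred1 p) h y.
Proof.
have tauP := fr_split fr; have etaP := fr_odd fr; split.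
  move=> Oy; apply: (fdeg_local fr) => x /Oy [W [k [Wx [r [c [g ey]]]]]].
  exists W, k; split=> //; rewrite [alg_res X k y]ey.
  apply: (fdeg_sum tauP) => i _.
  move: (subset_trans k h) => hW.
  apply: (fdegM tauP etaP (P := pred1 0%N) (Q := pred1 p)).
  - by move=> a b /eqP-> /eqP->; rewrite /= eqxx.
  - have -> : incF spl W (c i) = split_tau spl hW (c i) * mon (split_eta spl e) hW finset.set0.
      by rewrite mon_set0 mulr1.
    by apply: (fdeg_mon tauP); rewrite finset.cards0.
  move: (g i) => gi; clear Oy ey g; elim: p gi => [|q IH] g.
    rewrite big_ord0 -(mulr1 1) -[X in X * _](sp1 tauP hW) -(mon_set0 (split_eta spl e) hW).
    by apply: (fdeg_mon tauP); rewrite finset.cards0.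
  rewrite big_ord_recl; apply: (fdegM tauP etaP (P := pred1 1%N) (Q := pred1 q)).
  - by move=> a b /eqP-> /eqP->; rewrite /= add1n.
  - rewrite -[g ord0](bcoordK eP hW) (incG_bsum spl e).
    apply: (fdeg_sum tauP) => j _; rewrite -mon_set1.
    by apply: (fdeg_mon tauP); rewrite cards1.
  exact: IH.
move=> [c -> hc]; rewrite fsumE; apply: Odeg_sum => I _.
have [/eqP cI|/hc ->] := boolP (#|I| == p); last first.
  by rewrite (sp0 tauP) mul0r; apply: Odeg0.
apply: (@locally_in _ X); rewrite /mon /monomial /word big_tnth.
have es : size (enum I) = p by rewrite -cardE.
(* p is replaced by the length of the word, so that the letters are indexed by the same ordinals as
   the factors of the product. *)
case: p / es {cI hc y}.
exists 1%N, (fun=> c I), (fun _ l => mod_res G h (e (tnth (in_tuple (enum I)) l))).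
rewrite big_ord1; congr (_ * _); apply: eq_bigr => l _.
by rewrite /split_eta -[mod_res G _ _]/(ab_res G h _) ab_fun_res.
Qed.
End SplitDegrees.

(** * Bases of the module and leading terms *)

Section Bases.
Variables (R : realType) (T : topologicalType) (A : algSheaf R T) (E : modSheaf A).
Variables (r : nat) (U : opens T) (e : 'I_r -> E U).
Implicit Types V W : opens T.

Lemma is_basisI :
  (forall V (h : V `<=` U) (v : E V), exists c, v = bsum e h c) ->
  (forall V (h : V `<=` U) c, bsum e h c = 0 -> forall i, c i = 0) -> is_basis e.
Proof.
move=> sp ind V h v; have [c ev] := sp V h v; exists [ffun i => c i]; split.
  by rewrite ev; apply: eq_bigr => i _; rewrite ffunE.
move=> d ed; apply/ffunP => i; rewrite ffunE; apply/eqP; rewrite -subr_eq0; apply/eqP.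
apply: (ind V h (fun i => c i - d i)).
rewrite /bsum; under eq_bigr do rewrite scalerBl.
by rewrite sumrB -/(bsum e h c) -ev -[X in _ - X]ed subrr.
Qed.
End Bases.

Section PowerSheaf.
Variables (T : topologicalType) (X : abSheaf T) (r : nat).

Let pow_fun (U V : opens T) (h : V `<=` U) (f : {ffun 'I_r -> X U}) : {ffun 'I_r -> X V} :=
  [ffun i => ab_res X h (f i)].

Let pow_funD (U V : opens T) (h : V `<=` U) f g :
  @pow_fun U V h (f + g) = pow_fun h f + pow_fun h g.
Proof. by apply/ffunP => i; rewrite !ffunE raddfD. Qed.

(** The sheaf in which the coordinates with respect to a basis of r members take their values; it
    serves as a target for the universal property of the tensor product. *)
Definition pow_ab : abSheaf T.
Proof.
exists (fun U => {ffun 'I_r -> X U} : zmodType)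
  (fun U V h => additive_of (@pow_funD U V h)).
- by move=> U h s; apply/ffunP => i; rewrite ffunE ab_res_id.
- by move=> U V W h1 h2 h3 s; apply/ffunP => i; rewrite !ffunE (ab_res_comp h1 h2 h3).
move=> U I V hV s cV sV.
have ex i : exists t : X U, forall j, ab_res X (hV j) t = s j i.
  apply: ab_gluing => // j k W hj hk.
  by have /ffunP/(_ i) := sV j k W hj hk; rewrite !ffunE.
exists [ffun i => sval (cid (ex i))]; split.
  by move=> j; apply/ffunP => i; rewrite !ffunE; case: cid => t /= ->.
move=> t ht; apply/ffunP => i; rewrite ffunE; case: cid => u /= hu.
apply: (@ab_separated _ X) => x /cV [j Vx]; exists (V j), (hV j); split=> //.
by rewrite hu -ht ffunE.
Defined.
End PowerSheaf.

(** * Bases of a tensor product *)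

Section TensorBasis.
Variables (R : realType) (T : topologicalType) (F : algSheaf R T) (n m : nat).
Variables (X : supermanifold F n m) (G : modSheaf F) (spl : split_structure X G).
Variables (S : superMod (purely_even F)) (E : superMod X).
Variable tens : tensor_structure spl S E.
Implicit Types V W : opens T.

Lemma incSZ V (c : F V) (s : S V) : incS tens V (c *: s) = incF spl V c *: incS tens V s.
Proof. exact: (tens_linear (tensP tens)). Qed.

Variables (r : nat) (U : opens T) (s : 'I_r -> S U) (sP : is_basis s).

Definition tensor_basis (i : 'I_r) : E U := incS tens U (s i).

Lemma incS_bsum V (h : V `<=` U) (c : 'I_r -> F V) :
  incS tens V (bsum s h c) = bsum tensor_basis h (fun i => incF spl V (c i)).
Proof.
rewrite /bsum raddf_sum; apply: eq_bigr => i _.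
by rewrite incSZ -[mod_res S _ _]/(ab_res S h _) ab_fun_res.
Qed.

Let N := push_ab U (pow_ab X r).

(** The expected coordinates of the tensor of [f] and [t]: those of [t], multiplied by [f]. The
    induced map [u] on [E] will turn out to compute coordinates with respect to [tensor_basis]. *)
Let beta V (f : X V) (t : S V) : N V :=
  [ffun i => alg_res X (@opensIl _ V U) f *
     incF spl (opensI V U) (bcoord sP (@opensIr _ V U) (mod_res S (@opensIl _ V U) t) i)].

Let u_ex : exists u : abHom E N, forall V (f : X V) t, u V (f *: incS tens V t) = beta f t.
Proof.
have [||||u hu _] := tens_universal (tensP tens) (N := N) (beta := beta); last by exists u.
- by move=> V f f' t; apply/ffunP => i; rewrite !ffunE rmorphD mulrDl.
- by move=> V f t t'; apply/ffunP => i; rewrite !ffunE raddfD bcoordD rmorphD mulrDr.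
- move=> V f c t; apply/ffunP => i; rewrite !ffunE rmorphM -mulrA; congr (_ * _).
  by rewrite mod_res_scale bcoordZ rmorphM alg_fun_res.
move=> V W h f t; apply/ffunP => i; rewrite !ffunE -[RHS]/(alg_res X (opensIS h) _) rmorphM.
rewrite -alg_fun_res -(bcoord_res sP (@opensIr _ V U) (@opensIr _ W U)).
congr (_ * _); last congr (incF spl _ _); last congr (bcoord sP _ _ _).
  by rewrite (res_comp _ _ (subset_trans (@opensIl _ W U) h)) (res_comp _ _ (subset_trans
    (@opensIl _ W U) h)).
by rewrite (mod_res_comp _ _ (subset_trans (@opensIl _ W U) h)) (mod_res_comp _ _ (subset_trans
  (@opensIl _ W U) h)).
Qed.

Let u := sval (cid u_ex).
Let uE V (f : X V) t : u V (f *: incS tens V t) = beta f t.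
Proof. by rewrite /u; case: cid. Qed.

Let k_fun V (g : N V) : E (opensI V U) := bsum tensor_basis (@opensIr _ V U) g.

Let k_funD V (g g' : N V) : k_fun (g + g') = k_fun g + k_fun g'.
Proof. by rewrite /k_fun -bsumD; apply: eq_bigr => i _; rewrite ffunE. Qed.

Let ku : abHom E (push_ab U E).
Proof.
exists (fun V => @additive_of (E V) (push_ab U E V) (fun v => k_fun (u V v))
  (fun v w => etrans (f_equal _ (raddfD _ v w)) (k_funD _ _))).
move=> V W h v /=; rewrite ab_fun_res.
rewrite /k_fun (bsum_res _ (@opensIr _ V U) (@opensIr _ W U)).
by apply: eq_bigr => i _; rewrite ffunE.
Defined.

Let resE : abHom E (push_ab U E).
Proof.
exists (fun V => mod_res E (@opensIl _ V U)).
move=> V W h v; rewrite -[RHS]/(mod_res E (opensIS h) _).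
rewrite -[ab_res _ _ _]/(mod_res E _ _).
by rewrite (mod_res_comp _ _ (subset_trans (@opensIl _ W U) h)) (mod_res_comp _ _ (subset_trans
  (@opensIl _ W U) h)).
Defined.

(** Both sides are additive maps from [E] to its direct image that agree on the products
    [f *: incS tens W t], and factorizations through the tensor product are unique. *)
Let kuE V v : k_fun (u V v) = mod_res E (@opensIl _ V U) v.
Proof.
have [||||w _ hw] := tens_universal (tensP tens) (N := push_ab U E)
  (beta := fun V (f : X V) t => mod_res E (@opensIl _ V U) (f *: incS tens V t)).
- by move=> W f f' t; rewrite scalerDl raddfD.
- by move=> W f t t'; rewrite raddfD scalerDr raddfD.
- by move=> W f c t; rewrite incSZ scalerA.
- move=> W W' h f t; rewrite -[RHS]/(mod_res E (opensIS h) _).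
  rewrite (mod_res_comp _ _ (subset_trans (@opensIl _ W' U) h)).
  rewrite -[mod_res S _ _]/(ab_res S h _) ab_fun_res -[ab_res _ _ _]/(mod_res E h _).
  by rewrite -mod_res_scale (mod_res_comp _ _ (subset_trans (@opensIl _ W' U) h)).
rewrite -[LHS]/(ku V v) -[RHS]/(resE V v) !hw // => W f t.
rewrite /= uE mod_res_scale -[incS tens W t]/(incS tens W t) /k_fun.
rewrite -[mod_res E _ (incS _ _ _)]/(ab_res E _ _) -ab_fun_res.
rewrite -[in RHS](bcoordK sP (@opensIr _ W U) (ab_res S _ t)) incS_bsum -bsumZ.
by apply: eq_bigr => i _; rewrite ffunE.
Qed.

(** By [kuE] the values of [u] are coefficients that represent a given section, and [u] returns the
    coefficients of any sum in the basis, so a relation has zero coefficients. *)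
Lemma tensor_basisP : is_basis tensor_basis.
Proof.
apply: is_basisI => [V h v|V h c c0 i]; have VU : V `<=` opensI V U by apply: sub_opensI.
  exists (fun i => alg_res X VU (u V v i)).
  rewrite -(bsum_res _ (@opensIr _ V U)) -[bsum _ _ _]/(k_fun _) kuE.
  by rewrite (mod_res_comp _ _ (@subset_refl _ V)) mod_res_id.
rewrite -[c i](alg_res_id (@subset_refl _ V)) -(res_comp (@opensIl _ V U) VU).
suff -> : alg_res X (@opensIl _ V U) (c i) = 0 by rewrite rmorph0.
have /(congr1 (u V)) := c0; rewrite raddf0 /bsum raddf_sum => /ffunP/(_ i).
rewrite sum_ffunE [in X in _ = X]ffunE => <-; rewrite (bigD1 i) //= big1 => [|j ji].
  rewrite /tensor_basis -[mod_res E _ _]/(ab_res E h _) -ab_fun_res uE ffunE.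
  rewrite -[ab_res S _ _]/(mod_res S h _) (mod_res_comp _ _ (@opensIr _ V U)) bcoord_basis.
  by rewrite eqxx rmorph1 mulr1 addr0.
rewrite /tensor_basis -[mod_res E _ _]/(ab_res E h _) -ab_fun_res uE ffunE.
rewrite -[ab_res S _ _]/(mod_res S h _) (mod_res_comp _ _ (@opensIr _ V U)) bcoord_basis.
by rewrite eq_sym (negbTE ji) rmorph0 mulr0.
Qed.
End TensorBasis.

Section ModuleFiltration.
Variables (R : realType) (T : topologicalType) (O : superSheaf R T) (E : superMod O).
Implicit Types U V W : opens T.

Lemma mres_comp U V W (h1 : V `<=` U) (h2 : W `<=` V) (h3 : W `<=` U)
  (s : E U) : mod_res E h2 (mod_res E h1 s) = mod_res E h3 s.
Proof. exact: mod_res_comp. Qed.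

Lemma Epow_local p U (v : E U) : locally (X := E) (@Epow R T O E p) v -> Epow p v.
Proof. exact: (@locally_idem _ E). Qed.

Lemma EpowB p U (v w : E U) : Epow p v -> Epow p w -> Epow p (v - w).
Proof. by move=> hv hw; apply: EpowD => //; apply: EpowN. Qed.

Lemma Epow_sum p U (I : Type) (r : seq I) (P : pred I) (f : I -> E U) :
  (forall i, P i -> Epow p (f i)) -> Epow p (\sum_(i <- r | P i) f i).
Proof. by move=> hf; apply: big_ind => //; [apply: Epow0 | move=> *; apply: EpowD]. Qed.

Lemma EpowJ p U (a : O U) (v : E U) : Jpow p a -> Epow p (a *: v).
Proof.
move=> ha; apply: (@locally_in _ E); exists 1%N, (fun=> a), (fun=> v).
by rewrite big_ord1.
Qed.

Lemma Epow_res p U V (h : V `<=` U) (v : E U) : Epow p v -> Epow p (mod_res E h v).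
Proof.
apply: (locally_res (X := E)) => U' V' h' s [k [a [b [ha ->]]]].
exists k, (fun i => alg_res O h' (a i)), (fun i => mod_res E h' (b i)).
split=> [i|]; first exact/Jpow_res/ha.
by rewrite /= raddf_sum; apply: eq_bigr => i _; rewrite mod_res_scale.
Qed.

Lemma EpowZ p q U (a : O U) (v : E U) : Jpow p a -> Epow q v -> Epow (p + q) (a *: v).
Proof.
move=> ha hv; apply: Epow_local => x /hv [V [h [Vx [k [b [w [hb e]]]]]]].
exists V, h; split=> //; rewrite -[ab_res _ _ _]/(mod_res E h _) mod_res_scale.
rewrite [mod_res E h v]e scaler_sumr; apply: Epow_sum => i _.
by rewrite scalerA; apply: EpowJ; apply: JpowM => //; apply: Jpow_res.
Qed.

Lemma Epow_all U (v : E U) : Epow 0 v.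
Proof. by rewrite -[v]scale1r; apply: EpowJ. Qed.

Variables (r : nat) (U : opens T) (e : 'I_r -> E U) (eP : is_basis e).

Lemma Epow_bcoord p V (h : V `<=` U) (v : E V) :
  Epow p v <-> forall i, Jpow p (bcoord eP h v i).
Proof.
split=> [hv i|hv].
  apply: Jpow_local => x /hv [W [k [Wx [n [a [w [ha ev]]]]]]].
  exists W, k; split=> //.
  rewrite -[ab_res _ _ _]/(alg_res O k _) -(bcoord_res eP h (subset_trans k h)).
  rewrite [mod_res E k v]ev.
  have bsum_sum (f : 'I_n -> E W) : bcoord eP (subset_trans k h) (\sum_j f j) i =
      \sum_j bcoord eP (subset_trans k h) (f j) i.
    apply: (big_morph (fun v => bcoord eP (subset_trans k h) v i)).
      by move=> u u'; apply: bcoordD.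
    by apply: (addrI (bcoord eP (subset_trans k h) 0 i)); rewrite -bcoordD !addr0.
  by rewrite bsum_sum; apply: Jpow_sum => j _; rewrite bcoordZ; apply: JpowMr.
by rewrite -[v](bcoordK eP h); apply: Epow_sum => i _; apply: EpowJ.
Qed.

Variable b : 'I_r -> bool.
Hypothesis e_hom : forall i, homog (mgr E) (b i) (e i).

(** Taking from each coordinate the component of the parity expected for [c], or for the opposite of
    [c], splits [v] into its two homogeneous components. If [v] has parity [c], the second one
    vanishes, and the coordinates are the chosen components. *)
Lemma homog_bcoord c V (h : V `<=` U) (v : E V) :
  homog (mgr E) c v <-> forall i, homog (sgr O) (c (+) b i) (bcoord eP h v i).
Proof.
have hom (d : bool) (f : 'I_r -> O V) : (forall i, homog (sgr O) (d (+) b i) (f i)) ->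
    homog (mgr E) d (bsum e h f).
  move=> hf; apply: (homog_sum (g := mgr E)) => i _.
  by have := mgrZ (hf i) (homog_res h (e_hom i)); rewrite -addbA addbb addbF.
split=> [hv i|hv]; last by rewrite -[v](bcoordK eP h); apply: hom.
pose f0 j := sval (cid (homog_decomp (sgr O) (bcoord eP h v j))).
have f0P j : exists s1, [/\ homog (sgr O) false (f0 j), homog (sgr O) true s1 &
  bcoord eP h v j = f0 j + s1] by rewrite /f0; case: cid.
pose f1 j := sval (cid (f0P j)).
have fP j : [/\ homog (sgr O) false (f0 j), homog (sgr O) true (f1 j) &
  bcoord eP h v j = f0 j + f1 j] by rewrite /f1; case: cid.
pose g d j := if d (+) b j then f1 j else f0 j.
have g_hom d j : homog (sgr O) (d (+) b j) (g d j).
  by rewrite /g; have [? ? _] := fP j; case: (d (+) b j).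
have ev : v = bsum e h (g c) + bsum e h (g (~~ c)).
  rewrite -bsumD -[LHS](bcoordK eP h); congr bsum; apply: funext => j; rewrite /g.
  by have [_ _ ->] := fP j; rewrite addNb; case: (c (+) b j) => //=; rewrite addrC.
have z : bsum e h (g (~~ c)) = 0.
  apply: (homog_disjoint (g := mgr E) (b := c)); last exact: hom.
  have -> : bsum e h (g (~~ c)) = v - bsum e h (g c) by rewrite {1}ev addrAC subrr add0r.
  by apply: (homogB (g := mgr E)) => //; apply: hom.
by rewrite ev z addr0 bcoord_bsum.
Qed.
End ModuleFiltration.

Section TensorDegrees.
Variables (R : realType) (T : topologicalType) (F : algSheaf R T) (n m : nat).
Variables (X : supermanifold F n m) (G : modSheaf F) (spl : split_structure X G).
Variables (S : superMod (purely_even F)) (E : superMod X).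
Variable tens : tensor_structure spl S E.
Implicit Types U V W : opens T.

Let P p : subsheaf E := fun V (v : E V) =>
  exists (k : nat) (a : 'I_k -> X V) (s : 'I_k -> S V),
    (forall i, Odeg spl p (a i)) /\ v = \sum_i a i *: incS tens V (s i).

Let P_res p U V (h : V `<=` U) (v : E U) : P p v -> P p (ab_res E h v).
Proof.
move=> [k [a [s [ha ->]]]]; exists k, (fun i => alg_res X h (a i)), (fun i => mod_res S h (s i)).
split=> [i|]; first exact/Odeg_res/ha.
rewrite -[LHS]/(mod_res E h _) raddf_sum; apply: eq_bigr => i _.
rewrite mod_res_scale -[mod_res S _ _]/(ab_res S h _).
by rewrite -[mod_res E _ _]/(ab_res E h _) -ab_fun_res.
Qed.

Lemma Edeg_res p U V (h : V `<=` U) (v : E U) : Edeg tens p v -> Edeg tens p (mod_res E h v).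
Proof. exact: (locally_res (X := E) (@P_res p)). Qed.

Lemma Edeg_local p U (v : E U) :
  locally (X := E) (@Edeg _ _ _ _ _ _ _ _ _ _ tens p) v -> Edeg tens p v.
Proof. exact: (@locally_idem _ E). Qed.

Lemma Edeg0 p U : Edeg tens p (0 : E U).
Proof.
apply: (locally0 (X := E)) => V; exists 0%N, (fun=> 0), (fun=> 0); split; first by case.
by rewrite big_ord0.
Qed.

Lemma EdegD p U (v w : E U) : Edeg tens p v -> Edeg tens p w -> Edeg tens p (v + w).
Proof.
apply: (locallyD (X := E) (@P_res p)) => V v' w' [k [c [g [hc ->]]]] [k' [c' [g' [hc' ->]]]].
pose f (A : Type) (x : 'I_k -> A) (y : 'I_k' -> A) i :=
  match fintype.split i with inl j => x j | inr j => y j end.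
exists (k + k')%N, (f _ c c'), (f _ g g'); split=> [i|].
  by rewrite /f; case: (fintype.split i).
rewrite big_split_ord /=; congr (_ + _); apply: eq_bigr => i _; rewrite /f.
  by rewrite (unsplitK (inl i)).
by rewrite (unsplitK (inr i)).
Qed.

Lemma Edeg_sum p U (I : Type) (r : seq I) (Q : pred I) (f : I -> E U) :
  (forall i, Q i -> Edeg tens p (f i)) -> Edeg tens p (\sum_(i <- r | Q i) f i).
Proof. by move=> hf; apply: big_ind => //; [apply: Edeg0 | move=> *; apply: EdegD]. Qed.

Lemma Edeg_incS p U (a : X U) (s : S U) : Odeg spl p a -> Edeg tens p (a *: incS tens U s).
Proof.
move=> ha; apply: (@locally_in _ E); exists 1%N, (fun=> a), (fun=> s).
by rewrite big_ord1.
Qed.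
End TensorDegrees.

(** * Leading terms in a split supermanifold and in the tensor product *)

Section LeadingTerms.
Variables (R : realType) (T : topologicalType) (F : algSheaf R T) (n m : nat).
Variables (X : supermanifold F n m) (G : modSheaf F) (hG : locally_free_of_rank G m).
Variable spl : split_structure X G.
Implicit Types U V W : opens T.

Lemma OdegM p q U (a b : X U) : Odeg spl p a -> Odeg spl q b -> Odeg spl (p + q) (a * b).
Proof.
move=> ha hb; apply: Odeg_local => x Ux; have [V [e [Vx eP fr]]] := split_frame spl hG x.
exists (opensI V U), (@opensIr _ V U); split=> //.
rewrite -[ab_res _ _ _]/(alg_res X _ _) rmorphM.
apply/(Odeg_fdeg eP fr _ (@opensIl _ V U)).
apply: (fdegM (fr_split fr) (fr_odd fr) (P := pred1 p) (Q := pred1 q)).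
- by move=> c d /eqP-> /eqP->; rewrite /= eqxx.
- by apply/(Odeg_fdeg eP fr); apply: Odeg_res.
- by apply/(Odeg_fdeg eP fr); apply: Odeg_res.
Qed.

Lemma Odeg_Jpow p U (a : X U) : Odeg spl p a -> Jpow p a.
Proof.
move=> ha; apply: Jpow_local => x Ux; have [V [e [Vx eP fr]]] := split_frame spl hG x.
exists (opensI V U), (@opensIr _ V U); split=> //.
apply/(Jpow_fdeg fr _ (@opensIl _ V U)); apply: (fdeg_weak (P := pred1 p)).
  by move=> k /eqP->.
by apply/(Odeg_fdeg eP fr); apply: Odeg_res.
Qed.

Lemma Odeg_Jpow0 p U (a : X U) : Odeg spl p a -> Jpow p.+1 a -> a = 0.
Proof.
move=> ha ja; apply: (@ab_separated _ X) => x Ux.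
have [V [e [Vx eP fr]]] := split_frame spl hG x.
exists (opensI V U), (@opensIr _ V U); split=> //; rewrite raddf0.
apply: (fdeg_disjoint fr (h := @opensIl _ V U) (P := pred1 p) (Q := leq p.+1)).
- by move=> k /eqP->; rewrite ltnn.
- by apply/(Odeg_fdeg eP fr); apply: Odeg_res.
- by apply/(Jpow_fdeg fr); apply: Jpow_res.
Qed.

Lemma Odeg_homog p U (a : X U) : Odeg spl p a -> homog (sgr X) (odd p) a.
Proof.
move=> ha; apply: (homog_local (g := sgr X)) => x Ux.
have [V [e [Vx eP fr]]] := split_frame spl hG x.
exists (opensI V U), (@opensIr _ V U); split=> //.
apply/(homog_fdeg fr _ (@opensIl _ V U)); apply: (fdeg_weak (P := pred1 p)).
  by move=> k /eqP->.
by apply/(Odeg_fdeg eP fr); apply: Odeg_res.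
Qed.

Lemma OdegB p U (a b : X U) : Odeg spl p a -> Odeg spl p b -> Odeg spl p (a - b).
Proof. by move=> ha hb; apply: OdegD => //; apply: OdegN. Qed.

(** The class of [f] in J^p / J^(p+1), realized in degree p by means of the splitting. It follows
    that [f] lies in J^p. *)
Definition Olead p U (f t : X U) : Prop := Odeg spl p t /\ Jpow p.+1 (f - t).

Lemma Olead_res p U V (h : V `<=` U) (f t : X U) :
  Olead p f t -> Olead p (alg_res X h f) (alg_res X h t).
Proof. by move=> [ht hf]; split; [apply: Odeg_res | rewrite -rmorphB; apply: Jpow_res]. Qed.

Lemma Olead_unique p U (f t t' : X U) : Olead p f t -> Olead p f t' -> t = t'.
Proof.
move=> [ht hf] [ht' hf']; apply/eqP; rewrite -subr_eq0; apply/eqP.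
apply: (Odeg_Jpow0 (p := p)); first exact: OdegB.
have -> : t - t' = (f - t') - (f - t) by rewrite opprB [RHS]addrC addrA subrK.
exact: JpowB.
Qed.

Lemma Olead_local p U (f t : X U) :
  (forall x, oset U x -> exists V (h : V `<=` U), oset V x /\
    Olead p (alg_res X h f) (alg_res X h t)) -> Olead p f t.
Proof.
move=> H; split.
  by apply: Odeg_local => x /H [V [h [Vx []]]]; exists V, h.
apply: Jpow_local => x /H [V [h [Vx []]]]; exists V, h; split=> //.
by rewrite -[ab_res _ _ _]/(alg_res X _ _) rmorphB.
Qed.

(** In a local frame [t] is the part of [f] of degree p. The local choices agree because leading
    terms are unique. *)
Lemma Olead_ex p U (f : X U) : Jpow p f -> exists t, Olead p f t.
Proof.
move=> jf.
have [|||t ht] := @ab_glue_unique _ X U (fun V h t => Olead p (alg_res X h f) t).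
- by move=> V W hV hW k t ht; rewrite -(res_comp hV k hW); apply: Olead_res.
- by move=> V hV t t'; apply: Olead_unique.
- move=> x Ux; have [V [e [Vx eP fr]]] := split_frame spl hG x.
  exists (opensI V U), (@opensIr _ V U).
  have [t [t' [ht ht' e']]] :=
    fdeg_split fr (pred1 p) (@opensIl _ V U) (alg_res X (@opensIr _ V U) f).
  have jt : fdeg (split_tau spl (U:=V)) (split_eta spl e) (leq p.+1) (@opensIl _ V U) t'.
    have jr : fdeg (split_tau spl (U:=V)) (split_eta spl e) (leq p) (@opensIl _ V U) t'.
      have -> : t' = alg_res X (@opensIr _ V U) f - t by rewrite e' addrAC subrr add0r.
      apply/(Jpow_fdeg fr); apply: JpowB; first exact: Jpow_res.
      by apply: Odeg_Jpow; apply/(Odeg_fdeg eP fr _ (@opensIl _ V U)).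
    apply: fdeg_weak (fdegI fr ht' jr) => k /= /andP[kp]; rewrite leq_eqVlt eq_sym.
    by rewrite (negbTE kp).
  exists t; split=> //; split; first by apply/(Odeg_fdeg eP fr _ (@opensIl _ V U)).
  by rewrite e' addrAC subrr add0r; apply/(Jpow_fdeg fr _ (@opensIl _ V U)).
by exists t; apply: Olead_local.
Qed.

(** If p does not have the parity of [f], then [f] lies already in J^(p+1) and its leading term is
    0. *)
Lemma Olead_homog p b U (f t : X U) : homog (sgr X) b f -> Olead p f t -> homog (sgr X) b t.
Proof.
move=> hf [ht jf]; have [<-|pb] := eqVneq (odd p) b; first exact: Odeg_homog.
suff -> : t = 0 by apply: (homog0 (sgr X)).
have jf' : Jpow p.+1 f.
  apply: (Jpow_parity hf pb); rewrite -[f](subrK t); apply: JpowD; first exact: Jpow_S.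
  exact: Odeg_Jpow.
apply: (Odeg_Jpow0 ht); have -> : t = f - (f - t) by rewrite opprB addrC subrK.
exact: JpowB.
Qed.

Lemma Olead0 U (f : X U) : Olead 0 f (incF spl U (red X U f)).
Proof.
split.
  apply: (@locally_in _ X); exists 1%N, (fun=> red X U f), (fun _ _ => 0).
  by rewrite big_ord1 big_ord0 mulr1.
by apply/Jpow1/red_eq0; rewrite rmorphB incF_red subrr.
Qed.

Lemma Odeg_incF U (c : F U) : Odeg spl 0 (incF spl U c).
Proof. by have [] := Olead0 (incF spl U c); rewrite incF_red. Qed.

Lemma Odeg_incG U (g : G U) : Odeg spl 1 (incG spl U g).
Proof.
apply: (@locally_in _ X); exists 1%N, (fun=> 1), (fun _ _ => g).
by rewrite big_ord1 big_ord1 rmorph1 mul1r.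
Qed.

Section Module.
Variables (S : superMod (purely_even F)) (p0 q0 : nat).
Variable (hS : locally_free_of_superrank S p0 q0).
Variables (E : superMod X) (tens : tensor_structure spl S E).

Lemma tensor_frame x : exists U (e : 'I_m -> G U) (s : 'I_(p0 + q0) -> S U),
  [/\ oset U x, is_basis e, is_basis s &
    is_frame (@split_tau _ _ _ _ _ _ _ spl U) (split_eta spl e) /\
    forall i : 'I_(p0 + q0), homog (mgr S) (p0 <= i)%N (s i)].
Proof.
have [U [e [Ux eP fr]]] := split_frame spl hG x.
have [V [s [Vx sP hs]]] := hS x.
exists (opensI U V), (fun i => mod_res G (@opensIl _ U V) (e i)),
  (fun i => mod_res S (@opensIr _ U V) (s i)); split=> //.
- exact: (basis_res eP (@opensIl _ U V)).
- exact: (basis_res sP (@opensIr _ U V)).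
split; last by move=> i; exact: (homog_res (g := mgr S) (@opensIr _ U V) (hs i)).
exact: (split_frame_of spl (basis_res eP (@opensIl _ U V)) (frame_res fr (@opensIl _ U V))).
Qed.

Lemma tensor_basis_homog U (s : 'I_(p0 + q0) -> S U) :
  (forall i : 'I_(p0 + q0), homog (mgr S) (p0 <= i)%N (s i)) ->
  forall i : 'I_(p0 + q0), homog (mgr E) (p0 <= i)%N (tensor_basis tens s i).
Proof. by move=> hs i; apply: incS_hom. Qed.

Lemma Edeg_bcoord r U (s : 'I_r -> S U) (sP : is_basis s) p V (h : V `<=` U) (v : E V) :
  Edeg tens p v <-> forall i, Odeg spl p (bcoord (tensor_basisP tens sP) h v i).
Proof.
set eP := tensor_basisP tens sP; split=> [hv i|hv]; last first.
  rewrite -[v](bcoordK eP h); apply: Edeg_sum => i _.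
  rewrite /tensor_basis -[mod_res E _ _]/(ab_res E h _) -ab_fun_res.
  exact: Edeg_incS.
apply: Odeg_local => x /hv [W [k [Wx [n' [a [t [ha ev]]]]]]].
exists W, k; split=> //.
have hW := subset_trans k h.
rewrite -[ab_res _ _ _]/(alg_res X k _) -(bcoord_res eP h hW).
rewrite [mod_res E k v]ev.
have bsum_sum (f : 'I_n' -> E W) : bcoord eP hW (\sum_j f j) i =
    \sum_j bcoord eP hW (f j) i.
  apply: (big_morph (fun v => bcoord eP hW v i)).
    by move=> u u'; apply: bcoordD.
  by apply: (addrI (bcoord eP hW 0 i)); rewrite -bcoordD !addr0.
rewrite bsum_sum; apply: Odeg_sum => j _; rewrite bcoordZ.
rewrite -[t j](bcoordK sP hW) incS_bsum bcoord_bsum -[p]addn0.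
by apply: OdegM => //; apply: Odeg_incF.
Qed.

Let loc x := tensor_frame x.

Lemma EdegZ p q U (a : X U) (v : E U) :
  Odeg spl p a -> Edeg tens q v -> Edeg tens (p + q) (a *: v).
Proof.
move=> ha hv; apply: Edeg_local => x Ux; have [V [e [s [Vx eP sP [fr hs]]]]] := loc x.
exists (opensI V U), (@opensIr _ V U); split=> //.
rewrite -[ab_res _ _ _]/(mod_res E _ _) mod_res_scale.
apply/(Edeg_bcoord sP _ (@opensIl _ V U)) => i; rewrite bcoordZ.
apply: OdegM; first exact: Odeg_res.
by move: i; apply/(Edeg_bcoord sP _ (@opensIl _ V U)); apply: Edeg_res.
Qed.

Lemma Edeg_Epow p U (v : E U) : Edeg tens p v -> Epow p v.
Proof.
move=> hv; apply: Epow_local => x Ux; have [V [e [s [Vx eP sP [fr hs]]]]] := loc x.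
exists (opensI V U), (@opensIr _ V U); split=> //.
apply/(Epow_bcoord (tensor_basisP tens sP) p (@opensIl _ V U)) => i; apply: Odeg_Jpow.
by move: i; apply/(Edeg_bcoord sP _ (@opensIl _ V U)); apply: Edeg_res.
Qed.

Lemma EdegN p U (v : E U) : Edeg tens p v -> Edeg tens p (- v).
Proof.
have hm : Odeg spl 0 (-1 : X U) by apply: OdegN; rewrite -(rmorph1 (incF spl U)); apply: Odeg_incF.
by move=> hv; rewrite -scaleN1r -[p]add0n; apply: EdegZ.
Qed.

Lemma Edeg_Epow0 p U (v : E U) : Edeg tens p v -> Epow p.+1 v -> v = 0.
Proof.
move=> hv jv; apply: (@ab_separated _ E) => x Ux.
have [V [e [s [Vx eP sP [fr hs]]]]] := loc x.
exists (opensI V U), (@opensIr _ V U); split=> //; rewrite raddf0.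
set h := @opensIl _ V U; have tP := tensor_basisP tens sP.
rewrite -[LHS](bcoordK tP h); apply: big1 => i _.
rewrite (_ : bcoord _ _ _ i = 0) ?scale0r //; apply: (Odeg_Jpow0 (p := p)).
  rewrite (Prop_irrelevance tP (tensor_basisP tens sP)).
  by move: i; apply/(Edeg_bcoord sP); apply: Edeg_res.
by move: i; apply/Epow_bcoord; apply: Epow_res.
Qed.

Definition Elead p U (v t : E U) : Prop := Edeg tens p t /\ Epow p.+1 (v - t).

Lemma Elead_res p U V (h : V `<=` U) (f t : E U) :
  Elead p f t -> Elead p (mod_res E h f) (mod_res E h t).
Proof. by move=> [ht hf]; split; [apply: Edeg_res | rewrite -raddfB; apply: Epow_res]. Qed.

Lemma Elead_unique p U (f t t' : E U) : Elead p f t -> Elead p f t' -> t = t'.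
Proof.
move=> [ht hf] [ht' hf']; apply/eqP; rewrite -subr_eq0; apply/eqP.
apply: (Edeg_Epow0 (p := p)); first by apply: EdegD => //; apply: EdegN.
have -> : t - t' = (f - t') - (f - t) by rewrite opprB [RHS]addrC addrA subrK.
exact: EpowB.
Qed.

Lemma Elead_local p U (f t : E U) :
  (forall x, oset U x -> exists V (h : V `<=` U), oset V x /\
    Elead p (mod_res E h f) (mod_res E h t)) -> Elead p f t.
Proof.
move=> H; split.
  by apply: Edeg_local => x /H [V [h [Vx []]]]; exists V, h.
apply: Epow_local => x /H [V [h [Vx []]]]; exists V, h; split=> //.
by rewrite -[ab_res _ _ _]/(mod_res E _ _) raddfB.
Qed.

(** The tensor basis lies in degree 0, so both the degree and the filtration of [E] are read off
    from the coordinates. *)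
Lemma Elead_bcoord r U (s : 'I_r -> S U) (sP : is_basis s) p V (h : V `<=` U) (v t : E V) :
  Elead p v t <-> forall i, Olead p (bcoord (tensor_basisP tens sP) h v i)
    (bcoord (tensor_basisP tens sP) h t i).
Proof.
set tP := tensor_basisP tens sP.
have bB i : bcoord tP h (v - t) i = bcoord tP h v i - bcoord tP h t i.
  by apply: (addIr (bcoord tP h t i)); rewrite -bcoordD !subrK.
split=> [[ht hv] i|H]; split.
- by move: i; apply/Edeg_bcoord.
- by rewrite -bB; move: i; apply/Epow_bcoord.
- by apply/(Edeg_bcoord sP _ h) => i; case: (H i).
- by apply/(Epow_bcoord tP p.+1 h) => i; rewrite bB; case: (H i).
Qed.

Lemma Elead_ex p U (f : E U) : Epow p f -> exists t, Elead p f t.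
Proof.
move=> jf.
have [|||t ht] := @ab_glue_unique _ E U (fun V h t => Elead p (mod_res E h f) t).
- by move=> V W hV hW k t ht; rewrite -(mres_comp hV k hW); apply: Elead_res.
- by move=> V hV t t'; apply: Elead_unique.
- move=> x Ux; have [V [e [s [Vx eP sP [fr hs]]]]] := loc x.
  exists (opensI V U), (@opensIr _ V U).
  set f' := mod_res E _ f; set h := @opensIl _ V U.
  have ex i : exists t, Olead p (bcoord (tensor_basisP tens sP) h f' i) t.
    by apply: Olead_ex; move: i; apply/Epow_bcoord; apply: Epow_res.
  exists (bsum (tensor_basis tens s) h (fun i => sval (cid (ex i)))); split=> //.
  apply/(Elead_bcoord sP p h) => i; rewrite [in X in Olead p _ X]bcoord_bsum.
  by case: cid.
by exists t; apply: Elead_local.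
Qed.

Lemma Elead_homog p b U (f t : E U) : homog (mgr E) b f -> Elead p f t -> homog (mgr E) b t.
Proof.
move=> hf ht; apply: (homog_local (g := mgr E)) => x Ux.
have [V [e [s [Vx eP sP [fr hs]]]]] := loc x.
exists (opensI V U), (@opensIr _ V U); split=> //.
have hs' := tensor_basis_homog hs.
apply/(homog_bcoord (tensor_basisP tens sP) hs' _ (@opensIl _ V U)) => i.
have /(Elead_bcoord sP p (@opensIl _ V U))/(_ i) := Elead_res (@opensIr _ V U) ht.
apply: Olead_homog.
move: i; apply/(homog_bcoord (tensor_basisP tens sP) hs' _ (@opensIl _ V U)).
exact: (homog_res (g := mgr E) (@opensIr _ V U) hf).
Qed.
End Module.
End LeadingTerms.

(** * Criteria for frames and bases *)

(** Here [sm] stands for the formation of sums, [fsum] or [bsum]. As coordinates are unique, local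
    ones agree on overlaps and form global ones. *)
Lemma coordinates_glue (T : topologicalType) (A Z : abSheaf T) (K : Type) (U : opens T)
    (sm : forall V : opens T, V `<=` U -> (K -> A V) -> Z V) :
  (forall (V W : opens T) (hV : V `<=` U) (hW : W `<=` U) (h : W `<=` V) c,
     ab_res Z h (sm V hV c) = sm W hW (fun k => ab_res A h (c k))) ->
  (forall (V : opens T) (h : V `<=` U) c d, sm V h c = sm V h d -> c = d) ->
  forall (V : opens T) (h : V `<=` U) (z : Z V),
  (forall x, oset V x -> exists (W : opens T) (k : W `<=` V) (kU : W `<=` U) c,
     oset W x /\ ab_res Z k z = sm W kU c) ->
  exists c, z = sm V h c.
Proof.
move=> sm_res sm_inj V h z loc.
(* Each coordinate is glued separately, but the property keeps the whole family [c]: uniqueness is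
   available for families only. *)
pose P a (W : opens T) (k : W `<=` V) (t : A W) := exists2 c,
  ab_res Z k z = sm W (subset_trans k h) c & c a = t.
have ex a : exists s : A V, forall x, oset V x -> exists (W : opens T) (k : W `<=` V), oset W x /\
    P a W k (ab_res A k s).
  apply: ab_glue_unique => [W W' hW hW' k t [c ec <-]|W hW t t' [c ec <-] [d ed <-]|x Vx].
  - exists (fun b => ab_res A k (c b)) => //.
    by rewrite -(sm_res _ _ (subset_trans hW h)) -ec (ab_res_comp hW k hW').
  - by rewrite ec in ed; rewrite (sm_inj _ _ _ _ ed).
  have [W [k [kU [c [Wx ec]]]]] := loc x Vx.
  exists W, k, (c a); split=> //; exists c => //.
  by rewrite ec (Prop_irrelevance kU (subset_trans k h)).
pose s a := sval (cid (ex a)); exists s.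
apply: ab_separated => x Vx; have [W [k [kU [c [Wx ec]]]]] := loc x Vx.
exists W, k; split=> //; rewrite ec (sm_res _ _ h kU k); congr (sm W kU _).
apply: funext => a; apply: (@ab_separated _ A) => y Wy.
have [W' [k' [Wy' [d ed da]]]] : exists (W' : opens T) (k' : W' `<=` V), oset W' y /\
    P a W' k' (ab_res A k' (s a)).
  by rewrite /s; case: cid => t /= ht; apply: ht; exact: (k y Wy).
exists (opensI W' W), (@opensIr _ W' W); split=> //.
have hI := subset_trans (@opensIr _ W' W) k.
rewrite (ab_res_comp _ _ hI) -(ab_res_comp k' (@opensIl _ W' W)) -da.
have hIU := subset_trans hI h.
suff /(congr1 (@^~ a)) /= : (fun b => ab_res A (@opensIr _ W' W) (c b)) =
    (fun b => ab_res A (@opensIl _ W' W) (d b)) by [].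
apply: (sm_inj _ hIU); rewrite -(sm_res _ _ kU hIU) -ec -(sm_res _ _ (subset_trans k' h) hIU) -ed.
by rewrite (ab_res_comp _ _ hI) (ab_res_comp _ _ hI).
Qed.

Section FrameCriterion.
Variables (R : realType) (T : topologicalType) (F : algSheaf R T) (n m : nat).
Variables (Y : supermanifold F n m) (U : opens T) (tau : homfam F Y U).
Variables (eta : 'I_m -> Y U).
Hypotheses (tauP : is_splitting tau) (eta_odd : forall i, homog (sgr Y) true (eta i)).
Implicit Types (V W : opens T) (I J K : {set 'I_m}).

Hypothesis span1 : forall V (h : V `<=` U) (y : Y V), Jideal y ->
  forall x, oset V x -> exists W (k : W `<=` V) (kU : W `<=` U) (c : 'I_m -> F W), oset W x /\
    Jpow 2 (alg_res Y k y - \sum_i tau kU (c i) * alg_res Y kU (eta i)).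

Hypothesis gr_indep : forall p V (h : V `<=` U) (c : {set 'I_m} -> F V),
  (forall I, #|I| != p -> c I = 0) -> Jpow p.+1 (fsum tau eta h c) -> forall I, c I = 0.

(** Induction on the degree. Once the coefficients below degree p vanish, the part of degree p is
    minus a sum of terms of higher degree. It therefore lies in J^(p+1), and [gr_indep] applies to
    it. *)
Let indep V (h : V `<=` U) c : fsum tau eta h c = 0 -> forall I, c I = 0.
Proof.
move=> c0; suff H p I : (#|I| < p)%N -> c I = 0 by move=> I; apply: (H #|I|.+1).
elim: p I => [//|p IH] I; rewrite ltnS leq_eqVlt => /orP[/eqP Ip|]; last exact: IH.
have ind := @gr_indep p V h (fun J => if #|J| == p then c J else 0).
have := ind _ _ I; rewrite Ip eqxx; apply; first by move=> J /negbTE ->.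
have -> : fsum tau eta h (fun J => if #|J| == p then c J else 0) =
    - fsum tau eta h (fun J => if #|J| == p then 0 else c J).
  apply/eqP; rewrite -addr_eq0 -(fsumD tauP) -c0; apply/eqP; congr fsum; apply: funext => J.
  by case: ifP; rewrite ?addr0 ?add0r.
apply: JpowN; apply: (fdeg_Jpow tauP eta_odd (h := h)).
exists (fun J => if #|J| == p then 0 else c J) => // J.
by rewrite -leqNgt leq_eqVlt; case: eqP => //= _; apply: IH.
Qed.

Let fsum_inj' V (h : V `<=` U) c d : fsum tau eta h c = fsum tau eta h d -> c = d.
Proof.
move=> e; apply: funext => I; apply/eqP; rewrite -subr_eq0; apply/eqP.
apply: (indep (h := h) (c := fun I => c I - d I)).
by rewrite (fsumD tauP h c (fun I => - d I)) (fsumN tauP) e subrr.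
Qed.

Let Q p : subsheaf Y := fun V (y : Y V) =>
  exists (h : V `<=` U) c, Jpow p (y - fsum tau eta h c).

Let Q_res p V W (h : W `<=` V) (y : Y V) : Q p y -> Q p (ab_res Y h y).
Proof.
move=> [hV [c hc]]; exists (subset_trans h hV), (fun I => alg_res F h (c I)).
by rewrite -(fsum_res tauP hV) -[ab_res _ _ _]/(alg_res Y h y) -rmorphB; apply: Jpow_res.
Qed.

Let QD p V (y z : Y V) : Q p y -> Q p z -> Q p (y + z).
Proof.
move=> [h [c hc]] [k [d hd]]; exists h, (fun I => c I + d I).
rewrite (Prop_irrelevance k h) in hd.
by rewrite (fsumD tauP) opprD addrACA; apply: JpowD.
Qed.

Let Q0 p V (h : V `<=` U) : Q p (0 : Y V).
Proof. by exists h, (fun=> 0); rewrite (fsum0 tauP) subr0; apply: Jpow0. Qed.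

Let locQ p V (h : V `<=` U) (y : Y V) : Jpow p y -> locally (X := Y) (@Q p.+1) y.
Proof.
elim: p V h y => [|p IH] V h y.
  move=> _; apply: (@locally_in _ Y); exists h.
  exists (fun I => if I == finset.set0 then red Y V y else 0).
  rewrite (fsum_delta tauP) mon_set0 mulr1; apply/Jpow1/red_eq0.
  by rewrite rmorphB (sp_red tauP) subrr.
move=> Jy; apply: (@locally_idem _ Y) => x /Jy [W [k [Wx [r [a [b [hab e]]]]]]].
exists W, k; split=> //; rewrite e; have hW := subset_trans k h.
apply: big_ind => [|u v|i _].
- by apply: (@locally_in _ Y); apply: Q0.
- by apply: (locallyD (X := Y) (@Q_res p.+2)) => *; apply: QD.
have [ha hb] := hab i; move=> z Wz.
have [W1 [k1 [Wz1 [h1 [c hc]]]]] := IH W hW (a i) ha z Wz.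
have [W2 [k2 [h2 [d [Wz2 hd]]]]] := span1 hW hb Wz.
pose W' := opensI W1 W2.
have kW : W' `<=` W := subset_trans (@opensIl _ W1 W2) k1.
have hU : W' `<=` U := subset_trans kW hW.
exists W', kW; split=> //.
have hc' : Jpow p.+1 (alg_res Y kW (a i) -
    fsum tau eta hU (fun I => alg_res F (@opensIl _ W1 W2) (c I))).
  rewrite -(res_comp k1 (@opensIl _ W1 W2)) -(fsum_res tauP h1 hU) -rmorphB.
  exact: Jpow_res.
pose b' := \sum_i tau hU (alg_res F (@opensIr _ W1 W2) (d i)) * alg_res Y hU (eta i).
have hd' : Jpow 2 (alg_res Y kW (b i) - b').
  have -> : b' = alg_res Y (@opensIr _ W1 W2)
      (\sum_i tau h2 (d i) * alg_res Y h2 (eta i)).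
    rewrite rmorph_sum; apply: eq_bigr => j _; rewrite rmorphM (res_comp _ _ hU).
    by rewrite (sp_res tauP h2 hU).
  rewrite -(res_comp k2 (@opensIr _ W1 W2)) -rmorphB; exact: Jpow_res.
have b'1 : fdeg tau eta (leq 1) hU b'.
  apply: (fdeg_sum tauP) => j _; rewrite -mon_set1; apply: (fdeg_mon tauP).
  by rewrite cards1.
have aP : fdeg tau eta predT hU (fsum tau eta hU (fun I => alg_res F (@opensIl _ W1 W2) (c I))).
  by exists (fun I => alg_res F (@opensIl _ W1 W2) (c I)).
have [g eg _] := fdegM tauP eta_odd (S := predT) (fun _ _ _ _ => isT) aP b'1.
exists hU, g; rewrite -eg -[ab_res _ _ _]/(alg_res Y kW _) rmorphM.
set a1 := alg_res Y kW (a i); set b1 := alg_res Y kW (b i); set a2 := fsum _ _ _ _.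
(* Both terms lie in J^(p+2): [a1] is in J^p and [b1 - b'] in J^2, while [a1 - a2] is in J^(p+1) and
   [b'] in J. *)
have -> : a1 * b1 - a2 * b' = a1 * (b1 - b') + (a1 - a2) * b'.
  by rewrite mulrBr mulrBl addrA subrK.
apply: JpowD.
  by rewrite -addn2; apply: JpowM => //; apply: Jpow_res.
rewrite -addn1; apply: JpowM => //; exact: fdeg_Jpow b'1.
Qed.

(** Successive approximation: the error of a local approximation modulo J^p lies in J^p, and [locQ]
    approximates it one order further. At p = m + 1 no error is left, since J^(m+1) = 0. *)
Let locQ_all p V (h : V `<=` U) (y : Y V) : locally (X := Y) (@Q p) y.
Proof.
elim: p => [|p IH]; first by apply: (@locally_in _ Y); exists h, (fun=> 0).
apply: (@locally_idem _ Y) => x /IH [W [k [Wx [hW [c hc]]]]]; exists W, k; split=> //.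
rewrite -[ab_res _ _ _](subrK (fsum tau eta hW c)).
apply: (locallyD (X := Y) (@Q_res p.+1)); [by move=> *; apply: QD | exact: locQ |].
apply: (@locally_in _ Y); exists hW, c; rewrite subrr; exact: Jpow0.
Qed.

(* As J is nilpotent, generation and independence need to be tested on the associated
   graded sheaf only. *)
Lemma frame_criterion : is_frame tau eta.
Proof.
split=> // V h y.
apply: (@coordinates_glue T F Y _ U (fun V h c => fsum tau eta h c)).
- by move=> V' W hV hW k c; exact: (fsum_res tauP hV hW k c).
- by move=> V' h' c d; apply: fsum_inj'.
move=> x Vx; have [W [k [Wx [kU [c hc]]]]] := @locQ_all m.+1 V h y x Vx.
exists W, k, kU, c; split=> //; apply/eqP; rewrite -subr_eq0; apply/eqP.
exact: Jpow_max hc.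
Qed.
End FrameCriterion.

Section BasisCriterion.
Variables (R : realType) (T : topologicalType) (F : algSheaf R T) (n m : nat).
Variables (Y : supermanifold F n m) (E : superMod Y).
Variables (r : nat) (U : opens T) (b : 'I_r -> E U).
Implicit Types V W : opens T.

Hypothesis span1 : forall V (h : V `<=` U) (v : E V) x, oset V x ->
  exists W (k : W `<=` V) (kU : W `<=` U) c, oset W x /\
    Epow 1 (mod_res E k v - bsum b kU c).

Hypothesis gr_indep : forall p V (h : V `<=` U) c,
  (forall i, Jpow p (c i)) -> bsum b h c = 0 -> forall i, Jpow p.+1 (c i).

Lemma Epow_max V (v : E V) : Epow m.+1 v -> v = 0.
Proof.
move=> hv; apply: (@ab_separated _ E) => x /hv [W [k [Wx [j [a [w [ha e]]]]]]].
exists W, k; split=> //; rewrite e raddf0 big1 // => i _.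
by rewrite (Jpow_max (ha i)) scale0r.
Qed.

(** Repeated use of [gr_indep], starting from J^0, pushes the coefficients of a relation into
    J^(m+1), which is 0. *)
Let indep V (h : V `<=` U) c : bsum b h c = 0 -> forall i, c i = 0.
Proof.
move=> c0 i; apply: Jpow_max; move: i; elim: m.+1 => [//|p IH] i.
exact: (gr_indep IH c0).
Qed.

Let bsumB V (h : V `<=` U) c d : bsum b h (fun i => c i - d i) = bsum b h c - bsum b h d.
Proof. by rewrite /bsum -sumrB; apply: eq_bigr => i _; rewrite scalerBl. Qed.

Let bsum_inj' V (h : V `<=` U) c d : bsum b h c = bsum b h d -> c = d.
Proof.
move=> e; apply: funext => i; apply/eqP; rewrite -subr_eq0; apply/eqP.
by apply: (indep (h := h) (c := fun i => c i - d i)); rewrite bsumB e subrr.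
Qed.

Let Q p : subsheaf E := fun V (v : E V) =>
  exists (h : V `<=` U) c, Epow p (v - bsum b h c).

Let Q_res p V W (h : W `<=` V) (v : E V) : Q p v -> Q p (ab_res E h v).
Proof.
move=> [hV [c hc]]; exists (subset_trans h hV), (fun i => alg_res Y h (c i)).
by rewrite -(bsum_res _ hV) -[ab_res _ _ _]/(mod_res E h v) -raddfB; apply: Epow_res.
Qed.

Let QD p V (y z : E V) : Q p y -> Q p z -> Q p (y + z).
Proof.
move=> [h [c hc]] [k [d hd]]; exists h, (fun i => c i + d i).
rewrite (Prop_irrelevance k h) in hd.
by rewrite bsumD opprD addrACA; apply: EpowD.
Qed.

Let bsum0 V (h : V `<=` U) : bsum b h (fun=> 0) = 0.
Proof. by apply: big1 => i _; rewrite scale0r. Qed.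

(** The error of an approximation modulo E_(p) is locally a sum of products [a i *: w i] with [a i]
    in J^p. Approximating each [w i] modulo E_(1) by [span1] gains one order. *)
Let locQ p V (h : V `<=` U) (v : E V) : locally (X := E) (@Q p) v.
Proof.
elim: p V h v => [|p IH] V h v.
  by apply: (@locally_in _ E); exists h, (fun=> 0); apply: Epow_all.
apply: (@locally_idem _ E) => x /(IH V h v) [W [k [Wx [hW [c hc]]]]].
exists W, k; split=> //; rewrite -[ab_res _ _ _](subrK (bsum b hW c)).
apply: (locallyD (X := E) (@Q_res p.+1)); first by move=> *; apply: QD.
  apply: (@locally_idem _ E) => y /hc [W' [k' [Wy [j [a [w [ha e]]]]]]].
  exists W', k'; split=> //; rewrite e; have hW' := subset_trans k' hW.
  apply: big_ind => [|u u'|i _].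
  - by apply: (@locally_in _ E); exists hW', (fun=> 0); rewrite bsum0 subr0; apply: Epow0.
  - by apply: (locallyD (X := E) (@Q_res p.+1)) => *; apply: QD.
  move=> z Wz; have [W2 [k2 [h2 [d [Wz2 hd]]]]] := span1 hW' (w i) Wz.
  exists W2, k2; split=> //; exists h2, (fun l => alg_res Y k2 (a i) * d l).
  rewrite bsumZ -[ab_res _ _ _]/(mod_res E k2 _) mod_res_scale -scalerBr.
  by rewrite -addn1; apply: EpowZ => //; apply: Jpow_res.
apply: (@locally_in _ E); exists hW, c; rewrite subrr; exact: Epow0.
Qed.

Lemma basis_criterion : is_basis b.
Proof.
apply: is_basisI => [V h v|V h c]; last exact: indep.
apply: (@coordinates_glue T Y E _ U (fun V h c => bsum b h c)).
- by move=> V' W hV hW k c; apply: bsum_res.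
- by move=> V' h' c d; apply: bsum_inj'.
move=> x Vx; have [W [k [Wx [kU [c hc]]]]] := @locQ m.+1 V h v x Vx.
exists W, k, kU, c; split=> //; apply/eqP; rewrite -subr_eq0; apply/eqP.
exact: Epow_max hc.
Qed.
End BasisCriterion.

(** * Congruences modulo powers of J *)

Section Congruences.
Variables (R : realType) (T : topologicalType) (F : algSheaf R T) (n m : nat).
Variables (Y X : supermanifold F n m) (U : opens T).
Implicit Types (V W : opens T).

Section Superhom.
Variables (psi : homfam Y X U) (psiP : is_superhom psi).

Lemma sh0 V (h : V `<=` U) : psi h 0 = 0.
Proof. by apply: (addrI (psi h 0)); rewrite -(shD psiP) !addr0. Qed.

Lemma shN V (h : V `<=` U) y : psi h (- y) = - psi h y.
Proof. by apply: (addrI (psi h y)); rewrite -(shD psiP) !subrr sh0. Qed.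

Lemma shB V (h : V `<=` U) y z : psi h (y - z) = psi h y - psi h z.
Proof. by rewrite (shD psiP) shN. Qed.

Lemma sh1 V (h : V `<=` U) : psi h 1 = 1.
Proof. by rewrite -(rmorph1 (scal Y V)) (sh_scal psiP) rmorph1. Qed.

Lemma sh_sum V (h : V `<=` U) (A : Type) (r : seq A) (P : pred A) (f : A -> Y V) :
  psi h (\sum_(i <- r | P i) f i) = \sum_(i <- r | P i) psi h (f i).
Proof. by apply: (big_morph (psi h)); [exact: (shD psiP) | exact: sh0]. Qed.

Lemma sh_monomial V (h : V `<=` U) (eta : 'I_m -> Y V) I :
  psi h (monomial eta I) = monomial (fun i => psi h (eta i)) I.
Proof. by apply: (big_morph (psi h)); [exact: (shM psiP) | exact: sh1]. Qed.
End Superhom.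

Variables (psi psi' : homfam Y X U).
Hypotheses (psiP : is_superhom psi) (psiP' : is_superhom psi').

Lemma superhom_congr1 V (h : V `<=` U) y : Jideal (psi h y - psi' h y).
Proof. by apply/red_eq0; rewrite rmorphB (sh_red psiP) (sh_red psiP') subrr. Qed.

(* On even sections the difference is even and lies in J, hence in J^2. *)
Lemma superhom_congr2_ideal :
  (forall V (h : V `<=` U) y, Jideal y -> Jpow 2 (psi h y - psi' h y)) ->
  forall V (h : V `<=` U) y, Jpow 2 (psi h y - psi' h y).
Proof.
move=> H V h y; have [y0 [y1 [h0 h1 ->]]] := homog_decomp (sgr Y) y.
rewrite (shD psiP) (shD psiP') opprD addrACA; apply: JpowD.
  apply: (Jpow_parity (p := 1) (b := false)) => //; last exact/Jpow1/superhom_congr1.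
  by apply: (homogB (g := sgr X)); [apply: (sh_hom psiP) | apply: (sh_hom psiP')].
by apply: H; apply: Jideal_odd.
Qed.

(** By induction on p through the product rule for differences: a generator of J^p has p factors in
    J, and replacing one of them by its error in J^2 raises the order by one. For p = 0 both maps
    have the same reduction. *)
Lemma superhom_congr_shift :
  (forall V (h : V `<=` U) y, Jpow 2 (psi h y - psi' h y)) ->
  forall p V (h : V `<=` U) y, Jpow p y -> Jpow p.+1 (psi h y - psi' h y).
Proof.
move=> H; elim=> [|p IH] V h y Jy; first exact/Jpow1/superhom_congr1.
apply: Jpow_local => x /Jy [W [k [Wx [r [a [b [hab e]]]]]]].
exists W, k; split=> //; have hW := subset_trans k h.
rewrite -[ab_res _ _ _]/(alg_res X k _) rmorphB -(sh_res psiP h hW) -(sh_res psiP' h hW).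
rewrite [alg_res Y k y]e (sh_sum psiP) (sh_sum psiP') -sumrB; apply: Jpow_sum => i _.
have [ha hb] := hab i; rewrite (shM psiP) (shM psiP').
have -> : psi hW (a i) * psi hW (b i) - psi' hW (a i) * psi' hW (b i) =
   psi hW (a i) * (psi hW (b i) - psi' hW (b i)) +
   (psi hW (a i) - psi' hW (a i)) * psi' hW (b i).
  by rewrite mulrBr mulrBl addrA subrK.
apply: JpowD.
  by rewrite -addn2; apply: JpowM => //; apply: (superhom_Jpow psiP).
by rewrite -addn1; apply: JpowM; [apply: IH | apply/Jpow1; apply: (superhom_Jideal psiP')].
Qed.

Section FrameCongruence.
Variables (tau : homfam F Y U) (eta : 'I_m -> Y U) (fr : is_frame tau eta).

(** By parity only sections of J have to be compared. There, monomials of length at least 2 lie in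
    J^2 by themselves, and coefficients of linear terms agree modulo J, so everything is decided on
    the generators. *)
Lemma frame_congr2 :
  (forall i V (h : V `<=` U),
     Jpow 2 (psi h (alg_res Y h (eta i)) - psi' h (alg_res Y h (eta i)))) ->
  forall V (h : V `<=` U) y, Jpow 2 (psi h y - psi' h y).
Proof.
move=> H; apply: superhom_congr2_ideal => V h y /(Jideal_fdeg fr h) [c -> hc].
rewrite fsumE (sh_sum psiP) (sh_sum psiP') -sumrB; apply: Jpow_sum => I _.
have etaP := fr_odd fr.
have [I2|] := boolP (2 <= #|I|)%N.
  by apply: JpowB; [apply: (superhom_Jpow psiP) | apply: (superhom_Jpow psiP')];
    apply: JpowMl; apply: Jpow_le (mon_Jpow etaP h I).
rewrite -leqNgt leq_eqVlt ltnS leqn0 cards_eq0 => /orP[/cards1P [i ->]|/eqP->].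
  rewrite mon_set1 (shM psiP) (shM psiP').
  set a := psi _ _; set b := psi _ _; set a' := psi' _ _; set b' := psi' _ _.
  have -> : a * b - a' * b' = a * (b - b') + (a - a') * b'.
    by rewrite mulrBr mulrBl addrA subrK.
  apply: JpowD; first by apply: JpowMl; apply: H.
  apply: (@JpowM _ _ X 1 1); apply/Jpow1; first exact: superhom_congr1.
  by apply: (superhom_Jideal psiP'); apply: Jideal_odd; apply: res_odd.
rewrite hc ?finset.cards0 // (sp0 (fr_split fr)) mul0r (sh0 psiP) (sh0 psiP') subrr.
exact: Jpow0.
Qed.
End FrameCongruence.

Variables (B : superMod Y) (E : superMod X) (phi : homfam B E U).
Hypothesis phiP : is_quasihom psi phi.

Lemma qh0 V (h : V `<=` U) : phi h 0 = 0.
Proof. by apply: (addrI (phi h 0)); rewrite -(qhD phiP) !addr0. Qed.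

Lemma qhB V (h : V `<=` U) y z : phi h (y - z) = phi h y - phi h z.
Proof. by apply: (addIr (phi h z)); rewrite -(qhD phiP) !subrK. Qed.

Lemma qh_sum V (h : V `<=` U) (A : Type) (r : seq A) (P : pred A) (f : A -> B V) :
  phi h (\sum_(i <- r | P i) f i) = \sum_(i <- r | P i) phi h (f i).
Proof. by apply: (big_morph (phi h)); [exact: (qhD phiP) | exact: qh0]. Qed.
End Congruences.

Section ModuleCongruences.
Variables (R : realType) (T : topologicalType) (F : algSheaf R T) (n m : nat).
Variables (Y X : supermanifold F n m) (U : opens T).
Implicit Types (V W : opens T).
Variables (psi psi' : homfam Y X U).
Hypotheses (psiP : is_superhom psi) (psiP' : is_superhom psi').
Variables (B : superMod Y) (E : superMod X) (phi phi' : homfam B E U).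
Hypotheses (phiP : is_quasihom psi phi) (phiP' : is_quasihom psi' phi').

Let scale_diff V (h : V `<=` U) a v : phi h (a *: v) - phi' h (a *: v) =
   psi h a *: (phi h v - phi' h v) + (psi h a - psi' h a) *: phi' h v.
Proof. by rewrite (qhZ phiP) (qhZ phiP') scalerBr scalerBl addrA subrK. Qed.

(** On a product [a *: w] with [a] in J^p either factor of the difference gains one order: the
    scalar by [superhom_congr_shift], the vector by the congruence modulo E_(1). *)
Lemma quasihom_congr_shift :
  (forall V (h : V `<=` U) y, Jpow 2 (psi h y - psi' h y)) ->
  (forall V (h : V `<=` U) v, Epow 1 (phi h v - phi' h v)) ->
  forall p V (h : V `<=` U) v, Epow p v -> Epow p.+1 (phi h v - phi' h v).
Proof.
move=> H H' p V h v Ev.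
apply: Epow_local => x /Ev [W [k [Wx [r [a [w [ha e]]]]]]].
exists W, k; split=> //; have hW := subset_trans k h.
rewrite -[ab_res _ _ _]/(mod_res E k _) raddfB -(qh_res phiP h hW) -(qh_res phiP' h hW).
rewrite [mod_res B k v]e (qh_sum phiP) (qh_sum phiP') -sumrB; apply: Epow_sum => i _.
rewrite scale_diff; apply: EpowD.
  by rewrite -addn1; apply: EpowZ => //; apply: (superhom_Jpow psiP).
by apply: EpowJ; apply: superhom_congr_shift.
Qed.

(** Scalars take care of themselves, as any two homomorphisms over F agree modulo J. *)
Lemma basis_congr1 r (b : 'I_r -> B U) : is_basis b ->
  (forall i V (h : V `<=` U),
     Epow 1 (phi h (mod_res B h (b i)) - phi' h (mod_res B h (b i)))) ->
  forall V (h : V `<=` U) v, Epow 1 (phi h v - phi' h v).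
Proof.
move=> bP H V h v; rewrite -[v](bcoordK bP h) /bsum (qh_sum phiP) (qh_sum phiP') -sumrB.
apply: Epow_sum => i _; rewrite scale_diff; apply: EpowD.
  by rewrite -[1%N]add0n; apply: EpowZ.
by apply: EpowJ; apply/Jpow1; apply: superhom_congr1.
Qed.
End ModuleCongruences.

(** * Quasi-isomorphisms given by bases *)

Section BasisIso.
Variables (R : realType) (T : topologicalType) (F : algSheaf R T) (n m : nat).
Variables (Y X : supermanifold F n m) (U : opens T).
Variables (B : superMod Y) (E : superMod X) (r : nat).
Variables (b : 'I_r -> B U) (bP : is_basis b) (t : 'I_r -> E U) (tP : is_basis t).
Variable par : 'I_r -> bool.
Implicit Types (V W : opens T).

Definition basis_map (psi : homfam Y X U) : homfam B E U :=
  fun V h v => bsum t h (fun i => psi V h (bcoord bP h v i)).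

Lemma basis_map_bsum (psi : homfam Y X U) V (h : V `<=` U) c :
  basis_map psi h (bsum b h c) = bsum t h (fun i => psi V h (c i)).
Proof. by rewrite /basis_map bcoord_bsum. Qed.

Lemma basis_map_basis (psi : homfam Y X U) V (h : V `<=` U) i : is_superhom psi ->
  basis_map psi h (mod_res B h (b i)) = mod_res E h (t i).
Proof.
move=> psiP; rewrite -(bsum_delta b h i) basis_map_bsum -(bsum_delta t h i).
congr bsum; apply: funext => j.
by case: eqP; rewrite ?(sh1 psiP) ?(sh0 psiP).
Qed.

Hypothesis b_hom : forall i, homog (mgr B) (par i) (b i).
Hypothesis t_hom : forall i, homog (mgr E) (par i) (t i).

Lemma basis_map_quasihom (psi : homfam Y X U) :
  is_superhom psi -> is_quasihom psi (basis_map psi).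
Proof.
move=> psiP; split.
- move=> V h v w; rewrite /basis_map -bsumD; congr bsum; apply: funext => i.
  by rewrite bcoordD (shD psiP).
- move=> V h f v; rewrite /basis_map -bsumZ; congr bsum; apply: funext => i.
  by rewrite bcoordZ (shM psiP).
- move=> V W hV hW h v; rewrite /basis_map (bsum_res _ hV hW); congr bsum.
  by apply: funext => i; rewrite -(sh_res psiP hV hW) -(bcoord_res bP hV hW).
- move=> V h c v /(homog_bcoord bP b_hom c h) hv.
  apply/(homog_bcoord tP t_hom c h) => i; rewrite bcoord_bsum.
  by apply: (sh_hom psiP).
Qed.
End BasisIso.

Section BasisQiso.
Variables (R : realType) (T : topologicalType) (F : algSheaf R T) (n m : nat).
Variables (Y X : supermanifold F n m) (U : opens T) (a : siso Y X U).
Variables (B : superMod Y) (E : superMod X) (r : nat).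
Variables (b : 'I_r -> B U) (bP : is_basis b) (t : 'I_r -> E U) (tP : is_basis t).
Variable par : 'I_r -> bool.
Hypothesis b_hom : forall i, homog (mgr B) (par i) (b i).
Hypothesis t_hom : forall i, homog (mgr E) (par i) (t i).

Definition basis_qiso : qiso B E U.
Proof.
exists a (basis_map bP t (sfwd a)) (basis_map tP b (sbwd a)).
- by apply: (basis_map_quasihom bP tP b_hom t_hom); apply: sfwdP.
- by apply: (basis_map_quasihom tP bP t_hom b_hom); apply: sbwdP.
- move=> V h v; rewrite /(basis_map bP _) basis_map_bsum -[RHS](bcoordK bP h).
  by congr bsum; apply: funext => i; rewrite sfwdK.
- move=> V h v; rewrite /(basis_map tP _) basis_map_bsum -[RHS](bcoordK tP h).
  by congr bsum; apply: funext => i; rewrite sbwdK.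
Defined.
End BasisQiso.

Lemma fdeg_linear (R : realType) (T : topologicalType) (F : algSheaf R T) (n m : nat)
    (Y : supermanifold F n m) (U V : opens T) (h : V `<=` U) (tau : homfam F Y U)
    (eta : 'I_m -> Y U) (y : Y V) : is_splitting tau -> fdeg tau eta (pred1 1%N) h y ->
  exists c, y = \sum_i tau V h (c i) * alg_res Y h (eta i).
Proof.
move=> tauP [c -> hc]; exists (fun i => c (finset.set1 i)); rewrite fsumE.
rewrite (bigID (fun I : {set 'I_m} => #|I| == 1%N)) /= [X in _ + X]big1 ?addr0; last first.
  by move=> I /hc ->; rewrite (sp0 tauP) mul0r.
pose i0 (I : {set 'I_m}) : option 'I_m := [pick i | I == finset.set1 i].
rewrite (reindex_omap (fun i => finset.set1 i) i0) /=; last first.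
  move=> I /cards1P [i ->]; rewrite /i0; case: pickP => [j /eqP -> //|/(_ i)].
  by rewrite eqxx.
apply: eq_big => [i|i _]; last by rewrite mon_set1.
rewrite cards1 eqxx /= /i0; case: pickP => [j /eqP /set1_inj -> |/(_ i)]; by rewrite eqxx.
Qed.

(** * Local graded parts of automorphisms *)

Section LocalGrading.
Variables (R : realType) (T : topologicalType) (F : algSheaf R T) (n m : nat).
Variables (X : supermanifold F n m) (G : modSheaf F) (hG : locally_free_of_rank G m).
Variable spl : split_structure X G.
Implicit Types U V W : opens T.

Lemma mul_congr2 V (a a' b b' : X V) : Jideal (a - a') -> Jideal b -> Jpow 2 (b - b') ->
  Jpow 2 (a * b - a' * b').
Proof.
move=> ha hb hb'; have -> : a * b - a' * b' = (a - a') * b + a' * (b - b').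
  by rewrite mulrBr mulrBl addrA subrK.
by apply: JpowD; [apply: (@JpowM _ _ X 1 1); apply/Jpow1 | apply: JpowMl].
Qed.

Lemma monomial_congr V (a b : 'I_m -> X V) (I : {set 'I_m}) : (forall i, Jideal (a i)) ->
  (forall i, Jideal (b i)) -> (forall i, Jpow 2 (a i - b i)) ->
  Jpow #|I|.+1 (monomial a I - monomial b I).
Proof.
move=> ha hb hab; rewrite /monomial cardE.
have hw w : Jpow (size w) (word b w).
  elim: w => [//|i w IH]; rewrite /word big_cons.
  by apply: (@JpowM _ _ X 1 (size w)) => //; apply/Jpow1.
elim: (enum I) => [|i w IH]; first by rewrite /word !big_nil subrr; apply: Jpow0.
rewrite /word !big_cons -/(word a w) -/(word b w).
have -> : a i * word a w - b i * word b w =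
    a i * (word a w - word b w) + (a i - b i) * word b w.
  by rewrite mulrBr mulrBl addrA subrK.
apply: JpowD; last exact: (@JpowM _ _ X 2 (size w)).
by apply: (@JpowM _ _ X 1 (size w).+1) => //; apply/Jpow1.
Qed.

Lemma siso_Jpow p U (a : siso X X U) V (h : V `<=` U) f :
  Jpow p (sfwd a h f) -> Jpow p f.
Proof. by move=> Jf; rewrite -(sfwdK a h f); apply: (superhom_Jpow (sbwdP a)). Qed.

(** Let [t] be the leading term of [f]. Then the image of [f - t] has degree p and lies in J^(p+1),
    so it is 0 and [f = t]. *)
Lemma Odeg_preserve_inv U (a : siso X X U) :
  (forall V (h : V `<=` U) p f, Odeg spl p f -> Odeg spl p (sfwd a h f)) ->
  forall V (h : V `<=` U) p f, Odeg spl p (sfwd a h f) -> Odeg spl p f.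
Proof.
move=> H V h p f hf.
have [t [ht jt]] := Olead_ex hG spl (siso_Jpow (Odeg_Jpow hG hf)).
suff -> : f = t by [].
apply/eqP; rewrite -subr_eq0 -[f - t](sfwdK a h); apply/eqP.
have -> : sfwd a h (f - t) = 0; last exact: (sh0 (sbwdP a)).
apply: (Odeg_Jpow0 hG (spl := spl) (p := p)); last exact: (superhom_Jpow (sfwdP a)).
by rewrite (shB (sfwdP a)); apply: OdegB => //; apply: H.
Qed.

(* The leading terms of the preimages under a of a frame of X form another frame. Sending
   the second frame to the first one defines the graded automorphism. *)
Lemma saut_local_grading U (a : siso X X U) x : oset U x ->
  exists V (hV : V `<=` U) (a0 : siso X X V),
  [/\ oset V x, Aut_deg0_mem spl (a0 : SAut X V) &
    forall W (h : W `<=` V) f, Jpow 2 (sfwd a (subset_trans h hV) f - sfwd a0 h f)].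
Proof.
move=> Ux; have [V0 [e0 [Vx eP0 fr0]]] := split_frame spl hG x.
pose V := opensI V0 U; have hV : V `<=` U := @opensIr _ V0 U.
have h0 : V `<=` V0 := @opensIl _ V0 U.
pose e i := mod_res G h0 (e0 i).
have eP : is_basis e := basis_res eP0 h0.
have fr : is_frame (split_tau spl (U := V)) (split_eta spl e).
  exact: (split_frame_of spl eP (frame_res fr0 h0)).
have aP := sfwdP a; have bP := sbwdP a.
have eJ W (h : W `<=` V) i : Jideal (alg_res X h (split_eta spl e i)).
  by apply: Jideal_odd; apply: res_odd; apply: fr_odd fr.
have ex i : exists t, Olead spl 1 (sbwd a hV (split_eta spl e i)) t.
  apply: Olead_ex => //; apply/Jpow1; apply: (superhom_Jideal bP).
  by have := eJ V (@subset_refl _ V) i; rewrite alg_res_id.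
pose eta i := sval (cid (ex i)).
have etaP i : Olead spl 1 (sbwd a hV (split_eta spl e i)) (eta i).
  by rewrite /eta; case: cid.
have eta_odd i : homog (sgr X) true (eta i).
  by have [h1 _] := etaP i; exact: (Odeg_homog hG h1).
have tauP := split_tauP spl V.
have eta_lead W (h : W `<=` V) i : Jpow 2
    (sbwd a (subset_trans h hV) (alg_res X h (split_eta spl e i)) - alg_res X h (eta i)).
  rewrite (sh_res bP hV) -rmorphB; apply: Jpow_res; by case: (etaP i).
have eta_lead' W (h : W `<=` V) i : Jpow 2
    (sfwd a (subset_trans h hV) (alg_res X h (eta i)) - alg_res X h (split_eta spl e i)).
  rewrite -[X in _ - X](sbwdK a (subset_trans h hV)) -(shB aP) -opprB (shN aP).
  by apply: JpowN; apply: (superhom_Jpow aP).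
have eta_fr : is_frame (split_tau spl (U := V)) eta.
  apply: frame_criterion => // [W h y Jy z Wz|p W h c hc Jc I].
    exists W, (@subset_refl _ W), h.
    have /(Jideal_fdeg fr h) Jy' := superhom_Jideal aP (subset_trans h hV) Jy.
    have [y1 [y2 [hy1 hy2 ey]]] := fdeg_split fr (pred1 1%N) h (sfwd a (subset_trans h hV) y).
    have y2J : Jpow 2 y2.
      apply/(Jpow_fdeg fr _ h); have hy2' : fdeg (split_tau spl (U := V)) (split_eta spl e) (leq
        1) h y2.
        have -> : y2 = sfwd a (subset_trans h hV) y - y1 by rewrite ey addrAC subrr add0r.
        by apply: fdegD => //; apply: fdegN => //; apply: fdeg_weak hy1 => k /eqP->.
      by apply: fdeg_weak (fdegI fr hy2 hy2') => -[|[|k]].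
    have [c ec'] := fdeg_linear tauP hy1.
    exists c; split=> //; rewrite alg_res_id.
    (* [y] is the sum of the preimages of [y1] and [y2]. The latter lies in J^2, and the former is
       compared term by term with the sum in [eta]. *)
    rewrite -[y in X in Jpow _ X](sfwdK a (subset_trans h hV)) ey (shD bP) -addrA addrC.
    rewrite -addrA; apply: JpowD; first exact: (superhom_Jpow bP).
    rewrite addrC ec' (sh_sum bP) -sumrB; apply: Jpow_sum => i _.
    rewrite (shM bP); apply: mul_congr2.
    - by apply/red_eq0; rewrite rmorphB (sh_red bP) subrr.
    - exact: (superhom_Jideal bP).
    exact: eta_lead.
  have hW := subset_trans h hV.
  (* Modulo J^(p+1) the automorphism [a] carries the sum in [eta] to the sum with the same
     coefficients in the frame [e]. That sum has degree p and lies in J^(p+1), so it is 0. *)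
  suff e1 : fsum (split_tau spl (U := V)) (split_eta spl e) h c = 0 by apply: (fr_indep fr e1).
  apply: (fdeg_disjoint fr (h := h) (P := pred1 p) (Q := leq p.+1)).
  - by move=> k /eqP->; rewrite ltnn.
  - by exists c => // J; apply: hc.
  apply/(Jpow_fdeg fr).
  rewrite -[X in Jpow _ X](subrK (sfwd a hW (fsum (split_tau spl (U:=V)) eta h c))).
  apply: JpowD; last exact: (superhom_Jpow aP).
  rewrite -opprB; apply: JpowN; rewrite !fsumE (sh_sum aP) -sumrB; apply: Jpow_sum => J _.
  have [Jp|/hc ->] := eqVneq #|J| p; last first.
    by rewrite (sp0 tauP) !mul0r (sh0 aP) subrr; apply: Jpow0.
  rewrite (shM aP).
  set u := sfwd a hW _; set v := sfwd a hW _; set u' := split_tau _ _ _; set v' := mon _ _ _.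
  have -> : u * v - u' * v' = u * (v - v') + (u - u') * v' by rewrite mulrBr mulrBl addrA subrK.
  apply: JpowD.
    apply: JpowMl; rewrite /v /mon (sh_monomial aP) -Jp; apply: monomial_congr => i.
    - by apply: (superhom_Jideal aP); apply: Jideal_odd; apply: (res_odd eta_odd).
    - exact: eJ.
    by rewrite (Prop_irrelevance hW (subset_trans h hV)).
  rewrite -add1n -Jp; apply: JpowM; last exact: (mon_Jpow (fr_odd fr)).
  by apply/Jpow1/red_eq0; rewrite rmorphB (sh_red aP) subrr.
exists V, hV, (frame_siso eta_fr fr); split=> //.
  (* The inverse sends the frame [e] to the sections [eta] of degree 1, so it visibly preserves
     degrees; [Odeg_preserve_inv] adds the other direction. *)
  have back W (h : W `<=` V) p f : Odeg spl p f ->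
      Odeg spl p (sbwd (frame_siso eta_fr fr) h f).
    move=> /(Odeg_fdeg eP fr _ h) [c -> hc] /=; rewrite frame_map_fsum //.
    rewrite fsumE; apply: Odeg_sum => I _.
    have [/eqP Ip|/hc ->] := boolP (#|I| == p); last first.
      by rewrite (sp0 tauP) mul0r; apply: Odeg0.
    rewrite -[p]add0n; apply: OdegM => //; first exact: Odeg_incF.
    rewrite -Ip cardE /mon /monomial /word; elim: (enum I) => [|i w IH].
      by rewrite big_nil -(rmorph1 (incF spl W)); apply: Odeg_incF.
    rewrite big_cons; apply: (OdegM hG (p := 1)) => //; apply: Odeg_res.
    by case: (etaP i).
  move=> W h p f; split; last first.
    by move=> hf; rewrite -(sfwdK (frame_siso eta_fr fr) h f); apply: back.
  move=> hf; apply: (@Odeg_preserve_inv _ (siso_inv (frame_siso eta_fr fr)) back W h).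
  by rewrite -[sfwd (siso_inv _) _ _]/(sbwd (frame_siso eta_fr fr) h _) sfwdK.
have resP : is_superhom (fun W h f => sfwd a (subset_trans h hV) f : X W).
  exact: (sfwdP (siso_res hV a)).
apply: (frame_congr2 resP (sfwdP (frame_siso eta_fr fr)) eta_fr) => i W h.
by rewrite [sfwd (frame_siso _ _) _ _]frame_map_eta //.
Qed.

(** This is the triviality of the intersection of Aut_0 with Aut_(2): a term [t] of degree p changes
    by a section of degree p that lies in J^(p+1). *)
Lemma superhom_gr_id U (psi : homfam X X U) : is_superhom psi ->
  (forall V (h : V `<=` U) p f, Odeg spl p f -> Odeg spl p (psi V h f)) ->
  (forall V (h : V `<=` U) f, Jpow 2 (psi V h f - f)) ->
  forall V (h : V `<=` U) f, psi V h f = f.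
Proof.
move=> psiP Hdeg H2 V h f; apply: (@ab_separated _ X) => x Vx.
have [W0 [e [Wx eP fr]]] := split_frame spl hG x.
pose W := opensI W0 V; have hV : W `<=` V := @opensIr _ W0 V.
have h0 : W `<=` W0 := @opensIl _ W0 V; have hU := subset_trans hV h.
exists W, hV; split=> //.
rewrite -[RHS]/(alg_res X hV f) -[ab_res _ _ _]/(alg_res X hV _) -(sh_res psiP h hU).
have [c ->] := fr_span fr h0 (alg_res X hV f); rewrite fsumE (sh_sum psiP).
apply: eq_bigr => I _; set t := _ * _.
have dt : Odeg spl #|I| t.
  by apply/(Odeg_fdeg eP fr _ h0); apply: (fdeg_mon (fr_split fr)); rewrite /= eqxx.
apply/eqP; rewrite -subr_eq0; apply/eqP; apply: (Odeg_Jpow0 hG (spl := spl) (p := #|I|)).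
  by apply: OdegB => //; apply: Hdeg.
apply: (superhom_congr_shift psiP (sfwdP (siso_id X U)) H2).
exact: (Odeg_Jpow hG dt).
Qed.

Section Module.
Variables (S : superMod (purely_even F)) (p0 q0 : nat).
Variable (hS : locally_free_of_superrank S p0 q0).
Variables (E : superMod X) (tens : tensor_structure spl S E).

(** With the identity on scalars, only the members of a basis matter. They have degree 0 and change
    by sections of degree 0 that lie in E_(1). *)
Lemma quasihom_gr_id U (psi : homfam X X U) (phi : homfam E E U) :
  is_superhom psi -> is_quasihom psi phi ->
  (forall V (h : V `<=` U) f, psi V h f = f) ->
  (forall V (h : V `<=` U) v, Edeg tens 0 v -> Edeg tens 0 (phi V h v)) ->
  (forall V (h : V `<=` U) v, Epow 1 (phi V h v - v)) ->
  forall V (h : V `<=` U) v, phi V h v = v.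
Proof.
move=> psiP phiP psi1 Hdeg H1 V h v; apply: (@ab_separated _ E) => x Vx.
have [W0 [e [s [Wx eP sP [fr hs]]]]] := tensor_frame hG spl hS x.
pose W := opensI W0 V; have hV : W `<=` V := @opensIr _ W0 V.
have h0 : W `<=` W0 := @opensIl _ W0 V; have hU := subset_trans hV h.
exists W, hV; split=> //.
rewrite -[ab_res _ _ _]/(mod_res E hV _) -(qh_res phiP h hU).
have tP := tensor_basisP tens sP.
rewrite -[mod_res E hV v](bcoordK tP h0) /bsum (qh_sum phiP); apply: eq_bigr => i _.
rewrite (qhZ phiP) psi1; congr (_ *: _).
have d0 : Edeg tens 0 (mod_res E h0 (tensor_basis tens s i)).
  rewrite /tensor_basis -[mod_res E _ _]/(ab_res E h0 _) -ab_fun_res -[incS _ _ _]scale1r.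
  by apply: Edeg_incS; rewrite -(rmorph1 (incF spl W)); apply: Odeg_incF.
apply/eqP; rewrite -subr_eq0; apply/eqP.
apply: (Edeg_Epow0 hG hS (tens := tens) (p := 0)) => //.
by apply: EdegD; [apply: Hdeg | apply: (EdegN hG hS)].
Qed.

Lemma qiso_Epow p U (a : qiso E E U) V (h : V `<=` U) v :
  Epow p (qfwd a h v) -> Epow p v.
Proof.
by move=> Ev; rewrite -(qfwdK a h v); apply: (quasihom_Epow (sbwdP (qbase a)) (qbwdP a)).
Qed.

Lemma Edeg_preserve_inv U (a : qiso E E U) :
  (forall V (h : V `<=` U) p v, Edeg tens p v -> Edeg tens p (qfwd a h v)) ->
  forall V (h : V `<=` U) p v, Edeg tens p (qfwd a h v) -> Edeg tens p v.
Proof.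
move=> H V h p f hf.
have [t [ht jt]] := Elead_ex hG hS tens (qiso_Epow (Edeg_Epow hG hS hf)).
suff -> : f = t by [].
apply/eqP; rewrite -subr_eq0 -[f - t](qfwdK a h); apply/eqP.
have -> : qfwd a h (f - t) = 0; last exact: (qh0 (qbwdP a)).
apply: (Edeg_Epow0 hG hS (tens := tens) (p := p)).
  by rewrite (qhB (qfwdP a)); apply: EdegD => //; apply: (EdegN hG hS); apply: H.
exact: (quasihom_Epow (sfwdP (qbase a)) (qfwdP a)).
Qed.

(** The base is treated by [saut_local_grading]. Over its graded part, [a0] sends to the tensor
    basis [t] the leading terms [b] of the preimages of [t] under [a]; as these have degree 0, [a0]
    is graded. *)
Lemma qaut_local_grading U (a : qiso E E U) x : oset U x ->
  exists V (hV : V `<=` U) (a0 : qiso E E V),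
  [/\ oset V x, QAut_deg0_mem tens (a0 : QAut E V),
    forall W (h : W `<=` V) f, Jpow 2 (sfwd (qbase a) (subset_trans h hV) f - sfwd (qbase a0) h f) &
    forall W (h : W `<=` V) v, Epow 1 (qfwd a (subset_trans h hV) v - qfwd a0 h v)].
Proof.
move=> Ux; have [V1 [hV1 [a1 [Vx1 a1deg a1J]]]] := saut_local_grading (qbase a) Ux.
have [V0 [e0 [s0 [Vx0 _ sP0 [_ hs0]]]]] := tensor_frame hG spl hS x.
pose V := opensI V0 V1; have h0 : V `<=` V0 := @opensIl _ V0 V1.
have h1 : V `<=` V1 := @opensIr _ V0 V1; have hV := subset_trans h1 hV1.
pose s i := mod_res S h0 (s0 i); have sP : is_basis s := basis_res sP0 h0.
have hs (i : 'I_(p0 + q0)) : homog (mgr S) (p0 <= i)%N (s i).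
  exact: (homog_res (g := mgr S) h0 (hs0 i)).
pose t := tensor_basis tens s; pose tP : is_basis t := tensor_basisP tens sP.
have ht := tensor_basis_homog tens hs.
have aP := sfwdP (qbase a); have bP := sbwdP (qbase a).
have AP := qfwdP a; have BP := qbwdP a.
have ex i : exists u, Elead tens 0 (qbwd a hV (t i)) u.
  by apply: (Elead_ex hG hS); apply: Epow_all.
pose b i := sval (cid (ex i)).
have bL i : Elead tens 0 (qbwd a hV (t i)) (b i) by rewrite /b; case: cid.
have b_hom (i : 'I_(p0 + q0)) : homog (mgr E) (p0 <= i)%N (b i).
  by apply: (Elead_homog hG hS _ (bL i)); apply: (qh_hom BP); apply: ht.
have b_lead W (h : W `<=` V) i :
    Epow 1 (qbwd a (subset_trans h hV) (mod_res E h (t i)) - mod_res E h (b i)).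
  rewrite (qh_res BP hV) -raddfB; apply: Epow_res; by case: (bL i).
have b_lead' W (h : W `<=` V) i :
    Epow 1 (qfwd a (subset_trans h hV) (mod_res E h (b i)) - mod_res E h (t i)).
  rewrite -[X in _ - X](qbwdK a (subset_trans h hV)) -(qhB AP).
  apply: (quasihom_Epow aP AP); rewrite -opprB; exact: EpowN.
have bB : is_basis b.
  apply: basis_criterion => [W h v z Wz|p W h c hc c0 i].
    exists W, (@subset_refl _ W), h; have hW := subset_trans h hV.
    exists (fun i => sbwd (qbase a) hW (bcoord tP h (qfwd a hW v) i)); split=> //.
    rewrite mod_res_id -[X in Epow _ (X - _)](qfwdK a hW) -[in X in X - _](bcoordK tP h (qfwd a
      hW v)).
    rewrite /bsum (qh_sum BP) -sumrB; apply: Epow_sum => i _.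
    rewrite (qhZ BP) -scalerBr -[1%N]add0n; apply: EpowZ => //.
    by rewrite (Prop_irrelevance hW (subset_trans h hV)).
  (* Modulo E_(p+1) the image of the relation under [a] is the sum of the [t j] with coefficients
     the images of the [c j]. Being a basis, [t] forces these into J^(p+1), and with them the
     [c j]. *)
  have hW := subset_trans h hV; apply: (siso_Jpow (a := qbase a) (h := hW)).
  suff : Epow p.+1 (bsum t h (fun j => sfwd (qbase a) hW (c j))).
    by move=> /(Epow_bcoord tP p.+1 h)/(_ i); rewrite bcoord_bsum.
  have z : qfwd a hW (bsum b h c) = 0 by rewrite c0 (qh0 AP).
  rewrite -[X in Epow _ X]subr0 -z /bsum (qh_sum AP) -sumrB; apply: Epow_sum => j _.
  rewrite (qhZ AP) -scalerBr -addn1; apply: EpowZ; first exact: (superhom_Jpow aP).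
  rewrite -opprB; apply: EpowN.
  by rewrite (Prop_irrelevance hW (subset_trans h hV)).
pose a1' := siso_res h1 a1.
pose a0 := basis_qiso a1' bB tP b_hom ht.
have a1'deg W (h : W `<=` V) p f : Odeg spl p f <-> Odeg spl p (sfwd a1' h f).
  exact: a1deg.
have base W (h : W `<=` V) f :
    Jpow 2 (sfwd (qbase a) (subset_trans h hV) f - sfwd a1' h f).
  have := a1J W (subset_trans h h1) f.
  by rewrite (Prop_irrelevance (subset_trans (subset_trans h h1) hV1) (subset_trans h hV)).
exists V, hV, a0; split=> //.
  have back W (h : W `<=` V) p v : Edeg tens p v -> Edeg tens p (qbwd a0 h v).
    move=> /(Edeg_bcoord hG tens sP _ h) hv /=; rewrite /basis_map; apply: Edeg_sum => i _.
    rewrite -[p]addn0; apply: (EdegZ hG hS).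
      apply: (proj2 (a1'deg W h p _)); rewrite [sfwd a1' _ _](sbwdK a1' h); exact: hv.
    by apply: Edeg_res; case: (bL i).
  move=> W h p v; split; last first.
    by move=> hv; rewrite -(qfwdK a0 h v); apply: back.
  move=> hv; apply: (@Edeg_preserve_inv _ (qiso_inv a0) back W h).
  by rewrite -[qfwd (qiso_inv _) _ _]/(qbwd a0 h _) qfwdK.
have resP : is_superhom (fun W h f => sfwd (qbase a) (subset_trans h hV) f : X W).
  exact: (sfwdP (siso_res hV (qbase a))).
have resQ : is_quasihom (fun W h f => sfwd (qbase a) (subset_trans h hV) f : X W)
    (fun W h v => qfwd a (subset_trans h hV) v : E W).
  exact: (qfwdP (qiso_res hV a)).
apply: (basis_congr1 resP (sfwdP (qbase a0)) resQ (qfwdP a0) bB) => i W h.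
rewrite [qfwd a0 _ _](basis_map_basis bB t h i (sfwdP a1')); exact: b_lead'.
Qed.
End Module.
End LocalGrading.

(** * Nonabelian cohomology *)

Section CohomologyClasses.
Variables (T : topologicalType) (Q : grpPresheaf T) (N : subgrp Q).
Local Open Scope group_scope.
Implicit Types (U V W : opens T) (c d e : cocycle N).

Lemma gres1 U V (h : V `<=` U) : grp_res h (1 : Q U) = 1.
Proof. by apply: (mulgI (grp_res h 1)); rewrite -grp_resM !mulg1. Qed.

Lemma cval_ii c i V (h : V `<=` opensI (cov c i) (cov c i)) : grp_res h (cval c i i) = 1.
Proof. by apply: (mulgI (grp_res h (cval c i i))); rewrite (cvalM h h h) mulg1. Qed.

Lemma cvalV c i j V (hij : V `<=` opensI (cov c i) (cov c j))
    (hji : V `<=` opensI (cov c j) (cov c i)) :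
  (grp_res hij (cval c i j))^-1 = grp_res hji (cval c j i).
Proof.
have hii : V `<=` opensI (cov c i) (cov c i) by move=> x /hij [].
by apply: (mulgI (grp_res hij (cval c i j))); rewrite mulgV (cvalM hij hji hii) cval_ii.
Qed.

Lemma cohom_refl c : cohomologous c c.
Proof.
exists (cidx c), (cov c), id, id, (fun k => 1).
split=> [|k|k|k|k l V hk hl hc hd]; [exact: covP | by [] | by [] | exact: sg1 |].
by rewrite !gres1 invg1 mul1g mulg1 (Prop_irrelevance hc hd).
Qed.

Lemma cohom_sym c d : cohomologous c d -> cohomologous d c.
Proof.
move=> [K [W [r [s [b [cW hr hs hb e]]]]]].
exists K, W, s, r, (fun k => (b k)^-1); split=> // [k|k l V hk hl hd hc].
  exact: sgV.
by rewrite !grp_resV (e k l V hk hl hc hd) !mulgA mulVg mul1g invgK mulgVK.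
Qed.

(** The two refinements may place the same open set in different members of the cover of [d]; the
    value of [d] for this pair of members is inserted to pass from one to the other. *)
Lemma cohom_trans c d e : cohomologous c d -> cohomologous d e -> cohomologous c e.
Proof.
move=> [K [W [r [s [b [cW hr hs hb eb]]]]]] [K' [W' [r' [s' [b' [cW' hr' hs' hb' eb']]]]]].
have hmid k k' : opensI (W k) (W' k') `<=` opensI (cov d (r' k')) (cov d (s k)).
  by move=> x [Wx Wx']; split; [apply: hr' | apply: hs].
exists (K * K')%type, (fun kk => opensI (W kk.1) (W' kk.2)), (fun kk => r kk.1),
  (fun kk => s' kk.2), (fun kk => grp_res (@opensIr _ (W kk.1) (W' kk.2)) (b' kk.2) *
     grp_res (hmid kk.1 kk.2) (cval d (r' kk.2) (s kk.1)) *
     grp_res (@opensIl _ (W kk.1) (W' kk.2)) (b kk.1)); split.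
- by move=> x; have [k Wx] := cW x; have [k' Wx'] := cW' x; exists (k, k').
- by move=> [k k'] x [/hr].
- by move=> [k k'] x [_ /hs'].
- move=> [k k'] /=; apply: sgM; last exact/sg_res/hb.
  by apply: sgM; [exact/sg_res/hb' | exact/sg_res/cval_mem].
move=> [k k'] [l l'] V /= hk hl hc he.
have hkW := subset_trans hk (@opensIl _ _ _); have hkW' := subset_trans hk (@opensIr _ _ _).
have hlW := subset_trans hl (@opensIl _ _ _); have hlW' := subset_trans hl (@opensIr _ _ _).
have hd : V `<=` opensI (cov d (s k)) (cov d (s l)).
  by move=> x Vx; split; apply: hs; [apply: hkW | apply: hlW].
have hd' : V `<=` opensI (cov d (r' k')) (cov d (r' l')).
  by move=> x Vx; split; apply: hr'; [apply: hkW' | apply: hlW'].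
rewrite !grp_resM !(grp_res_comp _ _ hkW) !(grp_res_comp _ _ hkW') !(grp_res_comp _ _ hlW)
  !(grp_res_comp _ _ hlW').
have m1 : V `<=` opensI (cov d (r' k')) (cov d (s k)) := subset_trans hk (hmid k k').
have m2 : V `<=` opensI (cov d (r' l')) (cov d (s l)) := subset_trans hl (hmid l l').
have m3 : V `<=` opensI (cov d (s l)) (cov d (r' l')) by move=> x /m2 [].
have m4 : V `<=` opensI (cov d (s k)) (cov d (r' l')).
  by move=> x Vx; case: (m1 x Vx) => _ ?; case: (m3 x Vx).
rewrite !(grp_res_comp _ _ m1) !(grp_res_comp _ _ m2) !invgM.
rewrite (cvalV m2 m3) (eb' k' l' V hkW' hlW' hd' he) -(cvalM m1 m4 hd') -(cvalM hd m3 m4).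
by rewrite (eb k l V hkW hlW hc hd) !mulgA.
Qed.

Lemma cohom_classP c d : cohom_class c = cohom_class d <-> cohomologous c d.
Proof.
split=> [e|cd]; first by rewrite -[cohomologous c d]/(cohom_class c d) e; apply: cohom_refl.
apply: funext => e; apply: propext; split; last exact: cohom_trans.
by apply: cohom_trans; apply: cohom_sym.
Qed.

(* As cohomologous, except that the b k need not lie in N. *)
Definition cohomologous_in c d : Prop :=
  exists (K : Type) (W : K -> opens T) (r : K -> cidx c) (s : K -> cidx d)
         (b : forall k, Q (W k)),
    [/\ forall x : T, exists k, oset (W k) x,
        forall k, W k `<=` cov c (r k),
        forall k, W k `<=` cov d (s k) &
        forall k l (V : opens T) (hk : V `<=` W k) (hl : V `<=` W l)
          (hc : V `<=` opensI (cov c (r k)) (cov c (r l)))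
          (hd : V `<=` opensI (cov d (s k)) (cov d (s l))),
          grp_res hd (cval d (s k) (s l)) =
          grp_res hk (b k) * grp_res hc (cval c (r k) (r l)) * (grp_res hl (b l))^-1].

Variables (A : subgrp Q) (AN : conj_stable N A).

Lemma res_global_res (b : H0 A) U V (h : V `<=` U) :
  grp_res h (res_global b U) = res_global b V.
Proof. exact: grp_res_comp. Qed.

Lemma cohom_eq_cval c d (f : cidx d -> cidx c) (hf : forall i, cov d i `<=` cov c (f i)) :
  (forall i j V (hc : V `<=` opensI (cov c (f i)) (cov c (f j)))
     (hd : V `<=` opensI (cov d i) (cov d j)),
     grp_res hd (cval d i j) = grp_res hc (cval c (f i) (f j))) ->
  cohomologous c d.
Proof.
move=> e; exists (cidx d), (cov d), f, id, (fun=> 1).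
split=> [|k|k|k|k l V hk hl hc hd]; [exact: covP | exact: hf | by [] | exact: sg1 |].
by rewrite !gres1 invg1 mul1g mulg1; apply: e.
Qed.

Lemma conj_cohom (b : H0 A) c d : cohomologous c d ->
  cohomologous (conj_cocycle AN b c) (conj_cocycle AN b d).
Proof.
move=> [K [W [r [s [a [cW hr hs ha e]]]]]].
exists K, W, r, s, (fun k => res_global b (W k) * a k * (res_global b (W k))^-1).
split=> // [k|k l V hk hl hc hd].
  by apply: AN => //; apply: sg_res; apply: (svalP b).
rewrite /= !grp_resM !grp_resV !res_global_res (e k l V hk hl hc hd) !invgM invgK.
by rewrite !mulgA !mulgVK.
Qed.

Lemma H1_actE (b : H0 A) c : H1_act AN b (cohom_class c) = cohom_class (conj_cocycle AN b c).
Proof.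
apply: funext => d; apply: propext; split=> [[c' cc' cd]|cd]; last first.
  by exists c => //; apply: cohom_refl.
exact: cohom_trans (conj_cohom b cc') cd.
Qed.

Definition H0_mul (b b' : H0 A) : H0 A := exist _ _ (sgM (svalP b) (svalP b')).
Definition H0_inv (b : H0 A) : H0 A := exist _ _ (sgV (svalP b)).
Definition H0_one : H0 A := exist _ _ (sg1 A _).

Lemma conj_cohom_one c : cohomologous (conj_cocycle AN H0_one c) c.
Proof.
apply: (@cohom_eq_cval (conj_cocycle AN H0_one c) c id (fun i => @subset_refl _ _)) => i j V hc hd.
rewrite /= /res_global /= !grp_resM !gres1 grp_resV gres1 invg1 mulg1 mul1g.
by rewrite (Prop_irrelevance hc hd).
Qed.

Lemma conj_cohom_mul (b b' : H0 A) c :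
  cohomologous (conj_cocycle AN b (conj_cocycle AN b' c)) (conj_cocycle AN (H0_mul b b') c).
Proof.
pose c1 := conj_cocycle AN b (conj_cocycle AN b' c).
apply: (@cohom_eq_cval c1 (conj_cocycle AN (H0_mul b b') c) id (fun i => @subset_refl _ _)) => i
  j V hc hd.
by rewrite (Prop_irrelevance hc hd) /= /res_global /= !grp_resM invgM !grp_resM !mulgA.
Qed.

Lemma conj_cohom_inv (b : H0 A) c d :
  cohomologous (conj_cocycle AN b c) d -> cohomologous (conj_cocycle AN (H0_inv b) d) c.
Proof.
move=> /(conj_cohom (H0_inv b)) /cohom_sym h; apply: cohom_trans h _.
apply: cohom_trans (conj_cohom_mul _ _ _) _.
have -> : H0_mul (H0_inv b) b = H0_one by apply: eq_exist; apply: mulVg.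
exact: conj_cohom_one.
Qed.

Lemma H1_orbitE c z : H1_orbit AN (cohom_class c) z <->
  exists b, z = cohom_class (conj_cocycle AN b c).
Proof. by split=> -[b ->]; exists b; rewrite H1_actE. Qed.

Lemma H1_orbitP c d : H1_orbit AN (cohom_class c) = H1_orbit AN (cohom_class d) <->
  exists b, cohomologous (conj_cocycle AN b c) d.
Proof.
split=> [e|[b h]].
  have : H1_orbit AN (cohom_class d) (cohom_class d).
    apply/H1_orbitE; exists H0_one; apply/cohom_classP/cohom_sym/conj_cohom_one.
  rewrite -e => /H1_orbitE [b /cohom_classP h]; exists b; exact: cohom_sym.
apply: funext => z; apply: propext; split=> /H1_orbitE [b' ->]; apply/H1_orbitE.
  exists (H0_mul b' (H0_inv b)); apply/cohom_classP/cohom_sym.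
  apply: cohom_trans (cohom_sym (conj_cohom_mul _ _ _)) _.
  by apply: conj_cohom; apply: conj_cohom_inv.
exists (H0_mul b' b); apply/cohom_classP/cohom_sym.
by apply: cohom_trans (cohom_sym (conj_cohom_mul _ _ _)) _; apply: conj_cohom.
Qed.

Lemma H1_act_unit (b : H0 A) : H1_act AN b (H1_unit N) = H1_unit N.
Proof.
rewrite H1_actE; apply/cohom_classP; pose t := trivial_cocycle N.
apply: (@cohom_eq_cval (conj_cocycle AN b t) t id (fun i => @subset_refl _ _)) => i j V hc hd.
by rewrite /= mulg1 mulgV !gres1.
Qed.

(* Locally b k = n a with n in N and a in A. On overlaps the a's agree because N meets A
   trivially, so they glue to the global section by which c has to be conjugated. *)
Lemma conj_cocycle_of_cohom_in c d :
  (forall U (q a : Q U), N U a -> N U (q * a * q^-1)) ->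
  (forall U (a : Q U), N U a -> A U a -> a = 1) ->
  (forall U (q : Q U) x, oset U x -> exists V (h : V `<=` U) (a : Q V),
     [/\ oset V x, A V a & N V (grp_res h q * a^-1)]) ->
  (forall (K : Type) (V : K -> opens T) (b : forall k, Q (V k)),
     (forall x, exists k, oset (V k) x) ->
     (forall k l W (hk : W `<=` V k) (hl : W `<=` V l), grp_res hk (b k) = grp_res hl (b l)) ->
     exists g : Q (opensT T), forall k, grp_res (@subT _ (V k)) g = b k) ->
  (forall b : Q (opensT T), (forall x, exists V, oset V x /\ A V (grp_res (@subT _ V) b)) ->
     A (opensT T) b) ->
  cohomologous_in c d -> exists b : H0 A, cohomologous (conj_cocycle AN b c) d.
Proof.
move=> Nconj NA1 loc glue Aloc [K [W [r [s [b [cW hr hs e]]]]]].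
pose k x := sval (cid (cW x)).
have Wx x : oset (W (k x)) x by rewrite /k; case: cid.
have locx x := loc _ (b (k x)) x (Wx x).
pose V x := sval (cid (locx x)).
have hV x : V x `<=` W (k x) by rewrite /V; case: cid => ? [].
have hA x : exists a : Q (V x), [/\ oset (V x) x, A _ a & N _ (grp_res (hV x) (b (k x)) * a^-1)].
  move: (hV x); rewrite /V; case: cid => V0 /= [h [a [V0x Aa Na]]] h'; exists a; split=> //.
  by rewrite (Prop_irrelevance h' h).
pose a x := sval (cid (hA x)).
have aP x : [/\ oset (V x) x, A _ (a x) & N _ (grp_res (hV x) (b (k x)) * (a x)^-1)].
  by rewrite /a; case: cid.
have Vx x : oset (V x) x by case: (aP x).
have agree x y U (hx : U `<=` V x) (hy : U `<=` V y) : grp_res hx (a x) = grp_res hy (a y).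
  have kx := subset_trans hx (hV x); have ky := subset_trans hy (hV y).
  have hc : U `<=` opensI (cov c (r (k x))) (cov c (r (k y))).
    by move=> z Uz; split; apply: hr; [apply: kx | apply: ky].
  have hd : U `<=` opensI (cov d (s (k x))) (cov d (s (k y))).
    by move=> z Uz; split; apply: hs; [apply: kx | apply: ky].
  have eU := e (k x) (k y) U kx ky hc hd.
  set bx := grp_res kx (b (k x)) in eU; set by_ := grp_res ky (b (k y)) in eU.
  have [_ Ax Nx] := aP x; have [_ Ay Ny] := aP y.
  have Nx' : N U (bx * (grp_res hx (a x))^-1).
    by have := sg_res hx Nx; rewrite grp_resM grp_resV (grp_res_comp _ _ kx).
  have Ny' : N U (by_ * (grp_res hy (a y))^-1).
    by have := sg_res hy Ny; rewrite grp_resM grp_resV (grp_res_comp _ _ ky).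
  have Nd : N U (grp_res hd (cval d (s (k x)) (s (k y)))) by exact/sg_res/cval_mem.
  have Nc : N U (grp_res hc (cval c (r (k x)) (r (k y)))) by exact/sg_res/cval_mem.
  (* The relation between the cocycles expresses this quotient as a value of [d] times a conjugate
     of the inverse of a value of [c], and N is normal. *)
  have Nb : N U (bx * by_^-1).
    have -> : bx * by_^-1 = grp_res hd (cval d (s (k x)) (s (k y))) *
        (by_ * (grp_res hc (cval c (r (k x)) (r (k y))))^-1 * by_^-1).
      by rewrite eU !mulgA mulgVK mulgK.
    by apply: sgM => //; apply: Nconj; apply: sgV.
  (* The left-hand side lies in A, and it differs from [bx * by_^-1] only by factors in N. *)
  have h1 : grp_res hx (a x) * (grp_res hy (a y))^-1 = 1.
    apply: NA1; last by apply: sgM; [apply: sg_res | apply: sgV; apply: sg_res].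
    have -> : grp_res hx (a x) * (grp_res hy (a y))^-1 =
        (bx * (grp_res hx (a x))^-1)^-1 * (bx * by_^-1) * (by_ * (grp_res hy (a y))^-1).
      by rewrite invgM invgK !mulgA !mulgVK.
    by apply: sgM => //; apply: sgM => //; apply: sgV.
  by apply: (mulIg (grp_res hy (a y))^-1); rewrite h1 mulgV.
have [|g hg] := glue T V a _ agree; first by move=> x; exists x.
have Ag : A (opensT T) g.
  by apply: Aloc => x; exists (V x); split=> //; rewrite hg; case: (aP x).
exists (exist _ g Ag).
exists T, V, (fun x => r (k x)), (fun x => s (k x)),
  (fun x => grp_res (hV x) (b (k x)) * (a x)^-1).
split=> [x|x|x|x|x y U hx hy hc hd].
- by exists x.
- exact: subset_trans (hV x) (hr _).
- exact: subset_trans (hV x) (hs _).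
- by case: (aP x).
have kx := subset_trans hx (hV x); have ky := subset_trans hy (hV y).
rewrite (e (k x) (k y) U kx ky hc hd) /= !grp_resM !grp_resV !(grp_res_comp _ _ kx)
  !(grp_res_comp _ _ ky).
rewrite !res_global_res /res_global /=.
have gE z (h : U `<=` V z) p : @grp_res _ Q (opensT T) U p g = grp_res h (a z).
  by rewrite -hg (grp_res_comp _ _ p).
by rewrite {1}(gE x hx) (gE y hy) invgM invgK !mulgA !mulgVK.
Qed.
End CohomologyClasses.

(** * Gluing of isomorphisms and of sheaves *)

Section GluingHoms.
Variables (T : topologicalType) (A B : abSheaf T) (I : Type) (U : I -> opens T).
Hypothesis covU : forall x, exists i, oset (U i) x.
Variable f : forall i, homfam A B (U i).
Implicit Types V W : opens T.
Hypothesis f_res : forall i V W (hV : V `<=` U i) (hW : W `<=` U i) (h : W `<=` V) s,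
  f hW (ab_res A h s) = ab_res B h (f hV s).
Hypothesis f_agree : forall i j V (hi : V `<=` U i) (hj : V `<=` U j) s, f hi s = f hj s.

Lemma hom_glue : exists g : homfam A B (opensT T),
  (forall V W (hV : V `<=` opensT T) (hW : W `<=` opensT T) (h : W `<=` V) s,
     g W hW (ab_res A h s) = ab_res B h (g V hV s)) /\
  forall i V (h : V `<=` U i) (hT : V `<=` opensT T) s, g V hT s = f h s.
Proof.
(* [t] is the value at [s], over W. Testing it on all smaller open sets inside some U i makes the
   property stable under restriction. *)
pose P V s W (_ : W `<=` V) (t : B W) := forall i W' (k : W' `<=` W) (kV : W' `<=` V) (hi : W'
  `<=` U i),
  ab_res B k t = f hi (ab_res A kV s).
have Puniq V s W hW t t' : @P V s W hW t -> @P V s W hW t' -> t = t'.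
  move=> ht ht'; apply: ab_separated => x Wx; have [i Ux] := covU x.
  have kV := subset_trans (@opensIr _ (U i) W) hW.
  exists (opensI (U i) W), (@opensIr _ (U i) W); split=> //.
  by rewrite (ht i _ _ kV (@opensIl _ (U i) W)) (ht' i _ _ kV (@opensIl _ (U i) W)).
have ex V s : exists t, @P V s V (@subset_refl _ V) t.
  have [|||t ht] := @ab_glue_unique _ B V (@P V s).
  - move=> W W' hW hW' k t ht i W'' k' kV hi.
    by rewrite (ab_res_comp _ _ (subset_trans k' k)) (ht i _ _ kV hi).
  - by move=> W hW t t'; apply: Puniq.
  - move=> x Vx; have [i Ux] := covU x.
    exists (opensI (U i) V), (@opensIr _ (U i) V),
      (f (@opensIl _ (U i) V) (ab_res A (@opensIr _ (U i) V) s)).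
    split=> // j W' k kV hj; rewrite -(f_res _ (subset_trans k (@opensIl _ (U i) V))).
    by rewrite (ab_res_comp _ _ kV); apply: f_agree.
  exists t => i W k kV hi; apply: ab_separated => x Wx.
  have [W' [hW' [Wx' hP]]] := ht x (k x Wx).
  pose W2 := opensI W' W; have k2 : W2 `<=` W := @opensIr _ W' W.
  exists W2, k2; split=> //.
  rewrite -(f_res hi (subset_trans k2 hi)) (ab_res_comp _ _ (subset_trans k2 kV)).
  rewrite (ab_res_comp _ _ (subset_trans k2 k)).
  rewrite -(hP i W2 (@opensIl _ W' W) (subset_trans k2 k) (subset_trans k2 hi)).
  by rewrite (ab_res_comp _ _ (subset_trans k2 kV)).
exists (fun V _ s => sval (cid (ex V s))); split=> [V W hV hW h s|i V h hT s].
  case: (cid (ex W _)) => t ht /=; case: (cid (ex V _)) => t' ht' /=.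
  apply: (Puniq W (ab_res A h s) W (@subset_refl _ W)) => //.
  move=> i W' k kV hi; rewrite (ab_res_comp _ _ (subset_trans k h)).
  by rewrite (ht' i _ _ (subset_trans kV h) hi) (ab_res_comp _ _ (subset_trans kV h)).
case: (cid _) => t ht /=; have := ht i V (@subset_refl _ V) (@subset_refl _ V) h.
by rewrite !ab_res_id.
Qed.
End GluingHoms.

Section GluingIsos.
Variables (R : realType) (T : topologicalType) (F : algSheaf R T) (n m : nat).
Variables (I : Type) (U : I -> opens T).
Hypothesis covU : forall x, exists i, oset (U i) x.
Implicit Types V W : opens T.

Let glue_eq (A : abSheaf T) V (s t : A V) :
  (forall i W (hi : W `<=` U i) (k : W `<=` V), ab_res A k s = ab_res A k t) -> s = t.
Proof.
move=> H; apply: ab_separated => x Vx; have [i Ux] := covU x.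
exists (opensI (U i) V), (@opensIr _ (U i) V); split=> //.
by apply: (H i); apply: opensIl.
Qed.

Let glue_superhom (Y X : supermanifold F n m) (a : forall i, homfam Y X (U i))
    (g : homfam Y X (opensT T)) : (forall i, is_superhom (a i)) ->
  (forall V W (hV : V `<=` opensT T) (hW : W `<=` opensT T) (h : W `<=` V) s,
     g W hW (ab_res Y h s) = ab_res X h (g V hV s)) ->
  (forall i V (h : V `<=` U i) (hT : V `<=` opensT T) s, g V hT s = a i V h s) ->
  is_superhom g.
Proof.
move=> aP g_res ga; split.
- move=> V h s t; apply: glue_eq => i W hi k; rewrite raddfD -!(g_res _ _ h (subset_trans k h)).
  by rewrite !(ga i W hi) raddfD (shD (aP i)).
- move=> V h s t; apply: glue_eq => i W hi k; rewrite -(g_res _ _ h (subset_trans k h)).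
  rewrite -![ab_res _ _ _]/(alg_res _ k _) !rmorphM (ga i W hi) (shM (aP i)).
  by rewrite -!(ga i W hi (subset_trans k h)) !(g_res _ _ h (subset_trans k h)).
- move=> V h c; apply: glue_eq => i W hi k; rewrite -(g_res _ _ h (subset_trans k h)).
  by rewrite -![ab_res _ _ _]/(alg_res _ k _) !scal_res (ga i W hi) (sh_scal (aP i)).
- exact: g_res.
- move=> V h b s hs; apply: (homog_local (g := sgr X)) => x Vx; have [i Ux] := covU x.
  have k := @opensIr _ (U i) V.
  exists (opensI (U i) V), k; split=> //; rewrite -(g_res _ _ h (subset_trans k h)).
  rewrite (ga i _ (@opensIl _ (U i) V)); apply: (sh_hom (aP i)); exact: (homog_res k hs).
- move=> V h s; apply: (@glue_eq F) => i W hi k.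
  rewrite -![ab_res F _ _]/(alg_res F k _) -!alg_fun_res -[alg_res X k _]/(ab_res X k _).
  by rewrite -(g_res _ _ h (subset_trans k h)) (ga i W hi) (sh_red (aP i)).
Qed.

Lemma siso_glue (Y X : supermanifold F n m) (a : forall i, siso Y X (U i)) :
  (forall i j V (hi : V `<=` U i) (hj : V `<=` U j) s, sfwd (a i) hi s = sfwd (a j) hj s) ->
  exists g : siso Y X (opensT T), forall i V (h : V `<=` U i) (hT : V `<=` opensT T),
    (forall s, sfwd g hT s = sfwd (a i) h s) /\ (forall s, sbwd g hT s = sbwd (a i) h s).
Proof.
move=> agree.
have agree' i j V (hi : V `<=` U i) (hj : V `<=` U j) s : sbwd (a i) hi s = sbwd (a j) hj s.
  by apply: (can_inj (sfwdK (a i) hi)); rewrite sbwdK (agree i j V hi hj) sbwdK.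
have [g [g_res ga]] := @hom_glue T Y X I U covU (fun i => sfwd (a i)) (fun i => sh_res (sfwdP (a
  i))) agree.
have [g' [g_res' ga']] := @hom_glue T X Y I U covU (fun i => sbwd (a i)) (fun i => sh_res (sbwdP
  (a i))) agree'.
have gP := glue_superhom (fun i => sfwdP (a i)) g_res ga.
have gP' := glue_superhom (fun i => sbwdP (a i)) g_res' ga'.
have gK V (h : V `<=` opensT T) : cancel (g V h) (g' V h).
  move=> s; apply: glue_eq => i W hi k; have hW := subset_trans k h.
  by rewrite -(g_res' _ _ h hW) -(g_res _ _ h hW) (ga i W hi) (ga' i W hi) sfwdK.
have gK' V (h : V `<=` opensT T) : cancel (g' V h) (g V h).
  move=> s; apply: glue_eq => i W hi k; have hW := subset_trans k h.
  by rewrite -(g_res _ _ h hW) -(g_res' _ _ h hW) (ga' i W hi) (ga i W hi) sbwdK.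
by exists (Siso gP gP' gK gK') => i V h hT; split=> s; [apply: ga | apply: ga'].
Qed.

Let glue_quasihom (Y X : supermanifold F n m) (B : superMod Y) (E : superMod X)
    (psi : homfam Y X (opensT T)) (a : forall i, homfam Y X (U i))
    (phi : homfam B E (opensT T)) (c : forall i, homfam B E (U i)) :
  (forall i, is_quasihom (a i) (c i)) ->
  (forall i V (h : V `<=` U i) (hT : V `<=` opensT T) s, psi V hT s = a i V h s) ->
  (forall V W (hV : V `<=` opensT T) (hW : W `<=` opensT T) (h : W `<=` V) s,
     psi W hW (ab_res Y h s) = ab_res X h (psi V hV s)) ->
  (forall V W (hV : V `<=` opensT T) (hW : W `<=` opensT T) (h : W `<=` V) s,
     phi W hW (ab_res B h s) = ab_res E h (phi V hV s)) ->
  (forall i V (h : V `<=` U i) (hT : V `<=` opensT T) s, phi V hT s = c i V h s) ->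
  is_quasihom psi phi.
Proof.
move=> cP pa p_res g_res gc; split.
- move=> V h s t; apply: glue_eq => i W hi k; rewrite raddfD -!(g_res _ _ h (subset_trans k h)).
  by rewrite !(gc i W hi) raddfD (qhD (cP i)).
- move=> V h s t; apply: glue_eq => i W hi k; rewrite -(g_res _ _ h (subset_trans k h)).
  rewrite -![ab_res _ _ _]/(mod_res _ k _) !mod_res_scale (gc i W hi) (qhZ (cP i)).
  rewrite -(pa i W hi (subset_trans k h)) -(gc i W hi (subset_trans k h)).
  by rewrite -[alg_res X _ _]/(ab_res X k _) -(p_res _ _ h (subset_trans k h)) (g_res _ _ h
    (subset_trans k h)).
- exact: g_res.
- move=> V h b s hs; apply: (homog_local (g := mgr E)) => x Vx; have [i Ux] := covU x.
  have k := @opensIr _ (U i) V.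
  exists (opensI (U i) V), k; split=> //; rewrite -(g_res _ _ h (subset_trans k h)).
  rewrite (gc i _ (@opensIl _ (U i) V)); apply: (qh_hom (cP i)).
  exact: (homog_res (g := mgr B) k hs).
Qed.

Lemma qiso_glue (Y X : supermanifold F n m) (B : superMod Y) (E : superMod X)
    (a : forall i, qiso B E (U i)) :
  (forall i j V (hi : V `<=` U i) (hj : V `<=` U j) s,
     sfwd (qbase (a i)) hi s = sfwd (qbase (a j)) hj s) ->
  (forall i j V (hi : V `<=` U i) (hj : V `<=` U j) s, qfwd (a i) hi s = qfwd (a j) hj s) ->
  exists g : qiso B E (opensT T), forall i V (h : V `<=` U i) (hT : V `<=` opensT T),
    (forall s, sfwd (qbase g) hT s = sfwd (qbase (a i)) h s) /\
    (forall s, qfwd g hT s = qfwd (a i) h s).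
Proof.
move=> bagree agree; have [b hb] := siso_glue bagree.
have agree' i j V (hi : V `<=` U i) (hj : V `<=` U j) s : qbwd (a i) hi s = qbwd (a j) hj s.
  by apply: (can_inj (qfwdK (a i) hi)); rewrite qbwdK (agree i j V hi hj) qbwdK.
have [g [g_res ga]] := @hom_glue T B E I U covU (fun i => qfwd (a i)) (fun i => qh_res (qfwdP (a
  i))) agree.
have [g' [g_res' ga']] := @hom_glue T E B I U covU (fun i => qbwd (a i)) (fun i => qh_res (qbwdP
  (a i))) agree'.
have gP := glue_quasihom (fun i => qfwdP (a i)) (fun i V h hT => (hb i V h hT).1)
  (sh_res (sfwdP b)) g_res ga.
have gP' := glue_quasihom (fun i => qbwdP (a i)) (fun i V h hT => (hb i V h hT).2)
  (sh_res (sbwdP b)) g_res' ga'.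
have gK V (h : V `<=` opensT T) : cancel (g V h) (g' V h).
  move=> s; apply: glue_eq => i W hi k; have hW := subset_trans k h.
  by rewrite -(g_res' _ _ h hW) -(g_res _ _ h hW) (ga i W hi) (ga' i W hi) qfwdK.
have gK' V (h : V `<=` opensT T) : cancel (g' V h) (g V h).
  move=> s; apply: glue_eq => i W hi k; have hW := subset_trans k h.
  by rewrite -(g_res _ _ h hW) -(g_res' _ _ h hW) (ga' i W hi) (ga i W hi) qbwdK.
exists (Qiso gP gP' gK gK') => i V h hT; split=> s; last exact: ga.
by case: (hb i V h hT) => hb' _; apply: hb'.
Qed.
End GluingIsos.

(** * Gluing sheaves along transition maps *)

Section GluedGroups.
Variables (T : topologicalType) (A : abSheaf T) (I : Type) (U : I -> opens T).
Implicit Types V W : opens T.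

(** Descent data: over U i the glued sheaf is a copy of [A], and [tr] for i and j passes from the
    j-th copy to the i-th. *)
Record transition := Transition {
  tr : forall i j, homfam A A (opensI (U i) (U j));
  trD : forall i j V (h : V `<=` opensI (U i) (U j)) s s', tr h (s + s') = tr h s + tr h s';
  tr_res : forall i j V W (hV : V `<=` opensI (U i) (U j)) (hW : W `<=` opensI (U i) (U j))
    (h : W `<=` V) s, tr hW (ab_res A h s) = ab_res A h (tr hV s);
  tr_id : forall i V (h : V `<=` opensI (U i) (U i)) s, tr h s = s;
  tr_comp : forall i j k V (hij : V `<=` opensI (U i) (U j)) (hjk : V `<=` opensI (U j) (U k))
    (hik : V `<=` opensI (U i) (U k)) s, tr hij (tr hjk s) = tr hik s
}.

Variable t : transition.

Definition glue_compat V (f : forall i, A (opensI V (U i))) : Prop :=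
  forall i j W (ki : W `<=` opensI V (U i)) (kj : W `<=` opensI V (U j))
    (kij : W `<=` opensI (U i) (U j)),
  ab_res A ki (f i) = tr t kij (ab_res A kj (f j)).

Definition glued V : Type := {f : forall i, A (opensI V (U i)) | glue_compat f}.

Lemma glued_eq V (f g : glued V) : (forall i, sval f i = sval g i) -> f = g.
Proof.
by case: f g => f fP [g gP] /= fg; apply: eq_exist; apply: functional_extensionality_dep.
Qed.

Lemma tr0 i j V (h : V `<=` opensI (U i) (U j)) : tr t h 0 = 0.
Proof. by apply: (addrI (tr t h 0)); rewrite -trD !addr0. Qed.

Lemma trN i j V (h : V `<=` opensI (U i) (U j)) s : tr t h (- s) = - tr t h s.
Proof. by apply: (addrI (tr t h s)); rewrite -trD !subrr tr0. Qed.

Definition glued_zero V : glued V.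
Proof. by exists (fun i => 0) => i j W ki kj kij; rewrite !raddf0 tr0. Defined.

Definition glued_add V (f g : glued V) : glued V.
Proof.
exists (fun i => sval f i + sval g i) => i j W ki kj kij.
by rewrite !raddfD trD (svalP f i j W ki kj kij) (svalP g i j W ki kj kij).
Defined.

Definition glued_opp V (f : glued V) : glued V.
Proof.
exists (fun i => - sval f i) => i j W ki kj kij.
by rewrite !raddfN trN (svalP f i j W ki kj kij).
Defined.

Lemma glued_addA V : associative (@glued_add V).
Proof. by move=> f g h; apply: glued_eq => i; apply: addrA. Qed.
Lemma glued_addC V : commutative (@glued_add V).
Proof. by move=> f g; apply: glued_eq => i; apply: addrC. Qed.
Lemma glued_add0 V : left_id (glued_zero V) (@glued_add V).
Proof. by move=> f; apply: glued_eq => i; apply: add0r. Qed.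
Lemma glued_addN V : left_inverse (glued_zero V) (@glued_opp V) (@glued_add V).
Proof. by move=> f; apply: glued_eq => i; apply: addNr. Qed.

HB.instance Definition _ V := gen_eqMixin (glued V).
HB.instance Definition _ V := gen_choiceMixin (glued V).
HB.instance Definition _ V := GRing.isZmodule.Build (glued V)
  (@glued_addA V) (@glued_addC V) (@glued_add0 V) (@glued_addN V).

Lemma glued_resP V W (h : W `<=` V) (f : glued V) :
  glue_compat (fun i => ab_res A (opensIS (U := U i) h) (sval f i)).
Proof.
move=> i j W' ki kj kij; have kV i0 : W' `<=` opensI W (U i0) -> W' `<=` opensI V (U i0).
  by move=> k x /k [/h].
by rewrite (ab_res_comp _ _ (kV i ki)) (ab_res_comp _ _ (kV j kj)); apply: (svalP f).
Qed.

Definition glued_res V W (h : W `<=` V) (f : glued V) : glued W := exist _ _ (glued_resP h f).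

Lemma glued_resD V W (h : W `<=` V) (f g : glued V) :
  glued_res h (f + g) = glued_res h f + glued_res h g.
Proof. by apply: glued_eq => i /=; rewrite raddfD. Qed.

Lemma glued_res_id V (h : V `<=` V) (f : glued V) : glued_res h f = f.
Proof. by apply: glued_eq => i /=; rewrite ab_res_id. Qed.

Lemma glued_res_comp V W W' (h1 : W `<=` V) (h2 : W' `<=` W) (h3 : W' `<=` V) (f : glued V) :
  glued_res h2 (glued_res h1 f) = glued_res h3 f.
Proof. by apply: glued_eq => i /=; apply: ab_res_comp. Qed.

Lemma glued_sheaf : sheaf_condition (X := glued) glued_res.
Proof.
move=> V J W hW s cov agr.
have ex i : exists f : A (opensI V (U i)), forall a, ab_res A (opensIS (hW a)) f = sval (s a) i.
  apply: ab_gluing => [x [/cov [a Wx] Ux]|a b W' ha hb]; first by exists a.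
  have ka := subset_trans ha (@opensIl _ (W a) (U i)).
  have kb := subset_trans hb (@opensIl _ (W b) (U i)).
  have kU : W' `<=` opensI W' (U i) by apply: sub_opensI => //;
    apply: subset_trans ha (@opensIr _ _ _).
  have /(congr1 (fun f : glued W' => ab_res A kU (sval f i))) /= := agr a b W' ka kb.
  by rewrite (ab_res_comp _ _ ha) (ab_res_comp _ _ hb).
pose f i := sval (cid (ex i)).
have fP i a : ab_res A (opensIS (hW a)) (f i) = sval (s a) i by rewrite /f; case: cid.
have fc : glue_compat f.
  move=> i j W' ki kj kij; apply: ab_separated => x Wx.
  have [Vx Ux] := ki x Wx; have [a Wax] := cov x Vx.
  pose W2 := opensI (W a) W'; have k2 : W2 `<=` W' := @opensIr _ (W a) W'.
  exists W2, k2; split=> //; rewrite -(tr_res t kij (subset_trans k2 kij)).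
  have l i0 : W' `<=` opensI V (U i0) -> W2 `<=` opensI (W a) (U i0).
    by move=> k y [Way W'y]; split=> //; case: (k y W'y).
  rewrite (ab_res_comp _ _ (subset_trans k2 ki)) (ab_res_comp _ _ (subset_trans k2 kj)).
  rewrite -(ab_res_comp (opensIS (hW a)) (l i ki)) -(ab_res_comp (opensIS (hW a)) (l j kj)) !fP.
  exact: (svalP (s a)).
exists (exist _ f fc); split=> [a|g hg]; first by apply: glued_eq => i; apply: fP.
apply: glued_eq => i /=; apply: ab_separated => x [Vx Ux]; have [a Wax] := cov x Vx.
by exists (opensI (W a) (U i)), (opensIS (hW a)); split=> //; rewrite fP -hg.
Qed.

Definition glued_fwd i V (h : V `<=` U i) (f : glued V) : A V :=
  ab_res A (sub_opensI (@subset_refl _ V) h) (sval f i).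

(** Compatibility dictates the family whose i-th member is [s]: the j-th one is obtained by the
    transition from i to j. The cocycle relation makes it a section of the glued sheaf. *)
Lemma glued_bwdP i V (h : V `<=` U i) (s : A V) : glue_compat (fun j =>
  tr t (sub_opensI (@opensIr _ V (U j)) (subset_trans (@opensIl _ V (U j)) h))
    (ab_res A (@opensIl _ V (U j)) s)).
Proof.
move=> j k W kj kk kjk.
have hW : W `<=` V := subset_trans kj (@opensIl _ _ _).
have hji : W `<=` opensI (U j) (U i).
  by apply: sub_opensI; [apply: subset_trans kj (@opensIr _ _ _) | apply: subset_trans hW h].
have hki : W `<=` opensI (U k) (U i).
  by apply: sub_opensI; [apply: subset_trans kk (@opensIr _ _ _) | apply: subset_trans hW h].
rewrite -(tr_res t _ hji) -(tr_res t _ hki) !(ab_res_comp _ _ hW).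
by rewrite (tr_comp t kjk hki hji).
Qed.

Definition glued_bwd i V (h : V `<=` U i) (s : A V) : glued V := exist _ _ (glued_bwdP h s).

Lemma glued_fwdK i V (h : V `<=` U i) : cancel (glued_fwd h) (glued_bwd h).
Proof.
move=> f; apply: glued_eq => j /=; rewrite /glued_fwd (ab_res_comp _ _ (sub_opensI (@opensIl _ V
  (U j)) (subset_trans (@opensIl _ V (U j)) h))).
by rewrite -(svalP f j i _ (@subset_refl _ _)) ab_res_id.
Qed.

Lemma glued_bwdK i V (h : V `<=` U i) : cancel (glued_bwd h) (glued_fwd h).
Proof.
move=> s; rewrite /glued_fwd /= -(tr_res t _ (sub_opensI h h)) tr_id.
by rewrite (ab_res_comp _ _ (@subset_refl _ V)) ab_res_id.
Qed.

Lemma glued_fwdD i V (h : V `<=` U i) f g :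
  glued_fwd h (f + g) = glued_fwd h f + glued_fwd h g.
Proof. exact: raddfD. Qed.

Lemma glued_fwd_res i V W (hV : V `<=` U i) (hW : W `<=` U i) (h : W `<=` V) f :
  glued_fwd hW (glued_res h f) = ab_res A h (glued_fwd hV f).
Proof.
rewrite /glued_fwd /=; have k : W `<=` opensI V (U i) by apply: sub_opensI.
by rewrite (ab_res_comp _ _ k) (ab_res_comp _ _ k).
Qed.

Lemma glued_fwd_tr i j V (hi : V `<=` U i) (hj : V `<=` U j)
    (hij : V `<=` opensI (U i) (U j)) f :
  glued_fwd hi f = tr t hij (glued_fwd hj f).
Proof. exact: (svalP f). Qed.

Lemma glued_fwd_inj i V (h : V `<=` U i) : injective (glued_fwd h).
Proof. exact: can_inj (glued_fwdK h). Qed.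

Variable g : grading A.
Hypothesis tr_hom : forall i j V (h : V `<=` opensI (U i) (U j)) b s,
  homog g b s -> homog g b (tr t h s).

Definition glued_homog (b : bool) V (f : glued V) : Prop := forall i, homog g b (sval f i).

(** The transition maps preserve parity, so by uniqueness of the decomposition the components of the
    members match as the members do. *)
Lemma glued_split V (f : glued V) : exists! y : glued V * glued V,
  [/\ glued_homog false y.1, glued_homog true y.2 & f = y.1 + y.2].
Proof.
pose f0 i := sval (cid (homog_decomp g (sval f i))).
have f0P i : exists s1, [/\ homog g false (f0 i), homog g true s1 & sval f i = f0 i + s1].
  by rewrite /f0; case: cid.
pose f1 i := sval (cid (f0P i)).
have fP i : [/\ homog g false (f0 i), homog g true (f1 i) & sval f i = f0 i + f1 i].
  by rewrite /f1; case: cid.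
have c01 i j W (ki : W `<=` opensI V (U i)) (kj : W `<=` opensI V (U j))
    (kij : W `<=` opensI (U i) (U j)) :
    ab_res A ki (f0 i) = tr t kij (ab_res A kj (f0 j)) /\
    ab_res A ki (f1 i) = tr t kij (ab_res A kj (f1 j)).
  have [h0 h1 e] := fP i; have [h0' h1' e'] := fP j.
  apply: (homog_unique (g := g)); [exact: homog_res | | exact: homog_res | |].
  - by apply: tr_hom; apply: homog_res.
  - by apply: tr_hom; apply: homog_res.
  by rewrite -trD -!raddfD -e -e'; apply: (svalP f).
have c0 : glue_compat f0 by move=> i j W ki kj kij; case: (c01 i j W ki kj kij).
have c1 : glue_compat f1 by move=> i j W ki kj kij; case: (c01 i j W ki kj kij).
exists (exist _ f0 c0, exist _ f1 c1); split=> /=.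
  split=> [i|i|] /=; [by case: (fP i) | by case: (fP i) |].
  by apply: glued_eq => i; case: (fP i).
move=> [y0 y1] /= [h0 h1 e]; congr pair; apply: glued_eq => i /=.
  have [k0 k1 e'] := fP i.
  by have [] := homog_unique k0 (h0 i) k1 (h1 i) (etrans (esym e') (congr1 (fun f => sval f i) e)).
have [k0 k1 e'] := fP i.
by have [] := homog_unique k0 (h0 i) k1 (h1 i) (etrans (esym e') (congr1 (fun f => sval f i) e)).
Qed.

Lemma glued_fwd_homog i V (h : V `<=` U i) b f : glued_homog b f -> homog g b (glued_fwd h f).
Proof. by move=> hf; apply: homog_res. Qed.

Lemma glued_bwd_homog i V (h : V `<=` U i) b s : homog g b s -> glued_homog b (glued_bwd h s).
Proof. by move=> hs j; apply: tr_hom; apply: homog_res. Qed.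
End GluedGroups.

(** The glued sheaf is identified with [X] over the members of the cover only, so a chart of [X] has
    to be cut down to [U'] when it is carried over. *)
Definition superchart_transport (R : realType) (T : topologicalType) (O O' : superSheaf R T)
    (n m : nat) (U U' : opens T) (ch : superchart O n m U) (k : U' `<=` U)
    (f : homfam O' O U') (g : homfam O O' U')
    (fK : forall (V : opens T) (h : V `<=` U'), cancel (@f V h) (@g V h))
    (gK : forall (V : opens T) (h : V `<=` U'), cancel (@g V h) (@f V h))
    (fD : forall (V : opens T) (h : V `<=` U') s t, f V h (s + t) = f V h s + f V h t)
    (fM : forall (V : opens T) (h : V `<=` U') (s t : O' V), f V h (s * t) = f V h s * f V h t)
    (f_scal : forall (V : opens T) (h : V `<=` U') c, f V h (scal O' V c) = scal O V c)
    (f_res : forall (V W : opens T) (hV : V `<=` U') (hW : W `<=` U') (h : W `<=` V) s,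
       f W hW (alg_res O' h s) = alg_res O h (f V hV s))
    (f_hom : forall (V : opens T) (h : V `<=` U') b s,
      homog (sgr O') b s <-> homog (sgr O) b (f V h s)) :
  superchart O' n m U'.
Proof.
exists (chart ch) (fun W h s => coef ch (subset_trans h k) (f W h s)).
- by move=> x y U'x U'y; apply: chart_inj; apply: k.
- by move=> W hW; apply: (chart_homeo ch); apply: subset_trans hW k.
- by move=> *; apply: coef_holo.
- move=> W h u hu; have [s [hs su]] := @coef_bij _ _ _ _ _ _ ch W (subset_trans h k) u hu.
  exists (g W h s); split; first by rewrite gK.
  by move=> s' hs'; rewrite (su _ hs') fK.
- move=> W W' h h' l s; rewrite (f_res _ _ h h' l); exact: coef_res.
- by move=> W h s t; rewrite fD; apply: Defs.coefD.
- by move=> W h s t; rewrite fM; apply: Defs.coefM.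
- by move=> W h c; rewrite f_scal; apply: coef_scal.
- by move=> W h b s; apply: (iff_trans (f_hom W h b s)); apply: coef_hom.
Defined.

(** * The supermanifold and the bundle glued from a cocycle *)

Section GluedManifold.
Variables (R : realType) (T : topologicalType) (F : algSheaf R T) (n m : nat).
Variables (X : supermanifold F n m) (E : superMod X) (c : cocycle (QAut_mod E 1 2)).
Implicit Types V W : opens T.
Local Notation I := (cidx c).
Local Notation U := (cov c).

Let ca i j : qiso E E (opensI (U i) (U j)) := cval c i j.

Let ca_comp i j k V (hij : V `<=` opensI (U i) (U j)) (hjk : V `<=` opensI (U j) (U k))
    (hik : V `<=` opensI (U i) (U k)) :
  (forall s, sfwd (qbase (ca i j)) hij (sfwd (qbase (ca j k)) hjk s) = sfwd (qbase (ca i k)) hik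
    s) /\
  (forall s, qfwd (ca i j) hij (qfwd (ca j k) hjk s) = qfwd (ca i k) hik s).
Proof.
have pe (W : set T) (h : V `<=` W) : subset_trans (@subset_refl _ V) h = h by apply:
  Prop_irrelevance.
have e : qiso_comp (qiso_res hij (ca i j)) (qiso_res hjk (ca j k)) = qiso_res hik (ca i k).
  exact: cvalM hij hjk hik.
split=> s.
  by have := congr1 (fun a => sfwd (qbase a) (@subset_refl _ V) s) e; rewrite /= !pe.
by have := congr1 (fun a => qfwd a (@subset_refl _ V) s) e; rewrite /= !pe.
Qed.

(** The cocycle relation makes this map idempotent, and it is invertible. *)
Let ca_id i V (h : V `<=` opensI (U i) (U i)) :
  (forall s, sfwd (qbase (ca i i)) h s = s) /\ (forall s, qfwd (ca i i) h s = s).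
Proof.
have [e e'] := ca_comp h h h.
split=> s; first by apply: (can_inj (sfwdK (qbase (ca i i)) h)).
by apply: (can_inj (qfwdK (ca i i) h)).
Qed.

Definition trO : transition X U := @Transition T X I U (fun i j => sfwd (qbase (ca i j)))
  (fun i j => shD (sfwdP (qbase (ca i j)))) (fun i j => sh_res (sfwdP (qbase (ca i j))))
  (fun i V h => (ca_id h).1) (fun i j k V hij hjk hik => (ca_comp hij hjk hik).1).

Definition trE : transition E U := @Transition T E I U (fun i j => qfwd (ca i j))
  (fun i j => qhD (qfwdP (ca i j))) (fun i j => qh_res (qfwdP (ca i j)))
  (fun i V h => (ca_id h).2) (fun i j k V hij hjk hik => (ca_comp hij hjk hik).2).

Let trP i j := sfwdP (qbase (ca i j)).

Definition glued_mul V (f g : glued trO V) : glued trO V.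
Proof.
exists (fun i => (sval f i : X _) * sval g i) => i j W ki kj kij.
rewrite -[LHS]/(alg_res X ki _) -[ab_res X kj _]/(alg_res X kj _) !rmorphM.
rewrite -![alg_res X _ _]/(ab_res X _ _) (svalP f i j W ki kj kij) (svalP g i j W ki kj kij).
exact: (esym (shM (trP i j) kij _ _)).
Defined.

Definition glued_const V (a : complexes R) : glued trO V.
Proof.
exists (fun i => scal X (opensI V (U i)) a) => i j W ki kj kij.
by rewrite -![ab_res X _ _]/(alg_res X _ _) !scal_res; apply/esym/(sh_scal (trP i j)).
Defined.

Let glued_mulA V : associative (@glued_mul V).
Proof. by move=> f g h; apply: glued_eq => i; apply: mulrA. Qed.
Let glued_mul1 V : left_id (glued_const V 1) (@glued_mul V).
Proof. by move=> f; apply: glued_eq => i /=; rewrite rmorph1 mul1r. Qed.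
Let glued_mulr1 V : right_id (glued_const V 1) (@glued_mul V).
Proof. by move=> f; apply: glued_eq => i /=; rewrite rmorph1 mulr1. Qed.
Let glued_mulDl V : left_distributive (@glued_mul V) +%R.
Proof. by move=> f g h; apply: glued_eq => i; apply: mulrDl. Qed.
Let glued_mulDr V : right_distributive (@glued_mul V) +%R.
Proof. by move=> f g h; apply: glued_eq => i; apply: mulrDr. Qed.

Definition glued_ring V : pzRingType :=
  HB.pack_for pzRingType (glued trO V)
    (GRing.Zmodule_isPzRing.Build (glued trO V) (@glued_mulA V) (@glued_mul1 V)
      (@glued_mulr1 V) (@glued_mulDl V) (@glued_mulDr V)).

Let glued_resM V W (h : W `<=` V) (f g : glued_ring V) :
  glued_res h (f * g) = (glued_res h f : glued_ring W) * glued_res h g.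
Proof. by apply: glued_eq => i /=; apply: (rmorphM (alg_res X (opensIS h))). Qed.

Let glued_res1 V W (h : W `<=` V) : glued_res h (1 : glued_ring V) = (1 : glued_ring W).
Proof. by apply: glued_eq => i; exact: (@scal_res _ _ X _ _ (opensIS (U := U i) h) 1). Qed.

Let glued_constD V a b : glued_const V (a + b) = glued_const V a + glued_const V b.
Proof. by apply: glued_eq => i; exact: (rmorphD (scal X (opensI V (U i)))). Qed.

Let glued_constM V a b :
  glued_const V (a * b) = (glued_const V a : glued_ring V) * glued_const V b.
Proof. by apply: glued_eq => i; exact: (rmorphM (scal X (opensI V (U i)))). Qed.

Definition glued_scal V : {rmorphism complexes R -> glued_ring V} :=
  @rmorphism_of (complexes R) (glued_ring V) (@glued_const V)
    (@glued_constD V) (@glued_constM V) erefl.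

Definition glued_alg : algSheaf R T.
Proof.
refine (@AlgSheaf R T glued_ring (fun V W h => @rmorphism_of (glued_ring V) (glued_ring W)
  (@glued_res _ _ _ _ trO V W h) (glued_resD h) (glued_resM h) (glued_res1 h))
  (@glued_res_id _ _ _ _ trO) (@glued_res_comp _ _ _ _ trO) (@glued_sheaf _ _ _ _ trO)
  glued_scal _ _).
- by move=> V W h a; apply: glued_eq => i; exact: (@scal_res _ _ X _ _ (opensIS (U := U i) h) a).
- by move=> V a f; apply: glued_eq => i; apply: scal_central.
Defined.

Let trO_hom i j V (h : V `<=` opensI (U i) (U j)) b s :
  homog (sgr X) b s -> homog (sgr X) b (tr trO h s).
Proof. exact: (sh_hom (trP i j)). Qed.

Let trE_hom i j V (h : V `<=` opensI (U i) (U j)) b s :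
  homog (mgr E) b s -> homog (mgr E) b (tr trE h s).
Proof. exact: (qh_hom (qfwdP (ca i j))). Qed.

Definition glued_grading : grading glued_alg.
Proof.
refine (@Grading T glued_alg (fun b V f => @glued_homog T X I U trO (sgr X) b V f)
  _ _ _ (@glued_split T X I U trO (sgr X) trO_hom)).
- by move=> b V i; apply: (homog0 (sgr X)).
- by move=> b V f g hf hg i; apply: (homogB (g := sgr X)); [apply: hf | apply: hg].
- by move=> b V W h f hf i; apply: (homog_res (g := sgr X)); apply: hf.
Defined.

Definition glued_super : superSheaf R T.
Proof.
refine (@SuperSheaf R T glued_alg glued_grading _ _).
- by move=> a b V f g hf hg i; apply: Defs.sgrM; [apply: hf | apply: hg].
- by move=> V a i; apply: sgr_scal.
Defined.

Definition glued_ofwd i : homfam glued_super X (U i) := fun V h f => glued_fwd h f.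
Definition glued_obwd i : homfam X glued_super (U i) := fun V h s => glued_bwd trO h s.

Let ofwdM i V (h : V `<=` U i) (f g : glued_super V) :
  glued_ofwd h (f * g) = glued_ofwd h f * glued_ofwd h g.
Proof. exact: (rmorphM (alg_res X _)). Qed.

Let ofwd_scal i V (h : V `<=` U i) a : glued_ofwd h (scal glued_super V a) = scal X V a.
Proof. exact: (@scal_res _ _ X (opensI V (U i)) V (sub_opensI (@subset_refl _ V) h) a). Qed.

Let ofwd_hom i V (h : V `<=` U i) b (f : glued_super V) :
  homog (sgr glued_super) b f <-> homog (sgr X) b (glued_ofwd h f).
Proof.
split; first exact: glued_fwd_homog.
by move=> /(glued_bwd_homog trO_hom h); rewrite /glued_ofwd glued_fwdK.
Qed.

Let bwdD i V (h : V `<=` U i) s s' :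
  glued_obwd h (s + s') = glued_obwd h s + glued_obwd h s'.
Proof. by apply: (glued_fwd_inj (h := h)); rewrite glued_fwdD !glued_bwdK. Qed.

Let bwdM i V (h : V `<=` U i) (s s' : X V) :
  glued_obwd h (s * s') = glued_obwd h s * glued_obwd h s'.
Proof.
apply: (glued_fwd_inj (h := h)); rewrite glued_bwdK.
by rewrite -[RHS]/(glued_ofwd h (_ * _)) ofwdM /glued_ofwd !glued_bwdK.
Qed.

Let bwd_res i V W (hV : V `<=` U i) (hW : W `<=` U i) (h : W `<=` V) s :
  glued_obwd hW (alg_res X h s) = alg_res glued_super h (glued_obwd hV s).
Proof.
apply: (glued_fwd_inj (h := hW)); rewrite glued_bwdK.
by rewrite (glued_fwd_res hV hW h) glued_bwdK.
Qed.

(** The values of the cocycle induce the identity on F, so the reductions of matching members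
    agree. *)
Let red_ex V (f : glued trO V) :
  exists r : F V, forall i, ab_res F (@opensIl _ V (U i)) r = red X _ (sval f i).
Proof.
apply: (@ab_gluing _ F V I (fun i => opensI V (U i)) (fun i => @opensIl _ V (U i))
  (fun i => red X _ (sval f i))) => [x Vx|i j W hi hj]; first by have [i Ux] := covP c x; exists i.
rewrite -![ab_res F _ _]/(alg_res F _ _) -!alg_fun_res.
have hij : W `<=` opensI (U i) (U j).
  by apply: sub_opensI; [apply: subset_trans hi (@opensIr _ _ _) | apply: subset_trans hj
    (@opensIr _ _ _)].
rewrite -![alg_res X _ _]/(ab_res X _ _) (svalP f i j W hi hj hij).
exact: (sh_red (trP i j) hij).
Qed.

Definition glued_redf V (f : glued trO V) : F V := sval (cid (red_ex f)).

Let redfP V (f : glued trO V) i :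
  ab_res F (@opensIl _ V (U i)) (glued_redf f) = red X _ (sval f i).
Proof. by rewrite /glued_redf; case: cid. Qed.

Let redfE V (f : glued trO V) r :
  (forall i, ab_res F (@opensIl _ V (U i)) r = red X _ (sval f i)) -> glued_redf f = r.
Proof.
move=> hr; apply: (@ab_separated _ F) => x Vx; have [i Ux] := covP c x.
by exists (opensI V (U i)), (@opensIl _ V (U i)); split=> //; rewrite redfP hr.
Qed.

Let redfD V f g : @glued_redf V (f + g) = glued_redf f + glued_redf g.
Proof. by apply: redfE => i; rewrite raddfD !redfP -rmorphD. Qed.

Let redfM V (f g : glued_ring V) : @glued_redf V (f * g) = glued_redf f * glued_redf g.
Proof.
by apply: redfE => i; rewrite -[ab_res F _ _]/(alg_res F _ _) rmorphM
  -![alg_res F _ _]/(ab_res F _ _) !redfP -rmorphM.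
Qed.

Let redf_scal V a : glued_redf (glued_const V a) = scal F V a.
Proof.
apply: redfE => i; rewrite -[ab_res F _ _]/(alg_res F _ _) scal_res.
exact: (esym (alg_fun_scal (red X) _ a)).
Qed.

Let redf1 V : @glued_redf V (1 : glued_ring V) = 1.
Proof. by rewrite -[1 in LHS]/(glued_const V 1) redf_scal rmorph1. Qed.

Definition glued_red : algHom glued_super F.
Proof.
refine (@AlgHom R T glued_super F (fun V => @rmorphism_of (glued_ring V) (F V) (@glued_redf V)
  (@redfD V) (@redfM V) (@redf1 V)) _ redf_scal).
move=> V W h f; apply: redfE => i /=; rewrite -[ab_res X _ _]/(alg_res X _ _) alg_fun_res -redfP.
rewrite -![ab_res F _ _]/(alg_res F _ _) (res_comp _ _ (subset_trans (@opensIl _ W (U i)) h)).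
by rewrite (res_comp _ _ (subset_trans (@opensIl _ W (U i)) h)).
Defined.

Let red_fwd i V (h : V `<=` U i) (f : glued_super V) :
  red X V (glued_ofwd h f) = glued_red V f.
Proof.
rewrite /glued_ofwd /glued_fwd -[ab_res X _ _]/(alg_res X _ _) alg_fun_res -redfP.
rewrite -[ab_res F _ _]/(alg_res F _ _) (res_comp _ _ (@subset_refl _ V)).
exact: (alg_res_id (@subset_refl _ V) (glued_redf f)).
Qed.

Let bwd_sum i V (h : V `<=` U i) k (s : 'I_k -> X V) :
  glued_obwd h (\sum_j s j) = \sum_j glued_obwd h (s j) :> glued_super V.
Proof.
apply: (big_morph (glued_obwd h)); first exact: bwdD.
by apply: (addrI (glued_obwd h 0)); rewrite -bwdD !addr0.
Qed.

(** A section with reduction 0 is carried to [X], where it lies in J, and the local expressions in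
    odd sections are carried back. Conversely the members of an odd section are odd, so they have
    reduction 0. *)
Lemma glued_red_eq0 V (f : glued_super V) : glued_red V f = 0 <-> Jideal f.
Proof.
split=> [f0|Jf].
  move=> x Vx; have [i Ux] := covP c x; pose W0 := opensI (U i) V.
  have h0 : W0 `<=` U i := @opensIl _ (U i) V; have k0 : W0 `<=` V := @opensIr _ (U i) V.
  have : Jideal (glued_ofwd h0 (alg_res glued_super k0 f)).
    by apply/red_eq0; rewrite red_fwd alg_fun_res f0 rmorph0.
  move=> /(_ x (conj Ux Vx)) [W [k [Wx [r [a [b [d [hb e]]]]]]]].
  have hW := subset_trans k h0.
  exists W, (subset_trans k k0); split=> //.
  exists r, (fun j => glued_obwd hW (a j)), (fun j => glued_obwd hW (b j)),
    (fun j => glued_obwd hW (d j)); split=> [j|].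
    exact: (glued_bwd_homog trO_hom hW (hb j)).
  transitivity (glued_obwd hW (\sum_j a j * b j * d j)); last first.
    by rewrite bwd_sum; apply: eq_bigr => j _; rewrite !bwdM.
  rewrite -e; apply: (glued_fwd_inj (h := hW)); rewrite glued_bwdK.
  rewrite -(glued_fwd_res h0 hW k); congr glued_fwd.
  by apply: (esym (glued_res_comp k0 k (subset_trans k k0) f)).
apply: (@ab_separated _ F) => x /Jf [W [k [Wx [r [a [b [d [hb e]]]]]]]].
exists W, k; split=> //; rewrite raddf0 -[LHS]/(alg_res F k _) -alg_fun_res.
rewrite [alg_res glued_super k f]e rmorph_sum big1 // => j _; rewrite !rmorphM.
suff -> : glued_red W (b j) = 0 by rewrite mulr0 mul0r.
apply: redfE => i; rewrite raddf0; apply/esym/red_eq0/Jideal_odd; exact: hb.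
Qed.

Lemma glued_red_quotient : quotient_iso (X := glued_super) (Y := F)
    (fun _ _ => True) (@Jideal R T glued_super) (fun _ _ => True) (fun V => glued_red V).
Proof.
split=> //.
- by move=> V s t _ _; apply: rmorphD.
- by move=> V W h s _; apply: alg_fun_res.
- by move=> V s _; apply: glued_red_eq0.
move=> V r _ x Vx; have [i Ux] := covP c x; pose W0 := opensI (U i) V.
have k0 : W0 `<=` V := @opensIr _ (U i) V.
have [W [k [Wx [s _ es]]]] := quo_onto (red_quotient X) (t := alg_res F k0 r) Logic.I (conj Ux Vx).
have hW := subset_trans k (@opensIl _ (U i) V).
exists W, (subset_trans k k0); split=> //; exists (glued_obwd hW s) => //.
by rewrite -(red_fwd hW) /glued_ofwd glued_bwdK es; apply: (ab_res_comp (a:=F)).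
Qed.

Lemma glued_charts x : exists V : opens T,
  oset V x /\ inhabited (superchart glued_super n m V).
Proof.
have [i Ux] := covP c x; have [V [Vx [ch]]] := sm_charts X x.
exists (opensI (U i) V); split=> //; split.
pose hU W (h : W `<=` opensI (U i) V) : W `<=` U i := subset_trans h (@opensIl _ (U i) V).
apply: (@superchart_transport R T X glued_super n m V _ ch (@opensIr _ (U i) V)
  (fun W h => @glued_ofwd i W (hU W h)) (fun W h => @glued_obwd i W (hU W h))).
- by move=> W h; apply: glued_fwdK.
- by move=> W h; apply: glued_bwdK.
- by move=> W h; apply: glued_fwdD.
- by move=> W h; apply: ofwdM.
- by move=> W h; apply: ofwd_scal.
- by move=> W W' hW hW' h s; apply: glued_fwd_res.
- by move=> W h b s; apply: ofwd_hom.
Qed.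

Definition glued_manifold : supermanifold F n m :=
  Supermanifold glued_red_quotient glued_charts.

Definition glued_scale V (f : glued_ring V) (v : glued trE V) : glued trE V.
Proof.
exists (fun i => (sval f i : X _) *: sval v i) => i j W ki kj kij.
rewrite -[LHS]/(mod_res E ki _) -[ab_res E kj _]/(mod_res E kj _) !mod_res_scale.
rewrite -![alg_res X _ _]/(ab_res X _ _) -![mod_res E _ _]/(ab_res E _ _).
rewrite (svalP f i j W ki kj kij) (svalP v i j W ki kj kij).
exact: (esym (qhZ (qfwdP (ca i j)) kij _ _)).
Defined.

Let glued_scaleA V (a b : glued_ring V) v :
  glued_scale a (glued_scale b v) = glued_scale (a * b) v.
Proof. by apply: glued_eq => i; exact: scalerA. Qed.
Let glued_scale1 V : left_id (1 : glued_ring V) (@glued_scale V).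
Proof. by move=> v; apply: glued_eq => i /=; rewrite rmorph1 scale1r. Qed.
Let glued_scaleDr V : right_distributive (@glued_scale V) +%R.
Proof. by move=> a v w; apply: glued_eq => i; exact: scalerDr. Qed.
Let glued_scaleDl V v : {morph (@glued_scale V)^~ v : a b / a + b}.
Proof. by move=> a b; apply: glued_eq => i; exact: scalerDl. Qed.

Definition glued_lmod V : lmodType (glued_ring V) :=
  HB.pack_for (lmodType (glued_ring V)) (glued trE V)
    (GRing.Zmodule_isLmodule.Build (glued_ring V) (glued trE V) (@glued_scaleA V)
       (@glued_scale1 V) (@glued_scaleDr V) (@glued_scaleDl V)).

Definition glued_modsheaf : modSheaf glued_alg.
Proof.
refine (@ModSheaf R T glued_alg glued_lmod
  (fun V W h => @additive_of (glued_lmod V) (glued_lmod W) (@glued_res _ _ _ _ trE V W h)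
    (glued_resD h))
  _ (@glued_res_id _ _ _ _ trE) (@glued_res_comp _ _ _ _ trE) (@glued_sheaf _ _ _ _ trE)).
by move=> V W h a v; apply: glued_eq => i; exact: (mod_res_scale (opensIS (U := U i) h)).
Defined.

Definition glued_mod_grading : grading glued_modsheaf.
Proof.
refine (@Grading T glued_modsheaf (fun b V f => @glued_homog T E I U trE (mgr E) b V f)
  _ _ _ (@glued_split T E I U trE (mgr E) trE_hom)).
- by move=> b V i; apply: (homog0 (mgr E)).
- by move=> b V f g hf hg i; apply: (homogB (g := mgr E)); [apply: hf | apply: hg].
- by move=> b V W h f hf i; apply: (homog_res (g := mgr E)); apply: hf.
Defined.

Definition glued_supermod : superMod glued_manifold.
Proof.
refine (@SuperMod R T glued_manifold glued_modsheaf glued_mod_grading _).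
by move=> a b V f v hf hv i; apply: mgrZ; [apply: hf | apply: hv].
Defined.

Definition glued_siso i : siso glued_manifold X (U i).
Proof.
exists (glued_ofwd (i := i)) (glued_obwd (i := i)).
- split.
  + by move=> V h; apply: glued_fwdD.
  + by move=> V h; apply: ofwdM.
  + by move=> V h; apply: ofwd_scal.
  + by move=> V W hV hW h s; apply: glued_fwd_res.
  + by move=> V h b s /ofwd_hom; apply.
  + by move=> V h; apply: red_fwd.
- split.
  + by move=> V h; apply: bwdD.
  + by move=> V h; apply: bwdM.
  + by move=> V h a; apply: (glued_fwd_inj (h := h)); rewrite glued_bwdK; apply/esym/ofwd_scal.
  + by move=> V W hV hW h s; apply: bwd_res.
  + by move=> V h b s hs; apply: (glued_bwd_homog trO_hom).
  + by move=> V h s; rewrite -[red glued_manifold]/glued_red -(red_fwd h) /glued_ofwd glued_bwdK.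
- by move=> V h; apply: glued_fwdK.
- by move=> V h; apply: glued_bwdK.
Defined.

Definition glued_qiso i : qiso glued_supermod E (U i).
Proof.
exists (glued_siso i) (fun V h v => glued_fwd h v) (fun V h v => glued_bwd trE h v).
- split.
  + by move=> V h; apply: glued_fwdD.
  + by move=> V h f v; exact: (mod_res_scale (sub_opensI (@subset_refl _ V) h)).
  + by move=> V W hV hW h v; apply: glued_fwd_res.
  + by move=> V h b v hv; apply: (glued_fwd_homog (g := mgr E)).
- split.
  + by move=> V h v w; apply: (glued_fwd_inj (h := h)); rewrite glued_fwdD !glued_bwdK.
  + move=> V h f v; apply: (glued_fwd_inj (h := h)); rewrite glued_bwdK.
    transitivity (glued_ofwd h (glued_obwd h f) *: glued_fwd h (glued_bwd trE h v)).
      by rewrite /glued_ofwd !glued_bwdK.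
    by apply: esym; exact: (mod_res_scale (sub_opensI (@subset_refl _ V) h)).
  + move=> V W hV hW h s; apply: (glued_fwd_inj (h := hW)); rewrite glued_bwdK.
    by rewrite (glued_fwd_res hV hW h) glued_bwdK.
  + by move=> V h b s hs; apply: (glued_bwd_homog trE_hom).
- by move=> V h; apply: glued_fwdK.
- by move=> V h; apply: glued_bwdK.
Defined.

Lemma glued_qiso_cval i j V (hi : V `<=` U i) (hj : V `<=` U j)
    (hij : V `<=` opensI (U i) (U j)) :
  (forall f : glued_manifold V, sfwd (qbase (glued_qiso i)) hi f =
     sfwd (qbase (cval c i j : qaut E _)) hij (sfwd (qbase (glued_qiso j)) hj f)) /\
  (forall v : glued_supermod V, qfwd (glued_qiso i) hi v =
     qfwd (cval c i j : qaut E _) hij (qfwd (glued_qiso j) hj v)).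
Proof. by split=> f; [apply: (glued_fwd_tr hi hj hij) | apply: (glued_fwd_tr hi hj hij)]. Qed.
End GluedManifold.

(** * Local freeness under quasi-isomorphisms *)

Section LocallyFree.
Variables (R : realType) (T : topologicalType) (F : algSheaf R T) (n m : nat).
Implicit Types U V W : opens T.

Lemma qiso_basis (Y X : supermanifold F n m) (B : superMod Y) (E : superMod X) U
    (a : qiso B E U) r (t : 'I_r -> E U) :
  is_basis t -> is_basis (fun i => qbwd a (@subset_refl _ U) (t i)).
Proof.
move=> tP; have aP := qfwdP a; have bP := qbwdP a.
have E1 V (h : V `<=` U) (c : 'I_r -> X V) :
    bsum (fun i => qbwd a (@subset_refl _ U) (t i)) h (fun i => sbwd (qbase a) h (c i)) =
    qbwd a h (bsum t h c).
  rewrite /bsum (qh_sum bP); apply: eq_bigr => i _.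
  by rewrite (qhZ bP) (qh_res bP (@subset_refl _ U)).
apply: is_basisI => [V h v|V h c c0 i].
  by exists (fun i => sbwd (qbase a) h (bcoord tP h (qfwd a h v) i)); rewrite E1 bcoordK qfwdK.
have e : c = fun i => sbwd (qbase a) h (sfwd (qbase a) h (c i)).
  by apply: funext => j; rewrite sfwdK.
move: c0; rewrite e E1 => /(congr1 (qfwd a h)); rewrite qbwdK (qh0 aP) => c0.
suff -> : sfwd (qbase a) h (c i) = 0 by rewrite (sh0 (sbwdP (qbase a))).
have := congr1 (fun v => bcoord tP h v i) c0; rewrite bcoord_bsum => ->.
by rewrite -[X in bcoord _ _ X](_ : bsum t h (fun=> 0) = 0) ?bcoord_bsum //;
  apply: big1 => j _; rewrite scale0r.
Qed.

Lemma qiso_locally_free (Y X : supermanifold F n m) (B : superMod Y) (E : superMod X) p q :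
  (forall x, exists U, oset U x /\ inhabited (qiso B E U)) ->
  locally_free_of_superrank E p q -> locally_free_of_superrank B p q.
Proof.
move=> iso Elf x; have [U [Ux [a]]] := iso x; have [V [t [Vx tP t_hom]]] := Elf x.
pose W := opensI U V; pose b := qiso_res (@opensIl _ U V) a.
exists W, (fun i => qbwd b (@subset_refl _ W) (mod_res E (@opensIr _ U V) (t i))); split=> //.
  exact: (qiso_basis b (basis_res tP (@opensIr _ U V))).
move=> i; apply: (qh_hom (qbwdP b)); exact: (homog_res (g := mgr E) _ (t_hom i)).
Qed.

Lemma tensor_locally_free (X : supermanifold F n m) (G : modSheaf F)
    (hG : locally_free_of_rank G m) (spl : split_structure X G) (p q : nat)
    (S : superMod (purely_even F)) (hS : locally_free_of_superrank S p q)
    (E : superMod X) (tens : tensor_structure spl S E) : locally_free_of_superrank E p q.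
Proof.
move=> x; have [U [e [s [Ux eP sP [fr hs]]]]] := tensor_frame hG spl hS x.
exists U, (tensor_basis tens s); split=> //; first exact: tensor_basisP.
exact: tensor_basis_homog.
Qed.

Lemma glued_bundle_ex (X : supermanifold F n m) (E : superMod X) (c : cocycle (QAut_mod E 1 2)) :
  locally_free E -> exists x, glued_bundle c x.
Proof.
move=> [p [q Elf]].
have lf : locally_free (glued_supermod c).
  exists p, q; apply: qiso_locally_free Elf => x; have [i Ux] := covP c x.
  by exists (cov c i); split=> //; split; exact: glued_qiso.
exists (SuperBundle lf), (fun i => @glued_qiso _ _ _ _ _ _ _ c i) => i j V hi hj hij.
exact: (glued_qiso_cval hi hj hij).
Qed.
End LocallyFree.

(** * The retract of a glued bundle *)

Section TransportedSymbol.
Variables (T : topologicalType) (Y X : abSheaf T) (I : Type) (U : I -> opens T).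
Hypothesis covU : forall x, exists i, oset (U i) x.
Variable s : forall i, homfam Y X (U i).
Implicit Types V W : opens T.
Hypothesis sD : forall i V (h : V `<=` U i) f g, s h (f + g) = s h f + s h g.
Hypothesis s_res : forall i V W (hV : V `<=` U i) (hW : W `<=` U i) (h : W `<=` V) f,
  s hW (ab_res Y h f) = ab_res X h (s hV f).
Variables (A A' : subsheaf Y) (D : subsheaf X) (L : forall V, X V -> X V -> Prop).
Hypothesis A_res : forall V W (h : W `<=` V) f, A f -> A (ab_res Y h f).
Hypothesis AD : forall V (f g : Y V), A f -> A g -> A (f + g).
Hypothesis A'_res : forall V W (h : W `<=` V) f, A' f -> A' (ab_res Y h f).
Hypothesis A'_local : forall V (f : Y V), (forall x, oset V x -> exists W (h : W `<=` V),
  oset W x /\ A' (ab_res Y h f)) -> A' f.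
Hypothesis D_res : forall V W (h : W `<=` V) t, D t -> D (ab_res X h t).
Hypothesis D_local : forall V (t : X V), (forall x, oset V x -> exists W (h : W `<=` V),
  oset W x /\ D (ab_res X h t)) -> D t.
Hypothesis L_res : forall V W (h : W `<=` V) f t, L f t -> L (ab_res X h f) (ab_res X h t).
Hypothesis L_local : forall V (f t : X V), (forall x, oset V x -> exists W (h : W `<=` V),
  oset W x /\ L (ab_res X h f) (ab_res X h t)) -> L f t.
Hypothesis L_unique : forall V (f t t' : X V), L f t -> L f t' -> t = t'.
Hypothesis LD : forall V (f g t t' : X V), L f t -> L g t' -> L (f + g) (t + t').
Hypothesis L_into : forall V (f t : X V), L f t -> D t.
Hypothesis L_ex : forall i V (h : V `<=` U i) f, A f -> exists t, L (s h f) t.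
Hypothesis L_ker : forall i V (h : V `<=` U i) f, L (s h f) 0 <-> A' f.
Hypothesis L_onto : forall i V (h : V `<=` U i) t, D t -> exists2 f, A f & L (s h f) t.
Hypothesis L_agree : forall i j V (hi : V `<=` U i) (hj : V `<=` U j) f t,
  A f -> L (s hi f) t -> L (s hj f) t.

(* L f t means that t is the symbol of f. The symbol of a section f of Y is computed
   through any of the s i, independently of i by L_agree. *)
Let P V f W (_ : W `<=` V) (t : X W) := forall i W' (k : W' `<=` W) (kV : W' `<=` V)
  (hi : W' `<=` U i), L (s hi (ab_res Y kV f)) (ab_res X k t).

Let P_unique V f W hW t t' : @P V f W hW t -> @P V f W hW t' -> t = t'.
Proof.
move=> ht ht'; apply: ab_separated => x Wx; have [i Ux] := covU x.
have kV := subset_trans (@opensIr _ (U i) W) hW.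
exists (opensI (U i) W), (@opensIr _ (U i) W); split=> //.
by apply: L_unique (ht i _ _ kV (@opensIl _ (U i) W)) (ht' i _ _ kV (@opensIl _ (U i) W)).
Qed.

Let P_ex V f : A f -> exists t, @P V f V (@subset_refl _ V) t.
Proof.
move=> Af; have [|||t ht] := @ab_glue_unique _ X V (@P V f).
- move=> W W' hW hW' k t ht i W'' k' kV hi.
  by rewrite (ab_res_comp _ _ (subset_trans k' k)); apply: ht.
- by move=> W hW t t'; apply: P_unique.
- move=> x Vx; have [i Ux] := covU x; have k := @opensIr _ (U i) V.
  have [t ht] := L_ex (@opensIl _ (U i) V) (A_res k Af).
  exists (opensI (U i) V), k, t; split=> // j W' k' kV hj.
  have hi := subset_trans k' (@opensIl _ (U i) V).
  apply: (L_agree (hi := hi) hj (A_res kV Af)).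
  rewrite -(ab_res_comp k k') (s_res (@opensIl _ (U i) V)); exact: L_res.
exists t => i W k kV hi; apply: L_local => x Wx.
have [W' [hW' [Wx' hP]]] := ht x (k x Wx).
have k2 := @opensIr _ W' W; exists (opensI W' W), k2; split=> //.
have := hP i _ (@opensIl _ W' W) (subset_trans k2 kV) (subset_trans k2 hi).
by rewrite (ab_res_comp _ _ (subset_trans k2 k)) (ab_res_comp _ _ (subset_trans k2 k))
  -(s_res hi (subset_trans k2 hi)) (ab_res_comp _ _ (subset_trans k2 kV)).
Qed.

(** Formulated for abelian sheaves with an abstract relation [L], so as to serve both the structure
    sheaf and the bundle, in every degree. All clauses follow from the uniqueness of the symbol and
    its local computation. *)
Lemma transported_symbol : exists sym : forall V, Y V -> X V,
  quotient_iso A A' D sym /\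
  forall V f, A f -> forall i W (k : W `<=` V) (h : W `<=` U i),
    L (s h (ab_res Y k f)) (ab_res X k (sym V f)).
Proof.
have ex V f : exists t, A f -> @P V f V (@subset_refl _ V) t.
  have [/P_ex [t ht]|] := pselect (A f); first by exists t.
  (* Outside [A] there is no symbol; 0 is a default value. *)
  by exists 0.
pose sym V f := sval (cid (ex V f)).
have symP V f : A f -> @P V f V (@subset_refl _ V) (sym V f).
  by rewrite /sym; case: cid.
have symE V f t : A f -> @P V f V (@subset_refl _ V) t -> sym V f = t.
  by move=> Af; apply: P_unique; apply: symP.
exists sym; split; last by move=> V f Af i W k h; apply: symP.
split.
- move=> V f Af; apply: D_local => x Vx; have [i Ux] := covU x.
  have k := @opensIr _ (U i) V; exists (opensI (U i) V), k; split=> //.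
  exact: L_into (symP V f Af i _ k k (@opensIl _ (U i) V)).
- move=> V f g Af Ag; apply: symE => [|i W k kV h]; first exact: AD.
  by rewrite !raddfD sD; apply: LD; apply: symP.
- move=> V W h f Af; apply: symE => [|i W' k kV hi]; first exact: A_res.
  rewrite (ab_res_comp _ _ (subset_trans k h)) (ab_res_comp _ _ (subset_trans k h)).
  exact: symP.
- move=> V f Af; split=> [f0|A'f].
    apply: A'_local => x Vx; have [i Ux] := covU x.
    have k := @opensIr _ (U i) V; exists (opensI (U i) V), k; split=> //.
    apply/(L_ker (@opensIl _ (U i) V)).
    by have := symP V f Af i _ k k (@opensIl _ (U i) V); rewrite f0 raddf0.
  apply: symE => // i W k kV hi; rewrite raddf0; apply/L_ker; exact: A'_res.
move=> V t Dt x Vx; have [i Ux] := covU x; have k := @opensIr _ (U i) V.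
exists (opensI (U i) V), k; split=> //.
have [f Af Lf] := L_onto (@opensIl _ (U i) V) (D_res k Dt).
exists f => //; apply: symE => // j W k' kV hj.
have hi := subset_trans k' (@opensIl _ (U i) V).
apply: (L_agree (hi := hi) hj (A_res kV Af)); rewrite (Prop_irrelevance kV k').
by rewrite (s_res (@opensIl _ (U i) V)); apply: L_res.
Qed.
End TransportedSymbol.

Section GluedRetract.
Variables (R : realType) (T : topologicalType) (F : algSheaf R T) (n m : nat).
Variables (X : supermanifold F n m) (G : modSheaf F) (hG : locally_free_of_rank G m).
Variable spl : split_structure X G.
Variables (S : superMod (purely_even F)) (p0 q0 : nat).
Variable (hS : locally_free_of_superrank S p0 q0).
Variables (E : superMod X) (tens : tensor_structure spl S E).
Implicit Types U V W : opens T.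

Lemma Olead_Jpow p U (f t : X U) : Olead spl p f t -> Jpow p f.
Proof.
move=> [ht hf]; rewrite -[f](subrK t); apply: JpowD; first exact: Jpow_S.
exact: (Odeg_Jpow hG ht).
Qed.

Lemma OleadD p U (f g t u : X U) :
  Olead spl p f t -> Olead spl p g u -> Olead spl p (f + g) (t + u).
Proof.
by move=> [ht hf] [hu hg]; split; [apply: OdegD | rewrite opprD addrACA; apply: JpowD].
Qed.

Lemma OleadM p q U (f g t u : X U) :
  Olead spl p f t -> Olead spl q g u -> Olead spl (p + q) (f * g) (t * u).
Proof.
move=> ft gu; have Jf := Olead_Jpow ft; have [[ht hf] [hu hg]] := (ft, gu).
split; first exact: OdegM.
have -> : f * g - t * u = f * (g - u) + (f - t) * u by rewrite mulrBr mulrBl addrA subrK.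
apply: JpowD; first by rewrite -addnS; apply: JpowM.
by rewrite -addSn; apply: JpowM => //; apply: (Odeg_Jpow hG hu).
Qed.

Lemma EleadD p U (f g t u : E U) :
  Elead tens p f t -> Elead tens p g u -> Elead tens p (f + g) (t + u).
Proof.
by move=> [ht hf] [hu hg]; split; [apply: EdegD | rewrite opprD addrACA; apply: EpowD].
Qed.

Lemma EleadZ p q U (f t : X U) (v u : E U) :
  Olead spl p f t -> Elead tens q v u -> Elead tens (p + q) (f *: v) (t *: u).
Proof.
move=> ft vu; have Jf := Olead_Jpow ft; have [[ht hf] [hu hv]] := (ft, vu).
split; first exact: (EdegZ hG hS).
have -> : f *: v - t *: u = f *: (v - u) + (f - t) *: u.
  by rewrite scalerBr scalerBl addrA subrK.
apply: EpowD; first by rewrite -addnS; apply: EpowZ.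
by rewrite -addSn; apply: EpowZ => //; apply: (Edeg_Epow hG hS hu).
Qed.

Variables (x : superBundle F n m) (c : cocycle (QAut_mod E 1 2)).
Variable s : forall i, qiso (bundle x) E (cov c i).
Hypothesis s_tr : forall i j V (hi : V `<=` cov c i) (hj : V `<=` cov c j)
  (hij : V `<=` opensI (cov c i) (cov c j)),
  (forall f : base_sm x V, sfwd (qbase (s i)) hi f =
     sfwd (qbase (cval c i j : qaut E _)) hij (sfwd (qbase (s j)) hj f)) /\
  (forall v : bundle x V, qfwd (s i) hi v =
     qfwd (cval c i j : qaut E _) hij (qfwd (s j) hj v)).

Let trP i j := sfwdP (qbase (cval c i j : qaut E _)).

Let tr_shift i j p V (h : V `<=` opensI (cov c i) (cov c j)) (f : X V) :
  Jpow p f -> Jpow p.+1 (sfwd (qbase (cval c i j : qaut E _)) h f - f).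
Proof.
have [_ H] := @cval_mem _ _ _ c i j.
exact: (superhom_congr_shift (trP i j) (sfwdP (siso_id X _)) H).
Qed.

Let trE_shift i j p V (h : V `<=` opensI (cov c i) (cov c j)) (v : E V) :
  Epow p v -> Epow p.+1 (qfwd (cval c i j : qaut E _) h v - v).
Proof.
have [H' H] := @cval_mem _ _ _ c i j.
exact: (quasihom_congr_shift (trP i j) (sfwdP (siso_id X _)) (qfwdP _) (qfwdP (qiso_id E _)) H H').
Qed.

Let sO i : homfam (base_sm x) X (cov c i) := sfwd (qbase (s i)).
Let sE i : homfam (bundle x) E (cov c i) := qfwd (s i).

Let sP i := sfwdP (qbase (s i)).
Let sbP i := sbwdP (qbase (s i)).

Let O_ex p : exists sym : forall V, base_sm x V -> X V,
  quotient_iso (X := base_sm x) (Y := X) (@Jpow _ _ (base_sm x) p) (@Jpow _ _ (base_sm x) p.+1)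
    (Odeg spl p) sym /\
  forall V f, Jpow p f -> forall i W (k : W `<=` V) (h : W `<=` cov c i),
    Olead spl p (sO h (ab_res (base_sm x) k f)) (ab_res X k (sym V f)).
Proof.
apply: (@transported_symbol T (base_sm x) X _ (cov c) (@covP _ _ _ c) sO
  (fun i => shD (sP i)) (fun i => sh_res (sP i))
  (@Jpow _ _ (base_sm x) p) (@Jpow _ _ (base_sm x) p.+1) (Odeg spl p) (Olead spl p)).
- by move=> V W h f; apply: Jpow_res.
- by move=> V f g; apply: JpowD.
- by move=> V W h f; apply: Jpow_res.
- by move=> V f; apply: Jpow_local.
- by move=> V W h t; apply: Odeg_res.
- by move=> V t; apply: Odeg_local.
- by move=> V W h f t; apply: Olead_res.
- by move=> V f t; apply: Olead_local.
- by move=> V f t t'; apply: Olead_unique.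
- by move=> V f g t t'; apply: OleadD.
- by move=> V f t [].
- by move=> i V h f Jf; apply: (Olead_ex hG); apply: (superhom_Jpow (sP i)).
- move=> i V h f; split=> [[_]|Jf].
    by rewrite subr0 => /(superhom_Jpow (sbP i)) -/(_ h); rewrite sfwdK.
  by split; [apply: Odeg0 | rewrite subr0; apply: (superhom_Jpow (sP i))].
- move=> i V h t ht; exists (sbwd (qbase (s i)) h t).
    by apply: (superhom_Jpow (sbP i)); apply: Odeg_Jpow ht.
  by rewrite /sO sbwdK; split=> //; rewrite subrr; apply: Jpow0.
move=> i j V hi hj f t Jf [ht ft]; split=> //.
have hij : V `<=` opensI (cov c i) (cov c j) by apply: sub_opensI.
(* The two trivializations differ by a value of the cocycle, and such a value changes a section of
   J^p only by a section of J^(p+1). *)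
have -> : sO hj f - t = (sO hi f - t) - (sO hi f - sO hj f) by rewrite opprB [RHS]addrC addrA subrK.
apply: JpowB => //; rewrite {1}/sO (s_tr hi hj hij).1; apply: tr_shift.
exact: (superhom_Jpow (sP j)).
Qed.

Let E_ex p : exists sym : forall V, bundle x V -> E V,
  quotient_iso (X := bundle x) (Y := E) (@Epow _ _ _ (bundle x) p) (@Epow _ _ _ (bundle x) p.+1)
    (Edeg tens p) sym /\
  forall V f, Epow p f -> forall i W (k : W `<=` V) (h : W `<=` cov c i),
    Elead tens p (sE h (ab_res (bundle x) k f)) (ab_res E k (sym V f)).
Proof.
apply: (@transported_symbol T (bundle x) E _ (cov c) (@covP _ _ _ c) sE
  (fun i => qhD (qfwdP (s i))) (fun i => qh_res (qfwdP (s i)))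
  (@Epow _ _ _ (bundle x) p) (@Epow _ _ _ (bundle x) p.+1) (Edeg tens p) (Elead tens p)).
- by move=> V W h f; apply: Epow_res.
- by move=> V f g; apply: EpowD.
- by move=> V W h f; apply: Epow_res.
- by move=> V f; apply: Epow_local.
- by move=> V W h t; apply: Edeg_res.
- by move=> V t; apply: Edeg_local.
- by move=> V W h f t; apply: Elead_res.
- by move=> V f t; apply: Elead_local.
- by move=> V f t t'; apply: (Elead_unique hG hS).
- by move=> V f g t t'; apply: EleadD.
- by move=> V f t [].
- by move=> i V h f Jf; apply: (Elead_ex hG hS); apply: (quasihom_Epow (sP i) (qfwdP (s i))).
- move=> i V h f; split=> [[_]|Jf].
    by rewrite subr0 => /(quasihom_Epow (sbP i) (qbwdP (s i))) -/(_ h); rewrite qfwdK.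
  by split; [apply: Edeg0 | rewrite subr0; apply: (quasihom_Epow (sP i) (qfwdP (s i)))].
- move=> i V h t ht; exists (qbwd (s i) h t).
    by apply: (quasihom_Epow (sbP i) (qbwdP (s i))); apply: (Edeg_Epow hG hS ht).
  by rewrite /sE qbwdK; split=> //; rewrite subrr; apply: Epow0.
move=> i j V hi hj f t Jf [ht ft]; split=> //.
have hij : V `<=` opensI (cov c i) (cov c j) by apply: sub_opensI.
have -> : sE hj f - t = (sE hi f - t) - (sE hi f - sE hj f) by rewrite opprB [RHS]addrC addrA subrK.
apply: EpowB => //; rewrite {1}/sE (s_tr hi hj hij).2; apply: trE_shift.
exact: (quasihom_Epow (sP j) (qfwdP (s j))).
Qed.

Lemma glued_retract : has_retract tens x.
Proof.
pose sym p := sval (cid (O_ex p)); pose symE p := sval (cid (E_ex p)).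
have symP p : quotient_iso (X := base_sm x) (Y := X) (@Jpow _ _ (base_sm x) p)
    (@Jpow _ _ (base_sm x) p.+1) (Odeg spl p) (sym p) by rewrite /sym; case: cid => ? [].
have symEP p : quotient_iso (X := bundle x) (Y := E) (@Epow _ _ _ (bundle x) p)
    (@Epow _ _ _ (bundle x) p.+1) (Edeg tens p) (symE p) by rewrite /symE; case: cid => ? [].
have symL p V f : Jpow p f -> forall i W (k : W `<=` V) (h : W `<=` cov c i),
    Olead spl p (sO h (ab_res (base_sm x) k f)) (ab_res X k (sym p V f)).
  by rewrite /sym; case: cid => ? [? H]; apply: H.
have symEL p V f : Epow p f -> forall i W (k : W `<=` V) (h : W `<=` cov c i),
    Elead tens p (sE h (ab_res (bundle x) k f)) (ab_res E k (symE p V f)).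
  by rewrite /symE; case: cid => ? [? H]; apply: H.
exists sym, symE; split=> //.
- move=> p q V f g Jf Jg; apply: (@ab_separated _ X) => y Vy; have [i Uy] := covP c y.
  have k := @opensIr _ (cov c i) V; have h := @opensIl _ (cov c i) V.
  exists (opensI (cov c i) V), k; split=> //.
  apply: (Olead_unique hG (symL _ V (f * g) (JpowM Jf Jg) i _ k h)).
  rewrite -![ab_res _ k _]/(alg_res _ k _) !rmorphM /sO (shM (sP i)).
  by apply: OleadM; apply: symL.
- move=> p b V f Jf hf; apply: (homog_local (g := sgr X)) => y Vy; have [i Uy] := covP c y.
  have k := @opensIr _ (cov c i) V; have h := @opensIl _ (cov c i) V.
  exists (opensI (cov c i) V), k; split=> //.
  apply: (Olead_homog hG _ (symL p V f Jf i _ k h)).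
  by apply: (sh_hom (sP i)); apply: (homog_res k hf).
- move=> V f; apply: (@ab_separated _ F) => y Vy; have [i Uy] := covP c y.
  have k := @opensIr _ (cov c i) V; have h := @opensIl _ (cov c i) V.
  exists (opensI (cov c i) V), k; split=> //.
  rewrite -![ab_res F _ _]/(alg_res F k _) -!alg_fun_res.
  have L := symL 0%N V f Logic.I i _ k h.
  rewrite -[alg_res X k _]/(ab_res X k _) (Olead_unique hG L (Olead0 spl _)) incF_red.
  exact: (sh_red (sP i)).
- move=> p q V f v Jf Ev; apply: (@ab_separated _ E) => y Vy; have [i Uy] := covP c y.
  have k := @opensIr _ (cov c i) V; have h := @opensIl _ (cov c i) V.
  exists (opensI (cov c i) V), k; split=> //.
  apply: (Elead_unique hG hS (symEL _ V (f *: v) (EpowZ Jf Ev) i _ k h)).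
  rewrite -[ab_res E k _]/(mod_res E k _) -[ab_res (bundle x) k _]/(mod_res (bundle x) k _)
    !mod_res_scale /sE (qhZ (qfwdP (s i))).
  by apply: EleadZ; [apply: symL | apply: symEL].
- move=> p b V f Jf hf; apply: (homog_local (g := mgr E)) => y Vy; have [i Uy] := covP c y.
  have k := @opensIr _ (cov c i) V; have h := @opensIl _ (cov c i) V.
  exists (opensI (cov c i) V), k; split=> //.
  apply: (Elead_homog hG hS _ (symEL p V f Jf i _ k h)).
  by apply: (qh_hom (qfwdP (s i))); apply: (homog_res (g := mgr (bundle x)) k hf).
Qed.
End GluedRetract.

(** * Trivializations from a retract *)

(** Generators can be lifted through the symbol maps only locally. As there are finitely many of
    them, a common neighbourhood exists. *)
Lemma finite_nbhs (T : topologicalType) (x : T) (k : nat) (P : 'I_k -> opens T -> Prop) :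
  (forall i, exists V : opens T, oset V x /\ P i V) ->
  (forall i (V W : opens T), W `<=` V -> P i V -> P i W) ->
  exists V : opens T, oset V x /\ forall i, P i V.
Proof.
move=> ex mono; suff [V [Vx H]] : exists V : opens T, oset V x /\ {in enum 'I_k, forall i, P i V}.
  by exists V; split=> // i; apply: H; rewrite mem_enum.
elim: (enum 'I_k) => [|i w [V [Vx H]]]; first by exists (opensT T).
have [W [Wx Pi]] := ex i; exists (opensI W V); split=> // j.
rewrite inE => /predU1P[->|/H Pj]; first exact: mono (@opensIl _ W V) Pi.
exact: mono (@opensIr _ W V) Pj.
Qed.

Section RetractTrivialization.
Variables (R : realType) (T : topologicalType) (F : algSheaf R T) (n m : nat).
Variables (X : supermanifold F n m) (G : modSheaf F) (hG : locally_free_of_rank G m).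
Variable spl : split_structure X G.
Variables (S : superMod (purely_even F)) (p0 q0 : nat).
Variable (hS : locally_free_of_superrank S p0 q0).
Variables (E : superMod X) (tens : tensor_structure spl S E).
Variable x : superBundle F n m.
Variables (sym : nat -> forall U : opens T, base_sm x U -> X U)
          (symE : nat -> forall U : opens T, bundle x U -> E U).
Hypothesis symP : is_retract_iso tens sym symE.
Implicit Types U V W : opens T.
Local Notation Y := (base_sm x).
Local Notation B := (bundle x).

Lemma sym_eq0 p V (f : Y V) : Jpow p f -> (sym p f = 0 <-> Jpow p.+1 f).
Proof. by move=> Jf; apply: (quo_ker (sym_iso symP p)). Qed.

Lemma symE_eq0 p V (v : B V) : Epow p v -> (symE p v = 0 <-> Epow p.+1 v).
Proof. by move=> Ev; apply: (quo_ker (symE_iso symP p)). Qed.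

Lemma symD p V (f g : Y V) : Jpow p f -> Jpow p g -> sym p (f + g) = sym p f + sym p g.
Proof. exact: (quo_add (sym_iso symP p)). Qed.

Lemma symED p V (v w : B V) : Epow p v -> Epow p w -> symE p (v + w) = symE p v + symE p w.
Proof. exact: (quo_add (symE_iso symP p)). Qed.

Lemma symB p V (f g : Y V) : Jpow p f -> Jpow p g -> sym p (f - g) = sym p f - sym p g.
Proof.
by move=> Jf Jg; apply: (addIr (sym p g)); rewrite -symD ?subrK //; apply: JpowB.
Qed.

Lemma symEB p V (v w : B V) : Epow p v -> Epow p w -> symE p (v - w) = symE p v - symE p w.
Proof.
by move=> Ev Ew; apply: (addIr (symE p w)); rewrite -symED ?subrK //; apply: EpowB.
Qed.

Lemma sym_sum p V (I : Type) (r : seq I) (f : I -> Y V) : (forall i, Jpow p (f i)) ->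
  sym p (\sum_(i <- r) f i) = \sum_(i <- r) sym p (f i).
Proof.
move=> Jf; elim: r => [|i r IH].
  by rewrite !big_nil; apply/sym_eq0; apply: Jpow0.
by rewrite !big_cons symD // ?IH //; apply: Jpow_sum.
Qed.

Lemma symE_sum p V (I : Type) (r : seq I) (f : I -> B V) : (forall i, Epow p (f i)) ->
  symE p (\sum_(i <- r) f i) = \sum_(i <- r) symE p (f i).
Proof.
move=> Jf; elim: r => [|i r IH].
  by rewrite !big_nil; apply/symE_eq0; apply: Epow0.
by rewrite !big_cons symED // ?IH //; apply: Epow_sum.
Qed.

Lemma sym_res p V W (h : W `<=` V) (f : Y V) : Jpow p f ->
  sym p (alg_res Y h f) = alg_res X h (sym p f).
Proof. exact: (quo_res (sym_iso symP p)). Qed.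

Lemma symE_res p V W (h : W `<=` V) (v : B V) : Epow p v ->
  symE p (mod_res B h v) = mod_res E h (symE p v).
Proof. exact: (quo_res (symE_iso symP p)). Qed.

Lemma Odeg0_incF V (t : X V) : Odeg spl 0 t -> t = incF spl V (red X V t).
Proof.
move=> ht; apply: (Olead_unique hG (p := 0%N) (f := t)); last exact: Olead0.
by split=> //; rewrite subrr; apply: Jpow0.
Qed.

(** Compatibility with [red] leaves no freedom in degree 0. *)
Lemma sym0 V (f : Y V) : sym 0 f = incF spl V (red Y V f).
Proof.
rewrite [LHS]Odeg0_incF ?(sym_red symP) //.
exact: (quo_into (sym_iso symP 0)).
Qed.

Lemma sym_word V (eta : 'I_m -> Y V) (w : seq 'I_m) : (forall i, Jideal (eta i)) ->
  sym (size w) (word eta w) = word (fun i => sym 1 (eta i)) w.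
Proof.
move=> Jeta; elim: w => [|i w IH]; first by rewrite /word !big_nil sym0 !rmorph1.
rewrite /word !big_cons -!/(word _ w) -IH -[size (i :: w)]/(1 + size w)%N (symM symP) //.
  exact/Jpow1.
elim: w {IH} => [//|j w IH]; rewrite /word big_cons.
by apply: (@JpowM _ _ Y 1 (size w)) => //; apply/Jpow1.
Qed.

(** The odd component of an arbitrary local lift is again a lift: its even component lies in J and
    so in J^2, which has symbol 0. *)
Lemma sym_lift U (z : T) (t : X U) : oset U z -> Odeg spl 1 t ->
  exists V, oset V z /\ exists (h : V `<=` U) (f : Y V),
    [/\ Jideal f, homog (sgr Y) true f & sym 1 f = alg_res X h t].
Proof.
move=> Uz ht; have [V [h [Vz [f Jf ef]]]] := quo_onto (sym_iso symP 1) ht Uz.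
exists V; split=> //; exists h.
have [f0 [f1 [h0 h1 e]]] := homog_decomp (sgr Y) f.
have [J0 J1] := Jpow_homog h0 h1 e Jf.
exists f1; split=> //; first exact/Jpow1.
have := ef; rewrite e symD // => <-.
have -> : sym 1 f0 = 0 by apply/(sym_eq0 J0); apply: (Jpow_parity (b := false)) J0.
by rewrite add0r.
Qed.

(** Even and odd components of a lift both count in degree 0 here. Since symbols preserve parity,
    the component of parity [b] is the one that lifts [t], and the symbol of the other is 0. *)
Lemma symE_lift U (z : T) b (t : E U) : oset U z -> Edeg tens 0 t -> homog (mgr E) b t ->
  exists V, oset V z /\ exists (h : V `<=` U) (v : B V),
    homog (mgr B) b v /\ symE 0 v = mod_res E h t.
Proof.
move=> Uz ht tb; have [V [h [Vz [f _ ef]]]] := quo_onto (symE_iso symP 0) ht Uz.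
exists V; split=> //; exists h.
have [f0 [f1 [h0 h1 e]]] := homog_decomp (mgr B) f.
have e' : symE 0 f0 + symE 0 f1 = mod_res E h t.
  by rewrite -symED -?e //; apply: Epow_all.
have s0 : homog (mgr E) false (symE 0 f0) by apply: (symE_hom symP) => //; apply: Epow_all.
have s1 : homog (mgr E) true (symE 0 f1) by apply: (symE_hom symP) => //; apply: Epow_all.
have tb' : homog (mgr E) b (mod_res E h t) := homog_res (g := mgr E) h tb.
have z0 : homog (mgr E) (~~ b) (0 : E V) := homog0 (mgr E) (~~ b) V.
case: b tb tb' z0 => _ tb' z0.
  exists f1; split=> //; rewrite -[mod_res E h t]add0r in e'.
  by have [] := homog_unique s0 z0 s1 tb' e'.
exists f0; split=> //; rewrite -[mod_res E h t]addr0 in e'.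
by have [] := homog_unique s0 tb' s1 z0 e'.
Qed.

Section Frames.
Variables (U : opens T) (tau : homfam F Y U) (eta : 'I_m -> Y U) (e : 'I_m -> G U).
Hypotheses (tauP : is_splitting tau) (eta_odd : forall i, homog (sgr Y) true (eta i)).
Hypotheses (eP : is_basis e) (fr : is_frame (split_tau spl (U := U)) (split_eta spl e)).
Hypothesis sym_eta : forall i, sym 1 (eta i) = split_eta spl e i.

Let eta_J V (h : V `<=` U) i : Jideal (alg_res Y h (eta i)).
Proof. by apply: Jideal_odd; apply: res_odd. Qed.

Let sym_tau V (h : V `<=` U) d : sym 0 (tau h d) = incF spl V d.
Proof. by rewrite sym0 (sp_red tauP). Qed.

Let sym_eta_res V (h : V `<=` U) i : sym 1 (alg_res Y h (eta i)) = alg_res X h (split_eta spl e i).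
Proof. by rewrite sym_res ?sym_eta //; apply/Jpow1; apply: Jideal_odd. Qed.

Let lin_J V (h : V `<=` U) d : Jpow 1 (\sum_i tau h (d i) * alg_res Y h (eta i)).
Proof. by apply: Jpow_sum => i _; apply: JpowMl; apply/Jpow1. Qed.

Let sym_lin V (h : V `<=` U) d : sym 1 (\sum_i tau h (d i) * alg_res Y h (eta i)) =
  \sum_i incF spl V (d i) * alg_res X h (split_eta spl e i).
Proof.
rewrite sym_sum => [|i]; last by apply: JpowMl; apply/Jpow1.
apply: eq_bigr => i _; have := symM symP (p := 0) (q := 1) (f := tau h (d i)).
by rewrite add0n sym_tau -sym_eta_res => ->//; apply/Jpow1.
Qed.

(** The coefficients are read off from the symbol in the frame of [X]. The sum in [eta] with these
    coefficients has the same symbol as [y], so it differs from [y] by a section of J^2. *)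
Let symbol_linear V (h : V `<=` U) (y : Y V) : Jideal y -> exists d,
  sym 1 y = \sum_i incF spl V (d i) * alg_res X h (split_eta spl e i) /\
  Jpow 2 (y - \sum_i tau h (d i) * alg_res Y h (eta i)).
Proof.
move=> /Jpow1 Jy.
have [d ed] : exists d, sym 1 y = \sum_i incF spl V (d i) * alg_res X h (split_eta spl e i).
  apply: (fdeg_linear (h := h) (split_tauP spl U)).
  by apply/(Odeg_fdeg eP fr); apply: (quo_into (sym_iso symP 1)).
exists d; split=> //; apply/sym_eq0; first exact: JpowB.
by rewrite symB // sym_lin ed subrr.
Qed.

(** Symbols are multiplicative, so the symbol of a sum of degree p in [eta] is the sum with the same
    coefficients in the frame of [X]. Independence on the associated graded sheaf is thereby
    inherited from [X]. *)
Lemma retract_frame : is_frame tau eta.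
Proof.
apply: frame_criterion => // [V h y Jy z Vz|p V h d hd Jd].
  have [d [_ hd]] := symbol_linear h Jy.
  by exists V, (@subset_refl _ V), h, d; rewrite alg_res_id.
have Jterm I : Jpow p (tau h (d I) * mon eta h I).
  have [<-|/hd ->] := eqVneq #|I| p; first by apply: JpowMl; apply: mon_Jpow.
  by rewrite (sp0 tauP) mul0r; apply: Jpow0.
apply: (fr_indep fr (h := h)).
have <- : sym p (fsum tau eta h d) = fsum (split_tau spl (U := U)) (split_eta spl e) h d.
  rewrite fsumE sym_sum //; apply: eq_bigr => I _.
  have [Ip|Ip] := eqVneq #|I| p; last first.
    by rewrite (hd I Ip) (sp0 tauP) (sp0 (split_tauP spl U)) !mul0r; apply/sym_eq0; apply: Jpow0.
  have -> : sym p (tau h (d I) * mon eta h I) = sym 0 (tau h (d I)) * sym p (mon eta h I).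
    by rewrite -(symM symP) // -Ip; apply: mon_Jpow.
  rewrite sym_tau; congr (_ * _).
  rewrite /mon /monomial -Ip cardE sym_word //; congr word; apply: funext => i.
  exact: sym_eta_res.
by apply/sym_eq0 => //; rewrite fsumE; apply: Jpow_sum.
Qed.

(** The trivialization induces the prescribed symbol in degree 1. This normalization is what makes
    the quotient of two trivializations congruent to the identity modulo J^2 on J. *)
Lemma retract_siso (fr' : is_frame tau eta) V (h : V `<=` U) (y : Y V) :
  Jideal y -> Jpow 2 (sfwd (frame_siso fr' fr) h y - sym 1 y).
Proof.
move=> /(symbol_linear h) [d [-> hd]]; have aP := sfwdP (frame_siso fr' fr).
have := superhom_Jpow aP h hd; rewrite (shB aP) (sh_sum aP).
congr (Jpow 2 (_ - _)); apply: eq_bigr => i _; rewrite (shM aP); congr (_ * _).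
  exact: (frame_siso_tau fr' fr).
exact: (frame_siso_eta fr' fr).
Qed.

Section Modules.
Variables (r : nat) (s : 'I_r -> S U) (sP : is_basis s) (b : 'I_r -> B U).
Hypothesis symE_b : forall i, symE 0 (b i) = tensor_basis tens s i.

Let tP := tensor_basisP tens sP.

Let symE_b_res V (h : V `<=` U) i :
  symE 0 (mod_res B h (b i)) = mod_res E h (tensor_basis tens s i).
Proof. by rewrite symE_res ?symE_b //; apply: Epow_all. Qed.

Let symE_bsum p V (h : V `<=` U) d : (forall i, Jpow p (d i)) ->
  symE p (bsum b h d) = bsum (tensor_basis tens s) h (fun i => sym p (d i)).
Proof.
move=> hd; rewrite /bsum symE_sum => [|i]; last exact: EpowJ.
apply: eq_bigr => i _; have := symEZ symP (p := p) (q := 0) (f := d i).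
by rewrite addn0 -symE_b_res => ->//; apply: Epow_all.
Qed.

Let symbol_constant V (h : V `<=` U) (v : B V) : exists d,
  symE 0 v = bsum (tensor_basis tens s) h (fun i => incF spl V (d i)) /\
  Epow 1 (v - bsum b h (fun i => tau h (d i))).
Proof.
have vE : Edeg tens 0 (symE 0 v) by apply: (quo_into (symE_iso symP 0)); apply: Epow_all.
pose d i := red X V (bcoord tP h (symE 0 v) i); exists d.
have ev : symE 0 v = bsum (tensor_basis tens s) h (fun i => incF spl V (d i)).
  rewrite -[LHS](bcoordK tP h); congr bsum; apply: funext => i; apply: Odeg0_incF.
  by move: i; apply/(Edeg_bcoord hG tens sP).
split=> //; apply/(symE_eq0 (p := 0)); first exact: Epow_all.
rewrite symEB ?symE_bsum //; try exact: Epow_all.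
rewrite ev -[X in _ - X](_ : bsum (tensor_basis tens s) h (fun i => incF spl V (d i)) = _) ?subrr
  //.
by congr bsum; apply: funext => i; rewrite sym_tau.
Qed.

(** The symbols of the coefficients of a relation between the [b i] are the coefficients of a
    relation in the tensor basis, so they vanish and the coefficients lie one step deeper in the
    filtration. *)
Lemma retract_basis : is_basis b.
Proof.
apply: basis_criterion => [V h v z Vz|p V h d hd d0 i].
  have [d [_ hd]] := symbol_constant h v.
  by exists V, (@subset_refl _ V), h, (fun i => tau h (d i)); rewrite mod_res_id.
apply/sym_eq0 => //.
have z : symE p (bsum b h d) = 0 by rewrite d0; apply/symE_eq0; apply: Epow0.
have z' : bsum (tensor_basis tens s) h (fun i => sym p (d i)) =
    bsum (tensor_basis tens s) h (fun=> 0).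
  by rewrite -symE_bsum // z; apply/esym/big1 => j _; rewrite scale0r.
exact: (congr1 (@^~ i) (bsum_inj tP z')).
Qed.

Variable par : 'I_r -> bool.
Hypothesis b_hom : forall i, homog (mgr B) (par i) (b i).
Hypothesis t_hom : forall i, homog (mgr E) (par i) (tensor_basis tens s i).

Lemma retract_qiso (fr' : is_frame tau eta) (bP : is_basis b) V (h : V `<=` U) (v : B V) :
  Epow 1 (qfwd (basis_qiso (frame_siso fr' fr) bP tP b_hom t_hom) h v - symE 0 v).
Proof.
have [d [-> hd]] := symbol_constant h v.
set a := basis_qiso _ _ _ _ _; have aP := qfwdP a.
have := quasihom_Epow (sfwdP (qbase a)) aP h hd; rewrite (qhB aP).
congr (Epow 1 (_ - _)); rewrite [qfwd a _ _]basis_map_bsum; congr bsum.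
by apply: funext => i; exact: (frame_siso_tau fr' fr).
Qed.
End Modules.
End Frames.

Lemma retract_trivialization z : exists U (a : qiso B E U), [/\ oset U z,
  forall V (h : V `<=` U) y, Jideal y -> Jpow 2 (sfwd (qbase a) h y - sym 1 y) &
  forall V (h : V `<=` U) v, Epow 1 (qfwd a h v - symE 0 v)].
Proof.
(* Of this frame only the splitting [tau] is kept; its odd coordinates give way to lifts of the
   generators of [X], whose symbols are as prescribed. *)
have [U1 [tau [eta0 [Uz1 fr0]]]] := sm_frame Y z.
have [U2 [e [s [Uz2 eP sP [fr s_hom]]]]] := tensor_frame hG spl hS z.
have [|i V W hW [h [f [Jf fodd ef]]]|V1 [Vz1 HV1]] := @finite_nbhs T z m (fun i V =>
  exists (h : V `<=` U2) (f : Y V),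
    [/\ Jideal f, homog (sgr Y) true f & sym 1 f = alg_res X h (split_eta spl e i)]).
- by move=> i; apply: sym_lift => //; apply: Odeg_incG.
- exists (subset_trans hW h), (alg_res Y hW f); split; first exact: Jideal_res.
    exact: (homog_res hW fodd).
  by rewrite sym_res ?ef ?(res_comp _ _ (subset_trans hW h)) //; apply/Jpow1.
have t_hom := tensor_basis_homog tens s_hom.
have [|i V W hW [h [v [vhom ev]]]|V2 [Vz2 HV2]] := @finite_nbhs T z (p0 + q0) (fun i V =>
  exists (h : V `<=` U2) (v : B V),
    homog (mgr B) (p0 <= i)%N v /\ symE 0 v = mod_res E h (tensor_basis tens s i)).
- move=> i; apply: symE_lift => //; rewrite /tensor_basis -[incS _ _ _]scale1r.
  by apply: Edeg_incS; rewrite -(rmorph1 (incF spl U2)); apply: Odeg_incF.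
- exists (subset_trans hW h), (mod_res B hW v); split.
    exact: (homog_res (g := mgr B) hW vhom).
  by rewrite symE_res ?ev ?(mres_comp _ _ (subset_trans hW h)) //; apply: Epow_all.
pose V0 := opensI V1 V2; pose V := opensI V0 (opensI U1 U2).
have hV1 : V `<=` V1 := subset_trans (@opensIl _ V0 _) (@opensIl _ V1 V2).
have hV2 : V `<=` V2 := subset_trans (@opensIl _ V0 _) (@opensIr _ V1 V2).
have hU1 : V `<=` U1 := subset_trans (@opensIr _ V0 _) (@opensIl _ U1 U2).
have hU2 : V `<=` U2 := subset_trans (@opensIr _ V0 _) (@opensIr _ U1 U2).
have /choice [eta heta] : forall i, exists f : Y V, homog (sgr Y) true f /\
    sym 1 f = split_eta spl (fun i => mod_res G hU2 (e i)) i.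
  move=> i; have [h [f [Jf fodd ef]]] := HV1 i; exists (alg_res Y hV1 f); split.
    exact: (homog_res hV1 fodd).
  rewrite sym_res ?ef ?(res_comp _ _ hU2) //; last exact/Jpow1.
  exact: (esym (ab_fun_res (incG spl) hU2 (e i))).
have /choice [b hb] : forall i : 'I_(p0 + q0), exists v : B V, homog (mgr B) (p0 <= i)%N v /\
    symE 0 v = tensor_basis tens (fun i => mod_res S hU2 (s i)) i.
  move=> i; have [h [v [vhom ev]]] := HV2 i; exists (mod_res B hV2 v); split.
    exact: (homog_res (g := mgr B) hV2 vhom).
  rewrite symE_res ?ev ?(mres_comp _ _ hU2) //; last exact: Epow_all.
  exact: (esym (ab_fun_res (incS tens) hU2 (s i))).
have eP' := basis_res eP hU2; have sP' := basis_res sP hU2.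
have tauP := splitting_res hU1 (fr_split fr0).
have fr2 := split_frame_of spl eP' (frame_res fr hU2).
have eta_odd i : homog (sgr Y) true (eta i) by case: (heta i).
have eta_sym i : sym 1 (eta i) = split_eta spl (fun i => mod_res G hU2 (e i)) i by case: (heta i).
have b_hom (i : 'I_(p0 + q0)) : homog (mgr B) (p0 <= i)%N (b i) by case: (hb i).
have b_sym i : symE 0 (b i) = tensor_basis tens (fun i => mod_res S hU2 (s i)) i by case: (hb i).
have fr1 := retract_frame tauP eta_odd eP' fr2 eta_sym.
have bP := retract_basis tauP sP' b_sym.
have t_hom' := tensor_basis_homog tens (fun i => homog_res (g := mgr S) hU2 (s_hom i)).
exists V, (basis_qiso (frame_siso fr1 fr2) bP (tensor_basisP tens sP') b_hom t_hom').
split=> [//|W h y|W h v]; last first.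
  exact: (retract_qiso tauP fr2 sP' b_sym b_hom t_hom' fr1 bP h v).
exact: (retract_siso tauP eta_odd eP' fr2 eta_sym).
Qed.

Lemma retract_glued : exists c, glued_bundle (E := E) c x.
Proof.
pose U z := sval (cid (retract_trivialization z)).
have Ua z : exists a : qiso B E (U z), [/\ oset (U z) z,
    forall V (h : V `<=` U z) y, Jideal y -> Jpow 2 (sfwd (qbase a) h y - sym 1 y) &
    forall V (h : V `<=` U z) v, Epow 1 (qfwd a h v - symE 0 v)].
  by rewrite /U; case: cid.
pose a z := sval (cid (Ua z)).
have aP z : [/\ oset (U z) z,
    forall V (h : V `<=` U z) y, Jideal y -> Jpow 2 (sfwd (qbase (a z)) h y - sym 1 y) &
    forall V (h : V `<=` U z) v, Epow 1 (qfwd (a z) h v - symE 0 v)] by rewrite /a; case: cid.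
pose c z w : qaut E (opensI (U z) (U w)) :=
  qiso_comp (qiso_res (@opensIl _ (U z) (U w)) (a z))
    (qiso_inv (qiso_res (@opensIr _ (U z) (U w)) (a w))).
(* Each trivialization agrees with the symbol modulo J^2, so the symbol cancels from the comparison
   of two of them. Sections of J suffice, since [superhom_congr2_ideal] covers the rest by
   parity. *)
have congr2 z w V (hz : V `<=` U z) (hw : V `<=` U w) f : Jideal f ->
    Jpow 2 (sfwd (qbase (a z)) hz (sbwd (qbase (a w)) hw f) - f).
  move=> Jf; have [_ Hz _] := aP z; have [_ Hw _] := aP w.
  have Jy := superhom_Jideal (sbwdP (qbase (a w))) hw Jf.
  have := JpowB (Hz V hz _ Jy) (Hw V hw _ Jy).
  by rewrite sbwdK opprB addrA subrK.
have congr1 z w V (hz : V `<=` U z) (hw : V `<=` U w) v :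
    Epow 1 (qfwd (a z) hz (qbwd (a w) hw v) - v).
  have [_ _ Hz] := aP z; have [_ _ Hw] := aP w.
  have := EpowB (Hz V hz (qbwd (a w) hw v)) (Hw V hw (qbwd (a w) hw v)).
  by rewrite qbwdK opprB addrA subrK.
have c_mem z w : QAut_mod E 1 2 _ (c z w).
  split=> V h f; first exact: congr1.
  apply: (superhom_congr2_ideal (sfwdP (qbase (c z w))) (sfwdP (siso_id X _))) => W k g Jg.
  exact: congr2.
have c_mul i j k (W : opens T) (hij : W `<=` opensI (U i) (U j))
    (hjk : W `<=` opensI (U j) (U k)) (hik : W `<=` opensI (U i) (U k)) :
  (@grp_res _ (QAut E) _ _ hij (c i j) * @grp_res _ (QAut E) _ _ hjk (c j k))%g =
  @grp_res _ (QAut E) _ _ hik (c i k).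
  apply: qiso_eq => V h f /=.
    rewrite (Prop_irrelevance (subset_trans (subset_trans h hjk) _)
      (subset_trans (subset_trans h hij) (@opensIr _ (U i) (U j)))) sfwdK.
    by rewrite (Prop_irrelevance (subset_trans (subset_trans h hij) _)
      (subset_trans (subset_trans h hik) (@opensIl _ (U i) (U k))))
      (Prop_irrelevance (subset_trans (subset_trans h hjk) _)
      (subset_trans (subset_trans h hik) (@opensIr _ (U i) (U k)))).
  rewrite (Prop_irrelevance (subset_trans (subset_trans h hjk) _)
    (subset_trans (subset_trans h hij) (@opensIr _ (U i) (U j)))) qfwdK.
  by rewrite (Prop_irrelevance (subset_trans (subset_trans h hij) _)
      (subset_trans (subset_trans h hik) (@opensIl _ (U i) (U k))))
      (Prop_irrelevance (subset_trans (subset_trans h hjk) _)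
      (subset_trans (subset_trans h hik) (@opensIr _ (U i) (U k)))).
have cov z : exists i, oset (U i) z by exists z; case: (aP z).
exists (@Cocycle _ (QAut E) (QAut_mod E 1 2) T U cov c c_mem c_mul), a => i j V hi hj hij /=.
rewrite (Prop_irrelevance (subset_trans hij (@opensIl _ (U i) (U j))) hi).
rewrite (Prop_irrelevance (subset_trans hij (@opensIr _ (U i) (U j))) hj).
by split=> f; rewrite ?sfwdK ?qfwdK.
Qed.
End RetractTrivialization.

(** * The classification *)

Section PushedClasses.
Variables (T : topologicalType) (Q Q' : grpPresheaf T) (N A : subgrp Q) (N' A' : subgrp Q').
Variable f : forall U : opens T, Q U -> Q' U.
Hypothesis fM : forall U (a b : Q U), f (a * b)%g = (f a * f b)%g.
Hypothesis f_res : forall (U V : opens T) (h : V `<=` U) a, f (grp_res h a) = grp_res h (f a).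
Hypothesis fN : forall U (a : Q U), N U a -> N' U (f a).
Hypothesis fA : forall U (a : Q U), A U a -> A' U (f a).
Variables (AN : conj_stable N A) (AN' : conj_stable N' A').
Implicit Types (U V W : opens T) (c d : cocycle N).
Local Open Scope group_scope.

Let f1 U : f (1 : Q U) = 1.
Proof. by apply: (mulgI (f (1 : Q U))); rewrite -fM !mulg1. Qed.

Let fV U (a : Q U) : f a^-1 = (f a)^-1.
Proof. by apply: (mulgI (f a)); rewrite -fM !mulgV f1. Qed.

Let push c := push_cocycle fM f_res fN c.

Let push_cohom c d : cohomologous c d -> cohomologous (push c) (push d).
Proof.
move=> [K [W [r [s [b [cW hr hs hb e]]]]]].
exists K, W, r, s, (fun k => f (b k)); split=> // [k|k l V hk hl hc hd]; first exact: fN.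
by rewrite /= -!f_res (e k l V hk hl hc hd) !fM fV.
Qed.

Let H1_pushE c : H1_push fM f_res fN (cohom_class c) = cohom_class (push c).
Proof.
apply: funext => d; apply: propext; split=> [[c' cc' cd]|cd]; last first.
  by exists c => //; apply: cohom_refl.
exact: cohom_trans (push_cohom cc') cd.
Qed.

Let push_conj (b : H0 A) c : exists b' : H0 A',
  cohomologous (conj_cocycle AN' b' (push c)) (push (conj_cocycle AN b c)).
Proof.
exists (exist _ _ (fA (svalP b))).
apply: (@cohom_eq_cval _ _ _ (conj_cocycle AN' _ (push c)) (push (conj_cocycle AN b c)) id
  (fun i => @subset_refl _ _)) => i j V hc hd.
by rewrite (Prop_irrelevance hc hd) /= !fM fV /res_global /= !f_res.
Qed.

(** [H1_mod_push] collects the orbits of the images of all elements of an orbit. These orbits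
    coincide, because an element of A acts on images through its own image in A'. *)
Lemma H1_mod_pushE c : H1_mod_push fM f_res fN AN' (H1_orbit AN (cohom_class c)) =
  H1_orbit AN' (cohom_class (push c)).
Proof.
have orb b : H1_orbit AN' (H1_push fM f_res fN (cohom_class (conj_cocycle AN b c))) =
    H1_orbit AN' (cohom_class (push c)).
  rewrite H1_pushE; apply/esym/H1_orbitP; exact: push_conj.
apply: funext => z; apply: propext; split=> [[z' /H1_orbitE [b ->]]|hz]; first by rewrite orb.
exists (cohom_class (conj_cocycle AN (H0_one A) c)); last by rewrite orb.
by apply/H1_orbitE; exists (H0_one A).
Qed.
End PushedClasses.

Section GluingAndCohomology.
Variables (R : realType) (T : topologicalType) (F : algSheaf R T) (n m : nat).
Variables (X : supermanifold F n m) (E : superMod X).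
Implicit Types U V W : opens T.

(** Let s and t be the two families of trivializations. The maps t_j s_i^(-1) over the intersections
    of the two covers conjugate [c] into [d]. They are arbitrary automorphisms of [X], not
    restricted to Aut_(2), whence [cohomologous_in]. *)
Lemma glued_supermanifold_cohom (c d : cocycle (Aut_mod X 2)) Y :
  glued_supermanifold c Y -> glued_supermanifold d Y -> cohomologous_in c d.
Proof.
move=> [s hs] [t ht].
exists (cidx c * cidx d)%type, (fun k => opensI (cov c k.1) (cov d k.2)), fst, snd,
  (fun k => siso_comp (siso_res (@opensIr _ _ _) (t k.2))
     (siso_inv (siso_res (@opensIl _ _ _) (s k.1))) : saut X _).
split=> [x|[i j]|[i j]|[i j] [i' j'] V hk hl hc hd].
- by have [i Ux] := covP c x; have [j Ux'] := covP d x; exists (i, j).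
- exact: opensIl.
- exact: opensIr.
apply: siso_eq => W h f /=.
have k1 := subset_trans (subset_trans h hk) (@opensIl _ (cov c i) (cov d j)).
have k2 := subset_trans (subset_trans h hk) (@opensIr _ (cov c i) (cov d j)).
have l1 := subset_trans (subset_trans h hl) (@opensIl _ (cov c i') (cov d j')).
have l2 := subset_trans (subset_trans h hl) (@opensIr _ (cov c i') (cov d j')).
rewrite !(Prop_irrelevance (subset_trans _ (@opensIl _ (cov c i) (cov d j))) k1).
rewrite !(Prop_irrelevance (subset_trans _ (@opensIr _ (cov c i) (cov d j))) k2).
rewrite !(Prop_irrelevance (subset_trans _ (@opensIl _ (cov c i') (cov d j'))) l1).
rewrite !(Prop_irrelevance (subset_trans _ (@opensIr _ (cov c i') (cov d j'))) l2).
rewrite -(hs i i' W k1 l1) sfwdK.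
by rewrite (ht j j' W k2 l2 (subset_trans h hd)) sbwdK.
Qed.

(** The same argument with the given quasi-isomorphism inserted between the trivializations of [x]
    and [y]. *)
Lemma glued_bundle_cohom (c d : cocycle (QAut_mod E 1 2)) x y :
  glued_bundle c x -> glued_bundle d y -> quasi_isomorphic x y -> cohomologous_in c d.
Proof.
move=> [s hs] [t ht] [a].
exists (cidx c * cidx d)%type, (fun k => opensI (cov c k.1) (cov d k.2)), fst, snd,
  (fun k => qiso_comp (qiso_res (@opensIr _ _ _) (t k.2)) (qiso_comp (qiso_res (@subT _ _) a)
     (qiso_inv (qiso_res (@opensIl _ _ _) (s k.1)))) : qaut E _).
split=> [z|[i j]|[i j]|[i j] [i' j'] V hk hl hc hd].
- by have [i Ux] := covP c z; have [j Ux'] := covP d z; exists (i, j).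
- exact: opensIl.
- exact: opensIr.
apply: qiso_eq => W h f /=;
have k1 := subset_trans (subset_trans h hk) (@opensIl _ (cov c i) (cov d j));
have k2 := subset_trans (subset_trans h hk) (@opensIr _ (cov c i) (cov d j));
have l1 := subset_trans (subset_trans h hl) (@opensIl _ (cov c i') (cov d j'));
have l2 := subset_trans (subset_trans h hl) (@opensIr _ (cov c i') (cov d j'));
rewrite !(Prop_irrelevance (subset_trans _ (@opensIl _ (cov c i) (cov d j))) k1);
rewrite !(Prop_irrelevance (subset_trans _ (@opensIr _ (cov c i) (cov d j))) k2);
rewrite !(Prop_irrelevance (subset_trans _ (@opensIl _ (cov c i') (cov d j'))) l1);
rewrite !(Prop_irrelevance (subset_trans _ (@opensIr _ (cov c i') (cov d j'))) l2);
have [hsO hsE] := hs i i' W k1 l1 (subset_trans h hc);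
have [htO htE] := ht j j' W k2 l2 (subset_trans h hd);
rewrite (Prop_irrelevance (subset_trans (subset_trans h hk) (@subT _ _))
  (subset_trans (subset_trans h hl) (@subT _ (opensI (cov c i') (cov d j'))))).
  by rewrite -hsO sfwdK sbwdK htO sbwdK.
by rewrite -hsE qfwdK qbwdK htE qbwdK.
Qed.
End GluingAndCohomology.

Section Classification.
Variables (R : realType) (T : topologicalType) (F : algSheaf R T) (n m : nat).
Variables (X : supermanifold F n m) (G : modSheaf F) (hG : locally_free_of_rank G m).
Variable spl : split_structure X G.
Implicit Types U V W : opens T.

Lemma Aut_conj_of_cohom_in (c d : cocycle (Aut_mod X 2)) : cohomologous_in c d ->
  exists b : H0 (Aut_deg0 spl), cohomologous (conj_cocycle (Aut_mod_conj (A := Aut_deg0 spl)) b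
    c) d.
Proof.
apply: conj_cocycle_of_cohom_in.
- by move=> U q a; apply: Aut_mod_mem_conj.
- move=> U a ha a0; apply: siso_eq => V h s.
  by apply: (superhom_gr_id hG (sfwdP a)) => // W k p f; apply: (a0 W k p f).1.
- move=> U q z Uz; have [V [h [a [Vz a0 ha]]]] := saut_local_grading hG spl q Uz.
  exists V, h, a; split=> // W k f.
  by have := ha W k (sbwd a k f); rewrite sbwdK.
- move=> K V b cV agree.
  have [|g hg] := @siso_glue R T F n m K V cV X X b.
    move=> k l W hk hl s; have e := agree k l W hk hl.
    have := congr1 (fun a : saut X W => sfwd a (@subset_refl _ W) s) e.
    by rewrite /= !(Prop_irrelevance (subset_trans (@subset_refl _ W) _) hk)
      !(Prop_irrelevance (subset_trans (@subset_refl _ W) _) hl).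
  by exists g => k; apply: siso_eq => W h s; apply: (hg k W h _).1.
move=> b bloc V h p f; split=> hf.
  apply: Odeg_local => z Vz; have [W [Wz hW]] := bloc z.
  exists (opensI W V), (@opensIr _ W V); split=> //.
  rewrite -[ab_res _ _ _]/(alg_res X _ _) -(sh_res (sfwdP b) h (@subT _ _)).
  have := (hW _ (@opensIl _ W V) p (alg_res X (@opensIr _ W V) f)).1 (Odeg_res _ hf).
  by rewrite (Prop_irrelevance (@subT _ _) (subset_trans (@opensIl _ W V) (@subT _ W))).
apply: Odeg_local => z Vz; have [W [Wz hW]] := bloc z.
exists (opensI W V), (@opensIr _ W V); split=> //.
apply/(hW _ (@opensIl _ W V) p) => /=.
rewrite (sh_res (sfwdP b) h); exact: Odeg_res.
Qed.

Variables (S : superMod (purely_even F)) (p0 q0 : nat).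
Variable (hS : locally_free_of_superrank S p0 q0).
Variables (E : superMod X) (tens : tensor_structure spl S E).
Hypothesis pq_gt0 : (0 < p0 + q0)%N.

(* If f has degree p and r is the part of the image of f in degrees above p, then
   r annihilates the image of a member of a basis, and so vanishes. *)
Let base_deg U (a : qiso E E U) : QAut_deg0_mem tens (a : QAut E U) ->
  forall V (h : V `<=` U) p f, Odeg spl p f -> Odeg spl p (sfwd (qbase a) h f).
Proof.
move=> a0 V h p f hf; apply: Odeg_local => z Vz.
have [U0 [e [s [Uz eP sP _]]]] := tensor_frame hG spl hS z.
pose W := opensI U0 V; have k : W `<=` V := @opensIr _ U0 V; have h0 : W `<=` U0 := @opensIl _ U0 V.
exists W, k; split=> //; have hW := subset_trans k h.
rewrite -[ab_res _ _ _]/(alg_res X k _) -(sh_res (sfwdP (qbase a)) h hW).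
have {}hf := Odeg_res k hf; set g := alg_res X k f in hf *.
pose i0 := Ordinal pq_gt0; pose t := mod_res E h0 (tensor_basis tens s i0).
have t0 : Edeg tens 0 t.
  rewrite /t /tensor_basis -[mod_res E _ _]/(ab_res E h0 _) -ab_fun_res -[incS _ _ _]scale1r.
  by apply: Edeg_incS; rewrite -(rmorph1 (incF spl W)); apply: Odeg_incF.
have Jg := superhom_Jpow (sfwdP (qbase a)) hW (Odeg_Jpow hG hf).
have [gp [hgp Jr]] := Olead_ex hG spl Jg.
suff -> : sfwd (qbase a) hW g = gp by [].
apply/eqP; rewrite -subr_eq0; apply/eqP; set r := _ - gp in Jr *.
(* The product is a difference of two sections of degree p, since [a] preserves degrees, and it lies
   in E_(p+1) because [r] is in J^(p+1). *)
have rt : r *: qfwd a hW t = 0.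
  apply: (Edeg_Epow0 hG hS (tens := tens) (p := p)); last first.
    by rewrite -[p.+1]addn0; apply: EpowZ => //; apply: Epow_all.
  have w0 : Edeg tens 0 (qfwd a hW t) by apply: (a0 W hW 0%N t).1.
  rewrite scalerBl -(qhZ (qfwdP a)); apply: EdegD.
    by apply: (a0 W hW p _).1; rewrite -[p]addn0; apply: (EdegZ hG hS).
  by apply: (EdegN hG hS); rewrite -[p]addn0; apply: (EdegZ hG hS).
have tP := tensor_basisP tens sP.
have : sbwd (qbase a) hW r *: t = 0.
  by rewrite -(qfwdK a hW t) -(qhZ (qbwdP a)) rt (qh0 (qbwdP a)).
move=> /(congr1 (fun v => bcoord tP h0 v i0)); rewrite bcoordZ bcoord_basis eqxx mulr1 => rz.
rewrite -[r](sbwdK (qbase a) hW) rz.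
rewrite -[0 in LHS](scale0r t) bcoordZ mul0r; exact: (sh0 (sfwdP (qbase a))).
Qed.

Lemma QAut_deg0_base U (a : QAut E U) :
  QAut_deg0 tens U a -> Aut_deg0 spl U (QAut_base a).
Proof.
move=> a0 V h p f; split=> hf; first exact: base_deg.
have a0' : QAut_deg0_mem tens (a^-1 : QAut E U)%g by apply: QAut_deg0V.
by have := base_deg a0' h hf; rewrite [sfwd _ _ _](sfwdK (qbase a)).
Qed.

Let AN := @QAut_mod_conj R T F n m X E 1 2 (QAut_deg0 tens).

Lemma QAut_conj_of_cohom_in (c d : cocycle (QAut_mod E 1 2)) : cohomologous_in c d ->
  exists b : H0 (QAut_deg0 tens), cohomologous (conj_cocycle AN b c) d.
Proof.
apply: conj_cocycle_of_cohom_in.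
(* [QAut_mod E 0 0] is all of QAut, as congruence modulo E_(0) and J^0 imposes nothing; stability
   under it is normality. *)
- move=> U q a; apply: (@QAut_mod_conj _ _ _ _ _ _ E 1 2 (QAut_mod E 0 0)).
  by split=> V h f //; apply: Epow_all.
- move=> U a [ha ha'] a0.
  (* The base is the identity first, by [QAut_deg0_base] and the result for Aut; then the map on [E]
     is linear and is determined in degree 0. *)
  have base V (h : V `<=` U) f : sfwd (qbase a) h f = f.
    apply: (superhom_gr_id hG (sfwdP (qbase a))) => // W k p g hg.
    exact: (QAut_deg0_base a0 k p g).1.
  apply: qiso_eq => V h s; first exact: base.
  by apply: (quasihom_gr_id hG hS (sfwdP (qbase a)) (qfwdP a)) => // W k v; apply: (a0 W k 0%N v).1.
- move=> U q z Uz; have [V [h [a [Vz a0 ha ha']]]] := qaut_local_grading hG hS tens q Uz.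
  exists V, h, a; split=> //; split=> W k f.
    by have := ha' W k (qbwd a k f); rewrite qbwdK.
  by have := ha W k (sbwd (qbase a) k f); rewrite sbwdK.
- move=> K V b cV agree.
  have [||g hg] := @qiso_glue R T F n m K V cV X X E E b.
  + move=> k l W hk hl s; have e := agree k l W hk hl.
    have := congr1 (fun a : qaut E W => sfwd (qbase a) (@subset_refl _ W) s) e.
    by rewrite /= !(Prop_irrelevance (subset_trans (@subset_refl _ W) _) hk)
      !(Prop_irrelevance (subset_trans (@subset_refl _ W) _) hl).
  + move=> k l W hk hl s; have e := agree k l W hk hl.
    have := congr1 (fun a : qaut E W => qfwd a (@subset_refl _ W) s) e.
    by rewrite /= !(Prop_irrelevance (subset_trans (@subset_refl _ W) _) hk)
      !(Prop_irrelevance (subset_trans (@subset_refl _ W) _) hl).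
  by exists g => k; apply: qiso_eq => W h s; [apply: (hg k W h _).1 | apply: (hg k W h _).2].
move=> b bloc V h p f; split=> hf.
  apply: Edeg_local => z Vz; have [W [Wz hW]] := bloc z.
  exists (opensI W V), (@opensIr _ W V); split=> //.
  rewrite -[ab_res _ _ _]/(mod_res E _ _) -(qh_res (qfwdP b) h (@subT _ _)).
  have := (hW _ (@opensIl _ W V) p (mod_res E (@opensIr _ W V) f)).1 (Edeg_res _ hf).
  by rewrite (Prop_irrelevance (@subT _ _) (subset_trans (@opensIl _ W V) (@subT _ W))).
apply: Edeg_local => z Vz; have [W [Wz hW]] := bloc z.
exists (opensI W V), (@opensIr _ W V); split=> //.
apply/(hW _ (@opensIl _ W V) p) => /=.
rewrite (qh_res (qfwdP b) h); exact: Edeg_res.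
Qed.

(** Over W k the quasi-isomorphism is the trivialization of [x], followed by [b], by the cochain
    [beta k] and by the inverse of the trivialization of [y]. The relation between the cocycles says
    exactly that these agree on overlaps. *)
Lemma glued_bundle_iso (c d : cocycle (QAut_mod E 1 2)) x y (b : H0 (QAut_deg0 tens)) :
  glued_bundle c x -> glued_bundle d y -> cohomologous (conj_cocycle AN b c) d ->
  quasi_isomorphic x y.
Proof.
move=> [s hs] [t ht] [K [W [r [u [beta [cW hr hu _ e]]]]]].
pose b0 : qaut E (opensT T) := sval b.
pose th k : qiso (bundle x) (bundle y) (W k) :=
  qiso_comp (qiso_inv (qiso_res (hu k) (t (u k)))) (qiso_comp (beta k : qaut E _)
    (qiso_comp (qiso_res (@subT _ (W k)) b0) (qiso_res (hr k) (s (r k))))).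
have E1 k l V (hk : V `<=` W k) (hl : V `<=` W l)
    (hc : V `<=` opensI (cov c (r k)) (cov c (r l)))
    (hd : V `<=` opensI (cov d (u k)) (cov d (u l))) :
    (forall f, sfwd (qbase (cval d (u k) (u l) : qaut E _)) hd (sfwd (qbase (beta l : qaut E _)) hl
        (sfwd (qbase b0) (@subT _ V) f)) =
      sfwd (qbase (beta k : qaut E _)) hk (sfwd (qbase b0) (@subT _ V)
        (sfwd (qbase (cval c (r k) (r l) : qaut E _)) hc f))) /\
    (forall f, qfwd (cval d (u k) (u l) : qaut E _) hd (qfwd (beta l : qaut E _) hl
        (qfwd b0 (@subT _ V) f)) =
      qfwd (beta k : qaut E _) hk (qfwd b0 (@subT _ V)
        (qfwd (cval c (r k) (r l) : qaut E _) hc f))).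
  have ekl := e k l V hk hl hc hd.
  have pe (A : set T) (p q : V `<=` A) : p = q by apply: Prop_irrelevance.
  split=> f.
    have := congr1 (fun a : qaut E V => sfwd (qbase a) (@subset_refl _ V)
      (sfwd (qbase (beta l : qaut E _)) hl (sfwd (qbase b0) (@subT _ V) f))) ekl.
    by rewrite /= !(pe _ (subset_trans _ _) hd) !(pe _ (subset_trans _ _) hk) !(pe _
      (subset_trans _ _) hl)
      !(pe _ (subset_trans _ _) hc) !(pe _ (subset_trans _ _) (@subT _ V)) !sfwdK.
  have := congr1 (fun a : qaut E V => qfwd a (@subset_refl _ V)
    (qfwd (beta l : qaut E _) hl (qfwd b0 (@subT _ V) f))) ekl.
  by rewrite /= !(pe _ (subset_trans _ _) hd) !(pe _ (subset_trans _ _) hk) !(pe _ (subset_trans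
    _ _) hl)
      !(pe _ (subset_trans _ _) hc) !(pe _ (subset_trans _ _) (@subT _ V)) !qfwdK.
have agree k l V (hk : V `<=` W k) (hl : V `<=` W l) :
    (forall f, sfwd (qbase (th k)) hk f = sfwd (qbase (th l)) hl f) /\
    (forall f, qfwd (th k) hk f = qfwd (th l) hl f).
  have hc : V `<=` opensI (cov c (r k)) (cov c (r l)).
    by apply: sub_opensI; [apply: subset_trans hk (hr k) | apply: subset_trans hl (hr l)].
  have hd : V `<=` opensI (cov d (u k)) (cov d (u l)).
    by apply: sub_opensI; [apply: subset_trans hk (hu k) | apply: subset_trans hl (hu l)].
  have [eO eE] := E1 k l V hk hl hc hd.
  have [sO sE] := hs (r k) (r l) V (subset_trans hk (hr k)) (subset_trans hl (hr l)) hc.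
  have [tO tE] := ht (u k) (u l) V (subset_trans hk (hu k)) (subset_trans hl (hu l)) hd.
  split=> f /=; rewrite !(Prop_irrelevance (subset_trans _ (@subT _ _)) (@subT _ V)).
    apply: (can_inj (sfwdK (qbase (t (u k))) (subset_trans hk (hu k)))).
    by rewrite sbwdK tO sbwdK eO -sO.
  apply: (can_inj (qfwdK (t (u k)) (subset_trans hk (hu k)))).
  by rewrite qbwdK tE qbwdK eE -sE.
have [g _] := qiso_glue cW (fun k l V hk hl => (agree k l V hk hl).1)
  (fun k l V hk hl => (agree k l V hk hl).2).
by split.
Qed.

Lemma qclassP (x y : superBundle F n m) : qclass x = qclass y <-> quasi_isomorphic x y.
Proof.
split=> [e|[a]].
  rewrite -[quasi_isomorphic x y]/(qclass x y) e; split; exact: qiso_id.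
apply: funext => z; apply: propext; split=> -[b]; split.
  exact: (qiso_comp b (qiso_inv a)).
exact: (qiso_comp b a).
Qed.

(** Defined as the union over all representatives and all cocycles, so that no choice is made;
    [bundle_orbitE] shows that they all contribute the same orbit. *)
Definition bundle_orbit (k : superBundle F n m -> Prop) : QAut_orbits E := fun z =>
  exists x c, [/\ k = qclass x, glued_bundle c x & QAut_orbit tens (cohom_class c) z].

Lemma bundle_orbitE x c : glued_bundle c x ->
  bundle_orbit (qclass x) = QAut_orbit tens (cohom_class c).
Proof.
move=> cx; apply: funext => z; apply: propext; split=> [|cz]; last by exists x, c.
move=> [y [d [/qclassP xy dy]]]; suff -> : QAut_orbit tens (cohom_class c) =
  QAut_orbit tens (cohom_class d) by [].
by apply/H1_orbitP/QAut_conj_of_cohom_in; apply: glued_bundle_cohom xy.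
Qed.

Let push (c : cocycle (QAut_mod E 1 2)) : cocycle (Aut_mod X 2) :=
  push_cocycle (@QAut_baseM _ _ _ _ _ _ E) (@QAut_base_res _ _ _ _ _ _ E)
    (@QAut_mod_base _ _ _ _ _ _ E) c.

Let FtildeE c : Ftilde spl (QAut_orbit tens (cohom_class c)) =
  H1_orbit (Aut_mod_conj (A := Aut_deg0 spl)) (cohom_class (push c)).
Proof. by apply: H1_mod_pushE => U a; apply: QAut_deg0_base. Qed.

(** The image of [c] in Aut glues the base of [x]. A glued supermanifold determines the orbit of its
    cocycle, so the base belongs to the class of [a] just when that image has orbit [a]. *)
Lemma green_class_glued c x a : Aut_quotient spl a -> glued_bundle c x ->
  (green_class a (base_sm x) <-> Ftilde spl (QAut_orbit tens (cohom_class c)) = a).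
Proof.
move=> [z0 [c0 ->] ->] [s hs].
have gx : glued_supermanifold (push c) (base_sm x).
  by exists (fun i => qbase (s i)) => i j V hi hj hij f; apply: (hs i j V hi hj hij).1.
rewrite FtildeE; split=> [[z [c1 [/H1_orbitE [b ->] c1b gx']]]|<-].
  apply/H1_orbitP; have [b' hb'] := Aut_conj_of_cohom_in (glued_supermanifold_cohom gx gx').
  have [b1 hb1] : exists b1, cohomologous (conj_cocycle (Aut_mod_conj (A := Aut_deg0 spl)) b1 c1)
    c0.
    exists (H0_inv b); apply: conj_cohom_inv; exact: c1b.
  exists (H0_mul b1 b'); apply: cohom_trans hb1.
  by apply: cohom_trans (cohom_sym (conj_cohom_mul _ _ _ _)) _; apply: conj_cohom.
exists (cohom_class (push c)), (push c); split=> //; last exact: cohom_refl.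
apply/H1_orbitE; exists (H0_one _); apply/cohom_classP/cohom_sym; exact: conj_cohom_one.
Qed.
End Classification.

Theorem theorem2 (R : realType) (T : topologicalType) (F : algSheaf R T)
    (n m : nat) (X : supermanifold F n m)
    (G : modSheaf F) (hG : locally_free_of_rank G m) (spl : split_structure X G)
    (p q : nat) (pq_gt0 : (0 < p + q)%N)
    (S : superMod (purely_even F)) (hS : locally_free_of_superrank S p q)
    (E : superMod X) (tens : tensor_structure spl S E) :
  exists f : (superBundle F n m -> Prop) -> QAut_orbits E,
    [/\ bijective_between
          (fun k => exists2 x, has_retract tens x & k = qclass x)
          (QAut_quotient tens) f,
        (forall (x : superBundle F n m) (c : cocycle (QAut_mod E 1 2)),
           glued_bundle c x ->
           f (qclass x) = QAut_orbit tens (cohom_class c)),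
        (forall b : H0 (QAut_deg0 tens),
           QAut_act b (H1_unit (QAut_mod E 1 2)) = H1_unit (QAut_mod E 1 2)) &
        (forall a : Aut_orbits X, Aut_quotient spl a ->
           bijective_between
             (fun k => exists x : superBundle F n m,
                [/\ green_class a (base_sm x), has_retract tens x & k = qclass x])
             (fun o => QAut_quotient tens o /\ Ftilde spl o = a) f)].
Proof.
have Elf := tensor_locally_free hG hS tens.
have ex x : has_retract tens x -> exists c : cocycle (QAut_mod E 1 2), glued_bundle c x.
  by move=> [sym [symE symP]]; apply: (retract_glued hG hS symP).
have gl (c : cocycle (QAut_mod E 1 2)) : exists2 x, has_retract tens x & glued_bundle c x.
  have [|x cx] := @glued_bundle_ex _ _ _ _ _ X E c; first by exists p, q.
  by exists x => //; have [s hs] := cx; apply: glued_retract hs.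
have fE x c : glued_bundle c x -> bundle_orbit tens (qclass x) = QAut_orbit tens (cohom_class c).
  exact: bundle_orbitE.
have inj x y : has_retract tens x -> has_retract tens y ->
    bundle_orbit tens (qclass x) = bundle_orbit tens (qclass y) -> qclass x = qclass y.
  move=> /ex [c cx] /ex [d dy]; rewrite (fE _ _ cx) (fE _ _ dy) => /H1_orbitP [b hb].
  by apply/qclassP; apply: glued_bundle_iso cx dy hb.
have quot x : has_retract tens x -> QAut_quotient tens (bundle_orbit tens (qclass x)).
  by move=> /ex [c cx]; rewrite (fE _ _ cx); exists (cohom_class c) => //; exists c.
exists (bundle_orbit tens); split=> //.
- split=> [k [x hx ->]|k l [x hx ->] [y hy ->]|o [z [c ->] ->]]; [exact: quot | exact: inj |].
  have [x hx cx] := gl c; exists (qclass x); first by exists x.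
  exact: fE.
- by move=> b; apply: H1_act_unit.
(* For a glued bundle the condition on the base and the condition on [Ftilde] coincide by
   [green_class_glued], so the bijection already obtained restricts to the two sides. *)
move=> a ha; split=> [k [x [gx hx ->]]|k l [x [_ hx ->]] [y [_ hy ->]]|o [[z [c ->] ->] Fo]].
- split; first exact: quot.
  have [c cx] := ex x hx; rewrite (fE _ _ cx).
  exact/(green_class_glued hG hS tens pq_gt0 ha cx).
- exact: inj.
have [x hx cx] := gl c; exists (qclass x); last exact: fE.
exists x; split=> //; exact/(green_class_glued hG hS tens pq_gt0 ha cx).
Qed.
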